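(* Let $X$ and $Y$ be i.i.d.\ $\mathbb{Z}$-processes taking values in Polish spaces $\mathcal{A}$ and $\mathcal{B}$ respectively, with equal entropy. Then they are topo-finitarily isomorphic: there is a shift-equivariant measurable map $\phi:\mathcal{A}^\mathbb{Z}\to\mathcal{B}^\mathbb{Z}$ which restricts to a homeomorphism between sets of full measure and such that $\phi(X)$ has the distribution of $Y$.
   Context: The entropy of an i.i.d.\ process is its Kolmogorov–Sinai entropy (which equals the Shannon entropy of one coordinate when this is finite and is infinite otherwise, in particular infinite for non-atomic marginals). Sets of full measure refer to the laws of $X$ and $Y$ respectively. *)

(* Defs.v *)
From HB Require Import structures.
From mathcomp Require Import all_boot all_order all_algebra.
From mathcomp Require Import all_classical all_reals all_analysis.
Set Implicit Arguments.
Unset Strict Implicit.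
Unset Printing Implicit Defensive.
Import Order.TTheory GRing.Theory Num.Theory.
Local Open Scope classical_set_scope.
Local Open Scope ring_scope.

Definition polish (R : realType) (T : ptopologicalType) : Prop :=
  (exists d : T -> T -> R,
    [/\ (forall x y, 0 <= d x y) /\ (forall x y, d x y = 0 <-> x = y),
        (forall x y, d x y = d y x),
        (forall x y z, d x z <= d x y + d y z),
        (forall U : set T, open U <->
           (forall x, U x -> exists2 e : R, 0 < e & [set y | d x y < e] `<=` U)) &
        (forall u : nat -> T,
           (forall e : R, 0 < e -> exists N : nat, forall m n : nat,
              (N <= m)%N -> (N <= n)%N -> d (u m) (u n) < e) ->
           exists l : T, u @ \oo --> l)])
  /\ (exists D : set T, countable D /\ closure D = setT).

Definition borelT (T : ptopologicalType) := g_sigma_algebraType (@open T).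

Definition seqsp (A : ptopologicalType) := {ptws int -> A}.

Definition cyl_gen (A : ptopologicalType) : set (set (seqsp A)) :=
  [set C | exists (i : int) (B : set (borelT A)),
      measurable B /\ C = [set x : seqsp A | B (x i)]].

Definition seqT (A : ptopologicalType) := g_sigma_algebraType (@cyl_gen A).

Definition zshift (A : Type) (x : int -> A) : int -> A := fun n => x (n + 1).

Definition iid_law (R : realType) (A : ptopologicalType)
  (p : probability (borelT A) R) (mu : probability (seqT A) R) : Prop :=
  forall (s : seq int) (Bs : int -> set (borelT A)),
    uniq s -> (forall i, measurable (Bs i)) ->
    mu [set x : seqT A | forall i, i \in s -> Bs i (x i)] =
    (\prod_(i <- s) p (Bs i))%E.

Definition atoms (R : realType) (A : ptopologicalType)
  (p : probability (borelT A) R) : set (borelT A) :=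
  [set a | (0 < p [set a])%E].

(** Shannon entropy of the marginal (natural log): the sum of
    -p{a} log p{a} over atoms if p is purely atomic, +oo otherwise
    (a measure with a non-atomic part has infinite Shannon entropy). *)
Definition entropy (R : realType) (A : ptopologicalType)
  (p : probability (borelT A) R) : \bar R :=
  if pselect ((\esum_(a in atoms p) p [set a])%E = 1%E)
  then (\esum_(a in atoms p)
          (- (fine (p [set a]) * ln (fine (p [set a]))))%:E)%E
  else +oo%E.

(** Kolmogorov--Sinai entropy of the i.i.d. process with marginal [p]
    (equal to the Shannon entropy of one coordinate). *)
Definition iid_entropy (R : realType) (A : ptopologicalType)
  (p : probability (borelT A) R) : \bar R := entropy p.

(* Main.v *)
Require Import Defs.
From HB Require Import structures.
From mathcomp Require Import all_boot all_order all_algebra.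
From mathcomp Require Import all_classical all_reals all_analysis.
From mathcomp Require Import zify ring lra.
From mathcomp Require finmap.
Set Implicit Arguments.
Unset Strict Implicit.
Unset Printing Implicit Defensive.
Import Order.TTheory GRing.Theory Num.Theory.
Local Open Scope ring_scope.

(** The proof is a Keane--Smorodinsky marker-and-filler argument, with letters
    refined level by level.

    Letters are infinite bit strings, seen at level [r] through their first [r]
    bits, and an i.i.d. law is the function [P] giving the probability of each
    bit prefix.  Two such laws with a non-overlapping marker word of the same
    length and probability have the same law of marker positions; cutting at
    long marker-free stretches yields a hierarchy of blocks, and conditionally on
    the positions the names of the blocks (the fillers) are independent on either
    side.  At stage [j] the fillers of the two sides are coupled block by block,
    refining the product of the couplings of stage [j - 1].  The side [odd j] is
    seen at a level whose entropy rate lies between the rates used so far on the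
    other side and the common entropy; an extremal coupling then has so few edges
    that most names on that side have a single partner, so they determine the
    coarser name of the other side.  A symbol decoded at some stage stays decoded,
    which makes the limit maps continuous and mutually inverse on sets of full
    measure.

    Laws of equal entropy need not share a marker probability: for a set [V] of
    letters of mass [c], the marker [V U ... U] of length [k + 1] has probability
    [c * (1 - c) ^ k], and for large [k] the same value is attained at a mass so
    small that independent bits of the two required masses, completed by further
    independent bits, have the prescribed entropy.  That source is isomorphic to
    both.

    A Polish alphabet is coded by membership in balls around a dense sequence,
    with radii chosen so that the spheres are null; off the spheres the code is a
    homeomorphism onto a Borel set, and the entropies of the finite codes increase
    to the entropy of the marginal. *)

(** * Words with product weights *)

(** Entropy and alphabets may be infinite, so no single threshold separates the typical names of the
    two sides. Rates exist only at finite levels, where moreover gaps longer than the level are left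
    blank; the information of a name is then a sum of values of a local function. The resulting
    rates can be interleaved strictly between the sides, and this strictness drives all counting. At
    stage [j.+1] the constants satisfy [bet j < the j.+1 < rate < kap j.+1 < bet j.+1]: [bet] bounds
    the number of labels, [the] and [kap] frame the weights of typical names. Only one side is
    active per stage, so the labels of the other side stay below the old bound, and the typical
    names left ambiguous have mass at most [expR (- ((the j.+1 - bet j) * len s))].

    The image law needs no limit of couplings. Each cylinder of one side is decoded from the other
    with at least its own probability up to a vanishing error, and since the cylinders of a window
    have total mass 1, these lower bounds are equalities. *)

Section Words.
Context {R : realType} {I : Type} {T : eqType}.
Implicit Types (sp : I -> seq T) (m : I -> T -> R) (s : seq I) (w : seq T).

(** The letter space varies with the index: in the stages below an index is the length of a gap, and
    a letter is the word filling that gap. *)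
Fixpoint words sp s : seq (seq T) :=
  if s is i :: s' then [seq a :: w | a <- sp i, w <- words sp s'] else [:: [::]].

Fixpoint wt m s w : R :=
  match s, w with
  | i :: s', a :: w' => m i a * wt m s' w'
  | [::], [::] => 1
  | _, _ => 0
  end.

Lemma big_words_cons sp i s (F : seq T -> R) :
  \sum_(w <- words sp (i :: s)) F w =
  \sum_(a <- sp i) \sum_(w <- words sp s) F (a :: w).
Proof. by rewrite /= big_allpairs_dep. Qed.

Lemma size_words sp s w : w \in words sp s -> size w = size s.
Proof.
elim: s w => [|i s IH] w /=; first by rewrite inE => /eqP ->.
by case/allpairsP => -[a v] /= [_ hv ->]; rewrite /= (IH _ hv).
Qed.

Lemma words_consE sp i s a w :
  (a :: w \in words sp (i :: s)) = (a \in sp i) && (w \in words sp s).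
Proof.
apply/allpairsP/andP => [[[a' w'] /= [ha hw [-> ->]]]//|[ha hw]].
by exists (a, w).
Qed.

Lemma words_uniq sp s : (forall i, uniq (sp i)) -> uniq (words sp s).
Proof.
move=> hu; elim: s => //= i s IH.
by apply: allpairs_uniq => // -[a w] [a' w'] _ _ /= [-> ->].
Qed.

Lemma mem_words_cat sp s1 s2 w1 w2 : size w1 = size s1 ->
  (w1 ++ w2 \in words sp (s1 ++ s2)) = (w1 \in words sp s1) && (w2 \in words sp s2).
Proof.
elim: s1 w1 => [|i s IH] [|a w1] //= [hs].
by rewrite -/(words sp (i :: (s ++ s2))) -/(words sp (i :: s)) !words_consE IH // andbA.
Qed.

Lemma big_words_cat sp s1 s2 (F : seq T -> R) :
  \sum_(w <- words sp (s1 ++ s2)) F w =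
  \sum_(w1 <- words sp s1) \sum_(w2 <- words sp s2) F (w1 ++ w2).
Proof.
elim: s1 F => [|i s IH] F; first by rewrite /= big_seq1.
rewrite cat_cons !big_words_cons; apply: eq_bigr => a _.
by rewrite IH.
Qed.

Lemma wt_cat m s1 s2 w1 w2 : size w1 = size s1 ->
  wt m (s1 ++ s2) (w1 ++ w2) = wt m s1 w1 * wt m s2 w2.
Proof.
elim: s1 w1 => [|i s IH] [|a w1] //=; first by rewrite mul1r.
by move=> [hs]; rewrite IH // mulrA.
Qed.

Lemma wt_ge0 m s w : (forall i a, 0 <= m i a) -> 0 <= wt m s w.
Proof.
move=> h; elim: s w => [|i s IH] [|a w] //=; exact: mulr_ge0.
Qed.

Lemma wt_gt0 sp m s w : (forall i a, a \in sp i -> 0 < m i a) ->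
  w \in words sp s -> 0 < wt m s w.
Proof.
move=> h; elim: s w => [|i s IH] [|a w] //; first by move=> /size_words.
by rewrite words_consE => /andP[ha hw]; rewrite /= mulr_gt0 ?h ?IH.
Qed.

Lemma sum_wt sp m s : (forall i, \sum_(a <- sp i) m i a = 1) ->
  \sum_(w <- words sp s) wt m s w = 1.
Proof.
move=> h; elim: s => [|i s IH]; first by rewrite /= big_seq1.
rewrite big_words_cons -[RHS](h i); apply: eq_bigr => a _ /=.
by rewrite -mulr_sumr IH mulr1.
Qed.

Lemma sum_words_cat sp m s1 s2 (F G : seq T -> R) :
  \sum_(w1 <- words sp s1) \sum_(w2 <- words sp s2)
     wt m (s1 ++ s2) (w1 ++ w2) * (F w1 * G w2) =
  (\sum_(w <- words sp s1) wt m s1 w * F w) *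
  (\sum_(w <- words sp s2) wt m s2 w * G w).
Proof.
rewrite mulr_suml [LHS]big_seq [RHS]big_seq; apply: eq_bigr => w1 h1.
rewrite mulr_sumr; apply: eq_bigr => w2 _.
by rewrite wt_cat ?(size_words h1) //; rewrite mulrACA.
Qed.

End Words.

Section Push.
Context {R : realType} {I : Type} {T T' : eqType}.
Variables (sp : I -> seq T) (m : I -> T -> R) (sp' : I -> seq T') (m' : I -> T' -> R).
Variable f : I -> T -> T'.

Fixpoint mapw (s : seq I) (w : seq T) : seq T' :=
  match s, w with
  | i :: s', a :: w' => f i a :: mapw s' w'
  | _, _ => [::]
  end.

Lemma mapw_words s w : (forall i a, a \in sp i -> f i a \in sp' i) ->
  w \in words sp s -> mapw s w \in words sp' s.
Proof.
move=> h; elim: s w => [|i s IH] [|a w] //; first by move=> /size_words.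
by rewrite words_consE => /andP[ha hw]; rewrite [mapw _ _]/= words_consE h // IH.
Qed.

Lemma sum_mapw s (F : seq T' -> R) :
  (forall i (G : T' -> R), \sum_(a <- sp i) m i a * G (f i a) =
     \sum_(a <- sp' i) m' i a * G a) ->
  \sum_(w <- words sp s) wt m s w * F (mapw s w) =
  \sum_(w <- words sp' s) wt m' s w * F w.
Proof.
move=> h; elim: s F => [|i s IH] F; first by rewrite /= !big_seq1.
rewrite !big_words_cons /=.
pose G a' := \sum_(w <- words sp' s) wt m' s w * F (a' :: w).
transitivity (\sum_(a <- sp i) m i a * G (f i a)).
  apply: eq_bigr => a _; rewrite /G -(IH (fun w => F (f i a :: w))) mulr_sumr.
  by apply: eq_bigr => w _; rewrite mulrA.
rewrite h; apply: eq_bigr => a _; rewrite /G mulr_sumr.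
by apply: eq_bigr => w _; rewrite mulrA.
Qed.

End Push.

(** * Couplings with few ambiguous points *)

Section Extremal.
Context {R : realType} (U V : finType).
Implicit Types (c : U -> V -> R).

Definition esupp c : {set U * V} := [set e | c e.1 e.2 != 0].

(* More edges than vertices: the signed functions on the edges with zero
   marginals form a nontrivial space. *)
Lemma zero_marginals (E : {set U * V}) : (#|U| + #|V| < #|E|)%N ->
  exists f : U -> V -> R,
    [/\ forall u v, f u v != 0 -> (u, v) \in E,
        exists u v, f u v < 0,
        forall u, \sum_v f u v = 0 & forall v, \sum_u f u v = 0].
Proof.
move=> hE.
(* The edge-vertex incidence matrix; its left kernel consists of the edge weights with zero
   marginals. *)
pose A : 'M[R]_(#|E|, #|{: U + V}|) :=
  \matrix_(i, k) (match enum_val k with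
    | inl u => ((enum_val i).1 == u)%:R
    | inr v => ((enum_val i).2 == v)%:R end).
have hk : kermx A != 0.
  rewrite -mxrank_eq0 mxrank_ker subn_eq0 -ltnNge.
  by apply: leq_ltn_trans (rank_leq_col A) _; rewrite card_sum.
have [i hi] : exists i, row i (kermx A) != 0.
  apply/existsP; apply: contra_neqT hk => /existsPn h.
  by apply/row_matrixP => i; rewrite row0; apply/eqP; move: (h i); rewrite negbK.
set z := row i (kermx A) in hi.
have zA : z *m A = 0 by rewrite /z -row_mul mulmx_ker row0.
have [e0 he0] : exists e0 : 'I_#|E|, z 0 e0 != 0.
  apply/existsP; apply: contra_neqT hi => /existsPn h.
  by apply/rowP => e; rewrite [RHS]mxE; apply/eqP; move: (h e); rewrite negbK.
pose f u v : R := \sum_(e < #|E| | enum_val e == (u, v)) z 0 e.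
have fE e : f (enum_val e).1 (enum_val e).2 = z 0 e.
  rewrite /f (eq_bigl (pred1 e)) ?big_pred1_eq// => e' /=.
  by rewrite -surjective_pairing (inj_eq enum_val_inj).
have f0 u v : f u v != 0 -> (u, v) \in E.
  apply: contra_neqT => h; rewrite /f big_pred0// => e.
  by apply/negP => /eqP he; move: h; rewrite -he enum_valP.
have row0 u : \sum_v f u v = 0.
  transitivity ((z *m A) 0 (enum_rank (inl u))); last by rewrite zA mxE.
  rewrite [RHS]mxE.
  rewrite [RHS](eq_bigr (fun e => z 0 e * ((enum_val e).1 == u)%:R)); last first.
    by move=> e _; rewrite [A _ _]mxE enum_rankK.
  rewrite /f (exchange_big_dep xpredT)//=; apply: eq_bigr => e _.
  case: (enum_val e) => a b /=.
  case: (eqVneq a u) => [->|hne].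
    rewrite (eq_bigl (pred1 b)) ?big_pred1_eq ?mulr1// => v /=.
    by rewrite xpair_eqE eqxx /= eq_sym.
  by rewrite big_pred0 ?mulr0// => v; rewrite xpair_eqE (negbTE hne).
have col0 v : \sum_u f u v = 0.
  transitivity ((z *m A) 0 (enum_rank (inr v))); last by rewrite zA mxE.
  rewrite [RHS]mxE.
  rewrite [RHS](eq_bigr (fun e => z 0 e * ((enum_val e).2 == v)%:R)); last first.
    by move=> e _; rewrite [A _ _]mxE enum_rankK.
  rewrite /f (exchange_big_dep xpredT)//=; apply: eq_bigr => e _.
  case: (enum_val e) => a b /=.
  case: (eqVneq b v) => [->|hne].
    rewrite (eq_bigl (pred1 a)) ?big_pred1_eq ?mulr1// => u /=.
    by rewrite xpair_eqE eqxx /= andbT eq_sym.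
  by rewrite big_pred0 ?mulr0// => u; rewrite xpair_eqE (negbTE hne) andbF.
exists f; split=> //.
set u0 := (enum_val e0).1; set v0 := (enum_val e0).2.
have h0 : f u0 v0 != 0 by rewrite fE.
case: (ltrgtP (f u0 v0) 0) => [h|h|h]; [by exists u0, v0| |by rewrite h eqxx in h0].
apply: contrapT => hn.
have fp u v : 0 <= f u v by rewrite leNgt; apply/negP => ?; apply: hn; exists u, v.
have := row0 u0; rewrite (bigD1 v0)//= => /eqP.
rewrite paddr_eq0; [by rewrite (negbTE h0)|exact: fp|].
by apply: sumr_ge0 => v _; exact: fp.
Qed.

(** Moving [c] along a signed function with zero marginals, supported on its own edges, keeps the
    marginals. When the first weight reaches 0, an edge has been lost and none gained, so induction
    on the number of edges applies. *)
Lemma extremal_coupling c : (forall u v, 0 <= c u v) ->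
  exists c' : U -> V -> R,
    [/\ forall u v, 0 <= c' u v,
        forall u v, 0 < c' u v -> 0 < c u v,
        forall u, \sum_v c' u v = \sum_v c u v,
        forall v, \sum_u c' u v = \sum_u c u v &
        (#|esupp c'| <= #|U| + #|V|)%N].
Proof.
have [n] := ubnP #|esupp c|; elim: n c => // n IH c; rewrite ltnS => hn c0.
have [h|h] := leqP #|esupp c| (#|U| + #|V|).
  by exists c; split.
have [f [fE [u0 [v0 f0]] fr fc]] := zero_marginals h.
(* The time at which the weight of [e] reaches 0; the minimum over edges with [f] negative is the
   longest admissible move. *)
pose rt (e : U * V) := c e.1 e.2 / - f e.1 e.2.
case: (@Order.TotalTheory.arg_minP _ _ _ (u0, v0) (fun e => f e.1 e.2 < 0) rt f0)
  => -[u1 v1] /= f1 hmin.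
set t := rt (u1, v1) in hmin.
have t0 : 0 <= t by rewrite /t /rt /= divr_ge0 ?oppr_ge0 ?(ltW f1).
pose c1 u v := c u v + t * f u v.
have c10 u v : 0 <= c1 u v.
  rewrite /c1; case: (ltP (f u v) 0) => hf; last by apply: addr_ge0 => //; apply: mulr_ge0.
  have := hmin (u, v) hf; rewrite {1}/rt /= ler_pdivlMr ?oppr_gt0//.
  by rewrite mulrN -subr_ge0 opprK.
have c1z : c1 u1 v1 = 0.
  by rewrite /c1 /t /rt /= invrN mulrN mulNr divfK ?subrr// lt_eqF.
have sub u v : 0 < c1 u v -> 0 < c u v.
  move=> h1; rewrite lt_neqAle c0 andbT eq_sym; apply/negP => /eqP cz.
  move: h1; rewrite /c1 cz add0r.
  have [->|/fE] := eqVneq (f u v) 0; first by rewrite mulr0 ltxx.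
  by rewrite inE /= cz eqxx.
have [||c' [h1 h2 h3 h4 h5]] := IH c1 => //.
  apply: leq_trans hn; apply: proper_card; apply/properP; split.
    apply/fintype.subsetP => -[u v]; rewrite !inE /= => h1; rewrite gt_eqF//.
    by apply: sub; rewrite lt_neqAle eq_sym h1 c10.
  have f1n : f u1 v1 != 0 by rewrite lt_eqF.
  by exists (u1, v1); [exact: fE|rewrite inE /= c1z eqxx].
exists c'; split=> // [u v /h2/sub //|u|v].
  by rewrite h3 /c1 big_split /= -mulr_sumr fr mulr0 addr0.
by rewrite h4 /c1 big_split /= -mulr_sumr fc mulr0 addr0.
Qed.

(** Every [u] meets an edge and an ambiguous [u] meets two, so [#|U| + #|B|] is at most the number
    of edges. *)
Lemma esupp_deg c : (#|esupp c| <= #|U| + #|V|)%N ->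
  (forall u, exists v, c u v != 0%R) ->
  (#|[set u | [exists v1, [exists v2, [&& v1 != v2, c u v1 != 0%R & c u v2 != 0%R]]]]|
     <= #|V|)%N.
Proof.
move=> h hu; set B := [set u | _].
have : (#|U| + #|B| <= #|esupp c|)%N.
  have hU : #|U| = (\sum_(u : U) 1)%N by rewrite sum1_card.
  have hB : #|B| = (\sum_(u : U) (u \in B))%N.
    by rewrite -sum1_card big_mkcond /=; apply: eq_bigr => u _; case: (u \in B).
  rewrite hU hB -big_split /=.
  have -> : #|esupp c| = (\sum_u #|[set v | c u v != 0%R]|)%N.
    rewrite -sum1_card (partition_big fst xpredT)//=; apply: eq_bigr => u _.
    rewrite -sum1_card (reindex (fun v => (u, v))) /=; last first.
      by exists snd => [v//|[a b]]; rewrite !inE /= => /andP[_ /eqP ->].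
    by apply: eq_bigl => v; rewrite !inE /= eqxx andbT.
  apply: leq_sum => u _; rewrite inE; case: (boolP [exists v1, _]) => [/existsP[v1 /existsP[v2 /and3P[ne h1 h2]]]|_].
    have <- : #|[set v1; v2]| = (1 + 1)%N by rewrite cards2 ne.
    by apply: subset_leq_card; apply/fintype.subsetP => v; rewrite !inE => /orP[]/eqP->.
  by have [v hv] := hu u; rewrite card_gt0; apply/set0Pn; exists v; rewrite inE.
by move=> h2; rewrite -(leq_add2l #|U|) (leq_trans h2).
Qed.

End Extremal.

Section Labels.
Context {R : realType} {L : choiceType}.

Lemma big_seq_label (T : eqType) (W : seq T) (la : T -> L) (F : T -> R) :
  \sum_(w <- W) F w =
  \sum_(u : seq_sub (undup (map la W))) \sum_(w <- W | la w == val u) F w.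
Proof.
rewrite (exchange_big_dep xpredT)//= [LHS]big_seq [RHS]big_seq.
apply: eq_bigr => w hw.
have hu : la w \in undup (map la W) by rewrite mem_undup map_f.
rewrite (eq_bigl (pred1 (SeqSub hu))) ?big_pred1_eq// => u /=.
Qed.

Context {T1 T2 : eqType} (W1 : seq T1) (W2 : seq T2) (a : T1 -> R) (b : T2 -> R).
Context (la : T1 -> L) (lb : T2 -> L) (G : T1 -> T2 -> R).
Hypothesis a0 : {in W1, forall w, 0 < a w}.
Hypothesis b0 : {in W2, forall w, 0 < b w}.
Hypothesis G0 : forall w w', 0 <= G w w'.
Hypothesis sat1 : {in W1 &, forall w1 w2, la w1 = la w2 -> {in W2, forall w', G w1 w' = G w2 w'}}.
Hypothesis sat2 : {in W2 &, forall w1 w2, lb w1 = lb w2 -> {in W1, forall w, G w w1 = G w w2}}.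
Hypothesis marg1 : {in W1, forall w, \sum_(w' <- W2) b w' * G w w' = 1}.
Hypothesis marg2 : {in W2, forall w', \sum_(w <- W1) a w * G w w' = 1}.

Definition multi1 (g : L -> L -> R) (l : L) : bool :=
  has (fun w1 => has (fun w2 => [&& lb w1 != lb w2, 0 < g l (lb w1) & 0 < g l (lb w2)]) W2) W2.
Definition multi2 (g : L -> L -> R) (l : L) : bool :=
  has (fun w1 => has (fun w2 => [&& la w1 != la w2, 0 < g (la w1) l & 0 < g (la w2) l]) W1) W1.

Local Notation U := (seq_sub (undup (map la W1))).
Local Notation V := (seq_sub (undup (map lb W2))).
Let A (l : L) := \sum_(w <- W1 | la w == l) a w.
Let B (l : L) := \sum_(w <- W2 | lb w == l) b w.

Let A0 w : w \in W1 -> 0 < A (la w).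
Proof.
move=> hw; rewrite /A (big_rem w)//= eqxx ltr_pwDl ?a0//.
by rewrite big_seq_cond sumr_ge0// => x /andP[/mem_rem hx _]; exact: ltW (a0 hx).
Qed.
Let B0 w : w \in W2 -> 0 < B (lb w).
Proof.
move=> hw; rewrite /B (big_rem w)//= eqxx ltr_pwDl ?b0//.
by rewrite big_seq_cond sumr_ge0// => x /andP[/mem_rem hx _]; exact: ltW (b0 hx).
Qed.
Let c (u : U) (v : V) : R :=
  \sum_(w <- W1 | la w == val u) \sum_(w' <- W2 | lb w' == val v) a w * b w' * G w w'.

(** Couplings are kept as densities with respect to the product of the two weights. A density
    constant on label classes descends to a coupling [c] of the classes; the extremal coupling below
    [c], divided by the class masses, is a density again. Saturation of [G] turns positivity on a
    pair of classes into positivity at every pair of representatives. *)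
Lemma density_reduce : exists g : L -> L -> R,
  [/\ forall l l', 0 <= g l l',
      {in W1 & W2, forall w w', 0 < g (la w) (lb w') -> 0 < G w w'},
      {in W1, forall w, \sum_(w' <- W2) b w' * g (la w) (lb w') = 1},
      {in W2, forall w', \sum_(w <- W1) a w * g (la w) (lb w') = 1} &
      (size (undup [seq la w | w <- W1 & multi1 g (la w)]) <= size (undup (map lb W2)))%N /\
      (size (undup [seq lb w | w <- W2 & multi2 g (lb w)]) <= size (undup (map la W1)))%N].
Proof.
have c0 u v : 0 <= c u v.
  rewrite /c big_seq_cond sumr_ge0// => w /andP[hw _]; rewrite big_seq_cond sumr_ge0// => w' /andP[hw' _].
  by rewrite !mulr_ge0 ?G0 ?ltW ?a0 ?b0.
have crow u : \sum_v c u v = A (val u).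
  rewrite /c exchange_big /= /A [LHS]big_seq_cond [RHS]big_seq_cond.
  apply: eq_bigr => w /andP[hw _].
  rewrite -(big_seq_label _ lb (fun w' => a w * b w' * G w w')).
  by rewrite -[RHS]mulr1 -(marg1 hw) mulr_sumr; apply: eq_bigr => w' _; rewrite mulrA.
have ccol v : \sum_u c u v = B (val v).
  rewrite /c (eq_bigr (fun u : U => \sum_(w' <- W2 | lb w' == val v)
    \sum_(w <- W1 | la w == val u) a w * b w' * G w w')); last by move=> u _; rewrite exchange_big.
  rewrite exchange_big /= /B [LHS]big_seq_cond [RHS]big_seq_cond.
  apply: eq_bigr => w' /andP[hw' _].
  rewrite -(big_seq_label _ la (fun w => a w * b w' * G w w')).
  rewrite -[RHS]mulr1 -(marg2 hw') mulr_sumr; apply: eq_bigr => w _.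
  by rewrite mulrA (mulrC (b w')).
have [c' [c'0 c'c c'r c'l c'E]] := extremal_coupling c0.
have memU (u : U) : exists2 w, w \in W1 & la w = val u.
  by have := valP u; rewrite mem_undup => /mapP[w hw ->]; exists w.
have memV (v : V) : exists2 w, w \in W2 & lb w = val v.
  by have := valP v; rewrite mem_undup => /mapP[w hw ->]; exists w.
have AU (u : U) : 0 < A (val u) by have [w hw <-] := memU u; exact: A0.
have BV (v : V) : 0 < B (val v) by have [w hw <-] := memV v; exact: B0.
pose g (l l' : L) : R := if (insub l : option U) is Some u then
   if (insub l' : option V) is Some v then c' u v / (A l * B l') else 0 else 0.
have gE (u : U) (v : V) : g (val u) (val v) = c' u v / (A (val u) * B (val v)).
  by rewrite /g !valK.
have gp (u : U) (v : V) : (0 < g (val u) (val v)) = (c' u v != 0).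
  by rewrite gE pmulr_lgt0 ?invr_gt0 ?mulr_gt0// lt_neqAle c'0 andbT eq_sym.
have lU w : w \in W1 -> exists u : U, la w = val u.
  by move=> hw; have hu : la w \in undup (map la W1) by [rewrite mem_undup map_f]; exists (SeqSub hu).
have lV w : w \in W2 -> exists u : V, lb w = val u.
  by move=> hw; have hu : lb w \in undup (map lb W2) by [rewrite mem_undup map_f]; exists (SeqSub hu).
exists g; split.
- move=> l l'; rewrite /g; case: insubP => // u _ <-; case: insubP => // v _ <-.
  by rewrite divr_ge0// mulr_ge0 ?ltW.
- move=> w w' hw hw'; have [u hu] := lU w hw; have [v hv] := lV w' hw'.
  rewrite hu hv gp => hc.
  have hcp : 0 < c u v by apply: c'c; rewrite lt_neqAle c'0 eq_sym hc.
  rewrite lt_neqAle G0 andbT eq_sym; apply: contraTneq hcp => hG.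
  rewrite -leNgt /c big_seq_cond big1// => x /andP[hx /eqP xu].
  rewrite big_seq_cond big1// => y /andP[hy /eqP yv].
  by rewrite (sat1 hx hw _ hy) ?xu ?hu// (sat2 hy hw' _ hw) ?yv ?hv// hG mulr0.
- move=> w hw; have [u hu] := lU w hw; rewrite hu.
  rewrite (big_seq_label _ lb).
  rewrite (eq_bigr (fun v : V => c' u v / A (val u))).
    by rewrite -mulr_suml c'r crow divff// gt_eqF.
  move=> v _; rewrite (eq_bigr (fun w' => b w' * g (val u) (val v))).
    rewrite -mulr_suml -/(B (val v)) gE; have := BV v; have := AU u.
    by move=> /gt_eqF h1 /gt_eqF h2; field; rewrite h1 h2.
  by move=> w' /eqP ->.
- move=> w hw; have [v hv] := lV w hw; rewrite hv.
  rewrite (big_seq_label _ la).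
  rewrite (eq_bigr (fun u : U => c' u v / B (val v))).
    by rewrite -mulr_suml c'l ccol divff// gt_eqF.
  move=> u _; rewrite (eq_bigr (fun w' => a w' * g (val u) (val v))).
    rewrite -mulr_suml -/(A (val u)) gE; have := BV v; have := AU u.
    by move=> /gt_eqF h1 /gt_eqF h2; field; rewrite h1 h2.
  by move=> w' /eqP ->.
have hc1 u : exists v, c' u v != 0.
  apply: contrapT => h; have : \sum_v c' u v = 0.
    by apply: big1 => v _; apply/eqP; apply: contrapT => /negP hv; apply: h; exists v.
  by rewrite c'r crow => h0; have := AU u; rewrite h0 ltxx.
have hc2 v : exists u, c' u v != 0.
  apply: contrapT => h; have : \sum_u c' u v = 0.
    by apply: big1 => u _; apply/eqP; apply: contrapT => /negP hv; apply: h; exists u.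
  by rewrite c'l ccol => h0; have := BV v; rewrite h0 ltxx.
have cU : #|{: U}| = size (undup (map la W1)) by rewrite card_seq_sub ?undup_uniq.
have cV : #|{: V}| = size (undup (map lb W2)) by rewrite card_seq_sub ?undup_uniq.
split.
  rewrite -cV; apply: leq_trans (esupp_deg c'E hc1).
  rewrite [X in (_ <= X)%N]cardE -[X in (_ <= X)%N](size_map val).
  apply: uniq_leq_size; first exact: undup_uniq.
  move=> l; rewrite mem_undup => /mapP[w]; rewrite mem_filter => /andP[hm hw] ->.
  have [u hu] := lU w hw; rewrite hu map_f// mem_enum inE.
  move: hm => /hasP[w1 h1 /hasP[w2 h2 /and3P[]]]; have [v1 ->] := lV w1 h1; have [v2 ->] := lV w2 h2.
  rewrite hu !gp => hv g1 g2; apply/existsP; exists v1; apply/existsP; exists v2.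
  by rewrite g1 g2 !andbT; apply: contra_neq hv => ->.
have c'E' : (#|esupp (fun v u => c' u v)| <= #|{: V}| + #|{: U}|)%N.
  rewrite addnC; apply: leq_trans c'E.
  rewrite -(card_imset (mem (esupp (fun v u => c' u v))) (f := fun e => (e.2, e.1))); last by move=> [x y] [x' y'] /= [-> ->].
  apply: subset_leq_card; apply/fintype.subsetP => e /imsetP[[v u]] /=.
  by rewrite !inE /= => h ->.
rewrite -cU; apply: leq_trans (esupp_deg c'E' hc2).
rewrite [X in (_ <= X)%N]cardE -[X in (_ <= X)%N](size_map val).
apply: uniq_leq_size; first exact: undup_uniq.
move=> l; rewrite mem_undup => /mapP[w]; rewrite mem_filter => /andP[hm hw] ->.
have [u hu] := lV w hw; rewrite hu map_f// mem_enum inE.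
move: hm => /hasP[w1 h1 /hasP[w2 h2 /and3P[]]]; have [v1 ->] := lU w1 h1; have [v2 ->] := lU w2 h2.
rewrite hu !gp => hv g1 g2; apply/existsP; exists v1; apply/existsP; exists v2.
by rewrite g1 g2 !andbT; apply: contra_neq hv => ->.
Qed.

End Labels.

(** * Refining sequences of couplings *)

(** Cuts after every entry above [N]: on the gap lengths of a block of higher rank this produces its
    sub-blocks of rank [N]. *)
Fixpoint split (N : nat) (s : seq nat) : seq (seq nat) :=
  if s is n :: s' then
    if (N < n)%N then [:: n] :: split N s' else
    if split N s' is t :: ts then (n :: t) :: ts else [:: [:: n]]
  else [::].

Lemma flatten_split N s : flatten (split N s) = s.
Proof.
elim: s => //= n s IH; case: ifP => _ /=; first by rewrite IH.
by case: (split N s) IH => [|t ts] /= <-.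
Qed.

Section Chop.
Context {T : eqType} {L : Type} (f : seq nat -> seq T -> L).
Fixpoint chop (ss : seq (seq nat)) (w : seq T) : seq L :=
  if ss is s :: ss' then f s (take (size s) w) :: chop ss' (drop (size s) w) else [::].

Lemma size_chop ss w : size (chop ss w) = size ss.
Proof. by elim: ss w => //= s ss IH w; rewrite IH. Qed.

Lemma chop_cat ss1 ss2 w : chop (ss1 ++ ss2) w =
  chop ss1 w ++ chop ss2 (drop (size (flatten ss1)) w).
Proof.
elim: ss1 w => [|s ss IH] w /=; first by rewrite drop0.
by rewrite IH size_cat drop_drop addnC.
Qed.
End Chop.

Lemma size_wordsE (I : Type) (T : eqType) (sp : I -> seq T) s :
  size (words sp s) = (\prod_(i <- s) size (sp i))%N.
Proof.
elim: s => [|i s IH]; first by rewrite big_nil.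
by rewrite /= size_allpairs IH big_cons.
Qed.

Lemma chop_words (T L : eqType) (f : seq nat -> seq T -> L) (sp : nat -> seq T) ss w :
  w \in words sp (flatten ss) ->
  chop f ss w \in words (fun t => undup (map (f t) (words sp t))) ss.
Proof.
elim: ss w => [|s ss IH] w hw /=; first by rewrite inE.
have hs := size_words hw; rewrite /= size_cat in hs.
have := hw; rewrite -{1}(cat_take_drop (size s) w) /= mem_words_cat; last first.
  by rewrite size_takel// hs leq_addr.
case/andP => h1 h2; rewrite -/(words _ (s :: ss)) words_consE IH// andbT.
by rewrite mem_undup map_f.
Qed.

Section Stages.
Context {R : realType} {T : choiceType}.
Notation L := (GenTree.tree (seq T)).
Variables (sp : bool -> nat -> nat -> seq T) (m : bool -> nat -> nat -> T -> R).
Variables (co : bool -> nat -> nat -> T -> T).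
Variables (N : nat -> nat) (kap the bet : nat -> R).

Definition len (s : seq nat) : R := (sumn s)%:R.
Definition W b j s := words (sp b j) s.
Definition wj b j s w : R := wt (m b j) s w.
Definition cow b j s w := mapw (co b j) s w.

Definition typ b j s w : bool :=
  [&& b == odd j, (N j <= sumn s)%N, expR (- (kap j * len s)) <= wj b j s w &
      wj b j s w <= expR (- (the j * len s))].

(** What the coupling of stage [j] sees of a name: all of it ([Leaf]) if it is typical on the active
    side, otherwise only the labels its coarsened sub-blocks had one stage earlier ([Node]). At
    stage 0 there is one label, so the initial coupling is the product. Trees are used because the
    nesting depth grows with [j]. *)
Fixpoint lab b j s w : L :=
  if j is j'.+1 then
    if typ b j s w then GenTree.Leaf w
    else GenTree.Node 0 (chop (lab b j') (split (N j') s) (cow b j' s w))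
  else GenTree.Node 0 [::].

Hypothesis sp_uniq : forall b j n, uniq (sp b j n).
Hypothesis m_gt0 : forall b j n a, a \in sp b j n -> 0 < m b j n a.
Hypothesis m_sum : forall b j n, \sum_(a <- sp b j n) m b j n a = 1.
Hypothesis co_sp : forall b j n a, a \in sp b j.+1 n -> co b j n a \in sp b j n.
Hypothesis co_push : forall b j n (G : T -> R),
  \sum_(a <- sp b j.+1 n) m b j.+1 n a * G (co b j n a) =
  \sum_(a <- sp b j n) m b j n a * G a.
Hypothesis bet0 : 0 <= bet 0.
Hypothesis bet_mono : forall j, bet j <= bet j.+1.
Hypothesis betP : forall j n, (N j.+1 <= n)%N ->
  expR (kap j.+1 * n%:R) + expR (bet j * n%:R) <= expR (bet j.+1 * n%:R) :> R.

Lemma W_uniq b j s : uniq (W b j s). Proof. exact: words_uniq. Qed.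
Lemma wj_gt0 b j s w : w \in W b j s -> 0 < wj b j s w.
Proof. by apply: wt_gt0 => i a; exact: m_gt0. Qed.
Lemma sum_wj b j s : \sum_(w <- W b j s) wj b j s w = 1.
Proof. exact: sum_wt. Qed.
Lemma cow_W b j s w : w \in W b j.+1 s -> cow b j s w \in W b j s.
Proof. by apply: mapw_words => i a; exact: co_sp. Qed.

Definition nlab b j s := size (undup (map (lab b j s) (W b j s))).

(** Each typical name has mass at least [expR (- (kap j * len s))], and the total mass is 1. *)
Lemma count_typ b j s : (size [seq w <- W b j s | typ b j s w])%:R <= expR (kap j * len s).
Proof.
rewrite -[X in _ <= X]mul1r -ler_pdivrMr ?expR_gt0// -expRN.
rewrite -[X in _ <= X](sum_wj b j s) -sum1_size natr_sum mulr_suml big_filter [X in X <= _]big_mkcond /=.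
rewrite big_seq [X in _ <= X]big_seq; apply: ler_sum => w hw; case: ifP => [/and4P[_ _ h _]|_].
  by rewrite mul1r.
exact: ltW (wj_gt0 hw).
Qed.

Lemma len_flatten ss : len (flatten ss) = \sum_(s <- ss) len s.
Proof. by rewrite /len sumn_flatten sumnE big_map natr_sum. Qed.

Lemma node_count b j s : (forall t, (nlab b j t)%:R <= expR (bet j * len t)) ->
  (size (words (fun t => undup (map (lab b j t) (W b j t))) (split (N j) s)))%:R
    <= expR (bet j * len s).
Proof.
move=> IH; rewrite size_wordsE -{2}(flatten_split (N j) s) len_flatten mulr_sumr.
elim: (split (N j) s) => [|t ts IHt]; first by rewrite !big_nil expR0.
by rewrite !big_cons expRD natrM ler_pM// ?ler0n//; exact: IH.
Qed.

(** A label is a typical name or a tuple of old labels; tuples inherit the exponential bound because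
    the lengths of the sub-blocks add up. *)
Lemma nlab_step b j s : (forall t, (nlab b j t)%:R <= expR (bet j * len t)) ->
  (nlab b j.+1 s)%:R <= (if (b == odd j.+1) && (N j.+1 <= sumn s)%N
     then expR (kap j.+1 * len s) else 0) + expR (bet j * len s).
Proof.
move=> IH.
set X := if _ then _ else _.
have hX : (size [seq w <- W b j.+1 s | typ b j.+1 s w])%:R <= X.
  rewrite /X; case: ifP => [_|h]; first exact: count_typ.
  rewrite (_ : [seq _ <- _ | _] = [::])// -[RHS](filter_pred0 (W b j.+1 s)).
  by apply: eq_filter => w; rewrite /typ; move/negbT: h; rewrite negb_and => /orP[]/negbTE ->; rewrite ?andbF.
apply: le_trans (lerD hX (node_count s IH)).
rewrite -natrD ler_nat /nlab.
rewrite -(size_map (@GenTree.Leaf (seq T))) -(size_map (@GenTree.Node (seq T) 0)) -size_cat.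
apply: uniq_leq_size; first exact: undup_uniq.
move=> l; rewrite mem_undup => /mapP[w hw ->]; rewrite mem_cat /=; case: ifP => ht.
  by rewrite map_f// mem_filter ht.
apply/orP; right; apply: map_f; apply: chop_words.
by rewrite flatten_split; exact: cow_W.
Qed.

Lemma nlab_le b j s : (nlab b j s)%:R <= expR (bet j * len s).
Proof.
elim: j s => [|j IH] s.
  apply: (@le_trans _ _ 1); last by rewrite -expR0 ler_expR mulr_ge0// ler0n.
  rewrite -[1]/(1%:R) ler_nat; apply: (@uniq_leq_size _ _ [:: GenTree.Node 0 [::]]).
    exact: undup_uniq.
  by move=> l; rewrite mem_undup => /mapP[w _ ->] /=; rewrite inE.
apply: le_trans (nlab_step s IH) _; case: ifP => [/andP[_ h]|_]; first exact: betP.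
by rewrite add0r ler_expR ler_wpM2r ?bet_mono// ler0n.
Qed.

(** The inactive side acquires no [Leaf], so its labels are still bounded at the rate of the
    previous stage; [bad_mass] exploits this asymmetry. *)
Lemma nlab_other b j s : b != odd j.+1 -> (nlab b j.+1 s)%:R <= expR (bet j * len s).
Proof.
move=> hb; apply: le_trans (nlab_step s (nlab_le b j)) _.
by rewrite (negbTE hb) add0r.
Qed.

(** The first argument of [g] always belongs to the side [true]; [gg b] lets the label of side [b]
    come first. *)
Definition gg b (g : L -> L -> R) l l' := if b then g l l' else g l' l.

Definition stage_ok j (g : seq nat -> L -> L -> R) := forall s,
  (forall l l', 0 <= g s l l') /\
  forall b, {in W b j s, forall w,
    \sum_(w' <- W (~~ b) j s) wj (~~ b) j s w' *
        gg b (g s) (lab b j s w) (lab (~~ b) j s w') = 1}.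

Fixpoint pg b (g : seq nat -> L -> L -> R) ss ls ls' : R :=
  match ss, ls, ls' with
  | s :: ss, l :: ls, l' :: ls' => gg b (g s) l l' * pg b g ss ls ls'
  | [::], [::], [::] => 1
  | _, _, _ => 0
  end.

Lemma pg_flip g ss ls ls' : pg false g ss ls ls' = pg true g ss ls' ls.
Proof. by elim: ss ls ls' => [|s ss IH] [|l ls] [|l' ls'] //=; rewrite IH. Qed.

Lemma pg_ge0 b g ss ls ls' : (forall s l l', 0 <= g s l l') -> 0 <= pg b g ss ls ls'.
Proof.
move=> h; elim: ss ls ls' => [|s ss IH] [|l ls] [|l' ls'] //=.
by rewrite mulr_ge0 ?IH// /gg; case: (b) => /=.
Qed.

Lemma pg_gt0_cat b g ss1 t ss2 ls1 l ls2 ls1' l' ls2' :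
  (forall s l l', 0 <= g s l l') -> size ls1 = size ss1 -> size ls1' = size ss1 ->
  0 < pg b g (ss1 ++ t :: ss2) (ls1 ++ l :: ls2) (ls1' ++ l' :: ls2') ->
  0 < gg b (g t) l l'.
Proof.
move=> g0; have gg0 s x y : 0 <= gg b (g s) x y by rewrite /gg; case: b.
elim: ss1 ls1 ls1' => [|s ss IH] [|x ls] [|x' ls'] //=.
  by move=> _ _ h; rewrite lt_neqAle gg0 andbT; apply: contraTneq h => <-; rewrite mul0r ltxx.
move=> [h1] [h2] h; apply: (IH ls ls') => //.
by rewrite lt_neqAle pg_ge0// andbT; apply: contraTneq h => <-; rewrite mulr0 ltxx.
Qed.

Lemma pg_marg b j g ss w : stage_ok j g -> w \in W b j (flatten ss) ->
  \sum_(w' <- W (~~ b) j (flatten ss)) wj (~~ b) j (flatten ss) w' *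
    pg b g ss (chop (lab b j) ss w) (chop (lab (~~ b) j) ss w') = 1.
Proof.
move=> hg; elim: ss w => [|s ss IH] w hw; first by rewrite /W /= big_seq1 /wj /= mulr1.
have hs := size_words hw; rewrite /= size_cat in hs.
have := hw; rewrite -{1}(cat_take_drop (size s) w) /W /= mem_words_cat; last first.
  by rewrite size_takel// hs leq_addr.
case/andP => h1 h2.
rewrite big_words_cat big_seq.
rewrite (eq_bigr (fun w1 => \sum_(w2 <- W (~~ b) j (flatten ss)) wt (m (~~ b) j) (s ++ flatten ss) (w1 ++ w2) *
  (gg b (g s) (lab b j s (take (size s) w)) (lab (~~ b) j s w1) *
   pg b g ss (chop (lab b j) ss (drop (size s) w)) (chop (lab (~~ b) j) ss w2)))); last first.
  move=> w1 /size_words hw1; apply: eq_bigr => w2 _.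
  by rewrite -hw1 take_size_cat // drop_size_cat.
by rewrite -big_seq sum_words_cat IH// mulr1; case: (hg s) => _; apply.
Qed.

(** Supplies the saturation hypotheses of [density_reduce]: a [Leaf] keeps the whole name, a [Node]
    keeps exactly these sub-labels. *)
Lemma lab_sat b j s w1 w2 : lab b j.+1 s w1 = lab b j.+1 s w2 ->
  chop (lab b j) (split (N j) s) (cow b j s w1) = chop (lab b j) (split (N j) s) (cow b j s w2).
Proof. by rewrite /=; case: ifP => _; case: ifP => _ // -[->]. Qed.

Definition multi b j s (g : L -> L -> R) (l : L) : bool :=
  has (fun w1 => has (fun w2 => [&& lab (~~ b) j s w1 != lab (~~ b) j s w2,
    0 < gg b g l (lab (~~ b) j s w1) & 0 < gg b g l (lab (~~ b) j s w2)])
     (W (~~ b) j s)) (W (~~ b) j s).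

Definition refines j s (g : seq nat -> L -> L -> R) (g' : L -> L -> R) :=
  [/\ forall l l', 0 <= g' l l',
      forall b, {in W b j.+1 s, forall w,
        \sum_(w' <- W (~~ b) j.+1 s) wj (~~ b) j.+1 s w' *
           gg b g' (lab b j.+1 s w) (lab (~~ b) j.+1 s w') = 1},
      forall b, {in W b j.+1 s & W (~~ b) j.+1 s, forall w w',
        0 < gg b g' (lab b j.+1 s w) (lab (~~ b) j.+1 s w') ->
        0 < pg b g (split (N j) s) (chop (lab b j) (split (N j) s) (cow b j s w))
              (chop (lab (~~ b) j) (split (N j) s) (cow (~~ b) j s w'))} &
      forall b, (size (undup [seq lab b j.+1 s w | w <- W b j.+1 s & multi b j.+1 s g' (lab b j.+1 s w)])
         <= nlab (~~ b) j.+1 s)%N].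

(** The density being reduced is the product over sub-blocks of the densities of stage [j], read
    after coarsening. Its marginals are 1 since coarsening pushes the fine weights onto the coarse
    ones. *)
Lemma refine_stage j g s : stage_ok j g -> exists g', refines j s g g'.
Proof.
move=> hg.
pose G w w' := pg true g (split (N j) s) (chop (lab true j) (split (N j) s) (cow true j s w))
              (chop (lab false j) (split (N j) s) (cow false j s w')).
have hm b w : w \in W b j.+1 s -> \sum_(w' <- W (~~ b) j.+1 s) wj (~~ b) j.+1 s w' *
   pg b g (split (N j) s) (chop (lab b j) (split (N j) s) (cow b j s w))
              (chop (lab (~~ b) j) (split (N j) s) (cow (~~ b) j s w')) = 1.
  move=> hw.
  rewrite (sum_mapw (m' := m (~~ b) j) (sp' := sp (~~ b) j) _
    (fun w' => pg b g (split (N j) s) (chop (lab b j) (split (N j) s) (cow b j s w))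
              (chop (lab (~~ b) j) (split (N j) s) w'))); last by move=> n F; exact: co_push.
  have := @pg_marg b j g (split (N j) s) (cow b j s w) hg.
  by rewrite flatten_split; apply; exact: cow_W.
have := @density_reduce R _ _ _ (W true j.+1 s) (W false j.+1 s) (wj true j.+1 s) (wj false j.+1 s)
   (lab true j.+1 s) (lab false j.+1 s) G.
case.
- by move=> w; exact: wj_gt0.
- by move=> w; exact: wj_gt0.
- by move=> w w'; apply: pg_ge0 => t; case: (hg t).
- by move=> w1 w2 _ _ h w' _; rewrite /G (lab_sat h).
- by move=> w1 w2 _ _ h w' _; rewrite /G (lab_sat h).
- by move=> w hw; have := hm true w hw.
- by move=> w hw; have := hm false w hw; under eq_bigr do rewrite pg_flip.
move=> g' [g0 gs m1 m2 [c1 c2]]; exists g'; split => //.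
- by case=> w hw /=; [exact: m1|exact: m2].
- by case=> w w' hw hw' /=; [exact: gs|rewrite pg_flip; exact: gs].
- by case.
Qed.

Lemma stage_ok0 : stage_ok 0 (fun _ _ _ => 1).
Proof.
move=> s; split=> // b w _ /=.
by rewrite -[RHS](sum_wj (~~ b) 0 s); apply: eq_bigr => w' _; case: (b); rewrite /gg mulr1.
Qed.

Lemma stages_exist : exists g : nat -> seq nat -> L -> L -> R,
  (forall j, stage_ok j (g j)) /\ forall j s, refines j s (g j) (g j.+1 s).
Proof.
have step j (g : {g | stage_ok j g}) :
  {g' : {g' | stage_ok j.+1 g'} | forall s, refines j s (sval g) (sval g' s)}.
  case: g => g hg /=; apply: cid.
  have [g' hg'] := choice (fun s => @refine_stage j g s hg).
  have ok : stage_ok j.+1 g' by move=> s; case: (hg' s).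
  by exists (exist _ g' ok).
pose fix h j : {g | stage_ok j g} :=
  if j is j'.+1 then sval (step j' (h j')) else exist _ _ stage_ok0.
exists (fun j => sval (h j)); split=> [j|j s]; first exact: (svalP (h j)).
exact: (svalP (step j (h j))).
Qed.

(** Distinct typical names have distinct labels, so at most as many of them are ambiguous as the
    other side has labels, namely [expR (bet j * len s)]; each has mass at most
    [expR (- (the j.+1 * len s))]. *)
Lemma bad_mass j s g g' : refines j s g g' ->
  forall b, b = odd j.+1 ->
  \sum_(w <- W b j.+1 s | typ b j.+1 s w && multi b j.+1 s g' (lab b j.+1 s w)) wj b j.+1 s w
   <= expR (- ((the j.+1 - bet j) * len s)).
Proof.
move=> [_ _ _ hc] b hb'.
pose P w := typ b j.+1 s w && multi b j.+1 s g' (lab b j.+1 s w).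
have hb : ~~ b != odd j.+1 by rewrite hb'; case: odd.
rewrite -big_filter.
apply: (@le_trans _ _ ((size [seq w <- W b j.+1 s | P w])%:R * expR (- (the j.+1 * len s)))).
  rewrite -sum1_size natr_sum mulr_suml big_seq [X in _ <= X]big_seq; apply: ler_sum => w.
  by rewrite mem_filter mul1r => /andP[/andP[/and4P[_ _ _]]].
rewrite mulrBl opprB expRD; apply: ler_wpM2r; first exact: expR_ge0.
apply: le_trans (nlab_other s hb); rewrite ler_nat.
apply: leq_trans (hc b).
rewrite -(size_map (lab b j.+1 s)); apply: uniq_leq_size.
  rewrite map_inj_in_uniq ?filter_uniq ?W_uniq// => w1 w2.
  rewrite !mem_filter => /andP[/andP[t1 _] _] /andP[/andP[t2 _] _] /=.
  by rewrite t1 t2 => -[].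
move=> l /mapP[w]; rewrite mem_filter => /andP[/andP[_ hm] hw] ->.
by rewrite mem_undup map_f// mem_filter hm.
Qed.

End Stages.

(** * Marks and blocks *)

Definition Om := int -> nat -> bool.

Definition win r (x : Om) (u : int) (n : nat) : seq (seq bool) :=
  [seq mkseq (x (u + k%:Z)) r | k <- iota 0 n].

Lemma size_win r x u n : size (win r x u n) = n.
Proof. by rewrite size_map size_iota. Qed.

Lemma win_cat r x u a b : win r x u (a + b) = win r x u a ++ win r x (u + a%:Z) b.
Proof.
rewrite /win iotaD map_cat add0n -{2}[a]addn0 iotaDl -map_comp.
by congr (_ ++ _); apply: eq_map => k /=; congr (mkseq (x _) r); lia.
Qed.

Lemma winS r x u n : win r x u n.+1 = mkseq (x u) r :: win r x (u + 1) n.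
Proof. by rewrite -add1n win_cat /win /= addr0. Qed.

Lemma nth_win r x u n k : (k < n)%N -> nth [::] (win r x u n) k = mkseq (x (u + k%:Z)) r.
Proof. by move=> h; rewrite (nth_map 0%N) ?size_iota// nth_iota. Qed.

Lemma take_mkseq (T : Type) (f : nat -> T) r r' : (r' <= r)%N -> take r' (mkseq f r) = mkseq f r'.
Proof. by move=> h; rewrite /mkseq -map_take take_iota; congr map; congr iota; lia. Qed.

Lemma win_take r r' x u n : (r' <= r)%N -> map (take r') (win r x u n) = win r' x u n.
Proof. by move=> h; rewrite /win -map_comp; apply: eq_map => k /=; rewrite take_mkseq. Qed.

Lemma win_sub r x u n a b : (a + b <= n)%N -> take b (drop a (win r x u n)) = win r x (u + a%:Z) b.
Proof.
move=> h; have -> : n = (a + (b + (n - a - b)))%N by lia.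
by rewrite win_cat drop_size_cat ?size_win// win_cat take_size_cat ?size_win.
Qed.

Lemma eq_win r x y u n : (forall k, (k < n)%N -> mkseq (x (u + k%:Z)) r = mkseq (y (u + k%:Z)) r) ->
  win r x u n = win r y u n.
Proof. by move=> h; apply/eq_in_map => k; rewrite mem_iota => /andP[_ hk]; apply: h; lia. Qed.

Lemma win_inj r x y u n k : win r x u n = win r y u n -> (k < n)%N ->
  mkseq (x (u + k%:Z)) r = mkseq (y (u + k%:Z)) r.
Proof. by move=> h hk; rewrite -!(nth_win _ _ _ hk) h. Qed.

Lemma mkseq_bit (f g : nat -> bool) r k : mkseq f r = mkseq g r -> (k < r)%N -> f k = g k.
Proof. by move=> h hk; rewrite -(nth_mkseq false f hk) h nth_mkseq. Qed.

Definition oshift (x : Om) : Om := fun i => x (i + 1).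

Lemma win_shift r x u n : win r (oshift x) u n = win r x (u + 1) n.
Proof. by apply: eq_map => k; rewrite /oshift; congr mkseq; congr x; lia. Qed.

Section Marks.
Variable M : int -> bool.

Definition nomark (u : int) (n : nat) := all (fun k => ~~ M (u + k%:Z)) (iota 0 n).

Lemma nomarkP u n : reflect (forall i, u <= i < u + n%:Z -> ~~ M i) (nomark u n).
Proof.
apply: (iffP allP) => [h i hi|h k].
  have := h `|i - u|%N; rewrite mem_iota.
  have -> : u + `|i - u|%N%:Z = i by lia.
  by apply; lia.
by rewrite mem_iota => hk; apply: h; lia.
Qed.

Lemma nomarkF u n i : nomark u n -> M i -> u <= i < u + n%:Z -> False.
Proof. by move=> /nomarkP h hM /h; rewrite hM. Qed.

(** The list records the successive gaps between marks; the endpoint [u + sumn s] is a mark too. *)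
Fixpoint mpath (u : int) (s : seq nat) : bool :=
  M u && (if s is n :: s' then [&& (0 < n)%N, nomark (u + 1) n.-1 & mpath (u + n%:Z) s']
          else true).

Fixpoint rk (N : nat) (s : seq nat) : bool :=
  if s is n :: s' then if s' is [::] then (N < n)%N else (n <= N)%N && rk N s' else false.

(** A block runs from the mark closing one gap longer than [N] to the mark closing the next such
    gap, so it contains its final long gap and blocks of one rank tile the line. Only [N] positions
    before [u] are inspected, which keeps the notion local. *)
Definition blk N u s := [&& mpath u s, nomark (u - N%:Z) N & rk N s].

Lemma mpath_head u s : mpath u s -> M u.
Proof. by case: s => [|n s] /= /andP[]. Qed.

Lemma mpath_cat u s1 s2 :
  mpath u (s1 ++ s2) = mpath u s1 && mpath (u + (sumn s1)%:Z) s2.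
Proof.
elim: s1 u => [|n s IH] u /=.
  by rewrite addr0 andbT; apply/idP/andP => [h|[]//]; split=> //; exact: mpath_head h.
rewrite IH -!andbA; do 4 congr (_ && _).
by congr (mpath _ _); lia.
Qed.

Lemma mpath_last u s : mpath u s -> M (u + (sumn s)%:Z).
Proof. by move=> h; have := h; rewrite -{1}[s]cats0 mpath_cat => /andP[_ /andP[]]. Qed.

Lemma mpath_next u n s n' s' : mpath u (n :: s) -> mpath u (n' :: s') -> n = n'.
Proof.
move=> /= /and4P[_ a0 ha' /mpath_head ha] /and4P[_ b0 hb' /mpath_head hb].
apply/eqP; rewrite eqn_leq; apply/andP; split; rewrite leqNgt; apply/negP => hlt.
  by apply: nomarkF ha' hb _; lia.
by apply: nomarkF hb' ha _; lia.
Qed.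

(** Gap lists of rank [N] form a prefix code, and paths from the same mark read the same gaps. *)
Lemma rk_inj N u s s' : mpath u s -> mpath u s' -> rk N s -> rk N s' -> s = s'.
Proof.
elim: s s' u => [|n s IH] [|n' s'] u // h h'.
have e := mpath_next h h'; subst n'.
move: h h' => /= /and4P[_ _ _ h] /and4P[_ _ _ h'].
case: s s' IH h h' => [|a s] [|a' s'] IH h h'.
- by [].
- by move=> h1 /andP[h2 _]; lia.
- by move=> /andP[h2 _] h1; lia.
by move=> /andP[_ h1] /andP[_ h2]; rewrite (IH (a' :: s') _ h h').
Qed.

Lemma mpath_pos u s : mpath u s -> all (leq 1) s.
Proof. by elim: s u => //= n s IH u /and4P[_ -> _ /IH]. Qed.

Lemma rk_sumn N s : rk N s -> (N < sumn s)%N.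
Proof.
elim: s => //= n [|a s] IH; first by rewrite /= addn0.
by move=> /andP[_ /IH] /=; lia.
Qed.

(* A mark strictly inside a rank-N block ends a gap of length at most N, so it
   cannot start another rank-N block. *)
Lemma blk_start N u s v : mpath u s -> rk N s -> u < v < u + (sumn s)%:Z -> M v ->
  ~~ nomark (v - N%:Z) N.
Proof.
elim: s u => //= n s IH u /and4P[hu n0 hn hp] hr hv hM.
have hnv : u + n%:Z <= v.
  by rewrite leNgt; apply/negP => h; apply: nomarkF hn hM _; lia.
case: s IH hr hv hp => [|a s] IH hr hv hp; first by exfalso; move: hv => /=; lia.
move: hr => /andP[hnN hr].
have [e|hne] := eqVneq v (u + n%:Z).
  by apply/negP => h; apply: nomarkF h hu _; lia.
by apply: (IH (u + n%:Z)) => //; move: hv => /=; lia.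
Qed.

Lemma blk_uniq N u s u' s' i : blk N u s -> blk N u' s' ->
  u <= i < u + (sumn s)%:Z -> u' <= i < u' + (sumn s')%:Z -> u = u' /\ s = s'.
Proof.
have aux v t v' t' : blk N v t -> blk N v' t' -> v <= i < v + (sumn t)%:Z ->
    v' <= i < v' + (sumn t')%:Z -> v' <= v.
  move=> /and3P[p n r] /and3P[p' n' r'] h h'; rewrite leNgt; apply/negP => hlt.
  have h1 : v < v' < v + (sumn t)%:Z by lia.
  by have := blk_start p r h1 (mpath_head p'); rewrite n'.
move=> h h' hi hi'.
have e : u = u'.
  by have := aux _ _ _ _ h h' hi hi'; have := aux _ _ _ _ h' h hi' hi; lia.
subst u'; split=> //; move: h h' => /and3P[p _ r] /and3P[p' _ r'].
exact: rk_inj p p' r r'.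
Qed.

(** The last gap exceeds [N'], hence [N], so no unfinished piece remains at the end. *)
Lemma split_rk N N' s : (N <= N')%N -> rk N' s -> all (rk N) (split N s).
Proof.
move=> hN; elim: s => // n s IH /= h.
have hs : s != [::] -> all (rk N) (split N s).
  by case: (s) h IH => // a s' /andP[_ h] IH _; exact: IH.
case: ifP => hn /=.
  rewrite hn; case: (eqVneq s [::]) => [->//|/hs//].
have sne : s != [::] by case: (s) h => //; lia.
have := hs sne; case e : (split N s) => [|t ts] /=.
  by have := flatten_split N s; rewrite e /= => h1; rewrite -h1 in sne.
by move=> /andP[ht ->]; rewrite andbT; case: (t) ht => // a t' ht; rewrite ht andbT; lia.
Qed.

Lemma rk_last N s : rk N s -> exists s' n, s = rcons s' n /\ (N < n)%N.
Proof.
elim: s => // n [|a s] IH /=; first by exists [::], n.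
by move=> /andP[_ /IH[s' [n' [-> h]]]]; exists (n :: s'), n'.
Qed.

(** A sub-block is preceded by the long gap ending the previous one or, if it is the leftmost, by
    the [N'] unmarked positions before the whole block. *)
Lemma sub_blk N N' u s ss1 t ss2 : (N <= N')%N -> blk N' u s ->
  split N s = ss1 ++ t :: ss2 -> blk N (u + (sumn (flatten ss1))%:Z) t.
Proof.
move=> hN /and3P[hp hn hr] e.
have := split_rk hN hr; rewrite e all_cat /= => /and3P[h1 h2 _].
have hf : s = flatten ss1 ++ t ++ flatten ss2.
  by rewrite -(flatten_split N s) e flatten_cat.
move: hp; rewrite hf !mpath_cat => /and3P[p1 p2 _].
rewrite /blk p2 h2 andbT /=.
case/lastP: ss1 e h1 hf p1 p2 => [|ss0 t0] e h1 hf p1 p2.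
  by rewrite /= addr0; apply/nomarkP => i hi; move/nomarkP: hn; apply; lia.
move: h1; rewrite all_rcons => /andP[/rk_last[t' [n [et hn']]] _].
move: p1; rewrite et -cats1 flatten_cat /= cats0 -cats1 !mpath_cat !sumn_cat /= addn0.
move=> /and3P[_ _ /and4P[_ _ /nomarkP h _]].
by apply/nomarkP => i hi; apply: h; lia.
Qed.

Lemma split_find (ss : seq (seq nat)) (u i : int) :
  u <= i < u + (sumn (flatten ss))%:Z ->
  exists ss1 t ss2, ss = ss1 ++ t :: ss2 /\
    u + (sumn (flatten ss1))%:Z <= i < u + (sumn (flatten ss1))%:Z + (sumn t)%:Z.
Proof.
elim: ss u => [|t ss IH] u /=; first by lia.
rewrite sumn_cat => h; case: (ltP i (u + (sumn t)%:Z)) => hi.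
  by exists [::], t, ss; split=> //=; lia.
have [|ss1 [t' [ss2 [-> h']]]] := IH (u + (sumn t)%:Z); first by lia.
by exists (t :: ss1), t', ss2; split=> //=; rewrite sumn_cat; lia.
Qed.

Lemma mpath_exists u v : M u -> M v -> u <= v -> exists s, mpath u s /\ u + (sumn s)%:Z = v.
Proof.
move=> hu hv huv.
have [n] := ubnP `|v - u|%N; elim: n u hu huv => // n IH u hu huv hn.
have [->|hne] := eqVneq u v; first by exists [::]; rewrite /= hv; split=> //; lia.
have hex : exists k : nat, (0 < k)%N && M (u + k%:Z).
  by exists `|v - u|%N; have -> : u + `|v - u|%N%:Z = v by [lia]; rewrite hv andbT; lia.
case: (ex_minnP hex) => k /andP[k0 hk] hmin.
have hkv : u + k%:Z <= v.
  suff : (k <= `|v - u|)%N by lia.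
  by apply: hmin; have -> : u + `|v - u|%N%:Z = v by [lia]; rewrite hv andbT; lia.
have [|s [hs e]] := IH (u + k%:Z) hk hkv; first by lia.
exists (k :: s); split; last by rewrite /=; lia.
rewrite /= hu k0 hs andbT /=; apply/nomarkP => i hi; apply/negP => hM.
have := hmin `|i - u|%N; have -> : u + `|i - u|%N%:Z = i by lia.
by rewrite hM andbT; lia.
Qed.

Definition cut N u := M u && nomark (u - N%:Z) N.

Lemma rk_between N u s : mpath u s -> s != [::] -> cut N (u + (sumn s)%:Z) ->
  (forall v, u < v < u + (sumn s)%:Z -> ~~ cut N v) -> rk N s.
Proof.
elim: s u => // n s IH u /= /and4P[hu n0 /nomarkP hn hp] _ /andP[_ hc] hno.
case: s IH hp hc hno => [|a s] IH hp hc hno.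
  rewrite ltnNge; apply/negP => hnN; apply: nomarkF hc hu _; move=> /=; lia.
have hsp : (0 < sumn (a :: s))%N by have := mpath_pos hp => /= /andP[]; lia.
apply/andP; split; last first.
  apply: (IH (u + n%:Z)) => //.
    rewrite /cut (mpath_last hp); move: hc; congr (nomark _ _); lia.
  by move=> v hv; apply: hno; lia.
have := hno (u + n%:Z); rewrite /cut (mpath_head hp) /=.
have h1 : u < u + n%:Z < u + (n + sumn (a :: s))%:Z by lia.
move=> /(_ h1) /=; apply: contraR; rewrite -ltnNge => hnN.
by apply/nomarkP => i hi; apply: hn; lia.
Qed.

(** The block reaches from the last cut at or before [i] to the first cut after it. *)
Lemma blk_exists N u0 v0 i : cut N u0 -> cut N v0 -> u0 <= i < v0 ->
  exists u s, [/\ blk N u s, u0 <= u <= i & i < u + (sumn s)%:Z <= v0].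
Proof.
move=> hu hv hi.
have e1 : exists k : nat, (k <= `|i - u0|)%N && cut N (i - k%:Z).
  by exists `|i - u0|%N; have -> : i - `|i - u0|%N%:Z = u0 by [lia]; rewrite hu andbT.
case: (ex_minnP e1) => k /andP[hk ck] hkmin.
have e2 : exists k : nat, (0 < k <= `|v0 - i|)%N && cut N (i + k%:Z).
  by exists `|v0 - i|%N; have -> : i + `|v0 - i|%N%:Z = v0 by [lia]; rewrite hv andbT; lia.
case: (ex_minnP e2) => l /andP[hl cl] hlmin.
have [|||s [hs es]] := @mpath_exists (i - k%:Z) (i + l%:Z).
- by case/andP: ck.
- by case/andP: cl.
- by lia.
exists (i - k%:Z), s; split; [|lia|lia].
apply/and3P; split=> //; first by case/andP: ck.
apply: (rk_between hs).
- by case: (s) es => //= ; lia.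
- by rewrite es.
move=> v hv'; apply/negP => cv.
case: (leP v i) => hvi.
  have := hkmin `|i - v|%N; have -> : i - `|i - v|%N%:Z = v by lia.
  by rewrite cv andbT; lia.
have := hlmin `|v - i|%N; have -> : i + `|v - i|%N%:Z = v by lia.
by rewrite cv andbT; lia.
Qed.

End Marks.

Section Names.
Implicit Types (lv : nat -> nat) (x y : Om).

(** How many bits of a letter are shown depends on the length of its gap; [lvat] is that number at
    offset [k] of the block. *)
Fixpoint nm lv x (u : int) (s : seq nat) : seq (seq (seq bool)) :=
  if s is n :: s' then win (lv n) x u n :: nm lv x (u + n%:Z) s' else [::].

Fixpoint lvat lv (s : seq nat) (k : nat) : nat :=
  if s is n :: s' then if (k < n)%N then lv n else lvat lv s' (k - n) else 0.

Lemma size_nm lv x u s : size (nm lv x u s) = size s.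
Proof. by elim: s u => //= n s IH u; rewrite IH. Qed.

Lemma nm_cat lv x u s1 s2 : nm lv x u (s1 ++ s2) = nm lv x u s1 ++ nm lv x (u + (sumn s1)%:Z) s2.
Proof.
elim: s1 u => [|n s IH] u /=; first by rewrite addr0.
by rewrite IH; congr (_ :: _ ++ nm _ _ _ _); lia.
Qed.

Lemma nm_co lv lv' x u s : (forall n, (lv' n <= lv n)%N) ->
  mapw (fun n => map (take (lv' n))) s (nm lv x u s) = nm lv' x u s.
Proof. by move=> h; elim: s u => //= n s IH u; rewrite IH win_take. Qed.

Lemma eq_nm lv x y u s :
  (forall k, (k < sumn s)%N -> mkseq (x (u + k%:Z)) (lvat lv s k) = mkseq (y (u + k%:Z)) (lvat lv s k)) ->
  nm lv x u s = nm lv y u s.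
Proof.
elim: s u => //= n s IH u h; congr (_ :: _).
  by apply: eq_win => k hk; have := h k; rewrite hk; apply; lia.
apply: IH => k hk; have := h (n + k)%N.
have -> : (n + k < n)%N = false by lia.
have -> : (n + k - n)%N = k by lia.
by rewrite PoszD addrA; apply; lia.
Qed.

Lemma nm_inj lv x y u s k : nm lv x u s = nm lv y u s -> (k < sumn s)%N ->
  mkseq (x (u + k%:Z)) (lvat lv s k) = mkseq (y (u + k%:Z)) (lvat lv s k).
Proof.
elim: s u k => //= n s IH u k [h1 h2] hk; case: ifP => hkn; first exact: win_inj h1 hkn.
have := IH _ (k - n)%N h2; have -> : u + n%:Z + (k - n)%N%:Z = u + k%:Z by lia.
by apply; lia.
Qed.

Lemma nm_shift lv x u s : nm lv (oshift x) u s = nm lv x (u + 1) s.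
Proof. by elim: s u => //= n s IH u; rewrite win_shift IH; congr (_ :: nm _ _ _ _); lia. Qed.

Lemma lvat_cat lv s1 s2 k : lvat lv (s1 ++ s2) (sumn s1 + k) = lvat lv s2 k.
Proof.
elim: s1 => //= n s IH; rewrite -addnA.
have -> : (n + (sumn s + k) < n)%N = false by lia.
by have -> : (n + (sumn s + k) - n)%N = (sumn s + k)%N by [lia].
Qed.

Lemma lvat_catl lv s1 s2 k : (k < sumn s1)%N -> lvat lv (s1 ++ s2) k = lvat lv s1 k.
Proof.
elim: s1 k => //= n s IH k hk; case: ifP => // h; apply: IH; lia.
Qed.

Lemma leq_lvat lv lv' s k : (forall n, (lv' n <= lv n)%N) -> (lvat lv' s k <= lvat lv s k)%N.
Proof. by move=> h; elim: s k => //= n s IH k; case: ifP. Qed.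

End Names.

(** * Sources and marker words *)

Section Source.
Context {R : realType}.

Record source (P : seq bool -> R) : Prop := Source {
  src_ge0 : forall w, 0 <= P w;
  src_nil : P [::] = 1;
  src_add : forall w, P w = P (rcons w false) + P (rcons w true) }.

Fixpoint bits (r : nat) : seq (seq bool) :=
  if r is r'.+1 then [seq rcons w c | w <- bits r', c <- [:: false; true]] else [:: [::]].

(** Null prefixes are discarded because the couplings need positive weights, whose logarithms are
    also taken. *)
Definition lets (P : seq bool -> R) r := [seq w <- bits r | 0 < P w].

Lemma mem_bits r w : (w \in bits r) = (size w == r).
Proof.
elim: r w => [|r IH] w; first by rewrite inE; case: w.
apply/allpairsP/eqP => [[[v c] /= [hv _ ->]]|].
  by rewrite size_rcons; move: hv; rewrite IH => /eqP ->.
case/lastP: w => // v c; rewrite size_rcons => -[hv].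
by exists (v, c); rewrite /= IH hv eqxx; split=> //; case: c.
Qed.

Lemma bits_uniq r : uniq (bits r).
Proof.
elim: r => [//|r IH]; apply: (@allpairs_uniq _ _ _ rcons) => // -[w c] [w' c'] _ _ /= /rcons_inj [-> ->]//.
Qed.

Lemma big_bitsS r (F : seq bool -> R) :
  \sum_(w <- bits r.+1) F w = \sum_(w <- bits r) (F (rcons w false) + F (rcons w true)).
Proof.
rewrite [LHS](@big_allpairs_dep R 0 +%R _ _ _ (fun w c => rcons w c) (bits r) (fun _ => [:: false; true]) F).
by apply: eq_bigr => w _; rewrite big_cons big_seq1.
Qed.

Variable P : seq bool -> R.
Hypothesis HP : source P.

Lemma big_lets r (F : seq bool -> R) :
  \sum_(w <- lets P r) P w * F w = \sum_(w <- bits r) P w * F w.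
Proof.
rewrite /lets big_filter big_mkcond /=; apply: eq_bigr => w _; case: ifP => // /negbT.
by rewrite -leNgt => h; have -> : P w = 0 by [apply/eqP; rewrite eq_le h src_ge0]; rewrite mul0r.
Qed.

Lemma lets_push r r' (G : seq bool -> R) : (r <= r')%N ->
  \sum_(w <- lets P r') P w * G (take r w) = \sum_(w <- lets P r) P w * G w.
Proof.
move=> /subnK <-; rewrite big_lets big_lets.
elim: (r' - r)%N => [|k IH].
  rewrite add0n [LHS]big_seq [RHS]big_seq; apply: eq_bigr => w; rewrite mem_bits => /eqP <-.
  by rewrite take_size.
rewrite addSn big_bitsS -IH big_seq [RHS]big_seq; apply: eq_bigr => w; rewrite mem_bits => /eqP hw.
by rewrite (src_add HP w) mulrDl -!cats1 !takel_cat// hw leq_addl.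
Qed.

Lemma lets_sum r : \sum_(w <- lets P r) P w = 1.
Proof.
have := @lets_push 0 r (fun=> 1) (leq0n r).
under eq_bigr do rewrite mulr1.
move=> ->; rewrite big_lets /= big_seq1 mulr1; exact: src_nil.
Qed.

Lemma mem_lets r w : (w \in lets P r) = (size w == r) && (0 < P w).
Proof. by rewrite mem_filter mem_bits andbC. Qed.

Lemma lets_uniq r : uniq (lets P r).
Proof. by rewrite filter_uniq ?bits_uniq. Qed.

Lemma src_take w r : P w <= P (take r w).
Proof.
elim/last_ind: w => [//|w c IH]; case: (leqP r (size w)) => h.
  rewrite -cats1 takel_cat// cats1; apply: le_trans IH; rewrite (src_add HP w).
  by case: c; rewrite ?lerDl ?lerDr src_ge0.
by rewrite take_oversize// size_rcons.
Qed.

Definition lwords r n := words (fun _ : nat => lets P r) (nseq n 0%N).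
Definition lwt n w : R := wt (fun _ : nat => P) (nseq n 0%N) w.

Lemma lwords_uniq r n : uniq (lwords r n).
Proof. by apply: words_uniq => _; exact: lets_uniq. Qed.

Lemma mem_lwords r n w :
  (w \in lwords r n) = (size w == n) && all (fun a => (size a == r) && (0 < P a)) w.
Proof.
elim: n w => [|n IH] [|a w] //=; first by apply/negP => /size_words.
by rewrite /lwords -/(nseq n.+1 0%N) words_consE mem_lets -/(lwords r n) IH eqSS andbCA.
Qed.

Lemma lwt_gt0 r n w : w \in lwords r n -> 0 < lwt n w.
Proof. by apply: wt_gt0 => _ a; rewrite mem_lets => /andP[]. Qed.

Lemma lwt_ge0 n w : 0 <= lwt n w.
Proof. by apply: wt_ge0 => _ a; exact: src_ge0. Qed.

Lemma lwords_sum r n : \sum_(w <- lwords r n) lwt n w = 1.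
Proof. by apply: sum_wt => _; exact: lets_sum. Qed.

Lemma mapw_nseq (T T' : eqType) (f : T -> T') n w : size w = n ->
  mapw (fun _ : nat => f) (nseq n 0%N) w = map f w.
Proof. by elim: n w => [|n IH] [|a w] //= [h]; rewrite IH. Qed.

Lemma lwords_push r r' n (F : seq (seq bool) -> R) : (r <= r')%N ->
  \sum_(w <- lwords r' n) lwt n w * F (map (take r) w) =
  \sum_(w <- lwords r n) lwt n w * F w.
Proof.
move=> h.
rewrite -(@sum_mapw R nat _ _ (fun _ => lets P r') (fun _ => P) (fun _ => lets P r) (fun _ => P)
  (fun _ => take r)).
  rewrite [LHS]big_seq [RHS]big_seq; apply: eq_bigr => w /size_words hw.
  by rewrite mapw_nseq// hw size_nseq.
by move=> _ G; exact: lets_push.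
Qed.

Lemma lwords_take r r' n w : (r <= r')%N -> w \in lwords r' n -> map (take r) w \in lwords r n.
Proof.
rewrite !mem_lwords size_map => h /andP[-> /= /allP ha]; apply/allP => a /mapP[c /ha /andP[/eqP hs hp] ->].
by rewrite size_takel ?hs// eqxx (lt_le_trans hp)// src_take.
Qed.

Lemma nseqD (n k : nat) (a : nat) : nseq (n + k) a = nseq n a ++ nseq k a.
Proof. by elim: n => //= n ->. Qed.

Lemma lwords_cat r n k (F : seq (seq bool) -> R) :
  \sum_(w <- lwords r (n + k)) lwt (n + k) w * F w =
  \sum_(w <- lwords r n) lwt n w * \sum_(w' <- lwords r k) lwt k w' * F (w ++ w').
Proof.
rewrite /lwords nseqD big_words_cat big_seq [RHS]big_seq; apply: eq_bigr => w /size_words hw.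
rewrite mulr_sumr; apply: eq_bigr => w' _.
by rewrite /lwt nseqD wt_cat// mulrA.
Qed.

End Source.

Section Marker.
Context {R : realType} (P : seq bool -> R) (r0 K : nat) (mk : seq (seq bool) -> bool).

(** The test reads [r0] bits only, so its answer is the same at every level from [r0] on. *)
Definition mkat e k := mk (map (take r0) (take K (drop k e))).
Definition mark (x : Om) (i : int) := mk (win r0 x i K).
(** Only markers contained in the [n] letters are tested; one starting in the last [K - 1] places
    would overlap the mark that closes the gap. *)
Definition el n e := [&& (K <= n)%N, mkat e 0 & all (fun k => ~~ mkat e k) (iota 1 (n - K))].
Definition vel r n : R := \sum_(e <- lwords P r n | el n e) lwt P n e.

Lemma mkat_win r x u n k : (r0 <= r)%N -> (k + K <= n)%N ->
  mkat (win r x u n) k = mark x (u + k%:Z).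
Proof. by move=> h hk; rewrite /mkat win_sub// win_take. Qed.

Lemma mkat_take r e k : (r0 <= r)%N -> mkat (map (take r) e) k = mkat e k.
Proof.
move=> h; rewrite /mkat -map_drop -map_take -map_comp; congr mk.
by apply: eq_map => a /=; rewrite take_takel.
Qed.

Lemma el_take r n e : (r0 <= r)%N -> el n (map (take r) e) = el n e.
Proof.
by move=> h; rewrite /el mkat_take//; do 2 congr (_ && _); apply: eq_all => k; rewrite mkat_take.
Qed.

Hypothesis HP : source P.

Lemma velE r n : (r0 <= r)%N -> vel r n = vel r0 n.
Proof.
move=> h; rewrite /vel big_mkcond [RHS]big_mkcond /=.
transitivity (\sum_(e <- lwords P r n) lwt P n e * (el n (map (take r0) e))%:R).
  by apply: eq_bigr => e _; rewrite el_take//; case: (el n e); rewrite ?mulr1 ?mulr0.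
rewrite (lwords_push HP n (fun e => (el n e)%:R) h).
by apply: eq_bigr => e _; case: (el n e); rewrite ?mulr1 ?mulr0.
Qed.

Hypothesis K0 : (0 < K)%N.
Hypothesis novl : forall x i d, (0 < d < K)%N -> mark x i -> mark x (i + d%:Z) -> False.

(** Makes the marks a renewal process: being a gap of length [n] becomes an event about its own [n]
    letters. Non-overlap gives [K <= n] and excludes marks in the last [K - 1] positions. *)
Lemma mpath_el r x u n s : (r0 <= r)%N ->
  mpath (mark x) u (n :: s) = el n (win r x u n) && mpath (mark x) (u + n%:Z) s.
Proof.
move=> hr; apply/idP/andP => /=.
  case/and4P => hu n0 hn hp; split=> //.
  have hK : (K <= n)%N.
    by rewrite leqNgt; apply/negP => h; apply: (novl _ hu (mpath_head hp)); rewrite n0.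
  rewrite /el hK mkat_win// addr0 hu /=; apply/allP => k; rewrite mem_iota => hk.
  by rewrite mkat_win; [move/nomarkP: hn; apply; lia|done|lia].
case=> /and3P[hK]; rewrite mkat_win ?add0n// addr0 => hu /allP hn hp.
rewrite hu hp andbT (leq_trans K0 hK) /=; apply/nomarkP => i hi.
case: (leP i (u + (n - K)%N%:Z)) => hi'.
  have := hn `|i - u|%N; rewrite mem_iota mkat_win//; last by lia.
  have -> : u + `|i - u|%N%:Z = i by lia.
  by apply; lia.
apply/negP => hm; pose d := absz (u + n%:Z - i)%R.
have hd : i + d%:Z = u + n%:Z by rewrite /d; lia.
by apply: (novl (d := d) _ hm); rewrite ?hd ?(mpath_head hp)// /d; lia.
Qed.

Lemma el_mark r x u n : (r0 <= r)%N -> el n (win r x u n) -> mark x u.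
Proof. by move=> hr /and3P[hK]; rewrite mkat_win// addr0. Qed.

Lemma mark_shift x i : mark (oshift x) i = mark x (i + 1).
Proof. by rewrite /mark win_shift. Qed.

End Marker.

Section Pair.
Context {R : realType} (P : bool -> seq bool -> R) (r0 : bool -> nat) (K : nat).
Variables (mk : bool -> seq (seq bool) -> bool) (v : nat -> R) (lev : bool -> nat -> nat).
Notation T := (seq (seq bool)).
Notation elb b := (el (r0 b) K (mk b)).

(** Gaps longer than [lev b j] are left blank (level 0), so only finitely many gap lengths carry
    information at stage [j]. The condition on [v n] excludes lengths of probability 0, for which
    there is no conditional law. *)
Definition kept b j n := (n <= lev b j)%N && (0 < v n).
Definition lv b j n := if kept b j n then lev b j else 0%N.
Definition sp b j n : seq T :=
  if kept b j n then [seq e <- lwords (P b) (lev b j) n | elb b n e] else [:: nseq n [::]].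
Definition mm b j n (e : T) : R := if kept b j n then lwt (P b) n e / v n else 1.
Definition co b j n : T -> T := map (take (lv b j n)).

Hypothesis HP : forall b, source (P b).
Hypothesis lev0 : forall b j, (r0 b <= lev b j)%N.
Hypothesis levS : forall b j, (lev b j <= lev b j.+1)%N.
Hypothesis vP : forall b n, v n = vel (P b) (r0 b) K (mk b) (r0 b) n.

Lemma kept_mono b j n : kept b j n -> kept b j.+1 n.
Proof. by move=> /andP[h h']; rewrite /kept h' andbT (leq_trans h). Qed.

Lemma lv_mono b j n : (lv b j n <= lv b j.+1 n)%N.
Proof. by rewrite /lv; case: ifP => // /kept_mono ->. Qed.

Lemma lv_lev b j n : (lv b j n <= lev b j)%N.
Proof. by rewrite /lv; case: ifP. Qed.

Lemma sp_uniq b j n : uniq (sp b j n).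
Proof. by rewrite /sp; case: ifP => // _; rewrite filter_uniq ?lwords_uniq. Qed.

Lemma mm_gt0 b j n a : a \in sp b j n -> 0 < mm b j n a.
Proof.
rewrite /sp /mm; case: ifP => // /andP[_ v0]; rewrite mem_filter => /andP[_ ha].
by rewrite divr_gt0// (lwt_gt0 ha).
Qed.

Lemma mm_sum b j n : \sum_(a <- sp b j n) mm b j n a = 1.
Proof.
rewrite /sp /mm; case: ifP => [/andP[_ v0]|_]; last by rewrite big_seq1.
by rewrite big_filter -mulr_suml -/(vel _ _ _ _ _ _) velE// -vP divff// gt_eqF.
Qed.

Lemma nseq_take0 n (e : T) : size e = n -> map (take 0) e = nseq n [::].
Proof. by move=> <-; elim: e => //= a e ->; rewrite take0. Qed.

Lemma size_sp b j n a : a \in sp b j n -> size a = n.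
Proof.
rewrite /sp; case: ifP => _; last by rewrite inE => /eqP ->; rewrite size_nseq.
by rewrite mem_filter mem_lwords => /and3P[_ /eqP].
Qed.

Lemma sp_lv b j n a : a \in sp b j n -> all (fun c => size c == lv b j n) a.
Proof.
rewrite /sp /lv; case: ifP => _; last by rewrite inE => /eqP ->; rewrite all_nseq orbT.
by rewrite mem_filter mem_lwords => /and3P[_ _ /allP h]; apply/allP => c /h /andP[].
Qed.

Lemma co_sp b j n a : a \in sp b j.+1 n -> co b j n a \in sp b j n.
Proof.
move=> ha; rewrite /co /lv /sp; case: ifP => hk; last by rewrite (nseq_take0 (size_sp ha)) inE.
move: ha; rewrite /sp (kept_mono hk) !mem_filter => /andP[h1 h2].
by rewrite el_take// h1 (lwords_take _ _ h2).
Qed.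

Lemma co_push b j n (G : T -> R) :
  \sum_(a <- sp b j.+1 n) mm b j.+1 n a * G (co b j n a) =
  \sum_(a <- sp b j n) mm b j n a * G a.
Proof.
rewrite /co /lv; case: (boolP (kept b j n)) => hk.
  rewrite /sp /mm hk (kept_mono hk) !big_filter big_mkcond [RHS]big_mkcond /=.
  transitivity (\sum_(e <- lwords (P b) (lev b j.+1) n) lwt (P b) n e *
     (fun e' => if elb b n e' then G e' / v n else 0) (map (take (lev b j)) e)).
    apply: eq_bigr => e _; rewrite el_take//; case: ifP => _; last by rewrite mulr0.
    by rewrite mulrAC -mulrA.
  rewrite (lwords_push (HP b) n (fun e' => if elb b n e' then G e' / v n else 0))//.
  apply: eq_bigr => e _; case: ifP => _; last by rewrite mulr0.
  by rewrite mulrCA mulrC mulrAC.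
have -> : \sum_(a <- sp b j n) mm b j n a * G a = G (nseq n [::]).
  by rewrite /sp /mm (negbTE hk) big_seq1 mul1r.
rewrite (eq_big_seq (fun a => mm b j.+1 n a * G (nseq n [::]))).
  by rewrite -mulr_suml mm_sum mul1r.
by move=> a ha; rewrite (nseq_take0 (size_sp ha)).
Qed.

End Pair.

(** * The coding map *)

(** Decoding quantifies over arrays rather than names, so every admissible name has to come from an
    array. *)
Lemma nm_realize lv u s (w : seq (seq (seq bool))) : size w = size s ->
  (forall k, (k < size s)%N -> size (nth [::] w k) = nth 0%N s k /\
     all (fun c => size c == lv (nth 0%N s k)) (nth [::] w k)) ->
  exists y, nm lv y u s = w.
Proof.
elim: s u w => [|n s IH] u [|e w] //; first by exists (fun _ _ => false).
move=> [hs] hw.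
have [||y hy] := IH (u + n%:Z) w; [done|by move=> k hk; exact: (hw k.+1 hk)|].
have [/= he hl] := hw 0%N isT.
exists (fun i r => if i < u + n%:Z then nth false (nth [::] e `|i - u|%N) r else y i r).
rewrite /=; congr (_ :: _); last first.
  rewrite -hy; apply: eq_nm => k hk; apply: eq_map => r /=.
  by have -> : (u + n%:Z + k%:Z < u + n%:Z) = false by lia.
apply: (@eq_from_nth _ [::]); rewrite size_win// => k hk; rewrite nth_win//.
have hsz : size (nth [::] e k) = lv n.
  by apply/eqP; move/allP: hl; apply; rewrite mem_nth// he.
apply: (@eq_from_nth _ false); rewrite size_mkseq ?hsz// => r hr; rewrite nth_mkseq//.
have -> : (u + k%:Z < u + n%:Z) by lia.
by congr (nth _ (nth _ _ _) _); lia.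
Qed.

Lemma mpath_find M u s i : mpath M u s -> u <= i < u + (sumn s)%:Z ->
  exists s1 n s2, [/\ s = s1 ++ n :: s2, u + (sumn s1)%:Z <= i < u + (sumn s1)%:Z + n%:Z &
    mpath M (u + (sumn s1)%:Z) (n :: s2)].
Proof.
elim: s u => [|n s IH] u hp; first by rewrite /=; lia.
move=> /= h; case: (ltP i (u + n%:Z)) => hi.
  by exists [::], n, s; rewrite addr0; split=> //; lia.
have hp' : mpath M (u + n%:Z) s by move: hp => /= /and4P[].
have [|s1 [n' [s2 [-> h1 h2]]]] := IH _ hp'; first by lia.
exists (n :: s1), n', s2; split=> //=; first by lia.
by rewrite (_ : u + (n + sumn s1)%N%:Z = u + n%:Z + (sumn s1)%:Z)//; lia.
Qed.

Section Decode.
Context {R : realType} (P : bool -> seq bool -> R) (r0 : bool -> nat) (K : nat).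
Variables (mk : bool -> seq (seq bool) -> bool) (v : nat -> R) (lev : bool -> nat -> nat).
Variables (N : nat -> nat) (kap the : nat -> R).
Notation T := (seq (seq bool)).
Notation L := (GenTree.tree (seq T)).
Variable g : nat -> seq nat -> L -> L -> R.
Notation spb := (sp P r0 K mk v lev).
Notation mb := (mm P v lev).
Notation cob := (co v lev).
Notation labb := (lab mb cob N kap the).
Notation Wb := (W spb).
Notation lvb := (lv v lev).
Notation mkb b := (mark (r0 b) K (mk b)).
Notation nmb b j := (nm (lvb b j)).

Definition inW b j x u s := nmb b j x u s \in Wb b j s.
Definition Comp b j x y u s :=
  0 < gg b (g j s) (labb b j s (nmb b j x u s)) (labb (~~ b) j s (nmb (~~ b) j y u s)).

(** Quantifying over all compatible arrays makes decoding persist: compatibility at a later stage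
    implies compatibility on the block of an earlier one. The condition on [lvat] says that the
    partner names display bit [r] at [i]. *)
Definition Dec b j x i r be := exists u s,
  [/\ blk (mkb b x) (N j) u s, u <= i < u + (sumn s)%:Z, inW b j x u s,
      (r < lvat (lvb (~~ b) j) s `|i - u|%N)%N &
      forall y, inW (~~ b) j y u s -> Comp b j x y u s -> y i r = be].

(** Bits that are never decoded come out as [false], so the map is total and equivariant
    everywhere. *)
Definition Phi b (x : Om) : Om := fun i r => `[< exists j, Dec b j x i r true >].

(** A whole window is decoded at one stage, so that a single partner of [x] agrees with [Phi b x] on
    all of it. *)
Definition Good b x := forall n : nat, exists j, (n <= j)%N /\
  forall i r, `|i| <= n%:Z -> (r < n)%N -> exists be, Dec b j x i r be.

Hypothesis HP : forall b, source (P b).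
Hypothesis lev0 : forall b j, (r0 b <= lev b j)%N.
Hypothesis levS : forall b j, (lev b j <= lev b j.+1)%N.
Hypothesis Nmono : forall j, (N j <= N j.+1)%N.
Hypothesis K0 : (0 < K)%N.
Hypothesis novl : forall b x i d, (0 < d < K)%N -> mkb b x i -> mkb b x (i + d%:Z) -> False.
Hypothesis gok : forall j, stage_ok spb mb cob N kap the j (g j).
Hypothesis gref : forall j s, refines spb mb cob N kap the j s (g j) (g j.+1 s).

Lemma cow_nm b j x u s : cow cob b j s (nmb b j.+1 x u s) = nmb b j x u s.
Proof. by apply: nm_co => n; exact: lv_mono. Qed.

Lemma inW_co b j x u s : inW b j.+1 x u s -> inW b j x u s.
Proof. by rewrite /inW -(cow_nm b j x u s); apply: cow_W => b' j' n a; exact: co_sp. Qed.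

Lemma inW_cat b j x u s1 s2 :
  inW b j x u (s1 ++ s2) = inW b j x u s1 && inW b j x (u + (sumn s1)%:Z) s2.
Proof. by rewrite /inW nm_cat /W mem_words_cat ?size_nm. Qed.

Lemma split_flat n s ss1 t ss2 : split n s = ss1 ++ t :: ss2 -> s = flatten ss1 ++ t ++ flatten ss2.
Proof. by move=> h; rewrite -(flatten_split n s) h flatten_cat. Qed.

Lemma inW_sub b j x u s ss1 t ss2 : inW b j.+1 x u s -> split (N j) s = ss1 ++ t :: ss2 ->
  inW b j x (u + (sumn (flatten ss1))%:Z) t.
Proof. by move=> /inW_co h /split_flat e; move: h; rewrite e !inW_cat => /and3P[]. Qed.

Lemma nm_mid lv x u s1 t s2 :
  take (size t) (drop (size s1) (nm lv x u (s1 ++ t ++ s2))) = nm lv x (u + (sumn s1)%:Z) t.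
Proof. by rewrite nm_cat drop_size_cat ?size_nm// nm_cat take_size_cat ?size_nm. Qed.

Lemma Comp_sub b j x y u s ss1 t ss2 : inW b j.+1 x u s -> inW (~~ b) j.+1 y u s ->
  Comp b j.+1 x y u s -> split (N j) s = ss1 ++ t :: ss2 ->
  Comp b j x y (u + (sumn (flatten ss1))%:Z) t.
Proof.
move=> hx hy hc e; have [_ _ h _] := gref j s.
have := h b _ _ hx hy hc; rewrite !cow_nm e !chop_cat /=.
rewrite {2 5}(split_flat e) !nm_mid; apply: pg_gt0_cat.
- by move=> s'; case: (gok j s').
- by rewrite size_chop.
- by rewrite size_chop.
Qed.

(** Iterates [Comp_sub] down the hierarchy; uniqueness of the block of rank [N j] around [i]
    identifies the sub-block reached with the given one. *)
Lemma Comp_descent b j j' x y u s u' s' M i : (j <= j')%N ->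
  blk M (N j') u' s' -> blk M (N j) u s ->
  u' <= i < u' + (sumn s')%:Z -> u <= i < u + (sumn s)%:Z ->
  inW b j' x u' s' -> inW (~~ b) j' y u' s' -> Comp b j' x y u' s' ->
  [/\ inW b j x u s, inW (~~ b) j y u s, Comp b j x y u s & u' <= u /\ u + (sumn s)%:Z <= u' + (sumn s')%:Z].
Proof.
move=> /subnK <-; elim: (j' - j)%N u' s' => [|k IH] u' s' hb' hb hi' hi hx hy hc.
  by have [<- <-] := blk_uniq hb' hb hi' hi.
have hi'' : u' <= i < u' + (sumn (flatten (split (N (k + j)) s')))%:Z by rewrite flatten_split.
have [ss1 [t [ss2 [e ht]]]] := split_find hi''.
have hbt := sub_blk (Nmono _) hb' e.
have [h1 h2 h3 h4] := IH _ _ hbt hb ht hi (inW_sub hx e) (inW_sub hy e) (Comp_sub hx hy hc e).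
split=> //; have := split_flat e => ->; rewrite !sumn_cat; lia.
Qed.

Lemma W_realize b j u s w : w \in Wb b j s -> exists y, nmb b j y u s = w.
Proof.
move=> hw; apply: nm_realize; first exact: size_words hw.
have : forall k, (k < size s)%N -> nth [::] w k \in spb b j (nth 0%N s k).
  elim: s w hw => // n s IH [|e w] hw; first by have := size_words hw.
  move: hw; rewrite /W words_consE => /andP[he hw] [|k] //= hk; exact: IH.
by move=> h k /h hk; split; [exact: size_sp hk|exact: sp_lv hk].
Qed.

(** The conditional density integrates to 1, so it is positive at some admissible name. *)
Lemma Comp_exists b j x u s : inW b j x u s -> exists y, inW (~~ b) j y u s /\ Comp b j x y u s.
Proof.
move=> hx; have [g0 hm] := gok j s.
have gg0 l l' : 0 <= gg b (g j s) l l' by rewrite /gg; case: b {hm hx}.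
have : exists2 w', w' \in Wb (~~ b) j s &
    0 < gg b (g j s) (labb b j s (nmb b j x u s)) (labb (~~ b) j s w').
  apply: contrapT => hn; have := hm b _ hx; rewrite big_seq big1 => [/esym/eqP|w' hw'].
    by rewrite oner_eq0.
  suff -> : gg b (g j s) (labb b j s (nmb b j x u s)) (labb (~~ b) j s w') = 0 by rewrite mulr0.
  apply/eqP; rewrite eq_le gg0 andbT leNgt; apply/negP => h; apply: hn.
  by exists w'.
case=> w' hw' hg; have [y hy] := W_realize u hw'.
by exists y; rewrite /inW /Comp hy.
Qed.

(** A partner at the later stage is also one at the earlier stage, and both decoded values are its
    bit. *)
Lemma Dec_uniq b j j' x i r be be' : Dec b j x i r be -> Dec b j' x i r be' -> be = be'.
Proof.
wlog le : j j' be be' / (j <= j')%N => [H|].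
  by case/orP: (leq_total j j') => h d d'; [exact: H h d d'|apply/esym; exact: H h d' d].
move=> [u [s [hb hi hx hr hd]]] [u' [s' [hb' hi' hx' hr' hd']]].
have [y [hy hc]] := Comp_exists hx'.
have [h1 h2 h3 _] := Comp_descent le hb' hb hi' hi hx' hy hc.
by rewrite -(hd y h2 h3) -(hd' y hy hc).
Qed.

Lemma Phi_Dec b j x i r be : Dec b j x i r be -> Phi b x i r = be.
Proof.
move=> h; rewrite /Phi; case: be h => h; apply/asboolP.
  by exists j.
by case=> j' /Dec_uniq /(_ h).
Qed.

Lemma Phi_agree b j x u s y i r : blk (mkb b x) (N j) u s -> u <= i < u + (sumn s)%:Z ->
  inW b j x u s -> inW (~~ b) j y u s -> Comp b j x y u s ->
  (exists be, Dec b j x i r be) -> y i r = Phi b x i r.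
Proof.
move=> hb hi hx hy hc [be hd]; rewrite (Phi_Dec hd).
have [u' [s' [hb' hi' _ _ h]]] := hd.
by have [e1 e2] := blk_uniq hb hb' hi hi'; subst u' s'; exact: h.
Qed.

Lemma Good_block b x n : Good b x -> exists j, (n <= j)%N /\
  forall i, `|i| <= n%:Z -> exists u s, [/\ blk (mkb b x) (N j) u s,
    u <= i < u + (sumn s)%:Z, inW b j x u s,
    (n <= lvat (lvb (~~ b) j) s `|i - u|%N)%N &
    forall r, (r < n)%N -> exists be, Dec b j x i r be].
Proof.
move=> hG; have [j [hj hD]] := hG n.+1; exists j; split; first exact: ltnW.
move=> i hi; have hi1 : `|i| <= n.+1%:Z by lia.
have [be [u [s [hb hi' hx hr _]]]] := hD i n hi1 (ltnSn n).
exists u, s; split=> //; first exact: ltnW.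
by move=> r hr'; apply: hD => //; lia.
Qed.

(** On a large window [Phi b x] agrees with one partner [y], whose names consist of gap words
    satisfying [el] wherever the gap is not blank. The level at [u0] is positive, so this gap is
    not. *)
Lemma Phi_el b x u0 n : Good b x -> mpath (mkb b x) u0 [:: n] ->
  el (r0 (~~ b)) K (mk (~~ b)) n (win (r0 (~~ b)) (Phi b x) u0 n).
Proof.
move=> hG hp; have /= /and4P[_ n0 hnm _] := hp.
pose n1 := (`|u0| + n + r0 (~~ b)).+1%N.
have [j [_ hj]] := Good_block n1 hG.
have h0 : `|u0| <= n1%:Z by rewrite /n1; lia.
have [u [s [hb hi hx hl _]]] := hj _ h0.
have [y [hy hc]] := Comp_exists hx.
have [s1 [n' [s2 [es hi' hp']]]] := mpath_find (proj1 (andP hb)) hi.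
have e1 : u + (sumn s1)%:Z = u0.
  apply/eqP; rewrite eq_le; apply/andP; split; first by lia.
  rewrite leNgt; apply/negP => hlt; have /= /and4P[_ _ h1 _] := hp'.
  by apply: nomarkF h1 (mpath_head hp) _; lia.
have e2 : n' = n by rewrite e1 in hp'; exact: mpath_next hp' hp.
subst n'.
have hk : (`|u0 - u| = sumn s1)%N by lia.
have hlv : lvat (lvb (~~ b) j) s `|u0 - u|%N = lvb (~~ b) j n.
  by rewrite hk es -[sumn s1]addn0 lvat_cat /= n0.
have hke : kept v lev (~~ b) j n.
  by move: hl; rewrite hlv /lv; case: ifP => // _; rewrite /n1; lia.
have := hy; rewrite es inW_cat e1 => /andP[_]; rewrite /inW /= /W words_consE => /andP[+ _].
rewrite /sp /lv hke mem_filter => /andP[+ _].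
move=> he; have := he.
rewrite -(@el_take (r0 (~~ b)) K (mk (~~ b)) (r0 (~~ b)) n _ (leqnn _)) win_take//.
suff -> : win (r0 (~~ b)) y u0 n = win (r0 (~~ b)) (Phi b x) u0 n by [].
apply: eq_win => k hkn; apply/eq_in_map => r; rewrite mem_iota => hr.
have h1 : `|u0 + k%:Z| <= n1%:Z by rewrite /n1; lia.
have [_ [_ [_ _ _ _ hD]]] := hj _ h1.
apply: (Phi_agree hb _ hx hy hc); last by apply: hD; rewrite /n1; lia.
by rewrite es sumn_cat /=; lia.
Qed.

Lemma Good_gap b x i : Good b x ->
  exists u n, u <= i < u + n%:Z /\ mpath (mkb b x) u [:: n].
Proof.
move=> hG; have [j [_ hj]] := Good_block `|i|%N hG.
have [|u [s [hb hi _ _ _]]] := hj i; first by lia.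
have [s1 [n [s2 [_ h1 h2]]]] := mpath_find (proj1 (andP hb)) hi.
exists (u + (sumn s1)%:Z), n; split=> //.
by move: h2 => /= /and4P[-> -> -> /mpath_head ->].
Qed.

(** By [Phi_el] marks go to marks. A new mark inside a gap would either lie within its [el] word or
    overlap the mark closing the gap. *)
Lemma Phi_mark b x : Good b x -> mkb (~~ b) (Phi b x) = mkb b x.
Proof.
move=> hG.
have A i : mkb b x i -> mkb (~~ b) (Phi b x) i.
  move=> hi; have [u [n [hu hp]]] := Good_gap i hG.
  have e : u = i.
    apply/eqP; rewrite eq_le; apply/andP; split; first by lia.
    rewrite leNgt; apply/negP => hlt; have /= /and4P[_ _ h1 _] := hp.
    by apply: nomarkF h1 hi _; lia.
  by subst u; apply: el_mark (Phi_el hG hp).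
apply/funext => i; apply/idP/idP; last exact: A.
move=> hi; apply: contrapT => hn; have [u [n [hu hp]]] := Good_gap i hG.
have /and3P[hK _ /allP hall] := Phi_el hG hp.
have /= /and4P[hmu n0 _ /andP[/A hmn _]] := hp.
have hui : u != i by apply: contra_notN hn => /eqP <-.
case: (leP i (u + (n - K)%N%:Z)) => hi'.
  have := hall `|i - u|%N; rewrite mem_iota mkat_win//; last by lia.
  have -> : u + `|i - u|%N%:Z = i by lia.
  by rewrite hi => h; suff : ~~ true by []; apply: h; lia.
pose d := absz (u + n%:Z - i)%R.
have hd : i + d%:Z = u + n%:Z by rewrite /d; lia.
by apply: (novl (d := d) _ hi); rewrite ?hd// /d; lia.
Qed.

Lemma Comp_sym b j x y u s : Comp (~~ b) j y x u s = Comp b j x y u s.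
Proof. by rewrite /Comp; case: b. Qed.

Lemma lvat_le lv B s k : (forall n, (lv n <= B)%N) -> (lvat lv s k <= B)%N.
Proof. by move=> h; elim: s k => //= n s IH k; case: ifP. Qed.

(** A bit decoded from [y = Phi b x] is shared by all arrays compatible with [y] on some block, so
    it suffices that [x] is one of them. At a late stage a partner [y'] of [x] agrees with [y] on
    that whole block, and the compatibility of [x] and [y'] descends to it. *)
Theorem Phi_inv b x : Good b x -> Good (~~ b) (Phi b x) -> Phi (~~ b) (Phi b x) = x.
Proof.
move=> hG hG'; apply/funext => i; apply/funext => r; set y := Phi b x in hG' *.
have [j [_ hj]] := hG' (`|i| + r).+1%N.
have [||be hD] := hj i r; [lia|lia|].
rewrite (Phi_Dec hD); have [u [s [hb hi hy _ hd]]] := hD.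
rewrite (Phi_mark hG) in hb.
(* Covers the block, comes no earlier than stage [j], and includes every bit displayed by the name
   of [y]. *)
pose n2 := (`|i| + `|u| + sumn s + j + lev (~~ b) j)%N.
have [J [hJ hGJ]] := Good_block n2 hG.
have [|u' [s' [hb' hi' hx' _ _]]] := hGJ i; first by rewrite /n2; lia.
have [y' [hy' hc']] := Comp_exists hx'.
have jJ : (j <= J)%N by rewrite /n2 in hJ; lia.
have [hx hyy hc [hu1 hu2]] := Comp_descent jJ hb' hb hi' hi hx' hy' hc'.
have e : nmb (~~ b) j y' u s = nmb (~~ b) j y u s.
  apply: eq_nm => k hk; apply/eq_in_map => r'; rewrite mem_iota => hr'.
  have h1 : `|u + k%:Z| <= n2%:Z by rewrite /n2; lia.
  have [_ [_ [_ _ _ _ hDk]]] := hGJ _ h1.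
  apply: (Phi_agree hb' _ hx' hy' hc'); first by lia.
  apply: hDk; have := lvat_le s k (lv_lev v lev (~~ b) j).
  by rewrite /n2; lia.
apply/esym; apply: hd.
  by rewrite negbK.
by rewrite Comp_sym /Comp -e.
Qed.

Lemma blk_local M M' n u s : (forall k, u - n%:Z <= k <= u + (sumn s)%:Z -> M k = M' k) ->
  blk M n u s -> blk M' n u s.
Proof.
move=> h /and3P[hp hn hr]; rewrite /blk hr andbT; apply/andP; split.
  have h' k : u <= k <= u + (sumn s)%:Z -> M k = M' k by move=> hk; apply: h; lia.
  move: hp h' {h hn hr}; elim: s u => [|a s IH] u /=.
    by rewrite !andbT => hM h; rewrite -h//; lia.
  move=> /and4P[hM a0 hn hp] h; rewrite -h ?hM ?a0 ?IH ?andbT//=; first last.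
  - by lia.
  - by move=> k hk; apply: h; lia.
  by apply/nomarkP => i hi; rewrite -h; [move/nomarkP: hn; apply|lia].
by apply/nomarkP => i hi; rewrite -h; [move/nomarkP: hn; apply|lia].
Qed.

Definition agree (n : nat) (x x' : Om) := forall i r, `|i| <= n%:Z -> (r < n)%N -> x' i r = x i r.

Lemma agree_win n x x' r u k : agree n x x' -> (r <= n)%N -> - n%:Z <= u -> u + k%:Z <= n%:Z ->
  win r x' u k = win r x u k.
Proof.
move=> h hr hu hk; apply: eq_win => l hl; apply/eq_in_map => r'; rewrite mem_iota => hr'.
by apply: h; lia.
Qed.

Lemma Dec_local b j x i r be : Dec b j x i r be ->
  exists n, forall x', agree n x x' -> Dec b j x' i r be.
Proof.
move=> [u [s [hb hi hx hr hd]]].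
pose n := (`|u| + sumn s + N j + K + r0 b + lev b j)%N.
exists n => x' ha; exists u, s.
have e : nmb b j x' u s = nmb b j x u s.
  apply: eq_nm => k hk; apply/eq_in_map => r'; rewrite mem_iota => hr'.
  apply: ha; first by rewrite /n; lia.
  by have := lvat_le s k (lv_lev v lev b j); rewrite /n; lia.
split=> //.
- apply: blk_local hb => k hk; rewrite /mark (agree_win ha)//; rewrite /n; lia.
- by rewrite /inW e.
- by move=> y; rewrite /Comp e; exact: hd.
Qed.

Lemma Phi_cont b x i r : (exists j be, Dec b j x i r be) ->
  exists n, forall x', agree n x x' -> Phi b x' i r = Phi b x i r.
Proof.
move=> [j [be hd]]; have [n hn] := Dec_local hd; exists n => x' /hn hd'.
by rewrite (Phi_Dec hd) (Phi_Dec hd').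
Qed.

Lemma Good_Dec b x i r : Good b x -> exists j be, Dec b j x i r be.
Proof.
move=> hG; have [j [_ h]] := hG (`|i| + r).+1%N.
by have [||be hd] := h i r; [lia|lia|exists j, be].
Qed.

Lemma blk_shift M n u s : blk (fun i => M (i + 1)) n u s = blk M n (u + 1) s.
Proof.
have hn w k : nomark (fun i => M (i + 1)) w k = nomark M (w + 1) k.
  by apply: eq_all => l; congr (~~ M _); lia.
rewrite /blk; congr (_ && (_ && _)).
  elim: s u => //= a s IH u; rewrite hn IH; congr [&& _, _, _ & mpath M _ _]; lia.
by rewrite hn; congr (nomark M _ _); lia.
Qed.

Lemma Dec_shift b j x i r be : Dec b j (oshift x) i r be <-> Dec b j x (i + 1) r be.
Proof.
have hm y : mkb b (oshift y) = fun i => mkb b y (i + 1).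
  by apply/funext => k; rewrite mark_shift.
split=> [[u [s [hb hi hx hr hd]]]|[u [s [hb hi hx hr hd]]]].
  exists (u + 1), s; rewrite hm blk_shift in hb; rewrite /inW nm_shift in hx.
  split=> //; first by lia.
    by have -> : (i + 1 - (u + 1)) = i - u by lia.
  move=> y; rewrite /inW /Comp -!nm_shift => h1 h2.
  exact: (hd (oshift y)).
exists (u - 1), s; rewrite hm blk_shift /inW nm_shift.
have e : u - 1 + 1 = u by lia.
rewrite e; split=> //; first by lia.
  by have -> : (i - (u - 1)) = i + 1 - u by lia.
move=> y; pose y' : Om := fun k => y (k - 1).
have -> : y = oshift y' by apply/funext => k; rewrite /oshift /y'; congr y; lia.
by rewrite /inW /Comp !nm_shift e; exact: hd.
Qed.

Lemma Phi_shift b x : Phi b (oshift x) = oshift (Phi b x).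
Proof.
apply/funext => i; apply/funext => r; rewrite /oshift /Phi; apply/asboolP/asboolP.
  by move=> [j /Dec_shift]; exists j.
by move=> [j h]; exists j; apply/Dec_shift.
Qed.

Lemma Good_shift b x : Good b (oshift x) <-> Good b x.
Proof.
split=> h n; have [j [hj hd]] := h n.+1; exists j; split; try exact: ltnW.
  move=> i r hi hr; have [||be] := hd (i - 1) r; [lia|lia|].
  by move=> /Dec_shift; rewrite subrK; exists be.
move=> i r hi hr; have [||be hd'] := hd (i + 1) r; [lia|lia|].
by exists be; apply/Dec_shift.
Qed.

End Decode.

(** * Probabilities on finite windows *)

Definition emb (u0 : int) (w : seq (seq bool)) : Om :=
  fun i k => nth false (nth [::] w `|i - u0|%N) k.

Lemma win_emb r r' u0 n w u k : size w = n -> all (fun a => size a == r) w ->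
  (r' <= r)%N -> u0 <= u -> u + k%:Z <= u0 + n%:Z ->
  win r' (emb u0 w) u k = map (take r') (take k (drop `|u - u0|%N w)).
Proof.
move=> hs /allP ha hr hu hk.
have hsz : size (map (take r') (take k (drop `|u - u0|%N w))) = k.
  by rewrite size_map size_takel// size_drop hs; lia.
apply: (@eq_from_nth _ [::]); rewrite size_win ?hsz// => l hl.
rewrite nth_win// (nth_map [::]); last by rewrite size_map in hsz; rewrite hsz.
rewrite nth_take// nth_drop.
have e : (absz (u + l%:Z - u0)%R) = (`|u - u0| + l)%N by lia.
have hsl : size (nth [::] w (`|u - u0| + l)) = r.
  by apply/eqP; apply: ha; apply: mem_nth; rewrite hs; lia.
apply: (@eq_from_nth _ false); rewrite size_mkseq ?size_takel ?hsl// => m hm.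
by rewrite nth_mkseq// nth_take// /emb e.
Qed.

Section FinProb.
Context {R : realType} (P : seq bool -> R).
Hypothesis HP : source P.

Definition ew (r n : nat) (F : seq (seq bool) -> R) : R :=
  \sum_(w <- lwords P r n) lwt P n w * F w.
(** A finite expectation: independent letters of [B] bits at the positions in [[-B, B)], [false]
    elsewhere. For functions of a window its value does not depend on [B], by [Ex_win], so events of
    finite range need no measure on arrays. *)
Definition Ex (B : nat) (F : Om -> R) : R :=
  ew B (B + B) (fun w => F (emb (- B%:Z) w)).
Definition Pr (B : nat) (E : Om -> Prop) : R := Ex B (fun x => (`[< E x >])%:R).

Definition dom (B : nat) (x : Om) : Prop := win B x (- B%:Z) (B + B) \in lwords P B (B + B).

Lemma eq_ew r n F G : (forall w, w \in lwords P r n -> F w = G w) -> ew r n F = ew r n G.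
Proof. by move=> h; rewrite /ew !big_seq; apply: eq_bigr => w /h ->. Qed.

Lemma ew_le r n F G : (forall w, w \in lwords P r n -> F w <= G w) -> ew r n F <= ew r n G.
Proof.
move=> h; rewrite /ew !big_seq; apply: ler_sum => w /h hw.
by apply: ler_wpM2l => //; exact: lwt_ge0.
Qed.

Lemma ew_cst r n c : ew r n (fun=> c) = c.
Proof. by rewrite /ew -mulr_suml lwords_sum// mul1r. Qed.

Lemma ewD r n F G : ew r n (fun w => F w + G w) = ew r n F + ew r n G.
Proof. by rewrite /ew -big_split /=; apply: eq_bigr => w _; rewrite mulrDr. Qed.

Lemma ewZ r n c F : ew r n (fun w => c * F w) = c * ew r n F.
Proof. by rewrite /ew mulr_sumr; apply: eq_bigr => w _; rewrite mulrCA. Qed.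

Lemma ew_sum (I : Type) (s : seq I) (p : pred I) r n (F : I -> seq (seq bool) -> R) :
  ew r n (fun w => \sum_(i <- s | p i) F i w) = \sum_(i <- s | p i) ew r n (F i).
Proof. by rewrite /ew exchange_big /=; apply: eq_bigr => w _; rewrite mulr_sumr. Qed.

Lemma ew_cat r n k F : ew r (n + k) F = ew r n (fun w => ew r k (fun w' => F (w ++ w'))).
Proof. exact: lwords_cat. Qed.

Lemma ew_prod r n k F G :
  ew r (n + k) (fun w => F (take n w) * G (drop n w)) = ew r n F * ew r k G.
Proof.
rewrite ew_cat /ew mulr_suml big_seq [RHS]big_seq; apply: eq_bigr => w hw.
have hs : size w = n by move: hw; rewrite mem_lwords => /andP[/eqP].
rewrite -mulrA; congr (_ * _); rewrite mulr_sumr; apply: eq_bigr => w' _.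
by rewrite take_size_cat// drop_size_cat// mulrCA.
Qed.

Lemma ew_take r n k F : ew r (n + k) (fun w => F (take n w)) = ew r n F.
Proof.
rewrite -[RHS]mulr1 -(ew_cst r k 1) -ew_prod; apply: eq_ew => w _; rewrite mulr1//.
Qed.

Lemma ew_drop r n k F : ew r (n + k) (fun w => F (drop n w)) = ew r k F.
Proof.
rewrite -[RHS]mul1r -(ew_cst r n 1) -ew_prod; apply: eq_ew => w _; rewrite mul1r//.
Qed.

Lemma ew_push r r' n F : (r' <= r)%N -> ew r n (fun w => F (map (take r') w)) = ew r' n F.
Proof. exact: lwords_push. Qed.

Lemma Ex_win B r u k F : (r <= B)%N -> - B%:Z <= u -> u + k%:Z <= B%:Z ->
  Ex B (fun x => F (win r x u k)) = ew r k F.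
Proof.
move=> hr hu hk; rewrite /Ex.
have [a [c [ha hB]]] : exists a c : nat, a%:Z = u + B%:Z /\ (B + B = a + (k + c))%N.
  by exists (absz (u + B%:Z)%R), (absz (B%:Z - (u + k%:Z))%R); split; lia.
transitivity (ew B (B + B) (fun w => F (map (take r) (take k (drop a w))))).
  apply: eq_ew => w; rewrite mem_lwords => /andP[/eqP hs /allP hal].
  rewrite (@win_emb B r _ (B + B)%N)//; [|by apply/allP => z /hal /andP[]|by lia].
  by congr (F (map _ (take _ (drop _ _)))); lia.
rewrite hB (ew_drop B a _ (fun w => F (map (take r) (take k w)))).
by rewrite (ew_take B k c (fun w => F (map (take r) w))) ew_push.
Qed.

Lemma Ex_le B F G : (forall x, dom B x -> F x <= G x) -> Ex B F <= Ex B G.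
Proof.
move=> h; apply: ew_le => w hw; apply: h; rewrite /dom.
have := hw; rewrite mem_lwords => /andP[/eqP hs /allP hal].
rewrite (@win_emb B B _ (B + B)%N)//; last by apply/allP => z /hal /andP[].
have -> : (absz (- B%:Z - - B%:Z)%R) = 0%N by lia.
rewrite drop0 take_oversize ?hs// (_ : map _ _ = w)//.
rewrite -[RHS]map_id; apply/eq_in_map => a /hal /andP[/eqP <- _].
by rewrite take_size.
Qed.

Lemma eq_Ex B F G : (forall x, dom B x -> F x = G x) -> Ex B F = Ex B G.
Proof. by move=> h; apply/eqP; rewrite eq_le !Ex_le// => x /h ->. Qed.

Lemma ExD B F G : Ex B (fun x => F x + G x) = Ex B F + Ex B G.
Proof. exact: ewD. Qed.

Lemma ExZ B c F : Ex B (fun x => c * F x) = c * Ex B F.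
Proof. exact: ewZ. Qed.

Lemma Ex_sum (I : Type) (s : seq I) (p : pred I) B (F : I -> Om -> R) :
  Ex B (fun x => \sum_(i <- s | p i) F i x) = \sum_(i <- s | p i) Ex B (F i).
Proof. exact: ew_sum. Qed.

Lemma Ex_cst B c : Ex B (fun=> c) = c.
Proof. exact: ew_cst. Qed.

Lemma Pr_le B (E E' : Om -> Prop) : (forall x, dom B x -> E x -> E' x) -> Pr B E <= Pr B E'.
Proof.
move=> h; apply: Ex_le => x hx; rewrite ler_nat.
by case: asboolP => // hE; case: asboolP => // /(_ (h x hx hE)).
Qed.

Lemma eq_Pr B (E E' : Om -> Prop) : (forall x, dom B x -> E x <-> E' x) -> Pr B E = Pr B E'.
Proof. by move=> h; apply/eqP; rewrite eq_le !Pr_le// => x /h []. Qed.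

Lemma Pr_U B (E E' : Om -> Prop) : Pr B (fun x => E x \/ E' x) <= Pr B E + Pr B E'.
Proof.
rewrite /Pr -ExD Ex_le// => x _; rewrite -natrD ler_nat.
by case: asboolP => // -[] h; case: asboolP => // _; case: asboolP.
Qed.

Lemma Pr_bigU B (I : eqType) (s : seq I) (E : I -> Om -> Prop) :
  Pr B (fun x => exists2 i, i \in s & E i x) <= \sum_(i <- s) Pr B (E i).
Proof.
elim: s => [|i s IH].
  rewrite big_nil -(Ex_cst B 0); apply: Ex_le => x _.
  by case: asboolP => // -[].
rewrite big_cons; apply: le_trans (lerD (lexx _) IH); apply: le_trans (Pr_U _ _ _).
by apply: Pr_le => x _ [i']; rewrite inE => /orP[/eqP->|h hE]; [left|right; exists i'].
Qed.

Lemma Pr_win B r u k (Q : pred (seq (seq bool))) : (r <= B)%N -> - B%:Z <= u -> u + k%:Z <= B%:Z ->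
  Pr B (fun x => Q (win r x u k)) = ew r k (fun w => (Q w)%:R).
Proof.
by move=> *; rewrite -(Ex_win (B := B) (u := u))//; apply: eq_Ex => x _; rewrite asboolb.
Qed.

Lemma dom_letter B x i : dom B x -> - B%:Z <= i < B%:Z -> 0 < P (mkseq (x i) B).
Proof.
rewrite /dom mem_lwords => /andP[_ /allP h] hi.
have := h (mkseq (x i) B); case/(_ _)/andP => //.
have -> : mkseq (x i) B = nth [::] (win B x (- B%:Z) (B + B)) (absz (i + B%:Z)%R).
  by rewrite nth_win; [congr mkseq; congr x; lia|lia].
by apply: mem_nth; rewrite size_win; lia.
Qed.

Lemma dom_win B x r u k : dom B x -> (r <= B)%N -> - B%:Z <= u -> u + k%:Z <= B%:Z ->
  win r x u k \in lwords P r k.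
Proof.
move=> hx hr hu hk; rewrite mem_lwords size_win eqxx /=; apply/allP => a /mapP[l].
rewrite mem_iota => hl ->; rewrite size_mkseq eqxx /=.
have : 0 < P (mkseq (x (u + l%:Z)) B) by apply: dom_letter hx _; lia.
by rewrite -(take_mkseq (x (u + l%:Z)) hr) => h; apply: lt_le_trans h (src_take HP _ _).
Qed.

End FinProb.

Section MarkProb.
Context {R : realType} (P : seq bool -> R) (r0 K : nat) (mk : seq (seq bool) -> bool).
Hypothesis HP : source P.
Hypothesis K0 : (0 < K)%N.
Notation mkx := (mark r0 K mk).
Notation mkw := (mkat r0 K mk).
Hypothesis novl : forall x i d, (0 < d < K)%N -> mkx x i -> mkx x (i + d%:Z) -> False.

Definition nomk n w := all (fun k => ~~ mkw w k) (iota 0 (n.+1 - K)).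
Definition pik : R := ew P r0 K (fun w => (mkw w 0)%:R).
Definition unm n : R := ew P r0 n (fun w => (nomk n w)%:R).

Lemma nomk_take r n w : (r0 <= r)%N -> nomk n (map (take r) w) = nomk n w.
Proof. by move=> h; apply: eq_all => k; rewrite mkat_take. Qed.

Lemma pikE r : (r0 <= r)%N -> ew P r K (fun w => (mkw w 0)%:R) = pik.
Proof.
move=> h; rewrite /pik -(ew_push HP _ _ h); apply: eq_ew => w _.
by rewrite mkat_take.
Qed.

Lemma unmE r n : (r0 <= r)%N -> ew P r n (fun w => (nomk n w)%:R) = unm n.
Proof.
move=> h; rewrite /unm -(ew_push HP _ _ h); apply: eq_ew => w _.
by rewrite nomk_take.
Qed.

(** The mark at the end of the stretch rules out markers straddling it, so absence of marks becomes
    a condition on the [n] letters alone. *)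
Lemma nomk_win r x u n : (r0 <= r)%N -> mkx x (u + n%:Z) ->
  nomark (mkx x) u n = nomk n (win r x u n).
Proof.
move=> hr hm; apply/nomarkP/allP => [h k|h i hi].
  by rewrite mem_iota => hk; rewrite mkat_win//; [apply: h; lia|lia].
apply/negP => hi'; case: (leP (i + K%:Z) (u + n%:Z)) => hK.
  have := h (absz (i - u)%R); rewrite mem_iota mkat_win//; last by lia.
  have -> : u + (absz (i - u)%R)%:Z = i by lia.
  by rewrite hi' => h'; suff : ~~ true by []; apply: h'; lia.
pose d := absz (u + n%:Z - i)%R.
have hd : i + d%:Z = u + n%:Z by rewrite /d; lia.
by apply: (novl (d := d) _ hi'); rewrite ?hd// /d; lia.
Qed.

End MarkProb.

Section BlockProb.
Context {R : realType} (P : bool -> seq bool -> R) (r0 : bool -> nat) (K : nat).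
Variables (mk : bool -> seq (seq bool) -> bool) (v : nat -> R) (lev : bool -> nat -> nat).
Notation T := (seq (seq bool)).
Notation spb := (sp P r0 K mk v lev).
Notation mb := (mm P v lev).
Notation lvb := (lv v lev).
Notation mkb b := (mark (r0 b) K (mk b)).
Notation elb b := (el (r0 b) K (mk b)).
Hypothesis HP : forall b, source (P b).
Hypothesis lev0 : forall b j, (r0 b <= lev b j)%N.
Hypothesis K0 : (0 < K)%N.
Hypothesis novl : forall b x i d, (0 < d < K)%N -> mkb b x i -> mkb b x (i + d%:Z) -> False.
Hypothesis vP : forall b n, v n = vel (P b) (r0 b) K (mk b) (r0 b) n.
Variables (b : bool) (j : nat).

Fixpoint pth s (w : seq (seq bool)) : bool :=
  if s is n :: s' then elb b n (take n w) && pth s' (drop n w) else mkat (r0 b) K (mk b) w 0.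
Fixpoint nmw s (w : seq (seq bool)) : seq T :=
  if s is n :: s' then map (take (lvb b j n)) (take n w) :: nmw s' (drop n w) else [::].
Definition vs s := \prod_(n <- s) v n.

Lemma pth_win r x u s : (r0 b <= r)%N ->
  mpath (mkb b x) u s = pth s (win r x u (sumn s + K)).
Proof.
move=> hr; elim: s u => [|n s IH] u.
  by rewrite /= mkat_win// addr0 andbT.
rewrite (mpath_el K0 (@novl b) _ _ _ _ hr) [pth _ _]/= -addnA win_cat.
by rewrite take_size_cat ?size_win// drop_size_cat ?size_win// IH.
Qed.

Lemma nmw_win r x u s : (lev b j <= r)%N ->
  nm (lvb b j) x u s = nmw s (win r x u (sumn s + K)).
Proof.
move=> hr; elim: s u => //= n s IH u; rewrite -addnA win_cat.
rewrite take_size_cat ?size_win// drop_size_cat ?size_win// IH win_take//.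
exact: leq_trans (lv_lev _ _ _ _ _) hr.
Qed.

Lemma ew_el r n (G : T -> R) : (lev b j <= r)%N ->
  ew (P b) r n (fun e => (elb b n e)%:R * G (map (take (lvb b j n)) e)) =
  v n * \sum_(a <- spb b j n) mb b j n a * G a.
Proof.
move=> hr; have hr0 : (r0 b <= r)%N := leq_trans (lev0 b j) hr.
rewrite /lv /sp /mm; case: (boolP (kept v lev b j n)) => [hk|hk].
  transitivity (ew (P b) r n (fun e => (fun e' => (elb b n e')%:R * G e') (map (take (lev b j)) e))).
    by apply: eq_ew => e _; rewrite el_take.
  rewrite (ew_push (HP b) n (fun e' => (elb b n e')%:R * G e'))// /ew.
  rewrite [in RHS]big_filter [in RHS]big_mkcond /= [RHS]mulr_sumr; apply: eq_bigr => e _.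
  have /andP[_ v0] := hk.
  case: ifP => _; last by rewrite mul0r !mulr0.
  by rewrite mul1r mulrA mulrCA mulfV ?mulr1 ?gt_eqF.
rewrite big_seq1 mul1r mulrC (vP b) -(velE _ _ (HP b) n hr0) /vel mulr_sumr [RHS]big_mkcond /= /ew big_seq [RHS]big_seq.
apply: eq_bigr => e; rewrite mem_lwords => /andP[/eqP hs _]; rewrite (nseq_take0 hs).
by case: ifP => _; rewrite ?mul0r ?mulr0// mul1r mulrC.
Qed.

(** Conditional independence of the fillers: given the gap lengths, the name has the product law
    [wj]. *)
Lemma ew_pth r s (F : seq T -> R) : (lev b j <= r)%N ->
  ew (P b) r (sumn s + K) (fun w => (pth s w)%:R * F (nmw s w)) =
  vs s * pik (P b) (r0 b) K (mk b) * \sum_(w <- W spb b j s) wj mb b j s w * F w.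
Proof.
move=> hr; have hr0 : (r0 b <= r)%N := leq_trans (lev0 b j) hr.
elim: s F => [|n s IH] F.
  rewrite /vs big_nil mul1r /W /= big_seq1 /wj /= mul1r -(pikE _ _ (HP b) hr0).
  by rewrite mulrC -ewZ; apply: eq_ew => w _; rewrite mulrC.
rewrite [sumn _]/= -addnA ew_cat.
transitivity (ew (P b) r n (fun e => (elb b n e)%:R *
   (vs s * pik (P b) (r0 b) K (mk b) * \sum_(w <- W spb b j s) wj mb b j s w * F (map (take (lvb b j n)) e :: w)))).
  apply: eq_ew => e; rewrite mem_lwords => /andP[/eqP hs _].
  rewrite -(IH (fun w => F (map (take (lvb b j n)) e :: w))) -ewZ; apply: eq_ew => w' _ /=.
  by rewrite take_size_cat// drop_size_cat// -mulnb natrM mulrA.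
rewrite (@ew_el r n (fun e' => vs s * pik (P b) (r0 b) K (mk b) * \sum_(w <- W spb b j s) wj mb b j s w * F (e' :: w)))//.
rewrite /vs big_cons -!mulrA; congr (_ * _).
have -> : \sum_(w <- W spb b j (n :: s)) wj mb b j (n :: s) w * F w =
   \sum_(a <- spb b j n) \sum_(w <- W spb b j s) wj mb b j (n :: s) (a :: w) * F (a :: w).
  exact: big_words_cons.
rewrite [RHS]mulrA [RHS]mulr_sumr; apply: eq_bigr => a _.
rewrite [LHS]mulrCA; congr (_ * _); rewrite mulr_sumr; apply: eq_bigr => w _.
by rewrite /wj /= mulrA.
Qed.

(** The prefactor is made of [unm], [v] and the marker probability; these agree on the two sides,
    which permits a comparison block by block. *)
Lemma Ex_blk B n u s (F : seq T -> R) : (lev b j <= B)%N -> - B%:Z <= u - n%:Z ->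
  u + (sumn s)%:Z + K%:Z <= B%:Z ->
  Ex (P b) B (fun x => (blk (mkb b x) n u s)%:R * F (nm (lvb b j) x u s)) =
  (rk n s)%:R * unm (P b) (r0 b) K (mk b) n *
  (vs s * pik (P b) (r0 b) K (mk b) * \sum_(w <- W spb b j s) wj mb b j s w * F w).
Proof.
move=> hB h1 h2; have hr0 : (r0 b <= B)%N := leq_trans (lev0 b j) hB.
rewrite -(ew_pth _ _ hB) -(unmE K (mk b) (HP b) n hr0) -mulrA -ew_prod -ewZ.
rewrite -(Ex_win (HP b) (B := B) (u := u - n%:Z))//; last by lia.
apply: eq_Ex => // x _; rewrite win_cat take_size_cat ?size_win// drop_size_cat ?size_win//.
rewrite subrK -pth_win// -nmw_win// /blk.
case: (boolP (mpath (mkb b x) u s)) => hp /=; last by rewrite !mul0r !mulr0.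
rewrite (@nomk_win (r0 b) K (mk b) K0 (@novl b) B)//; last by rewrite subrK; exact: mpath_head hp.
by rewrite mul1r mulrA -natrM mulnb andbC.
Qed.

Lemma dom_inW B x u s : dom (P b) B x -> (lev b j <= B)%N -> - B%:Z <= u ->
  u + (sumn s)%:Z <= B%:Z -> mpath (mkb b x) u s -> nm (lvb b j) x u s \in W spb b j s.
Proof.
move=> hx hB hu hs; elim: s u hu hs => // n s IH u hu hs hp.
have := hp; rewrite (mpath_el K0 (@novl b) _ _ _ _ (lev0 b j)) => /andP[he hp'].
rewrite /W [nm _ _ _ _]/= words_consE IH ?andbT//; [|by lia|by move: hs => /=; lia].
rewrite /sp /lv; case: ifP => hk; last by rewrite inE -(nseq_take0 (size_win 0 x u n)) win_take.
rewrite mem_filter he /=; apply: dom_win hx hB hu _ => //.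
by move: hs => /=; lia.
Qed.

End BlockProb.

(** * Laws of large numbers *)

Section LLN.
Context {R : realType} (P : seq bool -> R).
Hypothesis HP : source P.
Variables (r mw : nat).
Hypothesis mw0 : (0 < mw)%N.
Implicit Types (w : seq (seq bool)).

Definition at_ (h : seq (seq bool) -> R) (w : seq (seq bool)) k := h (take mw (drop k w)).

Lemma expR_quad (y : R) : `|y| <= 2^-1 -> expR y <= 1 + y + 2 * y ^+ 2.
Proof.
move=> hy; have y1 : 0 < 1 - y by rewrite ler_norml in hy; lra.
have h : expR y <= (1 - y)^-1.
  rewrite -[expR y]invrK lef_pV2 ?posrE ?invr_gt0 ?expR_gt0// -expRN.
  by have := @expR_ge1Dx R (- y); lra.
apply: le_trans h _; rewrite -[X in X <= _]mul1r ler_pdivrMr//.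
rewrite ler_norml in hy; nra.
Qed.

Lemma ew_blocks (phi : seq (seq bool) -> R) res q n : (res + q * mw <= n)%N ->
  ew P r n (fun w => \prod_(i < q) at_ phi w (res + i * mw)) = ew P r mw phi ^+ q.
Proof.
move=> hn; rewrite -(subnKC hn); set c := (n - _)%N.
pose F w := \prod_(i < q) at_ phi w (i * mw).
have -> : ew P r (res + q * mw + c) (fun w => \prod_(i < q) at_ phi w (res + i * mw)) =
          ew P r (q * mw) F.
  rewrite -addnA -(ew_take HP r (q * mw) c F) -(ew_drop HP r res _ (fun w => F (take (q * mw) w))).
  apply: eq_ew => w _; apply: eq_bigr => i _; rewrite /at_; congr phi.
  rewrite [RHS]take_drop take_takel; last by have := ltn_ord i; nia.
  by rewrite -take_drop drop_drop addnC.
elim: q @F {hn c} => [|q IH] F.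
  by rewrite expr0 -[RHS](ew_cst HP r (0 * mw)); apply: eq_ew => w _; rewrite /F big_ord0.
rewrite mulSn exprS -IH -ew_prod; apply: eq_ew => w _; rewrite /F big_ord_recl /=.
congr (_ * _); first by rewrite /at_ mul0n drop0.
apply: eq_bigr => i _; rewrite /at_ drop_drop; congr phi; congr take; congr drop.
by rewrite /bump /=; lia.
Qed.

Lemma sum_residues (h : nat -> R) q :
  \sum_(k < q * mw) h k = \sum_(res < mw) \sum_(i < q) h (res + i * mw)%N.
Proof.
elim: q => [|q IH]; first by rewrite mul0n big_ord0 big1// => i _; rewrite big_ord0.
rewrite mulSnr big_split_ord /= IH -big_split /=; apply: eq_bigr => i _.
by rewrite big_ord_recr /= addnC.
Qed.

(** Windows of length [mw] overlap, so positions are sorted by residue modulo [mw]: within a class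
    the windows are disjoint, hence independent. A nonnegative total forces a nonnegative class sum,
    and each class is controlled by an exponential moment. *)
Lemma chernoff_block (h : seq (seq bool) -> R) (C de : R) q : 0 < de <= C ->
  (forall w, w \in lwords P r mw -> `|h w| <= C) -> ew P r mw h <= - de ->
  ew P r (q * mw + mw) (fun w => (0 <= \sum_(k < q * mw) at_ h w k)%R%:R) <=
  mw%:R * (1 - de ^+ 2 / (8 * C ^+ 2)) ^+ q.
Proof.
move=> /andP[de0 deC] hC hm.
have C0 : 0 < C := lt_le_trans de0 deC.
(* The minimiser of [1 - t * de + 2 * (t * C) ^+ 2]; the minimum is the base of the power in the
   claim. *)
pose t := de / (4 * C ^+ 2).
have t0 : 0 < t by rewrite divr_gt0// mulr_gt0// exprn_gt0.
have tC : t * C <= 2^-1.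
  rewrite /t invfM expr2 invfM !mulrA mulfVK ?gt_eqF// ler_pdivrMr//; lra.
pose phi w := expR (t * h w).
have hl : ew P r mw phi <= 1 - de ^+ 2 / (8 * C ^+ 2).
  apply: (@le_trans _ _ (ew P r mw (fun w => (1 + 2 * (t * C) ^+ 2) + t * h w))).
    apply: ew_le => // w hw; have := hC w hw => hh.
    have hth : `|t * h w| <= t * C by rewrite normrM gtr0_norm// ler_pM2l.
    apply: le_trans (expR_quad (le_trans hth tC)) _.
    have : (t * h w) ^+ 2 <= (t * C) ^+ 2.
      by rewrite -[X in X <= _]real_normK ?num_real// lerXn2r ?nnegrE// ltW// mulr_gt0.
    by lra.
  rewrite ewD ew_cst// ewZ.
  have : t * ew P r mw h <= t * - de by rewrite ler_pM2l.
  have -> : de ^+ 2 / (8 * C ^+ 2) = t * de / 2 by rewrite /t; field; rewrite gt_eqF.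
  have -> : 2 * (t * C) ^+ 2 = t * de / 2 by rewrite /t; field; rewrite gt_eqF.
  by lra.
have phi0 : 0 <= ew P r mw phi.
  by rewrite -(ew_cst HP r mw 0); apply: ew_le => // w _; exact: expR_ge0.
apply: (@le_trans _ _ (ew P r (q * mw + mw) (fun w => \sum_(res < mw) \prod_(i < q) at_ phi w (res + i * mw)))).
  apply: ew_le => // w _; case: (leP 0 (\sum_(k < q * mw) at_ h w k)) => [hs|_]; last first.
    by rewrite sumr_ge0// => i _; rewrite prodr_ge0// => k _; exact: expR_ge0.
  have [res hres] : exists res : 'I_mw, 0 <= \sum_(i < q) at_ h w (res + i * mw).
    apply: contrapT => hn; move: hs; rewrite sum_residues leNgt => /negP; apply.
    have hneg (res : 'I_mw) : \sum_(i < q) at_ h w (res + i * mw) < 0.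
      by rewrite ltNge; apply/negP => h'; apply: hn; exists res.
    rewrite (bigD1 (Ordinal mw0))// -[X in _ < X]addr0; apply: ltr_leD; first exact: (hneg (Ordinal mw0)).
    by apply: sumr_le0 => i _; exact: ltW.
  rewrite (bigD1 res)//= -[X in X <= _]addr0; apply: lerD; last first.
    by apply: sumr_ge0 => i _; apply: prodr_ge0 => k _; exact: expR_ge0.
  have -> : \prod_(i < q) at_ phi w (res + i * mw) = expR (t * \sum_(i < q) at_ h w (res + i * mw)).
    by rewrite mulr_sumr expR_sum.
  by rewrite -expR0 ler_expR mulr_ge0// ltW.
rewrite ew_sum (eq_bigr (fun=> ew P r mw phi ^+ q)); last first.
  by move=> i _; rewrite ew_blocks//; have := ltn_ord i; lia.
rewrite sumr_const card_ord -[X in X <= _]mulr_natl ler_wpM2l// lerXn2r ?nnegrE//.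
exact: le_trans phi0 hl.
Qed.


Lemma expR_small (c A e : R) : 0 < c -> 0 <= A -> 0 < e ->
  exists n0, forall n, (n0 <= n)%N -> A * expR (- (c * n%:R)) <= e.
Proof.
move=> c0 A0 e0; have [n0 hn0] : exists n0 : nat, A / (e * c) < n0%:R.
  by exists (Num.bound (A / (e * c))); rewrite archi_boundP// divr_ge0// mulr_ge0// ltW.
exists n0 => n hn; rewrite expRN ler_pdivrMr ?expR_gt0//.
have h1 : 1 + c * n%:R <= expR (c * n%:R) by exact: expR_ge1Dx.
have h2 : A / (e * c) < n%:R by apply: lt_le_trans hn0 _; rewrite ler_nat.
rewrite ltr_pdivrMr ?mulr_gt0// in h2.
have : e * (1 + c * n%:R) <= e * expR (c * n%:R) by rewrite ler_pM2l.
by nra.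
Qed.

(** Half of [de] is the drift used in [chernoff_block] for each of the two signs; the other half
    absorbs the fewer than [mw] leftover positions once [n] is large. *)
Lemma tail (f : seq (seq bool) -> R) (C0 de : R) : 0 < de ->
  (forall w, w \in lwords P r mw -> `|f w| <= C0) ->
  exists A c n0, [/\ 0 <= A, 0 < c & forall n, (n0 <= n)%N ->
    ew P r (n + mw) (fun w => (de * n%:R < `|\sum_(k < n) at_ f w k - ew P r mw f * n%:R|)%R%:R)
     <= A * expR (- (c * n%:R))].
Proof.
move=> de0 hC; set a := ew P r mw f.
have C00 : 0 <= C0.
  have : 0 <= ew P r mw (fun=> C0).
    rewrite -(ew_cst HP r mw 0); apply: ew_le => // w /hC; exact: le_trans.
  by rewrite ew_cst.
have ha : `|a| <= C0.
  rewrite ler_norml; apply/andP; split.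
    by rewrite -(ew_cst HP r mw (- C0)); apply: ew_le => // w /hC; rewrite ler_norml => /andP[].
  by rewrite -(ew_cst HP r mw C0); apply: ew_le => // w /hC; rewrite ler_norml => /andP[].
pose d := de / 2; pose C := 2 * C0 + de.
have d0 : 0 < d by rewrite divr_gt0.
have dC : 0 < d <= C by rewrite d0 /d /C; lra.
have CP : 0 < C by case/andP: dC => /lt_le_trans; apply.
pose c1 := d ^+ 2 / (8 * C ^+ 2).
have c10 : 0 < c1 by rewrite divr_gt0 ?exprn_gt0// mulr_gt0// exprn_gt0.
pose h1 w := f w - a - d; pose h2 w := a - f w - d.
have e1 : ew P r mw h1 <= - d.
  by rewrite /h1 (ewD P r mw (fun w => f w - a) (fun=> - d)) (ewD P r mw f (fun=> - a)) !ew_cst// subrr add0r.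
have e2 : ew P r mw h2 <= - d.
  rewrite /h2 (ewD P r mw (fun w => a - f w) (fun=> - d)) (ewD P r mw (fun=> a) (fun w => - f w)) !ew_cst//.
  have -> : ew P r mw (fun w => - f w) = - a.
    by rewrite -mulN1r -ewZ; apply: eq_ew => w _; rewrite mulN1r.
  by rewrite subrr add0r.
have b1 w : w \in lwords P r mw -> `|h1 w| <= C.
  by move=> /hC; move: ha; rewrite !ler_norml /h1 /C /d; lra.
have b2 w : w \in lwords P r mw -> `|h2 w| <= C.
  by move=> /hC; move: ha; rewrite !ler_norml /h2 /C /d; lra.
have [n0 hn0] : exists n0 : nat, mw%:R * (2 * C0) / d < n0%:R.
  by exists (Num.bound (mw%:R * (2 * C0) / d)); rewrite archi_boundP// divr_ge0 ?(ltW d0)// !mulr_ge0.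
exists (2 * mw%:R * expR c1), (c1 / mw%:R), n0; split.
- by rewrite mulr_ge0 ?expR_ge0// mulr_ge0.
- by rewrite divr_gt0// ltr0n.
move=> n hn; have [q [re [hq hre]]] : exists q re, n = (q * mw + re)%N /\ (re < mw)%N.
  by exists (n %/ mw)%N, (n %% mw)%N; split; [exact: divn_eq|rewrite ltn_mod].
have hnd : mw%:R * (2 * C0) <= d * n%:R.
  have hnn0 : n0%:R <= n%:R :> R by rewrite ler_nat.
  move: hn0; rewrite ltr_pdivrMr// => hn0.
  have : n0%:R * d <= n%:R * d by rewrite ler_pM2r.
  by rewrite [d * _]mulrC; exact: (le_trans (ltW hn0)).
have hlam : (1 - c1) ^+ q <= expR c1 * expR (- (c1 / mw%:R * n%:R)).
  apply: (@le_trans _ _ (expR (- c1) ^+ q)).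
    rewrite lerXn2r ?nnegrE ?expR_ge0//; last by have := @expR_ge1Dx R (- c1); lra.
    rewrite subr_ge0 /c1 ler_pdivrMr ?mulr_gt0 ?exprn_gt0// mul1r.
    have : d ^+ 2 <= C ^+ 2 by rewrite lerXn2r ?nnegrE ?(ltW d0) ?(ltW CP)//; case/andP: dC.
    have : 0 < C ^+ 2 by rewrite exprn_gt0.
    by lra.
  rewrite -expRM_natl -expRD ler_expR.
  have mwR : 0 < mw%:R :> R by rewrite ltr0n.
  have : c1 / mw%:R * n%:R <= c1 * (1 + q%:R).
    rewrite -mulrA ler_pM2l// mulrC ler_pdivrMr// {1}hq natrD natrM.
    have : re%:R <= mw%:R :> R by rewrite ler_nat ltnW.
    by lra.
  by rewrite -mulr_natl; lra.
have key : ew P r (n + mw) (fun w => (de * n%:R < `|\sum_(k < n) at_ f w k - a * n%:R|)%R%:R) <=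
   ew P r (q * mw + mw) (fun w => (0 <= \sum_(k < q * mw) at_ h1 w k)%R%:R) +
   ew P r (q * mw + mw) (fun w => (0 <= \sum_(k < q * mw) at_ h2 w k)%R%:R).
  have hl : (n + mw = (q * mw + mw) + re)%N by rewrite hq addnAC.
  rewrite hl -(ew_take HP r (q * mw + mw) re (fun w => (0 <= \sum_(k < q * mw) at_ h1 w k)%R%:R)).
  rewrite -(ew_take HP r (q * mw + mw) re (fun w => (0 <= \sum_(k < q * mw) at_ h2 w k)%R%:R)).
  rewrite -ewD; apply: ew_le => // w hw.
  have hsw : size w = (n + mw)%N by move: hw; rewrite mem_lwords hl => /andP[/eqP].
  have hat h k : (k < q * mw)%N -> at_ h (take (q * mw + mw) w) k = at_ h w k.
    move=> hk; rewrite /at_ [in LHS]take_drop take_takel -?take_drop//.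
    by rewrite addnC leq_add2r ltnW.
  rewrite -natrD ler_nat.
  have E h : \sum_(k < q * mw) at_ h (take (q * mw + mw) w) k = \sum_(k < q * mw) at_ h w k.
    by apply: eq_bigr => k _; exact: hat.
  rewrite !E.
  case: (leP 0 (\sum_(k < q * mw) at_ h1 w k)) => g1; first by case: (_ < _).
  case: (leP 0 (\sum_(k < q * mw) at_ h2 w k)) => g2; first by case: (_ < _).
  rewrite ltNge (_ : _ <= _ = true)//.
  move: g1 g2; rewrite /at_ /h1 /h2 !big_split /= !sumrN !sumr_const card_ord.
  have gen k0 : k0 = (q * mw + re)%N -> \sum_(k < k0) f (take mw (drop k w)) =
      \sum_(k < q * mw) f (take mw (drop k w)) + \sum_(k < re) f (take mw (drop (q * mw + k) w)).
    by move=> ->; rewrite big_split_ord.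
  rewrite (gen n hq).
  set S := \sum_(k < q * mw) _; set S' := \sum_(k < re) _.
  have hS' : `|S' - a * re%:R| <= mw%:R * (2 * C0).
    have -> : S' - a * re%:R = \sum_(k < re) (f (take mw (drop (q * mw + k) w)) - a).
      by rewrite big_split /= sumr_const card_ord mulNrn mulr_natr.
    apply: le_trans (ler_norm_sum _ _ _) _.
    apply: (@le_trans _ _ (\sum_(k < re) (2 * C0))).
      apply: ler_sum => k _; apply: le_trans (ler_normB _ _) _.
      have : `|f (take mw (drop (q * mw + k) w))| <= C0.
        apply: hC; move: hw; rewrite !mem_lwords => /andP[/eqP hs' /allP hal].
        apply/andP; split; last by apply/allP => z /mem_take /mem_drop /hal.
        rewrite size_takel// size_drop hsw hq; move: (ltn_ord k).
        by generalize (q * mw)%N => z; clear; lia.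
      by lra.
    rewrite sumr_const card_ord -[X in X <= _]mulr_natl ler_wpM2r ?mulr_ge0// ler_nat ltnW//.
  have cst (y : R) : y *+ (q * mw) = y * (q%:R * mw%:R) by rewrite -natrM mulr_natr.
  rewrite !cst => g1 g2.
  have hS'1 : S' - a * re%:R <= mw%:R * (2 * C0) by move: hS'; rewrite ler_norml => /andP[].
  have hS'2 : - (mw%:R * (2 * C0)) <= S' - a * re%:R by move: hS'; rewrite ler_norml => /andP[].
  have hre0 : 0 <= re%:R :> R by [].
  have hnn : n%:R = q%:R * mw%:R + re%:R :> R by rewrite {1}hq natrD natrM.
  have dre : 0 <= d * re%:R by rewrite mulr_ge0// ltW.
  rewrite hnn in hnd; rewrite hnn.
  move: hS'1 hS'2 hnd dre g1 g2; rewrite /d.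
  generalize (mw%:R * (2 * C0)) => Z; generalize (q%:R * mw%:R : R) => X.
  clear -de0 => *; rewrite ler_norml; apply/andP; split; lra.
apply: le_trans key _.
have B1 := @chernoff_block h1 C d q dC b1 e1.
have B2 := @chernoff_block h2 C d q dC b2 e2.
have : mw%:R * (1 - c1) ^+ q <= mw%:R * (expR c1 * expR (- (c1 / mw%:R * n%:R))) by rewrite ler_wpM2l.
by rewrite -/c1 in B1 B2; lra.
Qed.

End LLN.

Section Uniform.
Context {R : realType} (P : seq bool -> R).
Hypothesis HP : source P.

Lemma geo_sum (c : R) n0 k : 0 < c ->
  \sum_(n <- iota n0 k) expR (- (c * n%:R)) <= expR (- (c * n0%:R)) / (1 - expR (- c)).
Proof.
move=> c0; have hc : 0 < 1 - expR (- c) by rewrite subr_gt0 expR_lt1; lra.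
elim: k n0 => [|k IH] n0; first by rewrite big_nil divr_ge0 ?expR_ge0 ?ltW.
rewrite big_cons; apply: le_trans (lerD (lexx _) (IH n0.+1)) _.
rewrite -natr1 mulrDr mulr1 opprD expRD.
set E := expR (- (c * n0%:R)); set q := expR (- c) in hc *.
have -> : E + E * q / (1 - q) = E / (1 - q) by field; rewrite gt_eqF.
by [].
Qed.

(** Summability of the exponential tail gives one exceptional event for all lengths from [n0] to
    [n1], with [n0] independent of [n1] and [B]. Uniformity and both directions are needed because
    the ends of the block around the origin are random. *)
Lemma lln r mw (f : seq (seq bool) -> R) (C0 de e : R) : (0 < mw)%N -> 0 < de -> 0 < e ->
  (forall w, w \in lwords P r mw -> `|f w| <= C0) ->
  exists n0 : nat, forall n1 B : nat, (r <= B)%N -> (n1 + mw <= B)%N ->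
  Pr P B (fun x => exists n, [/\ (n0 <= n)%N, (n <= n1)%N &
     de * n%:R < `|\sum_(k < n) f (win r x k%:Z mw) - ew P r mw f * n%:R| \/
     de * n%:R < `|\sum_(k < n) f (win r x (k%:Z - n%:Z) mw) - ew P r mw f * n%:R|]) <= e.
Proof.
move=> mw0 de0 e0 hC; have [A [c [n0 [A0 c0 ht]]]] := tail HP mw0 de0 hC.
have hc : 0 < 1 - expR (- c) by rewrite subr_gt0 expR_lt1; lra.
have [n2 hn2] := expR_small c0 (divr_ge0 (mulr_ge0 (ler0n R 2) A0) (ltW hc)) e0.
exists (maxn n0 n2) => n1 B hr hB.
set m0 := maxn n0 n2.
pose a := ew P r mw f.
pose Q1 n (x : Om) := de * n%:R < `|\sum_(k < n) f (win r x k%:Z mw) - a * n%:R|.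
pose Q2 n (x : Om) := de * n%:R < `|\sum_(k < n) f (win r x (k%:Z - n%:Z) mw) - a * n%:R|.
apply: (@le_trans _ _ (\sum_(n <- iota m0 (n1.+1 - m0)) Pr P B (fun x => Q1 n x \/ Q2 n x))).
  apply: le_trans (Pr_bigU HP _ _ _); apply: Pr_le => // x _ [n [h1 h2 h3]].
  by exists n => //; rewrite mem_iota; lia.
apply: (@le_trans _ _ (\sum_(n <- iota m0 (n1.+1 - m0)) (2 * A) * expR (- (c * n%:R)))).
  rewrite big_seq [X in _ <= X]big_seq; apply: ler_sum => n; rewrite mem_iota => hn.
  have hn0 : (n0 <= n)%N by rewrite /m0 in hn; lia.
  have hat (u : int) x : forall k : 'I_n, at_ mw f (win r x u (n + mw)) k = f (win r x (u + k%:Z) mw).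
    by move=> k; rewrite /at_ win_sub//; have := ltn_ord k; lia.
  apply: le_trans (Pr_U HP _ _ _) _; rewrite -mulrA mulr2n mulrDl !mul1r; apply: lerD.
    have u1 : - B%:Z <= 0 by lia.
    have u2 : 0 + (n + mw)%N%:Z <= B%:Z by move: hn; rewrite /m0; lia.
    apply: le_trans (ht n hn0); rewrite -(Pr_win HP _ hr u1 u2).
    apply: Pr_le => // x _; rewrite /Q1.
    by under [in X in _ -> X]eq_bigr => k _ do rewrite hat add0r.
  have u1 : - B%:Z <= - n%:Z by move: hn; rewrite /m0; lia.
  have u2 : - n%:Z + (n + mw)%N%:Z <= B%:Z by move: hn; rewrite /m0; lia.
  apply: le_trans (ht n hn0); rewrite -(Pr_win HP _ hr u1 u2).
  apply: Pr_le => // x _; rewrite /Q2.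
  by under [in X in _ -> X]eq_bigr => k _ do rewrite hat addrC.
rewrite -mulr_sumr; apply: le_trans (ler_wpM2l _ (geo_sum _ _ c0)) _; first by rewrite mulr_ge0.
apply: le_trans (hn2 m0 _); last exact: leq_maxr.
by rewrite mulrA mulrAC.
Qed.

(** Independence over [q] disjoint windows, together with [1 - eta <= expR (- eta)]. *)
Lemma miss r mw (Q : pred (seq (seq bool))) q B (u : int) : (0 < mw)%N -> (r <= B)%N ->
  - B%:Z <= u -> u + (q * mw)%N%:Z <= B%:Z ->
  Pr P B (fun x => forall i, (i < q)%N -> ~~ Q (win r x (u + (i * mw)%N%:Z) mw)) <=
  expR (- (ew P r mw (fun w => (Q w)%:R) * q%:R)).
Proof.
move=> mw0 hr hu hB; set eta := ew P r mw _.
have e1 : ew P r mw (fun w => (~~ Q w)%:R) = 1 - eta.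
  rewrite /eta -{2}(ew_cst HP r mw 1) -mulN1r -ewZ -ewD; apply: eq_ew => w _.
  by case: (Q w); rewrite /= ?mulr0 ?mulr1 ?subrr ?addr0.
have e0 : 0 <= 1 - eta.
  by rewrite -e1 -(ew_cst HP r mw 0); apply: ew_le.
apply: (@le_trans _ _ ((1 - eta) ^+ q)); last first.
  have -> : - (eta * q%:R) = (- eta) *+ q by rewrite mulNrn mulr_natr.
  rewrite -[_ *+ q]mulr_natl expRM_natl.
  by rewrite lerXn2r ?nnegrE ?expR_ge0//; have := @expR_ge1Dx R (- eta); lra.
rewrite -e1 -(@ew_blocks _ P HP r mw mw0 (fun w => (~~ Q w)%:R) 0 q (q * mw))//.
rewrite -(Ex_win HP (B := B) (u := u))//; apply: Ex_le => // x _.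
case: asboolP => h; last by apply: prodr_ge0 => i _; rewrite /at_.
rewrite big1// => i _; rewrite /at_ add0n win_sub; first by rewrite h.
by have := ltn_ord i; nia.
Qed.

End Uniform.

Lemma blk_end M n u s : blk M n u s -> cut M n (u + (sumn s)%:Z).
Proof.
move=> /and3P[hp _ /rk_last[s' [k [e hk]]]]; subst s; rewrite /cut (mpath_last hp) /=.
move: hp; rewrite -cats1 mpath_cat sumn_cat /= addn0 => /andP[_ /and4P[_ _ h _]].
by apply/nomarkP => i hi; move/nomarkP: h; apply; lia.
Qed.

(** * Typical blocks around the origin *)

Section Typical.
Context {R : realType} (P : seq bool -> R) (r0 K : nat) (mk : seq (seq bool) -> bool).
Hypothesis HP : source P.
Hypothesis K0 : (0 < K)%N.
Notation mkx := (mark r0 K mk).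
Notation mkw := (mkat r0 K mk).
Hypothesis novl : forall x i d, (0 < d < K)%N -> mkx x i -> mkx x (i + d%:Z) -> False.
Notation pi_ := (pik P r0 K mk).
Notation un := (unm P r0 K mk).
Hypothesis pi0 : 0 < pi_.
Hypothesis un0 : forall n, 0 < un n.

Lemma un_small e : 0 < e -> exists n0, forall n, (n0 <= n)%N -> un n <= e.
Proof.
move=> e0; have [q0 hq0] := expR_small pi0 ler01 e0.
exists (q0 * K)%N => n hn; pose q := (n %/ K)%N.
have hq : (q * K <= n)%N by rewrite /q leq_trunc_div.
have hq' : (q0 <= q)%N by rewrite /q leq_divRL.
apply: le_trans (hq0 q hq'); rewrite mul1r.
have u1 : - (n + r0)%N%:Z <= 0 by lia.
have u2 : 0 + n%:Z <= (n + r0)%N%:Z by lia.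
have u3 : 0 + (q * K)%N%:Z <= (n + r0)%N%:Z by lia.
rewrite /unm -(Pr_win HP _ (leq_addl n r0) u1 u2).
apply: le_trans (miss HP (fun w => mkw w 0) K0 (leq_addl n r0) u1 u3).
apply: Pr_le => // x _ /allP h i hi; rewrite mkat_win// addr0 add0r.
have hiK : (i * K + K <= n)%N.
  by apply: leq_trans hq; rewrite addnC -mulSn leq_mul2r hi orbT.
have := h (i * K)%N; rewrite mkat_win// add0r mem_iota; apply.
by move: hiK; generalize (i * K)%N => z hz; lia.
Qed.

Lemma cut_prob B n u : (r0 <= B)%N -> - B%:Z <= u - n%:Z -> u <= B%:Z ->
  Pr P B (fun x => cut (mkx x) n u) <= un n.
Proof.
move=> hr h1 h2; rewrite /unm -(Pr_win HP (B := B) (u := u - n%:Z))//; last by lia.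
apply: Pr_le => // x _ /andP[hm]; rewrite -(@nomk_win r0 K mk K0 novl r0)//.
by rewrite subrK.
Qed.

Lemma no_cut n e : 0 < e -> exists L : nat, forall B (u : int), (r0 <= B)%N -> - B%:Z <= u ->
  u + L%:Z <= B%:Z ->
  Pr P B (fun x => forall i, u <= i <= u + L%:Z -> ~ cut (mkx x) n i) <= e.
Proof.
move=> e0; pose Q w := nomk r0 K mk n (take n w) && mkw (drop n w) 0.
have hQ : ew P r0 (n + K) (fun w => (Q w)%:R) = un n * pi_.
  by rewrite -ew_prod; apply: eq_ew => w _; rewrite /Q -mulnb natrM.
have eta0 : 0 < un n * pi_ by rewrite mulr_gt0.
have [q hq] := expR_small eta0 ler01 e0.
exists (q * (n + K))%N => B u hr h1 h2.
apply: le_trans (hq q (leqnn q)); rewrite mul1r -hQ.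
have nK : (0 < n + K)%N by lia.
apply: le_trans (miss HP Q nK hr h1 h2).
apply: Pr_le => // x _ h i hi; apply/negP => /andP[].
rewrite win_cat take_size_cat ?size_win// drop_size_cat ?size_win// mkat_win// addr0 => hn hm.
have hle : (i * (n + K) + (n + K) <= q * (n + K))%N by rewrite addnC -mulSn leq_mul2r hi orbT.
apply: (h (u + (i * (n + K))%N%:Z + n%:Z)).
  by move: hle; generalize (i * (n + K))%N (q * (n + K))%N => z z'; lia.
rewrite /cut hm /= addrK (@nomk_win r0 K mk K0 novl r0)//.
Qed.

(** For large [N] no cut is near the origin, so both ends of its block are beyond the threshold of
    [lln], and the left and right sums are each close to their means. The bound [B0] comes after
    [N], from the length [L] within which a cut is very likely. *)
Theorem typ_block r mw (f : seq (seq bool) -> R) (C0 de e : R) (j0 : nat) :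
  (0 < mw)%N -> 0 < de -> 0 < e -> (forall w, w \in lwords P r mw -> `|f w| <= C0) ->
  exists N0, forall N, (N0 <= N)%N -> exists B0, forall B, (B0 <= B)%N ->
  Pr P B (fun x => ~ exists u s, [/\ blk (mkx x) N u s,
     - B0%:Z <= u - N%:Z /\ u + (sumn s)%:Z + K%:Z <= B0%:Z,
     u <= - j0%:Z, j0%:Z < u + (sumn s)%:Z &
     `|\sum_(k < sumn s) f (win r x (u + k%:Z) mw) - ew P r mw f * (sumn s)%:R|
        <= de * (sumn s)%:R]) <= e.
Proof.
move=> mw0 de0 e0 hC; have e4 : 0 < e / 4 by rewrite divr_gt0.
have [n0' hl] := lln HP mw0 de0 e4 hC; have [n0 en0] : exists n0, n0 = (n0' + j0)%N by eexists.
(* Prepares a union bound over the [n0 + n0.+1] positions of [[-n0, n0]], each a cut with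
   probability at most [un N]. *)
have e2 : 0 < e / 4 / (n0 + n0.+1)%:R by rewrite divr_gt0// ltr0n; lia.
have [N1 hN1] := un_small e2; exists N1 => N hNN.
have [L hL] := no_cut N e4.
have [n1 en1] : exists n1, n1 = (n0.+1 + L)%N by eexists.
have [B0 eB0] : exists B0, B0 = (n1 + N + K + mw + r + r0)%N by eexists.
exists B0.
move=> B hB; have hB' : (n1 + N + K + mw + r + r0 <= B)%N by rewrite -eB0.
have rB : (r <= B)%N by lia.
have r0B : (r0 <= B)%N by lia.
have h1 := hl n1 B rB ltac:(lia).
have h2 : Pr P B (fun x => exists2 i, i \in [seq k%:Z - n0%:Z | k <- iota 0 (n0 + n0.+1)] & cut (mkx x) N i) <= e / 4.
  apply: le_trans (Pr_bigU HP _ _ _) _.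
  apply: (@le_trans _ _ (\sum_(i <- [seq k%:Z - n0%:Z | k <- iota 0 (n0 + n0.+1)]) (e / 4 / (n0 + n0.+1)%:R))).
    rewrite big_seq [X in _ <= X]big_seq; apply: ler_sum => i /mapP[k]; rewrite mem_iota => hk ->.
    apply: le_trans (hN1 N hNN).
    by apply: cut_prob => //; lia.
  rewrite big_map big_const_seq count_predT size_iota iter_addr addr0 -[_ *+ _]mulr_natr divfK//.
have h3 := hL B (n0.+1)%:Z r0B ltac:(clear; lia) ltac:(clear -hB' en1; lia).
have h4 := hL B (- (n0.+1)%:Z - L%:Z) r0B ltac:(clear -hB' en1; lia) ltac:(clear; lia).
have -> : e = e / 4 + (e / 4 + (e / 4 + e / 4)) by field.
apply: le_trans (lerD h1 (lerD h2 (lerD h3 h4))).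
apply: le_trans (lerD (lexx _) (lerD (lexx _) (Pr_U HP _ _ _))).
apply: le_trans (lerD (lexx _) (Pr_U HP _ _ _)).
apply: le_trans (Pr_U HP _ _ _).
apply: Pr_le => // x _ hno; apply: contrapT => hn; clear h1 h2 h3 h4 hl hL hN1 hC e2 e4.
have g1 : forall n, (n0' <= n)%N -> (n <= n1)%N ->
   `|\sum_(k < n) f (win r x k%:Z mw) - ew P r mw f * n%:R| <= de * n%:R /\
   `|\sum_(k < n) f (win r x (k%:Z - n%:Z) mw) - ew P r mw f * n%:R| <= de * n%:R.
  move=> n hn1 hn2; split; rewrite leNgt; apply/negP => h; apply: hn; left; exists n; split=> //.
    by left.
  by right.
have g2 i : - n0%:Z <= i <= n0%:Z -> ~ cut (mkx x) N i.
  move=> hi hc; apply: hn; right; left; exists i => //; apply/mapP; exists (absz (i + n0%:Z)%R).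
    by rewrite mem_iota; clear -hi; lia.
  by clear -hi; lia.
have [v0 hv0 cv0] : exists2 v, n0.+1%:Z <= v <= n0.+1%:Z + L%:Z & cut (mkx x) N v.
  apply: contrapT => h; apply: hn; right; right; left => i hi hc; apply: h; by exists i.
have [u0 hu0 cu0] : exists2 v, - n0.+1%:Z - L%:Z <= v <= - n0.+1%:Z & cut (mkx x) N v.
  apply: contrapT => h; apply: hn; right; right; right => i hi hc; apply: h; exists i => //; clear -hi; lia.
have [|u [s [hb hu hv]]] := @blk_exists _ N u0 v0 0 cu0 cv0; first by clear -hu0 hv0; lia.
have cu : cut (mkx x) N u by move: hb => /and3P[/mpath_head hm h' _]; rewrite /cut hm.
have cv := blk_end hb.
have hu' : u < - n0%:Z by rewrite ltNge; apply/negP => h; apply: (g2 u) => //; clear -h hu; lia.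
have hv' : n0%:Z < u + (sumn s)%:Z by rewrite ltNge; apply/negP => h; apply: (g2 (u + (sumn s)%:Z)) => //; clear -h hv; lia.
apply: hno; exists u, s; split=> //.
- by clear -hu hv hu0 hv0 eB0 en1; split; lia.
- by clear -hu' en0; lia.
- by clear -hv' en0; lia.
have [a1 ea1] : exists a1 : nat, a1%:Z = - u by clear -hu'; exists (absz u); lia.
have [a2 ea2] : exists a2 : nat, a2%:Z = u + (sumn s)%:Z by clear -hv'; exists (absz (u + (sumn s)%:Z)%R); lia.
have ea : sumn s = (a1 + a2)%N by clear -ea1 ea2; lia.
have [_ b1] := g1 a1 ltac:(clear -ea1 hu' en0; lia) ltac:(clear -ea1 hu hu0 en1; lia).
have [b2 _] := g1 a2 ltac:(clear -ea2 hv' en0; lia) ltac:(clear -ea2 hv hv0 en1; lia).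
have gen m : m = (a1 + a2)%N -> \sum_(k < m) f (win r x (u + k%:Z) mw) =
    \sum_(k < a1) f (win r x (k%:Z - a1%:Z) mw) + \sum_(k < a2) f (win r x k%:Z mw).
  move=> ->; rewrite big_split_ord /=; congr (_ + _); apply: eq_bigr => k _; congr (f (win r x _ mw)).
    by clear -ea1; lia.
  by clear -ea1; lia.
rewrite (gen _ ea) ea natrD !mulrDr opprD addrACA.
exact: le_trans (ler_normD _ _) (lerD b1 b2).
Qed.

Lemma no_mark e : 0 < e -> exists L : nat, forall B (u : int), (r0 <= B)%N -> - B%:Z <= u ->
  u + L%:Z <= B%:Z ->
  Pr P B (fun x => forall i, u <= i <= u + L%:Z -> ~ mkx x i) <= e.
Proof.
move=> e0; have [q hq] := expR_small pi0 ler01 e0.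
exists (q * K)%N => B u hr h1 h2.
apply: le_trans (hq q (leqnn q)); rewrite mul1r.
apply: le_trans (miss HP (fun w => mkw w 0) K0 hr h1 h2).
apply: Pr_le => // x _ h i hi; rewrite mkat_win// addr0; apply/negP; apply: h.
have hle : (i * K + K <= q * K)%N by rewrite addnC -mulSn leq_mul2r hi orbT.
by move: hle; generalize (i * K)%N (q * K)%N => z z'; clear; lia.
Qed.

End Typical.

(** * Information content of a gap *)

Section Information.
Context {R : realType} (P : seq bool -> R) (r0 K : nat) (mk : seq (seq bool) -> bool).
Variable v : nat -> R.
Notation mkx := (mark r0 K mk).
Notation mkw := (mkat r0 K mk).

Definition nxt rho w := (find (mkw w) (iota 1 rho)).+1.
(** The conditional information of a gap word given its length, charged entirely to the first letter
    of the gap. Gaps longer than [rho] count 0, matching the blank gaps, so [rho + K] letters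
    determine the value. *)
Definition fent rho w : R :=
  if [&& mkw w 0, (nxt rho w <= rho)%N & 0 < v (nxt rho w)]
  then - ln (lwt P (nxt rho w) (take (nxt rho w) w) / v (nxt rho w)) else 0.

Lemma fent_nomark rho x u : (r0 <= rho)%N -> ~~ mkx x u ->
  fent rho (win rho x u (rho + K)) = 0.
Proof. by move=> hr hm; rewrite /fent mkat_win ?leq_addl// addr0 (negbTE hm). Qed.

Lemma nxt_win rho x u n : (r0 <= rho)%N -> mpath (mkx x) u [:: n] ->
  nxt rho (win rho x u (rho + K)) = if (n <= rho)%N then n else rho.+1.
Proof.
move=> hr /= /and4P[_ n0 /nomarkP hn /andP[hm _]]; rewrite /nxt.
set a := mkw _.
have ha k : (k <= rho)%N -> a k = mkx x (u + k%:Z).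
  by move=> hk; rewrite /a mkat_win// leq_add2r.
have hlt k : (0 < k < n)%N -> ~~ mkx x (u + k%:Z) by move=> hk; apply: hn; lia.
case: (leqP n rho) => hnr.
  have hh : has a (iota 1 rho) by apply/hasP; exists n; rewrite ?mem_iota ?ha//; lia.
  have h1 := nth_find 0%N hh; have hsz := hh; rewrite has_find size_iota in hsz.
  rewrite nth_iota// add1n in h1.
  set i := find _ _ in h1 hsz *.
  apply/eqP; rewrite eqn_leq; apply/andP; split.
    rewrite ltnNge; apply/negP => hni.
    have hb := @before_find _ 0%N a (iota 1 rho) n.-1.
    have : a (nth 0%N (iota 1 rho) n.-1) = false by apply: hb; rewrite -/i; lia.
    by rewrite nth_iota ?add1n ?prednK// ?ha ?hm//; lia.
  rewrite leqNgt; apply/negP => hin; move: h1; rewrite ha; last by lia.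
  by apply/negP; apply: hlt; lia.
congr S; rewrite hasNfind ?size_iota//; apply/hasPn => k; rewrite mem_iota => hk.
by rewrite ha; [apply: hlt; lia|lia].
Qed.

Lemma fent_win rho x u n : (r0 <= rho)%N -> mpath (mkx x) u [:: n] ->
  fent rho (win rho x u (rho + K)) =
  if (n <= rho)%N && (0 < v n) then - ln (lwt P n (win rho x u n) / v n) else 0.
Proof.
move=> hr hp; rewrite /fent (nxt_win hr hp) mkat_win ?leq_addl// addr0.
have -> : mkx x u by move: hp => /= /andP[].
case: (leqP n rho) => hn /=; last by rewrite ltnn.
rewrite hn /=; case: ifP => // _.
by rewrite -[win rho x u (rho + K)]drop0 win_sub ?addr0// add0n (leq_trans hn)// leq_addr.
Qed.

Hypothesis HP : source P.
Hypothesis K0 : (0 < K)%N.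
Hypothesis novl : forall x i d, (0 < d < K)%N -> mkx x i -> mkx x (i + d%:Z) -> False.
Hypothesis vP : forall n, v n = vel P r0 K mk r0 n.

Definition rate rho := ew P rho (rho + K) (fent rho).

Lemma fent_bounded rho : exists C0, forall w, w \in lwords P rho (rho + K) -> `|fent rho w| <= C0.
Proof.
exists (\sum_(w <- lwords P rho (rho + K)) `|fent rho w|) => w hw.
by rewrite (big_rem w)//= lerDl sumr_ge0.
Qed.

Lemma v_gt0 rho x u n : (r0 <= rho)%N -> win rho x u n \in lwords P rho n ->
  mpath (mkx x) u [:: n] -> 0 < v n.
Proof.
move=> hr hw; rewrite (mpath_el K0 novl _ _ _ _ hr) => /andP[he _].
rewrite vP -(velE _ _ HP n hr) /vel (big_rem (win rho x u n))//= he ltr_pwDl ?(lwt_gt0 hw)//.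
by rewrite sumr_ge0// => e _; exact: lwt_ge0.
Qed.

End Information.

Section InformationPair.
Context {R : realType} (P : bool -> seq bool -> R) (r0 : bool -> nat) (K : nat).
Variables (mk : bool -> seq (seq bool) -> bool) (v : nat -> R) (lev : bool -> nat -> nat).
Notation spb := (sp P r0 K mk v lev).
Notation mb := (mm P v lev).
Notation lvb := (lv v lev).
Notation mkb b := (mark (r0 b) K (mk b)).
Hypothesis HP : forall b, source (P b).
Hypothesis lev0 : forall b j, (r0 b <= lev b j)%N.

(** Expresses the weight of a name through an ergodic sum, to which [typ_block] applies. *)
Lemma wj_fent b j x u s : nm (lvb b j) x u s \in W spb b j s -> mpath (mkb b x) u s ->
  wj mb b j s (nm (lvb b j) x u s) =
  expR (- \sum_(k < sumn s) fent (P b) (r0 b) K (mk b) v (lev b j)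
            (win (lev b j) x (u + k%:Z) (lev b j + K))).
Proof.
elim: s u => [|n s IH] u; first by rewrite /= big_ord0 oppr0 expR0.
move=> hw hp; have := hw; rewrite /W [nm _ _ _ _]/= words_consE => /andP[h1 h2].
have /= /and4P[hm n0 hn hp'] := hp.
have hp1 : mpath (mkb b x) u [:: n] by rewrite /= hm n0 hn (mpath_head hp').
have e1 : wj mb b j (n :: s) (nm (lvb b j) x u (n :: s)) =
   mb b j n (win (lvb b j n) x u n) * wj mb b j s (nm (lvb b j) x (u + n%:Z) s) by [].
rewrite e1 (IH _ h2 hp') [sumn _]/= big_split_ord /= opprD expRD; congr (_ * expR (- _)); last first.
  by apply: eq_bigr => k _; congr (fent _ _ _ _ _ _ (win _ _ _ _)); lia.
case: n n0 hn hp1 h1 {hw hp hp' h2 e1 IH} => // n _ hn hp1 h1.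
rewrite big_ord_recl addr0 big1 ?addr0.
  rewrite (fent_win _ _ _ hp1)// /mm /lv -/(kept v lev b j n.+1).
  case: ifP => hk; last by rewrite oppr0 expR0.
  have hpos : 0 < lwt (P b) n.+1 (win (lev b j) x u n.+1) / v n.+1.
    by have := mm_gt0 h1; rewrite /mm /lv hk.
  by rewrite opprK lnK ?posrE// hk.
move=> k _; apply: fent_nomark => //; move/nomarkP: hn; apply.
by rewrite /= /bump /=; have := ltn_ord k; lia.
Qed.

End InformationPair.

(** * Law of the coding map *)

Definition pats (k : nat) : seq (seq nat) :=
  flatten [seq words (fun _ : nat => iota 1 k) (nseq l 0%N) | l <- iota 0 k.+1].

Lemma mem_pats k s : all (leq 1) s -> (sumn s <= k)%N -> s \in pats k.
Proof.
move=> hp hs; apply/flatten_mapP; exists (size s).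
  rewrite mem_iota /= add0n ltnS; apply: leq_trans hs.
  by elim: s hp => //= n s IH /andP[h1 /IH]; lia.
elim: s hp hs => [|n s IH] //= /andP[h1 h2] hs.
rewrite -/(words _ (0%N :: nseq (size s) 0%N)) words_consE IH//; last by lia.
by rewrite mem_iota andbT; lia.
Qed.

Lemma sum_unique (R : realType) (T : eqType) (L : seq T) (p : pred T) (E : bool) : uniq L ->
  (forall a a', a \in L -> a' \in L -> p a -> p a' -> a = a') ->
  (forall a, a \in L -> p a -> E) -> \sum_(a <- L) (p a)%:R <= E%:R :> R.
Proof.
move=> hu h1 h2; case: (boolP (has p L)) => [/hasP[a ha hp]|/hasPn h].
  rewrite (h2 a ha hp) (big_rem a)//= hp big_seq big1 ?addr0// => a' ha'.
  case: (boolP (p a')) => // hp'; have e := h1 a a' ha (mem_rem ha') hp hp'.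
  by move: ha'; rewrite -e mem_rem_uniq// inE eqxx.
by rewrite big_seq big1// => a /h /negbTE ->.
Qed.

Section Law.
Context {R : realType} (P : bool -> seq bool -> R) (r0 : bool -> nat) (K : nat).
Variables (mk : bool -> seq (seq bool) -> bool) (v : nat -> R) (lev : bool -> nat -> nat).
Variables (N : nat -> nat) (kap the bet : nat -> R).
Notation T := (seq (seq bool)).
Notation L := (GenTree.tree (seq T)).
Variable g : nat -> seq nat -> L -> L -> R.
Notation spb := (sp P r0 K mk v lev).
Notation mb := (mm P v lev).
Notation cob := (co v lev).
Notation labb := (lab mb cob N kap the).
Notation typb := (typ mb N kap the).
Notation Wb := (W spb).
Notation wjb := (wj mb).
Notation lvb := (lv v lev).
Notation mkb b := (mark (r0 b) K (mk b)).
Notation nmb b j := (nm (lvb b j)).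
Notation Decb := (Dec P r0 K mk v lev N kap the g).

Hypothesis HP : forall b, source (P b).
Hypothesis lev0 : forall b j, (r0 b <= lev b j)%N.
Hypothesis levS : forall b j, (lev b j <= lev b j.+1)%N.
Hypothesis Nmono : forall j, (N j <= N j.+1)%N.
Hypothesis K0 : (0 < K)%N.
Hypothesis novl : forall b x i d, (0 < d < K)%N -> mkb b x i -> mkb b x (i + d%:Z) -> False.
Hypothesis vP : forall b n, v n = vel (P b) (r0 b) K (mk b) (r0 b) n.
Hypothesis gok : forall j, stage_ok spb mb cob N kap the j (g j).
Hypothesis gref : forall j s, refines spb mb cob N kap the j s (g j) (g j.+1 s).
Hypothesis bet0 : 0 <= bet 0.
Hypothesis bet_mono : forall j, bet j <= bet j.+1.
Hypothesis betP : forall j n, (N j.+1 <= n)%N ->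
  expR (kap j.+1 * n%:R) + expR (bet j * n%:R) <= expR (bet j.+1 * n%:R) :> R.
Hypothesis hpi : forall b b', pik (P b) (r0 b) K (mk b) = pik (P b') (r0 b') K (mk b').
Hypothesis hun : forall b b' n, unm (P b) (r0 b) K (mk b) n = unm (P b') (r0 b') K (mk b') n.

Definition within (B0 n : nat) (u : int) (s : seq nat) :=
  [&& - B0%:Z <= u - n%:Z, u + (sumn s)%:Z + K%:Z <= B0%:Z, u <= 0 & 0 < u + (sumn s)%:Z].

(** A finite list of candidates for the block around the origin, so that conditioning on the block
    is a finite sum. *)
Definition blklist B0 n : seq (int * seq nat) :=
  undup [seq p <- [seq (i%:Z - B0%:Z, s) | i <- iota 0 (B0 + B0).+1, s <- pats (B0 + B0)]
     | within B0 n p.1 p.2].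

Lemma mem_blklist B0 n M u s : within B0 n u s -> mpath M u s -> (u, s) \in blklist B0 n.
Proof.
move=> hw hp; rewrite mem_undup mem_filter hw andTb.
have /and4P[h1 h2 h3 h4] := hw.
apply/allpairsP; exists (absz (u + B0%:Z)%R, s); split; rewrite ?mem_iota /=.
- by clear -h1 h2 h3 h4; lia.
- by apply: mem_pats; [exact: mpath_pos hp|clear -h1 h2 h3 h4; lia].
- by congr (_, _); clear -h1 h2 h3 h4; lia.
Qed.

Lemma blklistP B0 n p : p \in blklist B0 n -> within B0 n p.1 p.2.
Proof. by rewrite mem_undup mem_filter => /andP[]. Qed.

Lemma blklist_uniq B0 n M p p' : p \in blklist B0 n -> p' \in blklist B0 n ->
  blk M n p.1 p.2 -> blk M n p'.1 p'.2 -> p = p'.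
Proof.
move=> /blklistP /and4P[_ _ h1 h2] /blklistP /and4P[_ _ h3 h4] hb hb'.
have i1 : p.1 <= 0 < p.1 + (sumn p.2)%:Z by rewrite h1.
have i2 : p'.1 <= 0 < p'.1 + (sumn p'.2)%:Z by rewrite h3.
have [e1 e2] := blk_uniq hb hb' i1 i2.
by case: p p' e1 e2 {h1 h2 h3 h4 hb hb' i1 i2} => [? ?] [? ?] /= -> ->.
Qed.

Variables (j n r : nat) (bit : int -> nat -> bool) (b : bool).
Hypothesis hb : b = odd j.+2.
Notation J := j.+2.
Notation b' := (~~ b).
Definition Qc (y : Om) := forall i k, - n%:Z <= i < n%:Z -> (k < r)%N -> y i k = bit i k.

(** Side [b'] was active at stage [j.+1], so a typical sub-block is a [Leaf] there and its full name
    is recorded in the label of stage [j.+2]. *)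
Definition Yin u s (y : Om) := exists ss1 t ss2, split (N j.+1) s = ss1 ++ t :: ss2 /\
  let u1 := u + (sumn (flatten ss1))%:Z in
  [/\ u1 <= - n%:Z, n%:Z < u1 + (sumn t)%:Z, typb b' j.+1 t (nmb b' j.+1 y u1 t) &
      forall i, - n%:Z <= i < n%:Z -> (r <= lvat (lvb b' j.+1) t (absz (i - u1)%R))%N].

Definition Gw u s (w' : seq T) : bool := `[< exists y, [/\ nmb b' J y u s = w', Qc y & Yin u s y] >].
Definition Aw u s (w : seq T) : bool := `[< [/\ u <= - n%:Z, n%:Z < u + (sumn s)%:Z,
   forall i, - n%:Z <= i < n%:Z -> (r <= lvat (lvb b' J) s (absz (i - u)%R))%N &
   forall y, nmb b' J y u s \in Wb b' J s ->
     0 < gg b (g J s) (labb b J s w) (labb b' J s (nmb b' J y u s)) -> Qc y] >].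
Definition Mw s (w : seq T) : bool :=
  typb b J s w && multi spb mb cob N kap the b J s (g J s) (labb b J s w).

(* An unambiguous typical name has all its partners in one label, and a typical
   target block inside is read off from that label. *)
Lemma Aw_good u s w w' : w \in Wb b J s -> w' \in Wb b' J s ->
  0 < gg b (g J s) (labb b J s w) (labb b' J s w') -> Gw u s w' ->
  typb b J s w -> ~~ Mw s w -> Aw u s w.
Proof.
move=> hw hw' hg /asboolP[y0 [e0 hQ [ss1 [t [ss2 [es [h1 h2 h3 h4]]]]]]] ht.
rewrite /Mw ht /= => /hasPn hm.
have hs := split_flat es.
set u1 := u + (sumn (flatten ss1))%:Z in h1 h2 h3 h4.
apply/asboolP; split.
- by rewrite /u1 in h1; clear -h1; lia.
- by rewrite hs !sumn_cat; rewrite /u1 in h1 h2; clear -h1 h2; lia.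
- move=> i hi; have hlt : (absz (i - u1)%R < sumn t)%N by clear -hi h1 h2; lia.
  have -> : absz (i - u)%R = (sumn (flatten ss1) + absz (i - u1)%R)%N by rewrite /u1 in h1 h2 *; clear -hi h1 h2; lia.
  rewrite hs lvat_cat lvat_catl//; apply: leq_trans (h4 i hi) _.
  by apply: leq_lvat => k; exact: lv_mono.
move=> y hy hgy i k hi hk.
have el : labb b' J s (nmb b' J y u s) = labb b' J s (nmb b' J y0 u s).
  rewrite e0; apply/eqP; apply: contrapT => /negP hne.
  have /hasPn := hm _ hy; move=> /(_ _ hw'); rewrite hne /= hg andbT.
  by rewrite hgy.
have ec := lab_sat el; rewrite !(cow_nm v levS) es !chop_cat /= in ec.
have mid z : take (size t) (drop (size (flatten ss1)) (nmb b' j.+1 z u s)) = nmb b' j.+1 z u1 t.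
  by rewrite hs nm_mid.
have /eqP := ec; rewrite eqseq_cat ?size_chop// => /andP[_ /eqP[+ _]].
rewrite !mid h3; case: ifP => // _ [en].
have hlt : (absz (i - u1)%R < sumn t)%N by clear -hi h1 h2; lia.
have := nm_inj en hlt.
have -> : u1 + (absz (i - u1)%R)%:Z = i by clear -hi h1 h2; lia.
move=> hm2; rewrite (mkseq_bit hm2 (leq_trans hk (h4 i hi))).
exact: hQ.
Qed.

(** The coupling spreads the mass of [Gw] over partners on side [b]. By [Aw_good] a typical
    unambiguous partner lies in [Aw]; the remaining names contribute at most their own mass. *)
Lemma inner_bound u s :
  \sum_(w' <- Wb b' J s) wjb b' J s w' * (Gw u s w')%:R <=
  \sum_(w <- Wb b J s) wjb b J s w * ((Aw u s w)%:R + (~~ typb b J s w)%:R + (Mw s w)%:R).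
Proof.
have [g0 hm] := gok J s.
have gg0 l l' : 0 <= gg b (g J s) l l' by rewrite /gg; case: (b).
have w0 d w : w \in Wb d J s -> 0 <= wjb d J s w.
  by move=> hw; apply: ltW; apply: wj_gt0 hw => ? ? ? ?; exact: mm_gt0.
have -> : \sum_(w' <- Wb b' J s) wjb b' J s w' * (Gw u s w')%:R =
  \sum_(w <- Wb b J s) wjb b J s w * \sum_(w' <- Wb b' J s) wjb b' J s w' *
     gg b (g J s) (labb b J s w) (labb b' J s w') * (Gw u s w')%:R.
  under [RHS]eq_bigr do rewrite mulr_sumr.
  rewrite exchange_big /= big_seq [RHS]big_seq; apply: eq_bigr => w' hw'.
  have := hm b' w' hw'; rewrite negbK => h1.
  rewrite -[LHS]mulr1 -h1 mulr_sumr; apply: eq_bigr => w _.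
  have -> : gg b' (g J s) (labb b' J s w') (labb b J s w) = gg b (g J s) (labb b J s w) (labb b' J s w').
    by rewrite /gg; case: (b).
  by ring.
rewrite big_seq [X in _ <= X]big_seq; apply: ler_sum => w hw; apply: ler_wpM2l; first exact: w0.
have hle1 : \sum_(w' <- Wb b' J s) wjb b' J s w' *
     gg b (g J s) (labb b J s w) (labb b' J s w') * (Gw u s w')%:R <= 1.
  rewrite -[X in _ <= X](hm b w hw) big_seq [X in _ <= X]big_seq; apply: ler_sum => w' hw'.
  rewrite -[X in _ <= X]mulr1; apply: ler_wpM2l; last by rewrite lern1 leq_b1.
  by apply: mulr_ge0; [exact: w0|exact: gg0].
case: (boolP (typb b J s w)) => ht /=; last first.
  by apply: le_trans hle1 _; rewrite addrAC -[X in X <= _]add0r lerD ?lexx// ?addr_ge0.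
case: (boolP (Mw s w)) => hM.
  by apply: le_trans hle1 _; rewrite -[X in X <= _]add0r lerD ?lexx// ?addr_ge0.
rewrite !addr0; case: (boolP (Aw u s w)) => hA; first exact: hle1.
rewrite big_seq big1// => w' hw'; case: (boolP (Gw u s w')) => hG; last by rewrite mulr0.
case: (ltP 0 (gg b (g J s) (labb b J s w) (labb b' J s w'))) => hg.
  by have := Aw_good hw hw' hg hG ht hM; rewrite (negbTE hA).
by have -> : gg b (g J s) (labb b J s w) (labb b' J s w') = 0 by [apply/eqP; rewrite eq_le hg gg0]; rewrite mulr0 mul0r.
Qed.

Lemma multi_bound s e3 : (N J <= sumn s)%N -> bet j.+1 <= the J ->
  expR (- ((the J - bet j.+1) * (N J)%:R)) <= e3 ->
  \sum_(w <- Wb b J s) wjb b J s w * (Mw s w)%:R <= e3.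
Proof.
move=> hs hbt; apply: le_trans; apply: (@le_trans _ _ (expR (- ((the J - bet j.+1) * len s)))); last first.
  by rewrite ler_expR lerN2 ler_wpM2l ?subr_ge0// ler_nat.
have := bad_mass (@sp_uniq _ P r0 K mk v lev) (@mm_gt0 _ P r0 K mk v lev) (mm_sum HP lev0 vP) (co_sp HP lev0 levS)
  bet0 bet_mono betP (gref j.+1 s) hb.
rewrite big_mkcond /= => h; apply: le_trans h.
rewrite le_eqVlt; apply/orP; left; apply/eqP; apply: eq_bigr => w _; rewrite /Mw.
by case: ifP; rewrite ?mulr1 ?mulr0.
Qed.

Definition TX B0 (x : Om) := exists u s,
  [/\ blk (mkb b x) (N J) u s, within B0 (N J) u s & typb b J s (nmb b J x u s)].
Definition TY B0 (y : Om) := exists u s u1 t,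
  [/\ blk (mkb b' y) (N J) u s, within B0 (N J) u s, blk (mkb b' y) (N j.+1) u1 t,
      [/\ u1 <= - n%:Z, n%:Z < u1 + (sumn t)%:Z & typb b' j.+1 t (nmb b' j.+1 y u1 t)] &
      forall i, - n%:Z <= i < n%:Z -> (r <= lvat (lvb b' j.+1) t (absz (i - u1)%R))%N].
Definition AQ B0 (x : Om) := exists u s, [/\ within B0 (N J) u s, blk (mkb b x) (N J) u s,
  inW P r0 K mk v lev b J x u s &
  forall i k, - n%:Z <= i < n%:Z -> (k < r)%N -> [/\ u <= i < u + (sumn s)%:Z,
    (k < lvat (lvb b' J) s (absz (i - u)%R))%N &
    forall y, inW P r0 K mk v lev b' J y u s -> Comp P v lev N kap the g b J x y u s -> y i k = bit i k]].

Lemma TY_Yin y u s u1 t : blk (mkb b' y) (N J) u s -> u <= 0 < u + (sumn s)%:Z ->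
  blk (mkb b' y) (N j.+1) u1 t -> u1 <= - n%:Z -> n%:Z < u1 + (sumn t)%:Z ->
  typb b' j.+1 t (nmb b' j.+1 y u1 t) ->
  (forall i, - n%:Z <= i < n%:Z -> (r <= lvat (lvb b' j.+1) t (absz (i - u1)%R))%N) -> Yin u s y.
Proof.
move=> hbl h0 hbl1 h1 h2 h3 h4.
have h0' : u <= 0 < u + (sumn (flatten (split (N j.+1) s)))%:Z by rewrite flatten_split.
have [ss1 [t' [ss2 [es ht']]]] := split_find h0'.
have hbl2 := sub_blk (Nmono _) hbl es.
have h1' : u1 <= 0 < u1 + (sumn t)%:Z by clear -h1 h2; lia.
have [e1 e2] := blk_uniq hbl2 hbl1 ht' h1'; subst t'.
by exists ss1, t, ss2; split=> //=; rewrite e1.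
Qed.

Lemma Aw_AQ B0 B x u s : within B0 (N J) u s ->
  dom (P b) B x -> (lev b J <= B)%N -> - B%:Z <= u -> u + (sumn s)%:Z <= B%:Z ->
  blk (mkb b x) (N J) u s -> Aw u s (nmb b J x u s) -> AQ B0 x.
Proof.
move=> hw hx hB hu hs hbl /asboolP[h1 h2 h3 h4]; exists u, s; split=> //.
  by rewrite /inW; apply: (dom_inW v HP lev0 K0 novl hx hB hu hs); case/and3P: hbl.
move=> i k hi hk; split.
- by clear -hi h1 h2; lia.
- exact: leq_trans hk (h3 i hi).
- by move=> y hy hc; apply: (h4 y hy hc).
Qed.

Lemma AQ_Dec B0 x i k : AQ B0 x -> - n%:Z <= i < n%:Z -> (k < r)%N -> Decb b J x i k (bit i k).
Proof. by move=> [u [s [_ h1 h2 h3]]] hi hk; have [h4 h5 h6] := h3 i k hi hk; exists u, s. Qed.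

(** Each candidate block has the same probability [cc] on the two sides, so [inner_bound] can be
    summed over the candidates. The errors come from an atypical block of [x], a missing typical
    sub-block of [y], and ambiguity. *)
Theorem law_step B0 e1 e2 e3 B : (B0 <= B)%N -> (lev b J <= B)%N -> (lev b' J <= B)%N ->
  Pr (P b) B (fun x => ~ TX B0 x) <= e1 -> Pr (P b') B (fun y => ~ TY B0 y) <= e2 ->
  bet j.+1 <= the J -> expR (- ((the J - bet j.+1) * (N J)%:R)) <= e3 ->
  Pr (P b') B Qc <= Pr (P b) B (AQ B0) + (e1 + e2 + e3).
Proof.
move=> hB0 hBb hBb' hX hY hbt he3.
pose Ls := blklist B0 (N J).
pose cc (p : int * seq nat) := (rk (N J) p.2)%:R * unm (P b) (r0 b) K (mk b) (N J) *
   (vs v p.2 * pik (P b) (r0 b) K (mk b)).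
have inB p : p \in Ls -> [/\ - B%:Z <= p.1 - (N J)%:Z, p.1 + (sumn p.2)%:Z + K%:Z <= B%:Z,
    - B%:Z <= p.1 & p.1 + (sumn p.2)%:Z <= B%:Z].
  by move=> /blklistP /and4P[h1 h2 _ _]; split; clear -h1 h2 hB0; lia.
have EB d p F : (d == b) || (d == b') -> p \in Ls ->
    Ex (P d) B (fun x => (blk (mkb d x) (N J) p.1 p.2)%:R * F (nmb d J x p.1 p.2)) =
    cc p * \sum_(w <- Wb d J p.2) wjb d J p.2 w * F w.
  move=> hd hp; have [h1 h2 _ _] := inB p hp.
  rewrite (Ex_blk HP lev0 K0 novl vP _ _ h1 h2).
    by rewrite (hun d b) (hpi d b) /cc -!mulrA.
  by case/orP: hd => /eqP ->.
have cc0 p : p \in Ls -> 0 <= cc p.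
  move=> hp; have := @EB b p (fun=> 1) _ hp; rewrite eqxx => /(_ isT).
  have -> : \sum_(w <- Wb b J p.2) wjb b J p.2 w * 1 = 1.
    by under eq_bigr do rewrite mulr1; apply: sum_wj => ? ? ?; exact: mm_sum.
  rewrite mulr1 => <-; apply: (@le_trans _ _ (Ex (P b) B (fun=> 0))); first by rewrite Ex_cst.
  by apply: Ex_le => // x _; apply: mulr_ge0; rewrite ?ler01 ?ler0n.
have hb1 : (b == b) || (b == b') by rewrite eqxx.
have hb2 : (b' == b) || (b' == b') by rewrite eqxx orbT.
have step1 : Pr (P b') B Qc <= e2 + Ex (P b') B (fun y => \sum_(p <- Ls)
     (blk (mkb b' y) (N J) p.1 p.2)%:R * (Gw p.1 p.2 (nmb b' J y p.1 p.2))%:R).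
  apply: (@le_trans _ _ (Pr (P b') B (fun y => ~ TY B0 y \/ (Qc y /\ TY B0 y)))).
    by apply: Pr_le => // y _ hq; case: (pselect (TY B0 y)) => h; [right|left].
  apply: le_trans (Pr_U (HP _) _ _ _) _; apply: lerD => //.
  apply: Ex_le => // y _; case: asboolP => [[hq [u [s [u1 [t [a1 a2 a3 [a4 a5 a6] a7]]]]]]|_]; last first.
    by apply: sumr_ge0 => p _; rewrite mulr_ge0.
  have hp : (u, s) \in Ls by apply: mem_blklist a2 _; case/and3P: a1 => h _ _; exact: h.
  rewrite (big_rem (u, s))//= a1 mul1r.
  have -> : Gw u s (nmb b' J y u s).
    apply/asboolP; exists y; split=> //; apply: TY_Yin a1 _ a3 a4 a5 a6 a7.
    by case/and4P: a2 => _ _ -> ->.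
  by rewrite -[X in X <= _]addr0 lerD// sumr_ge0// => p _; rewrite mulr_ge0.
apply: le_trans step1 _; rewrite Ex_sum.
have -> : \sum_(p <- Ls) Ex (P b') B (fun y => (blk (mkb b' y) (N J) p.1 p.2)%:R *
     (Gw p.1 p.2 (nmb b' J y p.1 p.2))%:R) =
   \sum_(p <- Ls) cc p * \sum_(w' <- Wb b' J p.2) wjb b' J p.2 w' * (Gw p.1 p.2 w')%:R.
  by rewrite big_seq [RHS]big_seq; apply: eq_bigr => p hp; rewrite (EB b' p (fun w => (Gw p.1 p.2 w)%:R) hb2 hp).
pose SS (F : int * seq nat -> seq T -> bool) :=
  \sum_(p <- Ls) cc p * \sum_(w <- Wb b J p.2) wjb b J p.2 w * (F p w)%:R.
have SSE F : SS F = Ex (P b) B (fun x => \sum_(p <- Ls)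
     (blk (mkb b x) (N J) p.1 p.2 && F p (nmb b J x p.1 p.2))%:R).
  rewrite Ex_sum /SS big_seq [RHS]big_seq; apply: eq_bigr => p hp.
  rewrite -(EB b p (fun w => (F p w)%:R) hb1 hp); apply: eq_Ex => // x _.
  by rewrite -natrM mulnb.
have SS_le (F : int * seq nat -> seq T -> bool) (E : Om -> Prop) : (forall x p, dom (P b) B x -> p \in Ls ->
    blk (mkb b x) (N J) p.1 p.2 -> F p (nmb b J x p.1 p.2) -> E x) -> SS F <= Pr (P b) B E.
  move=> h; rewrite SSE; apply: Ex_le => // x hx; apply: sum_unique.
  - exact: undup_uniq.
  - by move=> p p' hp hp' /andP[h1 _] /andP[h2 _]; exact: blklist_uniq hp hp' h1 h2.
  - by move=> p hp /andP[h1 h2]; apply/asboolP; exact: h hx hp h1 h2.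
have hA : SS (fun p w => Aw p.1 p.2 w) <= Pr (P b) B (AQ B0).
  apply: SS_le => x p hx hp hbl hA; have [_ _ h3 h4] := inB p hp.
  exact: Aw_AQ (blklistP hp) hx hBb h3 h4 hbl hA.
have hT : SS (fun p w => ~~ typb b J p.2 w) <= e1.
  apply: le_trans hX; apply: SS_le => x p hx hp hbl ht [u [s [h1 h2 h3]]].
  have hp' : (u, s) \in Ls by apply: mem_blklist h2 _; case/and3P: h1 => h _ _; exact: h.
  have e := blklist_uniq hp hp' hbl h1; move: ht; rewrite e /=.
  by rewrite h3.
have e30 : 0 <= e3 by apply: le_trans he3; exact: expR_ge0.
have hM : SS (fun p w => Mw p.2 w) <= e3.
  apply: (@le_trans _ _ (\sum_(p <- Ls) cc p * e3)).
    rewrite /SS big_seq [X in _ <= X]big_seq; apply: ler_sum => p hp.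
    case: (boolP (rk (N J) p.2)) => hr; last by rewrite /cc (negbTE hr) !mul0r.
    apply: ler_wpM2l; first exact: cc0.
    apply: multi_bound hbt he3.
    exact: ltnW (rk_sumn hr).
  rewrite -mulr_suml -[X in _ <= X]mul1r; apply: ler_wpM2r => //.
  have -> : \sum_(p <- Ls) cc p = SS (fun _ _ => true).
    apply: eq_bigr => p _; rewrite (_ : \sum_(w <- _) _ = 1) ?mulr1//.
    by under eq_bigr do rewrite mulr1; apply: sum_wj => ? ? ?; exact: mm_sum.
  rewrite -(Ex_cst (HP b) B 1); apply: le_trans (SS_le _ (fun=> True) _) _ => //.
  by apply: Ex_le => // x _; rewrite lern1 leq_b1.
have main : \sum_(p <- Ls) cc p * (\sum_(w' <- Wb b' J p.2) wjb b' J p.2 w' * (Gw p.1 p.2 w')%:R) <=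
   SS (fun p w => Aw p.1 p.2 w) + SS (fun p w => ~~ typb b J p.2 w) + SS (fun p w => Mw p.2 w).
  rewrite /SS -!big_split /= big_seq [X in _ <= X]big_seq; apply: ler_sum => p hp.
  rewrite -!mulrDr; apply: ler_wpM2l; first exact: cc0.
  apply: le_trans (inner_bound p.1 p.2) _; rewrite -!big_split /=.
  by apply: ler_sum => w _; rewrite !mulrDr.
by lra.
Qed.

Lemma AQ_det B0 B x x' : (B0 <= B)%N -> (lev b J <= B)%N ->
  win B x (- B%:Z) (B + B) = win B x' (- B%:Z) (B + B) -> AQ B0 x -> AQ B0 x'.
Proof.
move=> hB hl hx [u [s [hw h1 h2 h3]]]; exists u, s.
have /and4P[w1 w2 w3 w4] := hw.
have agr i : - B%:Z <= i < B%:Z -> mkseq (x i) B = mkseq (x' i) B.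
  move=> hi; have := win_inj (k := absz (i + B%:Z)%R) hx.
  have -> : - B%:Z + (absz (i + B%:Z)%R)%:Z = i by clear -hi; lia.
  by apply; clear -hi; lia.
have agrw q w k : (q <= B)%N -> - B%:Z <= w -> w + k%:Z <= B%:Z -> win q x w k = win q x' w k.
  move=> hq hw' hk; apply: eq_win => l hlk; rewrite -(take_mkseq _ hq) agr ?take_mkseq//.
  by clear -hlk hw' hk; lia.
have en : nmb b J x u s = nmb b J x' u s.
  apply: eq_nm => k hk; have hlt := lvat_le s k (lv_lev v lev b J).
  have hq := leq_trans hlt hl.
  by rewrite -(take_mkseq _ hq) agr ?take_mkseq//; clear -w1 w2 hk hB; lia.
split=> //.
- apply: (blk_local K0 _ h1) => k hk; rewrite /mark agrw//; first exact: leq_trans (lev0 b J) hl.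
  + by clear -w1 hk hB; lia.
  + by clear -w2 hk hB; lia.
- by rewrite /inW -en.
move=> i k hi hk; have [a1 a2 a3] := h3 i k hi hk; split=> // y hy.
by rewrite /Comp -en; exact: a3.
Qed.

End Law.

(** * Entropy rates and the schedule *)

Section Rate.
Context {R : realType} (P : seq bool -> R) (r0 K : nat) (mk : seq (seq bool) -> bool).
Variable v : nat -> R.
Notation mkx := (mark r0 K mk).
Notation mkw := (mkat r0 K mk).
Notation elx := (el r0 K mk).
Notation pi_ := (pik P r0 K mk).
Hypothesis HP : source P.
Hypothesis K0 : (0 < K)%N.
Hypothesis novl : forall x i d, (0 < d < K)%N -> mkx x i -> mkx x (i + d%:Z) -> False.
Hypothesis vP : forall n, v n = vel P r0 K mk r0 n.
Hypothesis pi0 : 0 < pi_.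

Definition hn r n : R := ew P r n (fun e => (elx n e)%:R * - ln (lwt P n e / v n)).
Definition Hlev r : R := ew P r 1 (fun e => - ln (lwt P 1 e)).

Lemma el_lwt_le r n e : (r0 <= r)%N -> e \in lwords P r n -> elx n e -> lwt P n e <= v n.
Proof.
move=> hr he hel; rewrite vP -(velE _ _ HP n hr) /vel (big_rem e)//= hel lerDl sumr_ge0// => a _.
exact: lwt_ge0.
Qed.

Lemma lwt_le1 r n e : e \in lwords P r n -> lwt P n e <= 1.
Proof.
move=> he; rewrite -(lwords_sum HP r n) (big_rem e)//= lerDl sumr_ge0// => a _; exact: lwt_ge0.
Qed.

Lemma lwt_take r r' n e : e \in lwords P r' n -> lwt P n e <= lwt P n (map (take r) e).
Proof.
rewrite mem_lwords => /andP[/eqP <- _]; elim: e => //= a e IH; rewrite /lwt /=.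
by apply: ler_pM => //; [exact: src_ge0|exact: lwt_ge0|exact: src_take].
Qed.

Lemma term_ge0 r n e : (r0 <= r)%N -> e \in lwords P r n ->
  0 <= (elx n e)%:R * - ln (lwt P n e / v n).
Proof.
move=> hr he; case: (boolP (elx n e)) => hel; last by rewrite mul0r.
have hl := lwt_gt0 he; have hle := el_lwt_le hr he hel.
have v0 := lt_le_trans hl hle.
by rewrite mul1r oppr_ge0 -ln1 ler_ln ?posrE ?divr_gt0// ler_pdivrMr// mul1r.
Qed.

Lemma hn_ge0 r n : (r0 <= r)%N -> 0 <= hn r n.
Proof. by move=> hr; rewrite -(ew_cst HP r n 0); apply: ew_le => // e he; exact: term_ge0 hr he. Qed.

Lemma hn_mono r r' n : (r0 <= r)%N -> (r <= r')%N -> hn r n <= hn r' n.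
Proof.
move=> hr hrr; rewrite /hn -(ew_push HP n _ hrr); apply: ew_le => // e he.
rewrite el_take//; case: (boolP (elx n e)) => hel; last by rewrite !mul0r.
have he' := lwords_take HP hrr he.
have hel' : elx n (map (take r) e) by rewrite el_take.
have v0 := lt_le_trans (lwt_gt0 he') (el_lwt_le hr he' hel').
rewrite !mul1r lerN2 ler_ln ?posrE ?divr_gt0 ?(lwt_gt0 he) ?(lwt_gt0 he')//.
by rewrite ler_pM2r ?invr_gt0// (lwt_take _ he).
Qed.

Lemma fentE rho w : (r0 <= rho)%N -> w \in lwords P rho (rho + K) ->
  fent P r0 K mk v rho w =
  \sum_(n <- iota 1 rho) (elx n (take n w))%:R * - ln (lwt P n (take n w) / v n) * (mkw (drop n w) 0)%:R.
Proof.
move=> hr hw; have := hw; rewrite mem_lwords => /andP[/eqP hs /allP hal].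
have hal' : all (fun a => size a == rho) w by apply/allP => a /hal /andP[].
pose x := emb 0 w.
have ew_ : w = win rho x 0 (rho + K).
  rewrite /x (@win_emb rho rho 0 (rho + K))//.
  rewrite drop0 take_oversize ?hs// -[LHS]map_id; apply/eq_in_map => a /hal /andP[/eqP <- _].
  by rewrite take_size.
have hT n : (0 < n <= rho)%N -> elx n (take n w) && mkw (drop n w) 0 = mpath (mkx x) 0 [:: n].
  move=> hn; rewrite (mpath_el K0 novl _ _ _ _ hr) ew_.
  have -> : take n (win rho x 0 (rho + K)) = win rho x 0 n.
    by rewrite -[win rho x 0 (rho + K)]drop0 win_sub ?addr0//; lia.
  have -> : drop n (win rho x 0 (rho + K)) = win rho x n%:Z (rho - n + K).
    have -> : (rho + K)%N = (n + (rho - n + K))%N by lia.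
    by rewrite win_cat drop_size_cat ?size_win// add0r.
  by rewrite mkat_win ?leq_addl// addr0 /= andbT add0r.
case: (boolP (has (fun n => mpath (mkx x) 0 [:: n]) (iota 1 rho))) => [/hasP[n hn hp]|/hasPn hno].
  have hn' := hn; rewrite mem_iota in hn'.
  rewrite ew_ (fent_win _ _ hr hp) -ew_ (big_rem n)//= big_seq big1 ?addr0; last first.
    move=> n'; rewrite mem_rem_uniq ?iota_uniq// !inE mem_iota => /andP[hne hn''].
    have : ~~ mpath (mkx x) 0 [:: n'] by apply/negP => h; move: hne; rewrite (mpath_next h hp) eqxx.
    rewrite -hT; last by lia.
    by rewrite negb_and => /orP[]/negbTE ->; rewrite ?mul0r ?mulr0.
  have := hp; rewrite -hT; last by lia.
  move=> /andP[h1 h2]; rewrite h1 h2 mulr1 mul1r.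
  have -> : win rho x 0 n = take n w by rewrite ew_ -[win rho x 0 (rho + K)]drop0 win_sub ?addr0//; lia.
  have -> : (n <= rho)%N by lia.
  suff -> : 0 < v n by [].
  have htw : take n w \in lwords P rho n.
    rewrite mem_lwords size_takel ?eqxx ?hs; last by lia.
    by apply/allP => a /mem_take /hal.
  exact: lt_le_trans (lwt_gt0 htw) (el_lwt_le hr htw h1).
rewrite big_seq big1; last first.
  move=> n hn; have := hno n hn; rewrite -hT; last by rewrite mem_iota in hn; lia.
  by rewrite negb_and => /orP[]/negbTE ->; rewrite ?mul0r ?mulr0.
rewrite /fent; case: ifP => // /and3P[h0 h1 _]; exfalso.
have hh : has (mkw w) (iota 1 rho) by rewrite has_find size_iota -ltnS.
have hf := nth_find 0%N hh; rewrite nth_iota in hf; last by rewrite -ltnS.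
move: hf; rewrite add1n -/(nxt r0 K mk rho w); set n := nxt _ _ _ _ _ => hf.
rewrite -/n in h1; have en : n = (find (mkw w) (iota 1 rho)).+1 by []; clearbody n.
have hn : n \in iota 1 rho by rewrite mem_iota add1n ltnS h1 en.
have hM k : (k <= rho)%N -> mkw w k = mkx x k%:Z by move=> hk; rewrite ew_ mkat_win ?leq_add2r// add0r.
move/negP: (hno n hn); apply; rewrite /= andbT !add0r -(hM n)// hf !andbT.
have -> : mkx x 0 by rewrite -(hM 0%N).
have n1 : (0 < n)%N by rewrite en.
rewrite n1 /=; apply/nomarkP => i hi.
have ei : i = (absz i)%:Z by clear -hi; lia.
rewrite ei -hM; last by clear -hi h1; lia.
have hb := @before_find _ 0%N (mkw w) (iota 1 rho) (absz i).-1.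
apply/negbT; have e1 : nth 0%N (iota 1 rho) (absz i).-1 = absz i.
  by rewrite nth_iota; clear -hi h1; lia.
by rewrite e1 in hb; apply: hb; clear -hi en; lia.
Qed.

(** The letters of a gap are independent of the marker that closes it. *)
Lemma rateE rho : (r0 <= rho)%N ->
  rate P r0 K mk v rho = \sum_(n <- iota 1 rho) pi_ * hn rho n.
Proof.
move=> hr; rewrite /rate (eq_ew (G := fun w => \sum_(n <- iota 1 rho) (elx n (take n w))%:R * - ln (lwt P n (take n w) / v n) * (mkw (drop n w) 0)%:R)).
  rewrite ew_sum big_seq [RHS]big_seq; apply: eq_bigr => n; rewrite mem_iota => hn'.
  have -> : (rho + K)%N = (n + (K + (rho - n)))%N by lia.
  rewrite (ew_prod P rho n _ (fun e => (elx n e)%:R * - ln (lwt P n e / v n)) (fun w => (mkw w 0)%:R)).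
  rewrite mulrC -/(hn rho n); congr (_ * _).
  rewrite -(pikE K mk HP hr) -(ew_take HP rho K (rho - n) (fun w => (mkw w 0)%:R)).
  apply: eq_ew => w _; congr (_%:R); congr (nat_of_bool _).
  by rewrite /mkat !drop0 take_takel.
by move=> w hw; exact: fentE.
Qed.

End Rate.

Lemma gap_between (M : int -> bool) (v1 v2 i : int) : M v1 -> M v2 -> v1 <= i < v2 ->
  exists u n, [/\ v1 <= u, u <= i < u + n%:Z, u + n%:Z <= v2 & mpath M u [:: n]].
Proof.
move=> h1 h2 hi; have [|s [hp es]] := mpath_exists h1 h2; first by lia.
have [|s1 [n [s2 [e hin hp']]]] := mpath_find (i := i) hp; first by rewrite es.
exists (v1 + (sumn s1)%:Z), n; split=> //.
- by clear; lia.
- by rewrite -es e sumn_cat /=; clear; lia.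
by move: hp' => /= /and4P[-> -> -> /mpath_head ->].
Qed.

Lemma gap_uniq (M : int -> bool) (u : int) n (u' : int) n' (i : int) : mpath M u [:: n] -> mpath M u' [:: n'] ->
  u <= i < u + n%:Z -> u' <= i < u' + n'%:Z -> u = u' /\ n = n'.
Proof.
move=> h h' hi hi'.
have e : u = u'.
  move: h h' => /= /and4P[hu _ hn _] /and4P[hu' _ hn' _].
  apply/eqP; rewrite eq_le; apply/andP; split; rewrite leNgt; apply/negP => hlt.
    by apply: nomarkF hn' hu _; clear -hi hi' hlt; lia.
  by apply: nomarkF hn hu' _; clear -hi hi' hlt; lia.
by subst u'; split=> //; exact: mpath_next h h'.
Qed.

(** * Mass transport between gaps and letters *)

Section Transport.
Context {R : realType} (P : seq bool -> R) (r0 K : nat) (mk : seq (seq bool) -> bool).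
Variable v : nat -> R.
Notation mkx := (mark r0 K mk).
Notation mkw := (mkat r0 K mk).
Notation elx := (el r0 K mk).
Notation pi_ := (pik P r0 K mk).
Hypothesis HP : source P.
Hypothesis K0 : (0 < K)%N.
Hypothesis novl : forall x i d, (0 < d < K)%N -> mkx x i -> mkx x (i + d%:Z) -> False.
Hypothesis vP : forall n, v n = vel P r0 K mk r0 n.
Hypothesis pi0 : 0 < pi_.

(** The unconditional counterpart of [hn]; their difference [v n * ln (v n)] involves only the law
    of the marks, which the two sides share. *)
Definition an r n : R := ew P r n (fun e => (elx n e)%:R * - ln (lwt P n e)).

Lemma hn_an r n : (r0 <= r)%N -> hn P r0 K mk v r n = an r n + v n * ln (v n).
Proof.
move=> hr; have -> : v n * ln (v n) = ew P r n (fun e => ln (v n) * (elx n e)%:R).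
  rewrite ewZ mulrC vP -(velE _ _ HP n hr) /vel /ew big_mkcond; congr (_ * _); apply: eq_bigr => e _.
  by case: ifP; rewrite ?mulr1 ?mulr0.
rewrite /an -ewD; apply: eq_ew => e he; case: (boolP (elx n e)) => hel; last by rewrite !mul0r mulr0 addr0.
have hl := lwt_gt0 he; have v0 := lt_le_trans hl (el_lwt_le HP vP hr he hel).
by rewrite !mul1r mulr1 ln_div ?posrE// opprB addrC.
Qed.

Definition gl (a : seq bool) : R := - ln (P a).

Lemma ln_lwt r n e : e \in lwords P r n -> - ln (lwt P n e) = \sum_(i <- iota 0 n) gl (nth [::] e i).
Proof.
rewrite mem_lwords => /andP[/eqP <- ha].
suff [] : 0 < lwt P (size e) e /\ - ln (lwt P (size e) e) = \sum_(i <- iota 0 (size e)) gl (nth [::] e i) by [].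
elim: e ha => [|a e IH] /=; first by rewrite big_nil /lwt /= ln1 oppr0.
move=> /andP[/andP[_ a0] /IH [h1 h2]].
rewrite big_cons /= /lwt /= -/(lwt P (size e) e) lnM ?posrE// mulr_gt0// opprD h2; split=> //.
by congr (_ + _); rewrite (iotaDl 1 0) big_map.
Qed.

Definition gaps m := [seq (n, i) | n <- iota 1 m, i <- iota 0 n].
Definition ingap (x : Om) (q : nat * nat) : bool := mpath (mkx x) (- q.2%:Z) [:: q.1].

Lemma gaps_uniq m : uniq (gaps m).
Proof.
apply: allpairs_uniq_dep => [|n _|]; rewrite ?iota_uniq//.
by move=> [n i] [n' i'] /= _ _ [-> ->].
Qed.

Lemma mem_gaps m q : (q \in gaps m) = (0 < q.1 <= m)%N && (q.2 < q.1)%N.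
Proof.
apply/allpairsPdep/idP => [[n [i [hn hi ->]]]|h] /=.
  by move: hn hi; rewrite !mem_iota; clear; lia.
by exists q.1, q.2; rewrite !mem_iota; split; [clear -h; lia|clear -h; lia|case: (q)].
Qed.

Lemma gaps_le1 m x : \sum_(q <- gaps m) (ingap x q)%:R <= 1 :> R.
Proof.
apply: (@sum_unique R _ (gaps m) (ingap x) true) => //; first exact: gaps_uniq.
move=> [n i] [n' i']; rewrite !mem_gaps /= => h h' hp hp'.
have [||e1 e2] := @gap_uniq _ _ _ _ _ 0 hp hp'; [move=> /=; clear -h; lia|move=> /=; clear -h'; lia|].
by move: e1 e2 => /= e1 ->; congr (_, _); clear -e1; lia.
Qed.

(** The information of a gap is the sum of that of its letters. By stationarity each letter can be
    moved to the origin, and summing over offsets leaves the information at 0 on the event that 0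
    lies in a gap of length at most [m]. *)
Lemma an_transport r m B : (r0 <= r)%N -> (r <= B)%N -> (m + K <= B)%N ->
  \sum_(n <- iota 1 m) pi_ * an r n =
  Ex P B (fun x => gl (mkseq (x 0) r) * \sum_(q <- gaps m) (ingap x q)%:R).
Proof.
move=> hr hrB hB.
have -> : Ex P B (fun x => gl (mkseq (x 0) r) * \sum_(q <- gaps m) (ingap x q)%:R) =
  \sum_(q <- gaps m) Ex P B (fun x => gl (mkseq (x 0) r) * (ingap x q)%:R).
  by rewrite -Ex_sum; apply: eq_Ex => // x _; rewrite mulr_sumr.
rewrite /gaps big_allpairs_dep /= big_seq [RHS]big_seq; apply: eq_bigr => n; rewrite mem_iota => hn.
have -> : pi_ * an r n = \sum_(i <- iota 0 n) pi_ * ew P r n (fun e => (elx n e)%:R * gl (nth [::] e i)).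
  rewrite -mulr_sumr -ew_sum; congr (_ * _); apply: eq_ew => e he.
  by rewrite (ln_lwt he) mulr_sumr.
rewrite big_seq [RHS]big_seq; apply: eq_bigr => i; rewrite mem_iota => hi.
rewrite mulrC -(pikE K mk HP hr) -ew_prod.
rewrite -(Ex_win HP (B := B) (u := - i%:Z))//; [|by clear -hn hi hB; lia|by clear -hn hi hB; lia].
apply: eq_Ex => // x _; rewrite /ingap (mpath_el K0 novl _ _ _ _ hr) /=.
rewrite win_cat take_size_cat ?size_win// drop_size_cat ?size_win// mkat_win ?leq_addl// addr0 andbT.
rewrite nth_win; last by clear -hi; lia.
rewrite addNr mulrC mulrA mulrC -mulnb natrM; congr (_ * _).
by rewrite mulrC.
Qed.

Lemma Hlev_gl r B : (r <= B)%N -> (1 <= B)%N -> Hlev P r = Ex P B (fun x => gl (mkseq (x 0) r)).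
Proof.
move=> hr hB; have u1 : - B%:Z <= 0 by lia.
have u2 : 0 + 1%N%:Z <= B%:Z by lia.
rewrite /Hlev -(Ex_win HP _ hr u1 u2); apply: eq_Ex => // x _.
by rewrite /win /= addr0 /lwt /= mulr1.
Qed.

Lemma gl_ge0 B x r : dom P B x -> (r <= B)%N -> (1 <= B)%N -> 0 <= gl (mkseq (x 0) r).
Proof.
move=> hx hr hB; have : win r x 0 1 \in lwords P r 1 by apply: dom_win hx hr _ _ => //; lia.
rewrite /win /= addr0 => hw; have := lwt_le1 HP hw; have := lwt_gt0 hw.
rewrite /lwt /= mulr1 /gl => h0 h1.
by rewrite oppr_ge0 -ln1 ler_ln ?posrE.
Qed.

Lemma an_le r m : (r0 <= r)%N -> \sum_(n <- iota 1 m) pi_ * an r n <= Hlev P r.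
Proof.
move=> hr; pose B := (r + m + K + 1)%N.
have rB : (r <= B)%N by rewrite /B; lia.
have B1 : (1 <= B)%N by rewrite /B; lia.
rewrite (an_transport hr rB); last by rewrite /B; lia.
rewrite (Hlev_gl rB B1); apply: Ex_le => // x hx.
by rewrite -[X in _ <= X]mulr1; apply: ler_wpM2l; [exact: gl_ge0 hx rB B1|exact: gaps_le1].
Qed.

Hypothesis un0 : forall n, 0 < unm P r0 K mk n.

(** At a fixed level the letter information is bounded by [C], and the origin lies in a long gap
    with probability at most [e / C]. *)
Lemma an_ge r e : (r0 <= r)%N -> 0 < e -> exists m0, forall m, (m0 <= m)%N ->
  Hlev P r - e <= \sum_(n <- iota 1 m) pi_ * an r n.
Proof.
move=> hr e0.
have [C [C0 hC]] : exists C, 0 < C /\ forall a, a \in lets P r -> gl a <= C.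
  exists (1 + \sum_(a <- lets P r) `|gl a|); split; first by rewrite ltr_pwDl// sumr_ge0.
  move=> a ha; rewrite (big_rem a)//= addrCA; apply: le_trans (ler_norm _) _.
  by rewrite lerDl addr_ge0// sumr_ge0.
have e1 : 0 < e / 2 / C by rewrite !divr_gt0.
have [h hh] := no_mark HP K0 pi0 e1.
exists (h + h + 2)%N => m hm; pose B := (r + m + K + 1)%N.
have rB : (r <= B)%N by rewrite /B; clear; lia.
have B1 : (1 <= B)%N by rewrite /B; clear; lia.
have mB : (m + K <= B)%N by rewrite /B; clear; lia.
rewrite (an_transport hr rB mB) (Hlev_gl rB B1).
have r0B : (r0 <= B)%N := leq_trans hr rB.
have b1 := hh B (- h%:Z) r0B ltac:(clear -hm mB; lia) ltac:(clear -hm mB; lia).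
have b2 := hh B 1 r0B ltac:(clear -hm mB; lia) ltac:(clear -hm mB; lia).
set E1 := fun x : Om => forall i, - h%:Z <= i <= - h%:Z + h%:Z -> ~ mkx x i in b1.
set E2 := fun x : Om => forall i, 1 <= i <= 1 + h%:Z -> ~ mkx x i in b2.
rewrite lerBlDr.
apply: (@le_trans _ _ (Ex P B (fun x => gl (mkseq (x 0) r) * \sum_(q <- gaps m) (ingap x q)%:R +
   (C * (`[< E1 x >])%:R + C * (`[< E2 x >])%:R)))).
  apply: Ex_le => // x hx; have g0 := gl_ge0 hx rB B1.
  have gC : gl (mkseq (x 0) r) <= C.
    apply: hC; have : win r x 0 1 \in lwords P r 1 by apply: dom_win hx rB _ _ => //; clear -B1; lia.
    by rewrite mem_lwords /win /= addr0 andbT mem_lets.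
  have s0 : 0 <= gl (mkseq (x 0) r) * \sum_(q <- gaps m) (ingap x q)%:R.
    by rewrite mulr_ge0// sumr_ge0.
  case: asboolP => hE1; first by rewrite mulr1; case: asboolP => _; rewrite ?mulr1 ?mulr0; clear -s0 gC C0; lra.
  case: asboolP => hE2; first by rewrite mulr1 mulr0; clear -s0 gC C0; lra.
  rewrite !mulr0 !addr0 -[X in X <= _]mulr1; apply: ler_wpM2l => //.
  have [v1 hv1 m1] : exists2 i, - h%:Z <= i <= - h%:Z + h%:Z & mkx x i.
    by apply: contrapT => hn; apply: hE1 => i hi hm'; apply: hn; exists i.
  have [v2 hv2 m2] : exists2 i, 1 <= i <= 1 + h%:Z & mkx x i.
    by apply: contrapT => hn; apply: hE2 => i hi hm'; apply: hn; exists i.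
  have [|u [n [a1 a2 a3 a4]]] := @gap_between _ _ _ 0 m1 m2; first by clear -hv1 hv2; lia.
  have hq : (n, absz u) \in gaps m by rewrite mem_gaps /=; clear -a1 a2 a3 hv1 hv2 hm; lia.
  rewrite (big_rem (n, absz u))//=.
  have -> : ingap x (n, absz u).
    by rewrite /ingap /=; have -> : - (absz u)%:Z = u by clear -a2; lia.
  by rewrite lerDl sumr_ge0.
rewrite ExD ExD !ExZ; apply: lerD => //.
have -> : e = C * (e / 2 / C) + C * (e / 2 / C) by field; rewrite gt_eqF.
by apply: lerD; rewrite ler_pM2l.
Qed.

End Transport.

Lemma emb_win (r n : nat) w : size w = n -> all (fun a => size a == r) w -> win r (emb 0 w) 0 n = w.
Proof.
move=> hs ha; rewrite (@win_emb r r 0 n)// drop0 take_oversize ?hs// -[RHS]map_id.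
by apply/eq_in_map => a; move/allP: ha => /[apply] /eqP <-; rewrite take_size.
Qed.

(** * The law of the marks *)

Section MarkLaw.
Context {R : realType} (P : seq bool -> R) (r0 K : nat) (mk : seq (seq bool) -> bool).
Notation mkx := (mark r0 K mk).
Notation mkw := (mkat r0 K mk).
Notation elx := (el r0 K mk).
Notation pi_ := (pik P r0 K mk).
Notation un := (unm P r0 K mk).
Hypothesis HP : source P.
Hypothesis K0 : (0 < K)%N.
Hypothesis novl : forall x i d, (0 < d < K)%N -> mkx x i -> mkx x (i + d%:Z) -> False.

Lemma unm_small n : (n < K)%N -> un n = 1.
Proof.
move=> h; rewrite /unm -[RHS](ew_cst HP r0 n); apply: eq_ew => w _.
by rewrite /nomk (_ : (n.+1 - K)%N = 0%N)//; lia.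
Qed.

Lemma lwords_emb n w : w \in lwords P r0 n -> win r0 (emb 0 w) 0 n = w.
Proof.
by rewrite mem_lwords => /andP[/eqP hs /allP ha]; apply: emb_win => //; apply/allP => a /ha /andP[].
Qed.

(** Split according to a marker in the last [K] letters. If there is one, non-overlap reduces the
    absence of earlier markers to the first [n] letters, which are independent of it. *)
Lemma unm_rec n : un (n + K) = un (n + K).-1 - un n * pi_.
Proof.
apply/eqP; rewrite eq_sym subr_eq; apply/eqP.
rewrite -[un (n + K).-1](ew_take HP r0 _ 1) -ew_prod.
have -> : ((n + K).-1 + 1)%N = (n + K)%N by lia.
rewrite -ewD; apply: eq_ew => w hw.
set x := emb 0 w.
have e : w = win r0 x 0 (n + K) by rewrite lwords_emb.
have hk k : (k <= n)%N -> mkw w k = mkx x k%:Z by move=> hk; rewrite e mkat_win ?leq_add2r// add0r.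
have h1 : nomk r0 K mk (n + K) w = [forall k : 'I_n.+1, ~~ mkx x k%:Z].
  rewrite /nomk (_ : ((n + K).+1 - K)%N = n.+1); last by lia.
  apply/allP/forallP => [h k|h k].
    have kn : (k <= n)%N by rewrite -ltnS ltn_ord.
    by rewrite -(hk k kn); apply: h; rewrite mem_iota add0n ltn_ord.
  rewrite mem_iota => hk'; rewrite hk; last by lia.
  by have := h (Ordinal (_ : (k < n.+1)%N)); apply; lia.
have h2 : nomk r0 K mk (n + K).-1 (take (n + K).-1 w) = [forall k : 'I_n, ~~ mkx x k%:Z].
  rewrite /nomk (_ : ((n + K).-1.+1 - K)%N = n); last by lia.
  have ek k : (k < n)%N -> mkw (take (n + K).-1 w) k = mkx x k%:Z.
    move=> hk'; rewrite -hk; last by lia.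
    by rewrite /mkat take_drop take_takel -?take_drop//; lia.
  apply/allP/forallP => [h k|h k].
    by rewrite -ek//; apply: h; rewrite mem_iota ltn_ord.
  rewrite mem_iota => hk'; rewrite ek; last by lia.
  by have := h (Ordinal (_ : (k < n)%N)); apply; lia.
have h3 : mkw (drop n w) 0 = mkx x n%:Z by rewrite -hk// /mkat drop0.
have h4 : mkx x n%:Z -> nomk r0 K mk n (take n w) = [forall k : 'I_n, ~~ mkx x k%:Z].
  move=> hn; have -> : take n w = win r0 x 0 n by rewrite e -[win _ _ _ (n + K)]drop0 win_sub ?addr0// add0n leq_addr.
  rewrite -(@nomk_win r0 K mk K0 novl r0) ?add0r//; apply/nomarkP/forallP => [h k|h i hi].
    by apply: h; have := ltn_ord k; lia.
  have ei : i = (absz i)%:Z by clear -hi; lia.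
  by rewrite ei; have := h (Ordinal (_ : (absz i < n)%N)); apply; clear -hi; lia.
rewrite h1 h2 h3; case: (boolP (mkx x n%:Z)) => hn; last first.
  rewrite mulr0 addr0; congr (_%:R); congr (nat_of_bool _).
  apply/forallP/forallP => h k; last by have := h (widen_ord (leqnSn n) k).
  have [hkn|hkn] := ltnP k n; first exact: (h (Ordinal hkn)).
  by have -> : k = n :> nat by have := ltn_ord k; lia.
rewrite h4// mulr1; have -> : [forall k : 'I_n.+1, ~~ mkx x k%:Z] = false.
  by apply/negP => /forallP /(_ ord_max); rewrite hn.
by rewrite add0r.
Qed.

Lemma vel_unm n : vel P r0 K mk r0 n = if (K <= n)%N then pi_ * un (n - K) else 0.
Proof.
rewrite /vel big_mkcond /=; case: (leqP K n) => hK; last first.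
  by rewrite big1// => e _; rewrite /el leqNgt hK.
have -> : n = (K + (n - K))%N by lia.
rewrite [X in un X](_ : _ = (n - K)%N); last by lia.
rewrite -ew_prod /ew big_seq [RHS]big_seq; apply: eq_bigr => w hw.
set k0 := (n - K)%N in hw *; set x := emb 0 w.
have e : w = win r0 x 0 (K + k0) by rewrite lwords_emb.
have hk k : (k <= k0)%N -> mkw w k = mkx x k%:Z.
  by move=> hk; rewrite e mkat_win ?add0r// addnC leq_add2l.
have m0 : mkw (take K w) 0 = mkx x 0 by rewrite -(hk 0%N)// /mkat !drop0 take_takel.
rewrite m0 -natrM mulnb.
rewrite (_ : elx (K + k0) w = mkx x 0 && nomk r0 K mk k0 (drop K w)).
  by case: ifP; rewrite ?mulr1 ?mulr0.
rewrite /el leq_addr (hk 0%N)//=; case: (boolP (mkx x 0)) => //= hx0.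
rewrite /nomk (_ : (K + k0 - K)%N = k0); last by lia.
apply/allP/allP => h k; rewrite mem_iota => hk'.
  rewrite /mkat drop_drop -/(mkw w (k + K)); apply: h; rewrite mem_iota; lia.
have [hkK|hkK] := leqP K k.
  have := h (k - K)%N; rewrite mem_iota /mkat drop_drop subnK//; apply; lia.
rewrite hk; last by lia.
by apply/negP => hm; apply: (novl (d := k) _ hx0); rewrite ?add0r//; lia.
Qed.

End MarkLaw.

(** * Comparison of the rates of two sides with equal marker probability *)

Section SameMarks.
Context {R : realType} (P : bool -> seq bool -> R) (r0 : bool -> nat) (K : nat).
Variables (mk : bool -> seq (seq bool) -> bool).
Notation mkb b := (mark (r0 b) K (mk b)).
Hypothesis HP : forall b, source (P b).
Hypothesis K0 : (0 < K)%N.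
Hypothesis novl : forall b x i d, (0 < d < K)%N -> mkb b x i -> mkb b x (i + d%:Z) -> False.
Notation pi_ b := (pik (P b) (r0 b) K (mk b)).
Hypothesis hpi : forall b b', pi_ b = pi_ b'.

(** The recursion [unm_rec] and its initial values involve only [K] and the marker probability. *)
Lemma same_unm b b' n : unm (P b) (r0 b) K (mk b) n = unm (P b') (r0 b') K (mk b') n.
Proof.
have [m] := ubnP n; elim: m n => // m IH n hm.
have [h|h] := ltnP n K; first by rewrite !unm_small.
have -> : n = (n - K + K)%N by lia.
rewrite !(unm_rec (HP _) K0 (@novl _)) (hpi b b') (IH (n - K)%N); last by lia.
by rewrite (IH (n - K + K).-1)//; lia.
Qed.

Lemma same_vel b b' n : vel (P b) (r0 b) K (mk b) (r0 b) n = vel (P b') (r0 b') K (mk b') (r0 b') n.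
Proof.
by rewrite (vel_unm (P b) K0 (@novl b)) (vel_unm (P b') K0 (@novl b')) (hpi b b') (same_unm b b').
Qed.

Variable v : nat -> R.
Hypothesis vP : forall b n, v n = vel (P b) (r0 b) K (mk b) (r0 b) n.
Hypothesis pi0 : forall b, 0 < pi_ b.
Hypothesis un0 : forall b n, 0 < unm (P b) (r0 b) K (mk b) n.
Notation rateb b := (rate (P b) (r0 b) K (mk b) v).
Notation hnb b := (hn (P b) (r0 b) K (mk b) v).
Notation Hb b := (Hlev (P b)).

Lemma rate_mono b r r' : (r0 b <= r)%N -> (r <= r')%N -> rateb b r <= rateb b r'.
Proof.
move=> hr hrr; have hr' := leq_trans hr hrr.
rewrite !(rateE (HP b) K0 (@novl b) (vP b))//.
rewrite -(subnKC hrr) iotaD big_cat /= -[X in X <= _]addr0; apply: lerD.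
  rewrite subnKC//; apply: ler_sum => n _; rewrite ler_pM2l//.
  by apply: hn_mono => //; exact: vP.
rewrite subnKC//; apply: sumr_ge0 => n _; apply: mulr_ge0; first exact: ltW.
by apply: hn_ge0 => //; exact: vP.
Qed.

Hypothesis HE : forall b b' r e, 0 < e -> exists r', Hb b r - e <= Hb b' r'.
Hypothesis HS : forall b m, exists n r, [/\ (m < n)%N, (r0 b <= r)%N & 0 < hnb b r n].

Lemma Hlev_mono b r r' : (r <= r')%N -> Hb b r <= Hb b r'.
Proof.
move=> hrr; rewrite /Hlev -(ew_push (HP b) 1 _ hrr); apply: ew_le => // e he.
have he' := lwords_take (HP b) hrr he.
by rewrite lerN2 ler_ln ?posrE ?(lwt_gt0 he) ?(lwt_gt0 he')//; apply: lwt_take he.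
Qed.

(** Up to a contribution of the marks common to both sides, sums of [hn] approximate letter
    entropies, which can be matched by [HE]. Strictness comes from a gap length [n > rho]: its
    information [eta] is positive and absent from [rateb b rho], while the approximations lose only
    [eta / 2] and [eta / 4]. *)
Lemma rate_interleave b b' rho : (r0 b <= rho)%N ->
  exists rho', (r0 b' <= rho')%N /\ rateb b rho < rateb b' rho'.
Proof.
move=> hr; have [n [r1 [hn1 hr1 h0]]] := HS b rho.
set eta := pi_ b * hnb b r1 n.
have eta0 : 0 < eta by rewrite mulr_gt0.
pose r2 := maxn (maxn rho r1) n.
have r2r : (rho <= r2)%N by rewrite /r2 !leq_max leqnn.
have r21 : (r1 <= r2)%N by rewrite /r2 !leq_max leqnn orbT.
have r2n : (n <= r2)%N by rewrite /r2 !leq_max leqnn orbT.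
have r20 : (r0 b <= r2)%N := leq_trans hr r2r.
(* The contribution of the marks, which cancels between the sides. *)
pose V m := \sum_(k <- iota 1 m) pi_ b * (v k * ln (v k)).
have decomp c r m : (r0 c <= r)%N -> \sum_(k <- iota 1 m) pi_ c * hnb c r k =
    \sum_(k <- iota 1 m) pi_ c * an (P c) (r0 c) K (mk c) r k + V m.
  move=> hc; rewrite /V -big_split /=; apply: eq_bigr => k _.
  by rewrite (hn_an (HP c) (vP c) _ hc) mulrDr (hpi b c).
have low m : (r2 <= m)%N -> rateb b rho + eta <= \sum_(k <- iota 1 m) pi_ b * hnb b r2 k.
  move=> hm; rewrite (rateE (HP b) K0 (@novl b) (vP b))//.
  have hm' : (rho <= m)%N := leq_trans r2r hm.
  rewrite -(subnKC hm') iotaD big_cat /=; apply: lerD.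
    apply: ler_sum => k _; rewrite ler_pM2l//; apply: hn_mono => //; exact: vP.
  rewrite (big_rem n) /=; last by rewrite mem_iota; lia.
  rewrite -[X in X <= _]addr0; apply: lerD.
    by rewrite /eta ler_pM2l//; apply: hn_mono => //; exact: vP.
  apply: sumr_ge0 => k _; apply: mulr_ge0; first exact: ltW.
  by apply: hn_ge0 => //; exact: vP.
have [r3 hr3] := HE b b' r2 (divr_gt0 eta0 (ltr0n R 2)).
pose r4 := maxn r3 (r0 b').
have r40 : (r0 b' <= r4)%N by rewrite leq_maxr.
have hr4 : Hb b r2 - eta / 2 <= Hb b' r4.
  by apply: le_trans hr3 (Hlev_mono _ _); rewrite leq_maxl.
have eta4 : 0 < eta / 4 by rewrite divr_gt0.
have [m0 hm0] := an_ge (HP b') K0 (@novl b') (pi0 b') r40 eta4.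
pose m := maxn (maxn m0 r2) r4.
have mm0 : (m0 <= m)%N by rewrite /m; clearbody r2 r4; clear; lia.
have mr2 : (r2 <= m)%N by rewrite /m; clearbody r2 r4; clear; lia.
have mr4 : (r4 <= m)%N by rewrite /m; clearbody r2 r4; clear; lia.
exists m; split; first exact: leq_trans r40 mr4.
have h1 := low m mr2; rewrite decomp// in h1.
have h2 := an_le (HP b) K0 (@novl b) (pi0 b) m r20.
have h3 := hm0 m mm0.
have h4 : \sum_(k <- iota 1 m) pi_ b' * hnb b' r4 k <= rateb b' m.
  rewrite (rateE (HP b') K0 (@novl b') (vP b')) ?(leq_trans r40 mr4)//.
  by apply: ler_sum => k _; rewrite ler_pM2l//; apply: hn_mono => //; exact: vP.
rewrite decomp// in h4.
by clear -h1 h2 h3 h4 hr4 eta0; lra.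
Qed.

End SameMarks.

(** * Choice of the parameters of all stages *)

Record stg (R : realType) := Stg
  { lvS : bool -> nat; NS : nat; kapS : R; theS : R; betS : R; B0S : nat }.

Section Schedule.
Context {R : realType} (P : bool -> seq bool -> R) (r0 : bool -> nat) (K : nat).
Variables (mk : bool -> seq (seq bool) -> bool) (v : nat -> R).
Notation mkb b := (mark (r0 b) K (mk b)).
Notation pi_ b := (pik (P b) (r0 b) K (mk b)).
Notation rateb b := (rate (P b) (r0 b) K (mk b) v).
Notation fentb b := (fent (P b) (r0 b) K (mk b) v).
Hypothesis HP : forall b, source (P b).
Hypothesis K0 : (0 < K)%N.
Hypothesis novl : forall b x i d, (0 < d < K)%N -> mkb b x i -> mkb b x (i + d%:Z) -> False.
Hypothesis vP : forall b n, v n = vel (P b) (r0 b) K (mk b) (r0 b) n.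
Hypothesis pi0 : forall b, 0 < pi_ b.
Hypothesis un0 : forall b n, 0 < unm (P b) (r0 b) K (mk b) n.
Hypothesis HI : forall b b' rho, (r0 b <= rho)%N ->
  exists rho', (r0 b' <= rho')%N /\ rateb b rho < rateb b' rho'.

Definition exev b n B0 j (x : Om) := exists u s, [/\ blk (mkb b x) n u s,
  - B0%:Z <= u - n%:Z /\ u + (sumn s)%:Z + K%:Z <= B0%:Z & u <= - j%:Z /\ j%:Z < u + (sumn s)%:Z].

(** The marks [v1] and [v2] keep the letters near the origin in gaps of length at most [rho]; such
    gaps are not blank, so these letters are shown with all bits of the level. *)
Definition okev b rho n B0 (de : R) j (x : Om) := exists u s v1 v2, [/\ blk (mkb b x) n u s,
  - B0%:Z <= u - n%:Z /\ u + (sumn s)%:Z + K%:Z <= B0%:Z,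
  u <= - j%:Z /\ j%:Z < u + (sumn s)%:Z,
  `|\sum_(k < sumn s) fentb b rho (win rho x (u + k%:Z) (rho + K)) - rateb b rho * (sumn s)%:R|
     <= de * (sumn s)%:R &
  [/\ mkb b x v1, mkb b x v2, v1 <= - j%:Z, j%:Z < v2 & v2 - v1 <= rho%:Z]].

(** Room for the next stage: on either side some rate still exceeds the label bound. *)
Definition inv (s : stg R) := (forall c, (r0 c <= lvS s c)%N) /\
  forall c, exists rho, (r0 c <= rho)%N /\ betS s < rateb c rho.

Definition eps j : R := j.+1%:R^-1.

Definition stepS j (s s' : stg R) := let b := odd j.+1 in
  [/\ [/\ lvS s' (~~ b) = lvS s (~~ b), (lvS s b <= lvS s' b)%N, (j.+1 <= lvS s' b)%N &
         (NS s <= NS s')%N],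
      [/\ betS s <= theS s', betS s <= betS s',
         forall n, (NS s' <= n)%N -> expR (kapS s' * n%:R) + expR (betS s * n%:R) <= expR (betS s' * n%:R) &
         expR (- ((theS s' - betS s) * (NS s')%:R)) <= eps j.+1],
      exists de, [/\ theS s' + de <= rateb b (lvS s' b), rateb b (lvS s' b) + de <= kapS s' &
        forall B, (B0S s' <= B)%N ->
          Pr (P b) B (fun x => ~ okev b (lvS s' b) (NS s') (B0S s') de j.+1 x) <= eps j.+1] &
      forall B, (B0S s' <= B)%N ->
        Pr (P (~~ b)) B (fun x => ~ exev (~~ b) (NS s') (B0S s') j.+1 x) <= eps j.+1].

Lemma eps_gt0 j : 0 < eps j. Proof. by rewrite invr_gt0. Qed.

(** With [a] the new rate of the active side and [M] attained or exceeded by later rates on both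
    sides, the constants satisfy [betS s < th < a < kp < bt < M]. Typical names are framed by [th]
    and [kp] with margin [de], [bt] accommodates the old labels and the new ones, and [bt < M]
    restores the invariant. *)
Lemma step_exists j s : inv s -> exists s', inv s' /\ stepS j s s'.
Proof.
move=> [hl hb0]; pose b := odd j.+1; pose e := eps j.+1.
have e0 : 0 < e := eps_gt0 _; have e4 : 0 < e / 4 by rewrite divr_gt0.
have [rho1 [hr1 hrate1]] := hb0 b.
have [h hh] := no_mark (HP b) K0 (pi0 b) e4.
(* The last summand bounds the distance of two marks found on either side of [[-j.+1, j.+1]], each
   within a stretch of length [h]. *)
pose rho := (rho1 + lvS s b + (j.+1 + j.+1 + h + h + 2))%N.
have hrho : (r0 b <= rho)%N by rewrite /rho; clear -hr1; lia.
have rho1r : (rho1 <= rho)%N by rewrite /rho; clear; lia.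
have rholv : (lvS s b <= rho)%N by rewrite /rho; clear; lia.
have rhoj : (j.+1 + j.+1 + h + h + 2 <= rho)%N by rewrite /rho; clear; lia.
clearbody rho.
set a := rateb b rho.
have ab : betS s < a by apply: lt_le_trans hrate1 (rate_mono HP K0 novl vP pi0 hr1 rho1r).
have [rt [hrt art]] := HI true hrho; have [rf [hrf arf]] := HI false hrho.
pose M := Num.min (rateb true rt) (rateb false rf).
have aM : a < M by rewrite lt_min art arf.
pose kp := a + (M - a) / 3; pose bt := a + (M - a) * 2 / 3; pose th := (betS s + a) / 2.
pose de := Num.min ((a - betS s) / 2) ((M - a) / 3).
have de0 : 0 < de by rewrite lt_min; apply/andP; split; clear -ab aM; lra.
have de1 : de <= (a - betS s) / 2 by rewrite ge_min lexx.
have de2 : de <= (M - a) / 3 by rewrite ge_min lexx orbT.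
have [C0 hC0] := fent_bounded (P b) (r0 b) K (mk b) v rho.
have mw0 : (0 < rho + K)%N by clear -K0; lia.
have [N1 hN1] := typ_block (HP b) K0 (@novl b) (pi0 b) (un0 b) j.+1 mw0 de0 e4 hC0.
have z0 : forall w, w \in lwords (P (~~ b)) 0 1 -> `|(fun=> 0 : R) w| <= 0 by move=> w _; rewrite normr0.
(* On the inactive side only a large block is wanted, so the averaged function is 0. *)
have [N2 hN2] := typ_block (HP (~~ b)) K0 (@novl (~~ b)) (pi0 (~~ b)) (un0 (~~ b)) j.+1 (ltn0Sn 0) de0 e0 z0.
have c1 : 0 < bt - kp by rewrite /bt /kp; clear -aM; lra.
have [N3 hN3] := expR_small c1 (ler0n R 2) (ltr01 : 0 < 1 :> R).
have c2 : 0 < th - betS s by rewrite /th; clear -ab; lra.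
have [N4 hN4] := expR_small c2 (ler01 : 0 <= 1 :> R) e0.
pose N := (N1 + N2 + N3 + N4 + NS s)%N.
have [B1 hB1] := hN1 N ltac:(rewrite /N; clear; lia).
have [B2 hB2] := hN2 N ltac:(rewrite /N; clear; lia).
have N3N : (N3 <= N)%N by rewrite /N; clear; lia.
have N4N : (N4 <= N)%N by rewrite /N; clear; lia.
have NSN : (NS s <= N)%N by rewrite /N; clear; lia.
clearbody N; clear hN1 hN2.
pose B0 := (B1 + B2 + (j.+1 + h + 1) + r0 b)%N.
exists (Stg (fun c => if c == b then rho else lvS s c) N kp th bt B0); split.
  split=> [c|c] /=; first by case: eqP => [->|_].
  have btM : bt < M by rewrite /bt; clear -aM; lra.
  by case: c; [exists rt|exists rf]; split=> //; apply: lt_le_trans btM _; rewrite ge_min lexx ?orbT.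
rewrite /stepS /= -/b eqxx; have -> : (~~ b == b) = false by case: (b).
split.
- by split=> //; clear -rhoj; lia.
- split.
  + by rewrite /th; clear -ab; lra.
  + by rewrite /bt; clear -ab aM; lra.
  + move=> n hn; have h3 := hN3 n (leq_trans N3N hn).
    have k1 : expR (betS s * n%:R) <= expR (kp * n%:R).
      by rewrite ler_expR; apply: ler_wpM2r => //; rewrite /kp; clear -ab aM; lra.
    have -> : expR (bt * n%:R) = expR (kp * n%:R) * expR ((bt - kp) * n%:R).
      by rewrite -expRD -mulrDl addrC subrK.
    have h4 : 2 <= expR ((bt - kp) * n%:R).
      by move: h3; rewrite expRN ler_pdivrMr ?expR_gt0// mul1r.
    have h5 : expR (kp * n%:R) * 2 <= expR (kp * n%:R) * expR ((bt - kp) * n%:R) by rewrite ler_pM2l ?expR_gt0.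
    by apply: le_trans h5; rewrite mulr2n mulrDr !mulr1 lerD.
  + by have := hN4 N N4N; rewrite mul1r.
- exists de; split.
  + by rewrite -/a /th; clear -de1; lra.
  + by rewrite -/a /kp; clear -de2; lra.
  move=> B hB.
  have l1 := hB1 B ltac:(rewrite /B0 in hB; clear -hB; lia).
  have r0B : (r0 b <= B)%N by rewrite /B0 in hB; clear -hB; lia.
  have l2 := hh B (- j.+1%:Z - h%:Z) r0B ltac:(rewrite /B0 in hB; clear -hB; lia) ltac:(rewrite /B0 in hB; clear -hB; lia).
  have l3 := hh B (j.+1%:Z + 1) r0B ltac:(rewrite /B0 in hB; clear -hB; lia) ltac:(rewrite /B0 in hB; clear -hB; lia).
  have -> : eps j.+1 = e / 4 + (e / 4 + (e / 4)) + e / 4 by rewrite -/e; field.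
  apply: (@le_trans _ _ (e / 4 + (e / 4 + e / 4))); last by rewrite lerDl ltW.
  apply: le_trans (lerD l1 (lerD l2 l3)).
  apply: le_trans (lerD (lexx _) (Pr_U (HP b) _ _ _)).
  apply: le_trans (Pr_U (HP b) _ _ _).
  apply: Pr_le => // x _ hno; apply: contrapT => hn.
  have [u [t [a1 [a2 a2'] a3 a4 a5]]] : exists u s0, [/\ blk (mkb b x) N u s0,
     - B1%:Z <= u - N%:Z /\ u + (sumn s0)%:Z + K%:Z <= B1%:Z,
     u <= - j.+1%:Z, j.+1%:Z < u + (sumn s0)%:Z &
     `|\sum_(k < sumn s0) fentb b rho (win rho x (u + k%:Z) (rho + K)) -
        ew (P b) rho (rho + K) (fentb b rho) * (sumn s0)%:R|
        <= de * (sumn s0)%:R] by apply: contrapT => hc; apply: hn; left.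
  have [v1 hv1 m1] : exists2 i, - j.+1%:Z - h%:Z <= i <= - j.+1%:Z - h%:Z + h%:Z & mkb b x i.
    by apply: contrapT => hc; apply: hn; right; left => i hi hm; apply: hc; exists i.
  have [v2 hv2 m2] : exists2 i, j.+1%:Z + 1 <= i <= j.+1%:Z + 1 + h%:Z & mkb b x i.
    by apply: contrapT => hc; apply: hn; right; right => i hi hm; apply: hc; exists i.
  apply: hno; exists u, t, v1, v2; split=> //.
    by rewrite /B0; clear -a2 a2'; split; lia.
  by split=> //; [clear -hv1; lia|clear -hv2; lia|clear -hv1 hv2 rhoj; lia].
- move=> B hB; apply: le_trans (hB2 B _); last by rewrite /B0 in hB; clear -hB; lia.
  apply: Pr_le => // x _ hno [u [t [a1 [a2 a2'] a3 a4 _]]]; apply: hno; exists u, t; split=> //.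
  by rewrite /B0; clear -a2 a2'; split; lia.
Qed.

Lemma schedule : exists st : nat -> stg R, [/\ betS (st 0) = 0, forall j, inv (st j) & forall j, stepS j (st j) (st j.+1)].
Proof.
have step j (s : {s | inv s}) : {s' : {s' | inv s'} | stepS j (sval s) (sval s')}.
  by case: s => s hs /=; apply: cid; have [s' [h1 h2]] := step_exists j hs; exists (exist _ s' h1).
have hs0 : inv (Stg r0 0 0 0 0 0).
  split=> //= c.
  have [rho [hr h]] := HI c (leqnn (r0 c)); exists rho; split=> //.
  apply: le_lt_trans h; rewrite (rateE (HP c) K0 (@novl c) (vP c))//; apply: sumr_ge0 => n _.
  by apply: mulr_ge0; [exact: ltW|apply: hn_ge0 => //; exact: vP].
pose fix f j : {s | inv s} :=
  if j is j'.+1 then sval (step j' (f j')) else exist _ _ hs0.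
exists (fun j => sval (f j)); split=> // j; first exact: (svalP (f j)).
exact: (svalP (step j (f j))).
Qed.

End Schedule.

(** * Random bit arrays *)

Local Open Scope classical_set_scope.
Local Open Scope ring_scope.

Section Meas.
Context {d : measure_display} {T : measurableType d}.

Lemma meas_ex (I : countType) (A : I -> T -> Prop) :
  (forall i, measurable [set t | A i t]) -> measurable [set t | exists i, A i t].
Proof.
move=> h; rewrite (_ : [set t | _] = \bigcup_i [set t | A i t]).
  by apply: countable_bigcupT_measurable => //; exact: countableP.
by apply/seteqP; split=> [t [i hi]|t [i _ hi]]; exists i.
Qed.

Lemma meas_not (A : T -> Prop) : measurable [set t | A t] -> measurable [set t | ~ A t].
Proof. by move=> h; exact: measurableC h. Qed.

Lemma meas_all (I : countType) (A : I -> T -> Prop) :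
  (forall i, measurable [set t | A i t]) -> measurable [set t | forall i, A i t].
Proof.
move=> h; rewrite (_ : [set t | _] = [set t | ~ exists i, ~ A i t]).
  by apply: meas_not; apply: meas_ex => i; exact: meas_not.
by apply/seteqP; split=> [t hi [i]|t /= hn i]; [exact|apply: contrapT => hi; apply: hn; exists i].
Qed.

Lemma meas_and (A B : T -> Prop) : measurable [set t | A t] -> measurable [set t | B t] ->
  measurable [set t | A t /\ B t].
Proof. by move=> hA hB; exact: measurableI hA hB. Qed.

Lemma meas_cst (A : Prop) : measurable [set t : T | A].
Proof.
case: (pselect A) => h.
  by rewrite (_ : [set _ | _] = setT)//; apply/seteqP; split.
by rewrite (_ : [set _ | _] = set0)//; apply/seteqP; split=> t //=.
Qed.

Lemma meas_imp (A : Prop) (B : T -> Prop) : measurable [set t | B t] -> measurable [set t | A -> B t].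
Proof.
move=> hB; case: (pselect A) => h.
  by rewrite (_ : [set _ | _] = [set t | B t])//; apply/seteqP; split=> t /=; [apply|].
by rewrite (_ : [set _ | _] = setT)//; apply/seteqP; split=> t //= _ /h.
Qed.

Definition mX (X : T -> Om) := forall i r, measurable [set t | X t i r].

End Meas.

(** Borel sets are tested on all measurable random arrays, so no sigma-algebra on [Om] needs to be
    fixed. *)
Definition bor (S : Om -> Prop) := forall (d : measure_display) (T : measurableType d) (X : T -> Om),
  mX X -> measurable [set t | S (X t)].

Lemma bor_bit i r (be : bool) : bor (fun x => x i r = be).
Proof.
move=> d T X hX; case: be; first exact: hX.
rewrite (_ : [set _ | _] = [set t | ~ X t i r]); first exact: meas_not (hX i r).
by apply/seteqP; split=> t /=; case: (X t i r).
Qed.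

Lemma bor_win r u n c : bor (fun x => win r x u n = c).
Proof.
move=> d T X hX.
rewrite (_ : [set _ | _] = [set t | size c = n /\ forall k, (k < n)%N -> size (nth [::] c k) = r /\
   forall l, (l < r)%N -> X t (u + k%:Z) l = nth false (nth [::] c k) l]).
  apply: meas_and; first exact: meas_cst.
  apply: meas_all => k; apply: meas_imp; apply: meas_and; first exact: meas_cst.
  apply: meas_all => l; apply: meas_imp; exact: bor_bit.
apply/seteqP; split=> t /=.
  move=> <-; rewrite size_win; split=> // k hk; rewrite nth_win// size_mkseq; split=> // l hl.
  by rewrite nth_mkseq.
move=> [hs h]; apply: (@eq_from_nth _ [::]); rewrite size_win// => k hk.
have [h1 h2] := h k hk; rewrite nth_win//.
apply: (@eq_from_nth _ false); rewrite size_mkseq ?h1// => l hl; rewrite nth_mkseq//.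
exact: h2.
Qed.

Lemma bor_det r u n (S : Om -> Prop) :
  (forall x x', win r x u n = win r x' u n -> S x -> S x') -> bor S.
Proof.
move=> h d T X hX.
rewrite (_ : [set _ | _] = [set t | exists w : seq (seq bool), (exists x0, win r x0 u n = w /\ S x0) /\ win r (X t) u n = w]).
  by apply: meas_ex => w; apply: meas_and; [exact: meas_cst|exact: bor_win].
apply/seteqP; split=> t /=; first by move=> hS; exists (win r (X t) u n); split=> //; exists (X t).
by move=> [w [[x0 [<- hS]] e]]; apply: h hS.
Qed.

Section Law.
Context {R : realType} (P : seq bool -> R).
Hypothesis HP : source P.

(** Unlike [lwords] this includes the words of weight 0, so every window of every array occurs. *)
Definition aw r n := words (fun _ : nat => bits r) (nseq n 0%N).

Lemma mem_aw r n w : (w \in aw r n) = (size w == n) && all (fun a => size a == r) w.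
Proof.
elim: n w => [|n IH] [|a w] //=; first by apply/negP => /size_words.
by rewrite /aw -/(nseq n.+1 0%N) words_consE mem_bits -/(aw r n) IH eqSS andbCA.
Qed.

Lemma aw_uniq r n : uniq (aw r n).
Proof. by apply: words_uniq => _; exact: bits_uniq. Qed.

Lemma win_aw r x u n : win r x u n \in aw r n.
Proof. by rewrite mem_aw size_win eqxx /=; apply/allP => a /mapP[k _ ->]; rewrite size_mkseq. Qed.

Lemma sum_aw r n (F : seq (seq bool) -> R) :
  \sum_(w <- aw r n) lwt P n w * F w = \sum_(w <- lwords P r n) lwt P n w * F w.
Proof.
rewrite /aw /lwords; elim: n F => [|n IH] F; first by rewrite /= !big_seq1.
rewrite !big_words_cons.
transitivity (\sum_(a <- bits r) P a * \sum_(w <- words (fun=> lets P r) (nseq n 0%N)) lwt P n w * F (a :: w)).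
  by apply: eq_bigr => a _; rewrite -IH mulr_sumr; apply: eq_bigr => w _; rewrite /lwt /= mulrA.
rewrite -(big_lets HP); apply: eq_bigr => a _; rewrite mulr_sumr; apply: eq_bigr => w _.
by rewrite /lwt /= mulrA.
Qed.

Lemma Pr_win_lwt r B w : (r <= B)%N -> w \in aw r (r + r) ->
  Pr P B (fun x => win r x (- r%:Z) (r + r) = w) = lwt P (r + r) w.
Proof.
move=> hr hw; have u1 : - r%:Z + (r + r)%N%:Z <= B%:Z by lia.
have u2 : - B%:Z <= - r%:Z by lia.
have -> : Pr P B (fun x => win r x (- r%:Z) (r + r) = w) = Pr P B (fun x => (pred1 w) (win r x (- r%:Z) (r + r))).
  by apply: eq_Pr => // x _; split=> /= /eqP.
rewrite (Pr_win HP _ hr u2 u1) /ew -sum_aw (big_rem w)//= eqxx mulr1 big_seq big1 ?addr0// => w'.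
by rewrite mem_rem_uniq ?aw_uniq// inE => /andP[/negbTE /= -> _]; rewrite mulr0.
Qed.

Lemma aw_sum r n : \sum_(w <- aw r n) lwt P n w = 1.
Proof.
by under eq_bigr do rewrite -[lwt _ _ _]mulr1; rewrite sum_aw; under eq_bigr do rewrite mulr1; exact: lwords_sum.
Qed.

Lemma win_emb_aw B w : w \in aw B (B + B) -> win B (emb (- B%:Z) w) (- B%:Z) (B + B) = w.
Proof.
rewrite mem_aw => /andP[/eqP hs /allP ha].
rewrite (@win_emb B B _ (B + B)%N)//; last by apply/allP.
have -> : absz (- B%:Z - - B%:Z)%R = 0%N by lia.
rewrite drop0 take_oversize ?hs// -[RHS]map_id; apply/eq_in_map => a /ha /eqP <-.
by rewrite take_size.
Qed.

Context {d : measure_display} {T : measurableType d} (mu : probability T R) (X : T -> Om).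
Hypothesis hX : mX X.

Definition lawX := forall B c, c \in aw B (B + B) ->
  mu [set t | win B (X t) (- B%:Z) (B + B) = c] = (lwt P (B + B) c)%:E.

Lemma mu_list (I : eqType) (f : T -> I) (ws : seq I) : uniq ws ->
  (forall w, measurable [set t | f t = w]) ->
  measurable [set t | f t \in ws] /\
  mu [set t | f t \in ws] = (\sum_(w <- ws) mu [set t | f t = w])%E.
Proof.
move=> hu hm; elim: ws hu => [_|w ws IH /= /andP[hw /IH [m1 e1]]].
  rewrite (_ : [set t | _] = set0) ?measure0 ?big_nil; last by apply/seteqP; split.
  by split.
have -> : [set t | f t \in w :: ws] = [set t | f t = w] `|` [set t | f t \in ws].
  apply/seteqP; split=> t /=; rewrite inE; first by case/orP => [/eqP|]; [left|right].
  by move=> [->|->]; rewrite ?eqxx ?orbT.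
split; first exact: measurableU.
rewrite measureU//; last by apply/seteqP; split=> t //= [-> h]; rewrite h in hw.
by rewrite [RHS]big_cons; congr (_ + _)%E; exact: e1.
Qed.

Lemma mu_det B (S : Om -> Prop) : lawX ->
  (forall x x', win B x (- B%:Z) (B + B) = win B x' (- B%:Z) (B + B) -> S x -> S x') ->
  mu [set t | S (X t)] = (Pr P B S)%:E.
Proof.
move=> hl hd; pose f t := win B (X t) (- B%:Z) (B + B).
pose ws := [seq w <- aw B (B + B) | `[< S (emb (- B%:Z) w) >]].
have we := @win_emb_aw B.
have -> : [set t | S (X t)] = [set t | f t \in ws].
  apply/seteqP; split=> t /=; rewrite mem_filter win_aw andbT; last first.
    by move=> /asboolP; apply: hd; rewrite we ?win_aw.
  by move=> hS; apply/asboolP; apply: hd hS; rewrite we ?win_aw.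
have hu : uniq ws by rewrite filter_uniq ?aw_uniq.
have hm w : measurable [set t | f t = w] by exact: bor_win.
have [_ e] := mu_list hu hm; rewrite e.
rewrite /Pr /Ex /ew -sum_aw /ws big_filter -sumEFin [RHS]big_seq big_mkcond big_seq.
apply: eq_bigr => w hw /=; case: ifP => h; last by rewrite mulr0.
by rewrite mulr1 hl.
Qed.

(** Both families of masses sum to 1 over the words of a window, so lower bounds for all of them are
    equalities. *)
Lemma lawX_mu : (forall B w, w \in aw B (B + B) ->
    (Pr P B (fun x => win B x (- B%:Z) (B + B) = w))%:E <= mu [set t | win B (X t) (- B%:Z) (B + B) = w])%E ->
  lawX.
Proof.
move=> h B; set f := fun t => win B (X t) (- B%:Z) (B + B).
have hm w : measurable [set t | f t = w] by exact: bor_win.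
have prE w := @Pr_win_lwt B B w (leqnn B).
have fin w : mu [set t | f t = w] \is a fin_num by rewrite fin_num_measure.
pose q w := fine (mu [set t | f t = w]).
have qE w : mu [set t | f t = w] = (q w)%:E by rewrite fineK.
have hle w : w \in aw B (B + B) -> lwt P (B + B) w <= q w.
  by move=> hw; have := h B w hw; rewrite prE// -/(f _) qE lee_fin.
have hsum : \sum_(w <- aw B (B + B)) q w = 1.
  have [_ e] := mu_list (aw_uniq B (B + B)) hm.
  have : mu [set t | f t \in aw B (B + B)] = 1%E.
    rewrite (_ : [set t | _] = setT) ?probability_setT//; apply/seteqP; split=> t //= _; exact: win_aw.
  by rewrite e; under eq_bigr do rewrite qE; rewrite sumEFin => -[].
have hsum' := aw_sum B (B + B).
move=> c hc; rewrite -/(f _) qE; congr (_%:E); apply/eqP; rewrite eq_le hle// andbT.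
have := hsum; rewrite -hsum' !(big_rem c hc) /= => e.
have : \sum_(w <- rem c (aw B (B + B))) lwt P (B + B) w <= \sum_(w <- rem c (aw B (B + B))) q w.
  by rewrite big_seq [X in _ <= X]big_seq; apply: ler_sum => w /mem_rem; exact: hle.
by clear -e; lra.
Qed.

End Law.

(** * Isomorphism of sources with a common marker structure *)

Definition cont_on (E : Om -> Prop) (F : Om -> Om) := forall x, E x -> forall i r,
  exists n, forall x', E x' -> agree n x x' -> F x' i r = F x i r.

(* A shift-equivariant homeomorphism between sets of full measure, carrying the
   law of an i.i.d. process with letter law P to that with letter law Q and back;
   laws are tested on arbitrary random elements, so no product measure is needed. *)
Definition Iso (R : realType) (P Q : seq bool -> R) : Prop :=
  exists (F G : Om -> Om) (D E : Om -> Prop),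
  [/\ (forall x, F (oshift x) = oshift (F x)) /\ (forall x, G (oshift x) = oshift (G x)),
      (forall i r, bor (fun x => F x i r)) /\ (forall i r, bor (fun x => G x i r)),
      [/\ bor D, bor E, forall x, D (oshift x) <-> D x & forall x, E (oshift x) <-> E x],
      [/\ forall x, D x -> E (F x) /\ G (F x) = x, forall x, E x -> D (G x) /\ F (G x) = x,
          cont_on D F & cont_on E G] &
      forall (d : measure_display) (T : measurableType d) (mu : probability T R) (X : T -> Om), mX X ->
       (lawX P mu X -> mu [set t | D (X t)] = 1%E /\ lawX Q mu (fun t => F (X t))) /\
       (lawX Q mu X -> mu [set t | E (X t)] = 1%E /\ lawX P mu (fun t => G (X t)))].

Lemma Iso_sym (R : realType) (P Q : seq bool -> R) : Iso P Q -> Iso Q P.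
Proof.
move=> [F [G [D [E [[h1 h2] [h3 h4] [h5 h6 h7 h8] [h9 h10 h11 h12] h13]]]]].
exists G, F, E, D; split=> // d T mu X hX; have [a b] := h13 d T mu X hX.
by split.
Qed.

Section MuDisj.
Context {R : realType} {d : measure_display} {T : measurableType d} (mu : probability T R).

Lemma mu_disj (I : eqType) (A : I -> T -> Prop) (ws : seq I) : uniq ws ->
  (forall w, measurable [set t | A w t]) ->
  (forall w w' t, A w t -> A w' t -> w = w') ->
  measurable [set t | exists2 w, w \in ws & A w t] /\
  mu [set t | exists2 w, w \in ws & A w t] = (\sum_(w <- ws) mu [set t | A w t])%E.
Proof.
move=> hu hm hd; elim: ws hu => [_|w ws IH /= /andP[hw /IH [m1 e1]]].
  rewrite (_ : [set t | _] = set0) ?measure0 ?big_nil; last by apply/seteqP; split=> t //= [].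
  by split.
have -> : [set t | exists2 w0, w0 \in w :: ws & A w0 t] = [set t | A w t] `|` [set t | exists2 w0, w0 \in ws & A w0 t].
  apply/seteqP; split=> t /=.
    by move=> [w0]; rewrite inE => /orP[/eqP -> h|h1 h2]; [left|right; exists w0].
  by move=> [h|[w0 h1 h2]]; [exists w|exists w0] => //; rewrite inE ?eqxx ?h1 ?orbT.
split; first exact: measurableU.
rewrite measureU//; last first.
  by apply/seteqP; split=> t //= [h [w0 h1 h2]]; rewrite (hd _ _ _ h h2) h1 in hw.
by rewrite [RHS]big_cons; congr (_ + _)%E; exact: e1.
Qed.

Lemma mu_not0 (C : T -> Prop) : measurable [set t | C t] -> mu [set t | C t] = 1%E ->
  mu [set t | ~ C t] = 0%E.
Proof. by move=> mC e; have := probability_setC mu mC; rewrite e subee. Qed.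

Lemma full_bigcap (A : nat -> T -> Prop) : (forall n, measurable [set t | A n t]) ->
  (forall n, mu [set t | ~ A n t] = 0%E) -> mu [set t | forall n, A n t] = 1%E.
Proof.
move=> hm h0; have hA : measurable [set t | forall n, A n t] by exact: meas_all.
have hneg : mu.-negligible (\bigcup_n [set t | ~ A n t]).
  by apply: negligible_bigcup => n; apply/negligibleP; [exact: meas_not|exact: h0].
have mC : measurable (~` [set t | forall n, A n t]) by exact: measurableC.
have e : mu (~` [set t | forall n, A n t]) = 0%E.
  apply/negligibleP => //; apply: negligibleS hneg => t /= hn.
  apply: contrapT => h; apply: hn => n; apply: contrapT => hn'; apply: h; exists n => //.
by have := probability_setC mu mC; rewrite setCK e sube0.
Qed.

End MuDisj.

Lemma lvat_gap (M : int -> bool) lv (u : int) s (i v1 v2 : int) : mpath M u s ->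
  u <= i < u + (sumn s)%:Z -> M v1 -> M v2 -> v1 <= i < v2 ->
  exists u' n, [/\ u <= u', u' + n%:Z <= u + (sumn s)%:Z, n%:Z <= v2 - v1, mpath M u' [:: n] &
    lvat lv s (absz (i - u)%R) = lv n].
Proof.
move=> hp hi m1 m2 hv; have [s1 [n [s2 [e hin hp']]]] := mpath_find hp hi.
have hp1 : mpath M (u + (sumn s1)%:Z) [:: n].
  by move: hp' => /= /and4P[-> -> -> /mpath_head ->].
exists (u + (sumn s1)%:Z), n; have /= /and4P[_ n0 hn _] := hp1; split=> //.
- by clear; lia.
- by rewrite e sumn_cat /=; clear; lia.
- have a1 : v1 <= u + (sumn s1)%:Z.
    by rewrite leNgt; apply/negP => h; apply: nomarkF hn m1 _; clear -h hin hv; lia.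
  have a2 : u + (sumn s1)%:Z + n%:Z <= v2.
    by rewrite leNgt; apply/negP => h; apply: nomarkF hn m2 _; clear -h hin hv; lia.
  by clear -a1 a2; lia.
have -> : absz (i - u)%R = (sumn s1 + absz (i - (u + (sumn s1)%:Z))%R)%N by clear -hin; lia.
rewrite e lvat_cat /=; case: ifP => // h; exfalso; move/negbT: h; clear -hin; lia.
Qed.

Lemma bor_open (S : Om -> Prop) :
  (forall x, S x -> exists n, forall x', agree n x x' -> S x') -> bor S.
Proof.
move=> h d T X hX.
have -> : [set t | S (X t)] = [set t | exists nc : nat * seq (seq bool),
    (forall x', win nc.1 x' (- nc.1%:Z) (nc.1 + nc.1).+1 = nc.2 -> S x') /\
    win nc.1 (X t) (- nc.1%:Z) (nc.1 + nc.1).+1 = nc.2].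
  apply/seteqP; split=> t /=; last by move=> [nc [h1 h2]]; exact: h1.
  move=> /h [n hn]; exists (n, win n (X t) (- n%:Z) (n + n).+1); split=> //= x' e.
  apply: hn => i r hi hr; have hk : (absz (i + n%:Z)%R < (n + n).+1)%N by clear -hi; lia.
  have := win_inj e hk; have -> : - n%:Z + (absz (i + n%:Z)%R)%:Z = i by clear -hi; lia.
  by move=> /(congr1 (fun s => nth false s r)); rewrite !nth_mkseq.
apply: meas_ex => nc; apply: meas_and; first exact: meas_cst.
exact: bor_win.
Qed.

(** Stages active on side [b] have a prescribed parity; the doubled summand makes [j] large without
    changing it. *)
Lemma eps_ex (R : realType) (b : bool) m (c e : R) : 0 < e ->
  exists j, [/\ (m <= j)%N, b = odd j.+2 & c * @eps R j.+1 <= e].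
Proof.
move=> e0; exists (b + (m + Num.bound `|c / e|).*2)%N; split.
- by rewrite -addnn; lia.
- by rewrite /= negbK oddD odd_double addbF; case: b.
rewrite /eps ler_pdivrMr// -ler_pdivrMl// [e^-1 * c]mulrC.
have := archi_boundP (normr_ge0 (c / e)); move: (Num.bound _) => k hk.
apply: le_trans (ler_norm _) _; apply: le_trans (ltW hk) _.
by rewrite ler_nat -addnn; case: b; lia.
Qed.

Lemma typ_arith (R : realType) (tn dn an kn S : R) : tn + dn <= an -> an + dn <= kn ->
  - dn <= S - an -> S - an <= dn -> (S <= kn) && (tn <= S).
Proof. by move=> *; apply/andP; split; lra. Qed.

Lemma eps_arith (R : realType) (a b : R) : a <= b -> a + (a + b) + a <= 4 * b.
Proof. by lra. Qed.

Section PairIso.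
Context {R : realType} (P : bool -> seq bool -> R) (r0 : bool -> nat) (K : nat).
Variables (mk : bool -> seq (seq bool) -> bool) (v : nat -> R).
Notation mkb b := (mark (r0 b) K (mk b)).
Notation pi_ b := (pik (P b) (r0 b) K (mk b)).
Notation rateb b := (rate (P b) (r0 b) K (mk b) v).
Hypothesis HP : forall b, source (P b).
Hypothesis K0 : (0 < K)%N.
Hypothesis novl : forall b x i d, (0 < d < K)%N -> mkb b x i -> mkb b x (i + d%:Z) -> False.
Hypothesis vP : forall b n, v n = vel (P b) (r0 b) K (mk b) (r0 b) n.
Hypothesis hpi : forall b b', pi_ b = pi_ b'.
Variable st : nat -> stg R.
Hypothesis st0 : betS (st 0) = 0.
Hypothesis stI : forall j, inv P r0 K mk v (st j).
Hypothesis stS : forall j, stepS P r0 K mk v j (st j) (st j.+1).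

Let lev b j := lvS (st j) b.
Let N j := NS (st j).
Let kap j := kapS (st j).
Let the j := theS (st j).
Let bet j := betS (st j).
Let lev0 b j : (r0 b <= lev b j)%N. Proof. by case: (stI j). Qed.
Let levS b j : (lev b j <= lev b j.+1)%N.
Proof.
have [[h1 h2 _ _] _ _ _] := stS j; rewrite /lev.
have [->//|hb] := eqVneq b (odd j.+1).
have -> : b = ~~ odd j.+1 by case: (b) (odd j.+1) hb => [] [].
by rewrite h1.
Qed.
Let Nmono j : (N j <= N j.+1)%N. Proof. by have [[]] := stS j. Qed.
Let bet0 : 0 <= bet 0. Proof. by rewrite /bet st0. Qed.
Let bet_mono j : bet j <= bet j.+1. Proof. by have [_ []] := stS j. Qed.
Let betP j n : (N j.+1 <= n)%N ->
  expR (kap j.+1 * n%:R) + expR (bet j * n%:R) <= expR (bet j.+1 * n%:R) :> R.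
Proof. by have [_ [_ _ h _] _ _] := stS j; exact: h. Qed.
Let levj b j : b = odd j.+1 -> (j.+1 <= lev b j.+1)%N.
Proof. by move=> ->; have [[_ _ h _] _ _ _] := stS j. Qed.

Notation T := (seq (seq bool)).
Notation L := (GenTree.tree (seq T)).
Variable g : nat -> seq nat -> L -> L -> R.
Notation spb := (sp P r0 K mk v lev).
Notation mb := (mm P v lev).
Notation cob := (co v lev).
Hypothesis gok : forall j, stage_ok spb mb cob N kap the j (g j).
Hypothesis gref : forall j s, refines spb mb cob N kap the j s (g j) (g j.+1 s).
Notation Decb := (Dec P r0 K mk v lev N kap the g).
Notation Phib := (Phi P r0 K mk v lev N kap the g).
Notation Goodb := (Good P r0 K mk v lev N kap the g).

Lemma okev_typ b j B de x u s : b = odd j.+1 -> dom (P b) B x -> (lev b j.+1 <= B)%N ->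
  - B%:Z <= u -> u + (sumn s)%:Z <= B%:Z -> blk (mkb b x) (N j.+1) u s ->
  the j.+1 + de <= rateb b (lev b j.+1) -> rateb b (lev b j.+1) + de <= kap j.+1 ->
  `|\sum_(k < sumn s) fent (P b) (r0 b) K (mk b) v (lev b j.+1) (win (lev b j.+1) x (u + k%:Z) (lev b j.+1 + K))
     - rateb b (lev b j.+1) * (sumn s)%:R| <= de * (sumn s)%:R ->
  typ mb N kap the b j.+1 s (nm (lv v lev b j.+1) x u s).
Proof.
move=> hb hx hB hu hs hbl h1 h2 h3.
have hp : mpath (mkb b x) u s by case/and3P: hbl.
have hW := dom_inW v HP lev0 K0 novl hx hB hu hs hp.
rewrite /typ hb eqxx -hb /= (wj_fent lev0 hW hp) !ler_expR !lerN2 /len.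
apply/andP; split; first by case/and3P: hbl => _ _ /rk_sumn /ltnW.
move: h3; rewrite ler_norml => /andP[h3 h4].
have n0 : 0 <= (sumn s)%:R :> R by [].
move: (ler_wpM2r n0 h1) (ler_wpM2r n0 h2); rewrite !mulrDl => a1 a2.
exact: typ_arith a1 a2 h3 h4.
Qed.

Lemma okev_lvat b j B x u s v1 v2 (n : nat) i : dom (P b) B x -> (lev b j <= B)%N ->
  - B%:Z <= u -> u + (sumn s)%:Z <= B%:Z -> mpath (mkb b x) u s -> u <= i < u + (sumn s)%:Z ->
  mkb b x v1 -> mkb b x v2 -> v1 <= i < v2 -> v2 - v1 <= (lev b j)%:Z ->
  lvat (lv v lev b j) s (absz (i - u)%R) = lev b j.
Proof.
move=> hx hB hu hs hp hi m1 m2 hv hl.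
have [u' [k [a1 a2 a3 a4 ->]]] := lvat_gap (lv v lev b j) hp hi m1 m2 hv.
have hv0 : 0 < v k.
  apply: (v_gt0 (HP b) K0 (@novl b) (vP b) (lev0 b j) _ a4).
  by apply: dom_win hx hB _ _ => //; [clear -a1 hu; lia|clear -a2 hs; lia].
rewrite /lv /kept hv0 andbT; case: ifP => // h; exfalso.
by move: h; clear -a3 hl; lia.
Qed.

Section Stage.
Variables (j : nat) (b : bool).
Hypothesis hb : b = odd j.+2.
Notation J := j.+2.
Notation b' := (~~ b).
Notation B0 := (B0S (st J)).
Variables (n r : nat) (bit : int -> nat -> bool).
Hypothesis hn : (n <= j.+1)%N.
Hypothesis hr : (r <= j.+1)%N.
Notation AQb := (AQ P r0 K mk v lev N kap the g j n r bit b B0).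

Let hb' : b' = odd j.+1. Proof. by rewrite hb /= negbK. Qed.

(** Feeds the schedule into [law_step]: [okev] at stage [J] gives [TX], while [exev] at [J] and
    [okev] at [j.+1] on the other side give [TY]. *)
Lemma stage_law B : (B0 <= B)%N -> (B0S (st j.+1) <= B)%N -> (lev b J <= B)%N -> (lev b' J <= B)%N ->
  Pr (P b') B (Qc n r bit) <= Pr (P b) B AQb + 4 * @eps R j.+1.
Proof.
move=> hB1 hB2 hl1 hl2.
have [_ [ht _ _ he3] [de [d1 d2 hX]] hY] := stS j.+1; rewrite -hb in d1 d2 hX hY.
have [_ _ [de' [d1' d2' hZ]] _] := stS j; rewrite -hb' in d1' d2' hZ.
have epsle : @eps R J <= @eps R j.+1 by rewrite lef_pV2 ?posrE// ler_nat.
have hl3 : (lev b' j.+1 <= B)%N := leq_trans (levS _ _) hl2.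
have e1 : Pr (P b) B (fun x => ~ TX P r0 K mk v lev N kap the j b B0 x) <= @eps R J.
  apply: le_trans (hX B hB1); apply: Pr_le => // x hx hno [u [s [v1 [v2 [a1 [a2 a2'] [a3 a3'] a4 _]]]]].
  apply: hno; exists u, s; split=> //.
    by apply/and4P; split; [exact: a2|exact: a2'|clear -a3; lia|clear -a3'; lia].
  apply: (okev_typ hb hx hl1 _ _ a1 d1 d2 a4).
    by clear -a2 hB1; lia.
  by clear -a2' hB1; lia.
have e2 : Pr (P b') B (fun y => ~ TY P r0 K mk v lev N kap the j n r b B0 y) <= @eps R J + @eps R j.+1.
  apply: le_trans (lerD (hY B hB1) (hZ B hB2)).
  apply: le_trans (Pr_U (HP _) _ _ _); apply: Pr_le => // y hy hno.
  apply: contrapT => hn'; apply: hno.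
  have [u [s [a1 [a2 a2'] [a3 a3']]]] : exev r0 K mk b' (NS (st J)) B0 J y.
    by apply: contrapT => h; apply: hn'; left.
  have [u1 [t [v1 [v2 [c1 [c2 c2'] [c3 c3'] c4 [c5 c6 c7 c8 c9]]]]]] :
      okev P r0 K mk v b' (lvS (st j.+1) b') (NS (st j.+1)) (B0S (st j.+1)) de' j.+1 y.
    by apply: contrapT => h; apply: hn'; right.
  have q1 : - B%:Z <= u1 by clear -c2 hB2; lia.
  have q2 : u1 + (sumn t)%:Z <= B%:Z by clear -c2' hB2; lia.
  exists u, s, u1, t; split=> //.
  - by apply/and4P; split; [exact: a2|exact: a2'|clear -a3; lia|clear -a3'; lia].
  - split; [by clear -c3 hn; lia|by clear -c3' hn; lia|].
    exact: (okev_typ hb' hy hl3 q1 q2 c1 d1' d2' c4).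
  - move=> i hi; rewrite (okev_lvat 0 hy hl3 q1 q2 _ _ c5 c6 _ c9).
    + exact: leq_trans hr (levj hb').
    + by case/and3P: c1.
    + by clear -hi hn c3 c3'; lia.
    + by clear -hi hn c7 c8; lia.
have := law_step HP lev0 levS Nmono K0 novl vP gok gref bet0 bet_mono betP hpi
  (same_unm HP K0 novl hpi) bit hb hB1 hl1 hl2 e1 e2 ht he3.
by move=> h; apply: le_trans h _; rewrite lerD2l; exact: eps_arith.
Qed.

End Stage.

Lemma Dec_bor b j i r be : bor (fun x => Decb b j x i r be).
Proof. by apply: bor_open => x /(Dec_local K0). Qed.

Lemma Phi_bor b i r : bor (fun x => Phib b x i r).
Proof.
apply: bor_open => x /asboolP[j /(Dec_local K0) [n hn]]; exists n => x' /hn h.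
by apply/asboolP; exists j.
Qed.

Lemma Good_n_bor b n : bor (fun x => exists j, (n <= j)%N /\
  forall i r, `|i| <= n%:Z -> (r < n)%N -> exists be, Decb b j x i r be).
Proof.
move=> d T X hX; apply: (@meas_ex _ _ nat) => j; apply: meas_and; first exact: meas_cst.
apply: (@meas_all _ _ int) => i; apply: (@meas_all _ _ nat) => r.
apply: meas_imp; apply: meas_imp; apply: (@meas_ex _ _ bool) => be.
exact: Dec_bor hX.
Qed.

Lemma Good_bor b : bor (Goodb b).
Proof. by move=> d T X hX; apply: (@meas_all _ _ nat) => n; exact: Good_n_bor hX. Qed.

Section RandomElement.
Context {d : measure_display} {T : measurableType d} (mu : probability T R) (X : T -> Om).
Hypothesis hX : mX X.
Variable b : bool.
Hypothesis hL : lawX (P b) mu X.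
Notation A j B1 w := (AQ P r0 K mk v lev N kap the g j B1 B1 (emb (- B1%:Z) w) b (B0S (st j.+2))).

Lemma AQ_mass j B1 w : b = odd j.+2 -> (B1 <= j.+1)%N -> w \in aw B1 (B1 + B1) ->
  exists2 p : R, mu [set t | A j B1 w (X t)] = p%:E & lwt (P (~~ b)) (B1 + B1) w - 4 * eps j.+1 <= p.
Proof.
move=> hb hj hw.
pose B := (B0S (st j.+2) + B0S (st j.+1) + lev b j.+2 + lev (~~ b) j.+2 + B1)%N.
have [h1 h2 h3 [h4 h5]] : [/\ (B0S (st j.+2) <= B)%N, (B0S (st j.+1) <= B)%N, (lev b j.+2 <= B)%N &
   (lev (~~ b) j.+2 <= B)%N /\ (B1 <= B)%N] by rewrite /B; split; [lia..|split; lia].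
clearbody B; exists (Pr (P b) B (A j B1 w)).
  by apply: (mu_det (HP b) hX hL) => x x'; exact: AQ_det.
have hs := stage_law hb (emb (- B1%:Z) w) hj hj h1 h2 h3 h4.
rewrite lerBlDr; apply: le_trans hs.
rewrite -(Pr_win_lwt (HP _) h5 hw); apply: Pr_le => // y _ e i k hi hk.
rewrite /emb -e nth_win; last by clear -hi; lia.
rewrite nth_mkseq//; congr (y _ k); clear -hi; lia.
Qed.

Lemma AQ_win j B1 w x : w \in aw B1 (B1 + B1) -> A j B1 w x ->
  win B1 (Phib b x) (- B1%:Z) (B1 + B1) = w.
Proof.
move=> hw hA; rewrite -[RHS](win_emb_aw hw); apply: eq_win => k hk.
apply/eq_in_map => r; rewrite mem_iota => /andP[_ hr].
have hi : - B1%:Z <= - B1%:Z + k%:Z < B1%:Z by clear -hk; lia.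
have hd := AQ_Dec hA hi hr; exact: (Phi_Dec HP lev0 levS Nmono K0 gok gref hd).
Qed.

Lemma AQ_meas j B1 w : measurable [set t | A j B1 w (X t)].
Proof.
pose B := (B0S (st j.+2) + lev b j.+2)%N.
apply: (@bor_det B (- B%:Z) (B + B) (A j B1 w)) hX => x x'.
by apply: AQ_det => //; rewrite /B; [exact: leq_addr|exact: leq_addl].
Qed.

Lemma Phi_mX : mX (fun t => Phib b (X t)).
Proof. by move=> i r; exact: Phi_bor hX. Qed.

(** Arbitrarily late stages of the right parity show that each cylinder receives at least its mass,
    and [lawX_mu] turns this into equality. *)
Lemma Phi_law : lawX (P (~~ b)) mu (fun t => Phib b (X t)).
Proof.
apply: (lawX_mu (HP _) Phi_mX) => B w hw; rewrite (Pr_win_lwt (HP _) (leqnn B) hw).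
have mw : measurable [set t | win B (Phib b (X t)) (- B%:Z) (B + B) = w] by exact: bor_win Phi_mX.
rewrite -(fineK (fin_num_measure mu _ mw)) lee_fin; apply/ler_addgt0Pr => e e0.
have [j [hj hb he]] := eps_ex b B 4 e0.
have [p hp1 hp2] := AQ_mass hb (leqW hj) hw.
have hp3 : p <= fine (mu [set t | win B (Phib b (X t)) (- B%:Z) (B + B) = w]).
  rewrite -lee_fin fineK ?fin_num_measure// -hp1; apply: le_measure; rewrite ?inE//.
    exact: AQ_meas.
  by move=> t /= /(AQ_win hw).
move: hp2; rewrite lerBlDr => h; apply: le_trans h _; exact: lerD hp3 he.
Qed.

(** The decoding events of the finitely many words on a window are disjoint, since each determines
    that window of the image, and together they miss at most [4 * size ws * eps]. *)
Lemma Good_full : mu [set t | Goodb b (X t)] = 1%E.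
Proof.
apply: full_bigcap => n; first exact: Good_n_bor hX.
set G := (X in mu [set t | ~ X t]).
have mG : measurable [set t | G t] by exact: Good_n_bor hX.
have fG := fin_num_measure mu _ mG.
suff h : 1 <= fine (mu [set t | G t]).
  apply: (mu_not0 mG).
  apply: le_anti; apply/andP; split; first exact: probability_le1.
  by move: h; rewrite -lee_fin (fineK fG).
apply/ler_addgt0Pr => e e0; pose ws := aw n.+1 (n.+1 + n.+1).
have [j [hj hb he]] := eps_ex b n (4 * (size ws)%:R) e0.
pose Aw w t := w \in ws /\ A j n.+1 w (X t).
have mA w : measurable [set t | Aw w t] by apply: meas_and; [exact: meas_cst|exact: AQ_meas].
have [|m1 e1] := mu_disj mu (aw_uniq n.+1 (n.+1 + n.+1)) mA.
  by move=> w w' t [h1 /(AQ_win h1) <-] [h2 /(AQ_win h2) <-].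
have hsub : fine (mu [set t | exists2 w, w \in ws & Aw w t]) <= fine (mu [set t | G t]).
  apply: fine_le; rewrite ?fin_num_measure//; apply: le_measure; rewrite ?inE//.
  move=> t /= [w hw [_ hA]]; exists j.+2; split; first by clear -hj; lia.
  move=> i r hi hr; exists (emb (- n.+1%:Z) w i r); apply: AQ_Dec hA _ _; first by clear -hi; lia.
  by clear -hr; lia.
have hlow : 1 - 4 * (size ws)%:R * eps j.+1 <= fine (mu [set t | exists2 w, w \in ws & Aw w t]).
  rewrite -lee_fin fineK ?fin_num_measure// e1.
  rewrite -[X in (X - _)%:E](aw_sum (HP (~~ b)) n.+1 (n.+1 + n.+1)).
  rewrite (_ : 4 * (size ws)%:R * eps j.+1 = \sum_(w <- ws) 4 * eps j.+1); last first.
    by rewrite big_const_seq count_predT iter_addr_0 mulrAC mulr_natr.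
  rewrite -sumrB -sumEFin big_seq [X in (_ <= X)%E]big_seq; apply: lee_sum => w hw.
  have [p hp1 hp2] := AQ_mass hb (hj : n.+1 <= j.+1)%N hw.
  rewrite (_ : [set t | Aw w t] = [set t | A j n.+1 w (X t)]) ?hp1 ?lee_fin//.
  by apply/seteqP; split=> t /=; [case|].
move: hlow; rewrite lerBlDr => h; apply: le_trans h _; exact: lerD hsub he.
Qed.

End RandomElement.

(** [S b] asks that both [x] and its image be decodable. The two maps exchange these sets by
    [Phi_inv], and they are full because the image has the law of the other side. *)
Lemma Iso_stages : Iso (P true) (P false).
Proof.
pose S b x := Goodb b x /\ Goodb (~~ b) (Phib b x).
have inv_ b x : S b x -> S (~~ b) (Phib b x) /\ Phib (~~ b) (Phib b x) = x.
  move=> [h1 h2]; have e := Phi_inv HP lev0 levS Nmono K0 novl gok gref h1 h2.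
  by rewrite /S e negbK.
have cont b : cont_on (S b) (Phib b).
  move=> x [h _] i r; have [n hn] := Phi_cont HP lev0 levS Nmono K0 gok gref (Good_Dec K0 i r h).
  by exists n => x' _; exact: hn.
have shS b x : S b (oshift x) <-> S b x.
  by rewrite /S (Phi_shift _ _ _ _ _ _ _ _ _ K0) !(Good_shift _ _ _ _ _ _ _ _ _ K0).
have borS b : bor (S b).
  move=> d T X hX; apply: meas_and; first exact: Good_bor hX.
  exact: (@Good_bor (~~ b) _ _ _ (Phi_mX hX b)).
exists (Phib true), (Phib false), (S true), (S false); split.
- by split=> x; exact: (Phi_shift _ _ _ _ _ _ _ _ _ K0).
- by split=> i r; exact: Phi_bor.
- by split.
- by split=> //; [exact: (inv_ true)|exact: (inv_ false)].
move=> d T mu X hX.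
have main b : lawX (P b) mu X -> mu [set t | S b (X t)] = 1%E /\ lawX (P (~~ b)) mu (fun t => Phib b (X t)).
  move=> hL; split; last exact: Phi_law.
  have h1 := Good_full hX hL.
  have h2 := Good_full (Phi_mX hX b) (Phi_law hX hL).
  have m1 : measurable [set t | Goodb b (X t)] by exact: Good_bor hX.
  have m2 : measurable [set t | Goodb (~~ b) (Phib b (X t))] by exact: (@Good_bor (~~ b) _ _ _ (Phi_mX hX b)).
  have -> : [set t | S b (X t)] = [set t | forall n, (fun n t => if n is 0 then Goodb b (X t) else Goodb (~~ b) (Phib b (X t))) n t].
    apply/seteqP; split=> t /=; first by move=> [a1 a2] [].
    by move=> h; split; [exact: (h 0%N)|exact: (h 1%N)].
  by apply: full_bigcap => -[|n] //; exact: mu_not0.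
by split; [exact: (main true)|exact: (main false)].
Qed.

End PairIso.

Lemma pair_iso (R : realType) (P : bool -> seq bool -> R) (r0 : bool -> nat) (K : nat)
  (mk : bool -> seq (seq bool) -> bool) (v := vel (P true) (r0 true) K (mk true) (r0 true)) :
  (forall b, source (P b)) -> (0 < K)%N ->
  (forall b x i d, (0 < d < K)%N -> mark (r0 b) K (mk b) x i -> mark (r0 b) K (mk b) x (i + d%:Z) -> False) ->
  (forall b b', pik (P b) (r0 b) K (mk b) = pik (P b') (r0 b') K (mk b')) ->
  (forall b, 0 < pik (P b) (r0 b) K (mk b)) ->
  (forall b n, 0 < unm (P b) (r0 b) K (mk b) n) ->
  (forall b b' r e, 0 < e -> exists r', Hlev (P b) r - e <= Hlev (P b') r') ->
  (forall b m, exists n r, [/\ (m < n)%N, (r0 b <= r)%N & 0 < hn (P b) (r0 b) K (mk b) v r n]) ->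
  Iso (P true) (P false).
Proof.
move=> HP K0 novl hpi pi0 un0 HE HS.
have vP b n : v n = vel (P b) (r0 b) K (mk b) (r0 b) n by exact: same_vel.
have [st [st0 stI stS]] := schedule HP K0 novl vP pi0 un0 (@rate_interleave _ _ _ _ _ HP K0 novl hpi _ vP pi0 HE HS).
pose lev b j := lvS (st j) b.
have lev0 b j : (r0 b <= lev b j)%N by case: (stI j).
have levS b j : (lev b j <= lev b j.+1)%N.
  have [[h1 h2 _ _] _ _ _] := stS j; rewrite /lev.
  have [->//|hb] := eqVneq b (odd j.+1).
  have -> : b = ~~ odd j.+1 by case: (b) (odd j.+1) hb => [] [].
  by rewrite h1.
have [g [gok gref]] := stages_exist (fun j => NS (st j)) (fun j => kapS (st j)) (fun j => theS (st j))
  (@mm_gt0 _ P r0 K mk v lev) (mm_sum HP lev0 vP) (co_sp HP lev0 levS) (co_push HP lev0 levS vP).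
exact: (Iso_stages HP K0 novl vP hpi st0 stI stS gok gref).
Qed.

(** * Isomorphism of sources of equal entropy *)

Lemma agree_le m n x x' : (m <= n)%N -> agree n x x' -> agree m x x'.
Proof. by move=> h ha i r hi hr; apply: ha; lia. Qed.

(** A window has finitely many bits, and the sum of their moduli of continuity serves for all; this
    form composes. *)
Lemma cont_agree (E : Om -> Prop) (F : Om -> Om) x n : cont_on E F -> E x ->
  exists m, forall x', E x' -> agree m x x' -> agree n (F x) (F x').
Proof.
move=> hc hx.
have [f hf] : exists f : int -> nat -> nat, forall i r x', E x' -> agree (f i r) x x' -> F x' i r = F x i r.
  have h (q : int * nat) : exists m, forall x', E x' -> agree m x x' -> F x' q.1 q.2 = F x q.1 q.2 by exact: hc.
  by have [f hf] := choice h; exists (fun i r => f (i, r)) => i r; exact: (hf (i, r)).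
exists (\sum_(k < (n + n).+1) \sum_(r < n) f (k%:Z - n%:Z)%R r)%N => x' hx' ha i r hi hr.
apply: hf => //; apply: agree_le ha.
have hk : (absz (i + n%:Z)%R < (n + n).+1)%N by lia.
rewrite (bigD1 (Ordinal hk))//= (bigD1 (Ordinal hr))//=.
have -> : (absz (i + n%:Z)%R)%:Z - n%:Z = i by lia.
by rewrite -addnA leq_addr.
Qed.

Lemma bor_comp (S : Om -> Prop) (F : Om -> Om) : bor S -> (forall i r, bor (fun x => F x i r)) ->
  bor (fun x => S (F x)).
Proof. by move=> hS hF d T X hX; apply: (hS d T (fun t => F (X t))) => i r; exact: hF. Qed.

Lemma mu_and1 (R : realType) (d : measure_display) (T : measurableType d) (mu : probability T R)
  (C C' : T -> Prop) : measurable [set t | C t] -> measurable [set t | C' t] ->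
  mu [set t | C t] = 1%E -> mu [set t | C' t] = 1%E -> mu [set t | C t /\ C' t] = 1%E.
Proof.
move=> m1 m2 h1 h2.
have -> : [set t | C t /\ C' t] = [set t | forall n, (fun n t => if n is 0 then C t else C' t) n t].
  apply/seteqP; split=> t /=; first by move=> [a1 a2] [].
  by move=> h; split; [exact: (h 0%N)|exact: (h 1%N)].
by apply: full_bigcap => -[|n] //; exact: mu_not0.
Qed.

Lemma Iso_trans (R : realType) (P Q S : seq bool -> R) : Iso P Q -> Iso Q S -> Iso P S.
Proof.
move=> [F [G [D [E [[a1 a2] [a3 a4] [a5 a6 a7 a8] [a9 a10 a11 a12] a13]]]]].
move=> [F' [G' [D' [E' [[b1 b2] [b3 b4] [b5 b6 b7 b8] [b9 b10 b11 b12] b13]]]]].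
exists (fun x => F' (F x)), (fun x => G (G' x)), (fun x => D x /\ D' (F x)), (fun x => E' x /\ E (G' x)).
split.
- by split=> x; rewrite ?a1 ?b1 ?b2 ?a2.
- split=> i r.
    exact: (@bor_comp (fun x => F' x i r)).
  exact: (@bor_comp (fun x => G x i r)).
- split.
  + by move=> d T X hX; apply: meas_and; [exact: a5|exact: (bor_comp b5 a3)].
  + by move=> d T X hX; apply: meas_and; [exact: b6|exact: (bor_comp a6 b4)].
  + by move=> x; rewrite a7 a1 b7.
  + by move=> x; rewrite b8 b2 a8.
- split.
  + move=> x [h1 h2]; have [e1 e2] := a9 x h1; have [e3 e4] := b9 _ h2.
    by rewrite e4 e2.
  + move=> x [h1 h2]; have [e1 e2] := b10 x h1; have [e3 e4] := a10 _ h2.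
    by rewrite e4 e2.
  + move=> x [h1 h2] i r; have [n hn] := b11 _ h2 i r.
    have [m hm] := cont_agree n a11 h1; exists m => x' [h1' h2'] ha.
    by apply: hn => //; exact: hm.
  + move=> x [h1 h2] i r; have [n hn] := a12 _ h2 i r.
    have [m hm] := cont_agree n b12 h1; exists m => x' [h1' h2'] ha.
    by apply: hn => //; exact: hm.
move=> d T mu X hX; have [c1 c2] := a13 d T mu X hX; have [e1 e2] := b13 d T mu X hX.
have hF : mX (fun t => F (X t)) by move=> i r; exact: a3.
have hG : mX (fun t => G' (X t)) by move=> i r; exact: b4.
have [c3 _] := b13 d T mu _ hF; have [_ e3] := a13 d T mu _ hG.
split=> hL.
  have [h1 h2] := c1 hL; have [h3 h4] := c3 h2; split=> //.
  by apply: mu_and1 => //; [exact: a5|exact: b5].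
have [h1 h2] := e2 hL; have [h3 h4] := e3 h2; split=> //.
by apply: mu_and1 => //; [exact: b6|exact: a6].
Qed.

(** * Sources of entropy zero *)

Section Zero.
Context {R : realType}.

Definition branch (P : seq bool -> R) (be : nat -> bool) := forall r, P (mkseq be r) = 1.

Lemma branch_win (P : seq bool -> R) be r x u n : branch P be -> (forall i, x i = be) ->
  lwt P n (win r x u n) = 1.
Proof.
move=> hb hx; rewrite /lwt; elim: n u => [//|n IH] u.
by rewrite winS /= hx hb mul1r IH.
Qed.

Lemma branch_law (P : seq bool -> R) be : source P -> branch P be ->
  forall (d : measure_display) (T : measurableType d) (mu : probability T R) (X : T -> Om), mX X ->
  (forall t i, X t i = be) -> lawX P mu X.
Proof.
move=> HP hb d T mu X hX hx B c hc.
pose w := win B (fun _ => be) (- B%:Z) (B + B).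
have hw t : win B (X t) (- B%:Z) (B + B) = w by apply: eq_win => k _; rewrite hx.
have [<-|hne] := eqVneq w c.
  rewrite (_ : [set t | _] = setT); last by apply/seteqP; split=> t //= _; exact: hw.
  by rewrite probability_setT (branch_win _ _ _ hb).
rewrite (_ : [set t | _] = set0); last by apply/seteqP; split=> t //=; rewrite hw => /eqP; rewrite (negbTE hne).
rewrite measure0; congr (_%:E); apply/eqP; rewrite eq_le lwt_ge0//= .
have := aw_sum HP B (B + B); rewrite (big_rem w) ?win_aw//= (branch_win _ _ _ hb)// => e.
have e' : \sum_(y <- rem w (aw B (B + B))) lwt P (B + B) y = 0 by move: e; lra.
rewrite -e' (big_rem c) /=; last by rewrite mem_rem_uniq ?aw_uniq// inE eq_sym hne.
by rewrite lerDl sumr_ge0// => y _; exact: lwt_ge0.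
Qed.

(** Such processes are almost surely one constant array and admit no marker of the form used below;
    constant maps do instead. *)
Lemma Iso_zero (P Q : seq bool -> R) be be' : source P -> source Q -> branch P be -> branch Q be' -> Iso P Q.
Proof.
move=> HP HQ hP hQ.
pose D (be : nat -> bool) (x : Om) := forall i r, x i r = be r.
have cD b : (fun _ => b : nat -> bool) = (fun _ : int => b) by [].
have DE b x : D b x -> (fun _ => b) = x.
  by move=> h; apply/funext => i; apply/funext => r; rewrite h.
have bD b : bor (D b).
  move=> d T X hX; apply: (@meas_all _ _ int) => i; apply: (@meas_all _ _ nat) => r.
  exact: bor_bit hX.
have sD b x : D b (oshift x) <-> D b x.
  split=> h i r; last exact: h.
  by have := h (i - 1) r; rewrite /oshift subrK.
have law (S S' : seq bool -> R) b b' : source S -> source S' -> branch S b -> branch S' b' ->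
  forall d (T : measurableType d) (mu : probability T R) (X : T -> Om), mX X -> lawX S mu X ->
  mu [set t | D b (X t)] = 1%E /\ lawX S' mu (fun t => (fun _ => b')).
  move=> hS hS' hb hb' d T mu X hX hL; split; last first.
    by apply: branch_law => // i r; exact: meas_cst.
  have -> : [set t | D b (X t)] = [set t | forall B, win B (X t) (- B%:Z) (B + B) = win B (fun _ => b) (- B%:Z) (B + B)].
    apply/seteqP; split=> t /= h; first by move=> B; apply: eq_win => k _; congr mkseq; rewrite -(DE _ _ h).
    move=> i r; pose B := (absz i + r).+1; have hk : (absz (i + B%:Z)%R < B + B)%N by rewrite /B; lia.
    have := win_inj (h B) hk; have -> : - B%:Z + (absz (i + B%:Z)%R)%:Z = i by rewrite /B; lia.
    by move=> /(congr1 (fun s => nth false s r)); rewrite !nth_mkseq//; rewrite /B; lia.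
  apply: full_bigcap => B; first exact: bor_win hX.
  apply: mu_not0; first exact: bor_win hX.
  by rewrite hL ?win_aw// (branch_win _ _ _ hb).
exists (fun _ _ => be'), (fun _ _ => be), (D be), (D be'); split.
- by [].
- by split=> i r d T X hX; exact: meas_cst.
- by split.
- split.
  + by move=> x /DE ->; split.
  + by move=> x /DE ->; split.
  + by move=> x _ i r; exists 0%N.
  + by move=> x _ i r; exists 0%N.
by move=> d T mu X hX; split; exact: law.
Qed.

End Zero.

(** * Markers built from a set of letters *)

Definition mkV (V : pred (seq bool)) (w : seq (seq bool)) := V (head [::] w) && all (predC V) (behead w).

Definition mass (R : realType) (P : seq bool -> R) r (V : pred (seq bool)) := \sum_(a <- lets P r | V a) P a.

Section MarkV.
Context {R : realType} (P : seq bool -> R) (r0 k : nat) (V : pred (seq bool)).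
Hypothesis HP : source P.
Variables (a a' : seq bool).
Hypotheses (la : a \in lets P r0) (la' : a' \in lets P r0) (Va : V a) (Va' : ~~ V a').
Notation K := k.+2.
Notation mk := (mkV V).

Lemma markVE x i : mark r0 K mk x i = V (mkseq (x i) r0) &&
  all (fun d : nat => ~~ V (mkseq (x (i + d%:Z)) r0)) (iota 1 k.+1).
Proof. by rewrite /mark /win (_ : iota 0 K = 0%N :: iota 1 k.+1)// map_cons /mkV /head /behead addr0 all_map. Qed.

(** The first letter of the second occurrence lies in the part of the first that avoids [V]. *)
Lemma markV_novl x i d : (0 < d < K)%N -> mark r0 K mk x i -> mark r0 K mk x (i + d%:Z) -> False.
Proof.
rewrite !markVE => hd /andP[_ /allP h] /andP[h' _]; have : d \in iota 1 k.+1 by rewrite mem_iota; clear -hd; lia.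
by move=> /h; rewrite h'.
Qed.

Lemma ew_gt0 r n F w : w \in lwords P r n -> (forall w, w \in lwords P r n -> 0 <= F w) -> 0 < F w -> 0 < ew P r n F.
Proof.
move=> hw h0 hF; rewrite /ew (big_rem w)//= ltr_wpDr//; last by rewrite mulr_gt0// (lwt_gt0 hw).
by rewrite big_seq sumr_ge0// => y /mem_rem hy; rewrite mulr_ge0 ?h0// ?lwt_ge0.
Qed.

Lemma mkatV n w j : w \in lwords P r0 n -> (j + K <= n)%N -> mkat r0 K mk w j =
  V (nth [::] w j) && all (fun d => ~~ V (nth [::] w (j + d))) (iota 1 k.+1).
Proof.
move=> hw hj; have e := lwords_emb hw; rewrite -{1}e mkat_win// markVE.
have hL i : (i < n)%N -> mkseq (emb 0 w (0 + i%:Z)) r0 = nth [::] w i.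
  by move=> hi; rewrite -{2}e nth_win.
rewrite hL; last by lia.
congr (_ && _); apply: eq_in_all => d; rewrite mem_iota => hd.
by rewrite -addrA -PoszD hL//; lia.
Qed.

Lemma ewV1 : ew P r0 1 (fun w => (V (head [::] w))%:R) = mass P r0 V.
Proof.
rewrite /ew /lwords big_words_cons /mass [RHS]big_mkcond; apply: eq_bigr => b _.
by rewrite /= big_seq1 /lwt /= mulr1; case: (V b); rewrite ?mulr1 ?mulr0.
Qed.

Lemma ewVC1 : ew P r0 1 (fun w => (~~ V (head [::] w))%:R) = 1 - mass P r0 V.
Proof.
rewrite -ewV1 -[X in X - _](ew_cst HP r0 1 1); apply/eqP; rewrite eq_sym subr_eq -ewD; apply/eqP/eq_ew => w _.
by case: (V _); rewrite ?add0r ?addr0.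
Qed.

Lemma ewVC n : ew P r0 n (fun w => (all (predC V) w)%:R) = (1 - mass P r0 V) ^+ n.
Proof.
elim: n => [|n IH]; first by rewrite expr0 /ew /lwords /= big_seq1 /lwt /= mulr1.
rewrite exprS -IH -ewVC1 -ew_prod add1n; apply: eq_ew => -[|b w]; first by rewrite mem_lwords.
by rewrite /= drop0; case: (V b); rewrite ?mul0r ?mul1r.
Qed.

Lemma pikV : pik P r0 K mk = mass P r0 V * (1 - mass P r0 V) ^+ k.+1.
Proof.
rewrite -ewVC -ewV1 -ew_prod add1n /pik; apply: eq_ew => w.
rewrite mem_lwords => /andP[/eqP hs /allP ha]; rewrite /mkat drop0 -hs take_size.
have -> : map (take r0) w = w.
  by rewrite -[RHS]map_id; apply/eq_in_map => b /ha /andP[/eqP <- _]; rewrite take_size.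
case: w hs ha => // b w _ _; rewrite /mkV /= drop0.
by case: (V b); rewrite ?mul0r ?mul1r.
Qed.

Lemma mass_gt0 : 0 < mass P r0 V.
Proof.
rewrite /mass (big_rem a)//= Va ltr_wpDr//; last by move: la; rewrite mem_lets => /andP[].
by rewrite sumr_ge0// => y _; exact: src_ge0.
Qed.

Lemma mass_lt1 : mass P r0 V < 1.
Proof.
rewrite -subr_gt0 -ewVC1; apply: (@ew_gt0 _ _ _ [:: a']) => //=; last by rewrite Va'.
by move: la'; rewrite mem_lwords /= mem_lets => ->.
Qed.

Lemma pikV_gt0 : 0 < pik P r0 K mk.
Proof. by rewrite pikV mulr_gt0 ?mass_gt0// exprn_gt0// subr_gt0 mass_lt1. Qed.

Lemma nseq_lwords n : nseq n a' \in lwords P r0 n.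
Proof. by rewrite mem_lwords size_nseq eqxx all_nseq; move: la'; rewrite mem_lets => ->; rewrite orbT. Qed.

Lemma unmV_gt0 n : 0 < unm P r0 K mk n.
Proof.
apply: (@ew_gt0 _ _ _ (nseq n a')); [exact: nseq_lwords|by []|].
rewrite (_ : nomk _ _ _ _ _ = true) ?ltr01//; apply/allP => j; rewrite mem_iota => hj.
rewrite (mkatV (nseq_lwords n)); last by lia.
by rewrite nth_nseq (_ : (j < n)%N) ?(negbTE Va')//; lia.
Qed.

Lemma hn_gt0 v n w1 w2 : (forall n, v n = vel P r0 K mk r0 n) ->
  w1 \in lwords P r0 n -> w2 \in lwords P r0 n -> el r0 K mk n w1 -> el r0 K mk n w2 -> w1 != w2 ->
  0 < hn P r0 K mk v r0 n.
Proof.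
move=> hv h1 h2 e1 e2 hne; apply: (@ew_gt0 _ _ _ w1) => //.
  by move=> w hw; exact: (term_ge0 HP hv (leqnn _) hw).
have hlt : lwt P n w1 < v n.
  rewrite hv /vel (big_rem w1)//= e1 ltrDl (big_rem w2)/=; last first.
    by rewrite mem_rem_uniq ?lwords_uniq// inE eq_sym hne.
  rewrite e2 ltr_wpDr ?(lwt_gt0 h2)// sumr_ge0// => y _; exact: lwt_ge0.
have h0 := lwt_gt0 h1.
by rewrite e1 mul1r oppr_gt0 ln_lt0// divr_gt0 ?(lt_trans h0 hlt)//= ltr_pdivrMr ?mul1r// (lt_trans h0 hlt).
Qed.

(** Two gap words of the same length suffice. Beyond its marker [w1] has only letters outside [V]
    and [w2] only letters in [V]; the latter start no tested marker, as each is followed by another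
    letter in [V]. *)
Lemma hnV v m : (forall n, v n = vel P r0 K mk r0 n) -> 0 < hn P r0 K mk v r0 (m + k + 3).
Proof.
move=> hv; pose n := (m + k + 3)%N.
pose w1 := a :: nseq (m + k + 2) a'; pose w2 := a :: nseq k.+1 a' ++ nseq m.+1 a.
have l1 : w1 \in lwords P r0 n.
  rewrite mem_lwords /= size_nseq all_nseq /n; move: la la'; rewrite !mem_lets => -> ->.
  by rewrite orbT !andbT; apply/eqP; lia.
have l2 : w2 \in lwords P r0 n.
  rewrite mem_lwords; apply/andP; split; first by apply/eqP; rewrite /w2 -cat1s !size_cat !size_nseq /n /=; lia.
  apply/allP => y; rewrite inE mem_cat !mem_nseq => /or3P[/eqP ->|/andP[_ /eqP ->]|/andP[_ /eqP ->]];
  by rewrite -mem_lets.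
have n1 j : (0 < j < n)%N -> nth [::] w1 j = a'.
  by case: j => // j hj; rewrite /= nth_nseq (_ : (j < m + k + 2)%N)//; move: hj; rewrite /n; lia.
have n2 j : (0 < j <= k.+1)%N -> nth [::] w2 j = a'.
  by case: j => // j /andP[_ hj]; rewrite -[nth _ _ _]/(nth [::] (nseq k.+1 a' ++ nseq m.+1 a) j) nth_cat size_nseq (hj : (j < k.+1)%N) nth_nseq (hj : (j < k.+1)%N).
have n3 j : (k.+1 < j < n)%N -> nth [::] w2 j = a.
  case: j => // j hj; rewrite -[nth _ _ _]/(nth [::] (nseq k.+1 a' ++ nseq m.+1 a) j) nth_cat size_nseq (_ : (j < k.+1)%N = false); last by lia.
  by rewrite nth_nseq (_ : (j - k.+1 < m.+1)%N)//; move: hj; rewrite /n; lia.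
apply: (@hn_gt0 v n w1 w2) => //; last first.
- apply/negP => /eqP e; have := congr1 (fun w => nth [::] w n.-1) e; rewrite n1 ?n3; [|rewrite /n; lia..].
  by move=> e'; move: Va'; rewrite e' Va.
- rewrite /el (_ : (K <= n)%N) ?andTb; last by rewrite /n; lia.
  apply/andP; split.
    rewrite (mkatV l2); last by rewrite /n; lia.
    rewrite [nth _ _ 0]/= Va andTb.
    by apply/allP => d; rewrite mem_iota => hd; rewrite add0n n2//; lia.
  apply/allP => j; rewrite mem_iota => hj; rewrite (mkatV l2); last by move: hj; rewrite /n; lia.
  have [h|h] := leqP j k.+1; first by rewrite n2 ?(negbTE Va')//; lia.
  rewrite n3; last by move: hj; rewrite /n; lia.
  rewrite Va andTb -has_predC; apply/hasP; exists 1%N; first by rewrite mem_iota; lia.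
  by rewrite /predC /= negbK n3 ?Va//; move: hj; rewrite /n; lia.
- rewrite /el (_ : (K <= n)%N) ?andTb; last by rewrite /n; lia.
  apply/andP; split.
    rewrite (mkatV l1); last by rewrite /n; lia.
    rewrite [nth _ _ 0]/= Va andTb.
    by apply/allP => d; rewrite mem_iota => hd; rewrite add0n n1//; rewrite /n; lia.
  apply/allP => j; rewrite mem_iota => hj; rewrite (mkatV l1); last by move: hj; rewrite /n; lia.
  by rewrite n1 ?(negbTE Va')//; move: hj; rewrite /n; lia.
Qed.

End MarkV.

Definition entle (R : realType) (P Q : seq bool -> R) :=
  forall r e, 0 < e -> exists r', Hlev P r - e <= Hlev Q r'.

Definition split_by (R : realType) (P : seq bool -> R) r (V : pred (seq bool)) :=
  (exists2 a, a \in lets P r & V a) /\ (exists2 a, a \in lets P r & ~~ V a).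

Lemma entle_refl (R : realType) (P : seq bool -> R) : entle P P.
Proof. by move=> r e e0; exists r; rewrite gerBl ltW. Qed.

Lemma Iso_link (R : realType) (P Q : seq bool -> R) rP rQ VP VQ k : source P -> source Q ->
  split_by P rP VP -> split_by Q rQ VQ ->
  mass P rP VP * (1 - mass P rP VP) ^+ k.+1 = mass Q rQ VQ * (1 - mass Q rQ VQ) ^+ k.+1 ->
  entle P Q -> entle Q P -> Iso P Q.
Proof.
move=> HP HQ [[a1 la1 Va1] [a2 la2 Va2]] [[b1 lb1 Vb1] [b2 lb2 Vb2]] hm h1 h2.
pose PP b := if b then P else Q; pose r0 (b : bool) := if b then rP else rQ.
pose VV (b : bool) := if b then VP else VQ.
have HPP b : source (PP b) by case: b.
have hpi b b' : pik (PP b) (r0 b) k.+2 (mkV (VV b)) = pik (PP b') (r0 b') k.+2 (mkV (VV b')).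
  by rewrite !pikV//; case: b b' => [] [].
apply: (@pair_iso R PP r0 k.+2 (fun b => mkV (VV b)) HPP isT _ hpi).
- by move=> b; exact: markV_novl.
- by move=> [] /=; [exact: (pikV_gt0 _ HP la1 la2 Va1 Va2)|exact: (pikV_gt0 _ HQ lb1 lb2 Vb1 Vb2)].
- by move=> [] n /=; [exact: (unmV_gt0 _ HP la1 la2 Va1 Va2)|exact: (unmV_gt0 _ HQ lb1 lb2 Vb1 Vb2)].
- by move=> [] [] /=; [exact: entle_refl| | |exact: entle_refl].
move=> b m; exists (m + k + 3)%N, (r0 b); split=> //; first by lia.
have hv n : vel (PP true) (r0 true) k.+2 (mkV (VV true)) (r0 true) n =
    vel (PP b) (r0 b) k.+2 (mkV (VV b)) (r0 b) n by exact: (@same_vel R PP r0 k.+2 (fun b => mkV (VV b)) HPP isT (fun b => @markV_novl (r0 b) k (VV b)) hpi true b n).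
case: b hv => hv; first exact: (hnV HP la1 la2 Va1 Va2 _ hv).
exact: (hnV HQ lb1 lb2 Vb1 Vb2 _ hv).
Qed.

Import numFieldNormedType.Exports.

(** * Binary entropy and the matching of marker probabilities *)

Section Eta.
Context {R : realType}.
Implicit Types x y t : R.

Definition eta x : R := - (x * ln x).
Definition H2 t : R := eta t + eta (1 - t).

Lemma eta0 : eta 0 = 0. Proof. by rewrite /eta mul0r oppr0. Qed.
Lemma eta1 : eta 1 = 0. Proof. by rewrite /eta ln1 mulr0 oppr0. Qed.

Lemma etaM x y : 0 <= x -> 0 <= y -> eta (x * y) = y * eta x + x * eta y.
Proof.
rewrite !le_eqVlt => /predU1P[<-|hx]; first by rewrite eta0 !mul0r eta0 mulr0 addr0.
move=> /predU1P[<-|hy]; first by rewrite !mulr0 eta0 mulr0 mul0r addr0.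
by rewrite /eta lnM ?posrE//; ring.
Qed.

Lemma eta_ge0 x : 0 <= x <= 1 -> 0 <= eta x.
Proof. by move=> /andP[h0 h1]; rewrite oppr_ge0 mulr_ge0_le0// ln_le0. Qed.

Lemma H2_ge0 t : 0 <= t <= 1 -> 0 <= H2 t.
Proof. by move=> h; rewrite addr_ge0// eta_ge0//; move: h; lra. Qed.

Lemma H2_0 : H2 0 = 0. Proof. by rewrite /H2 subr0 eta0 eta1 addr0. Qed.

Lemma H2_half : H2 2^-1 = ln 2.
Proof. by rewrite /H2 (_ : 1 - 2^-1 = 2^-1 :> R); [rewrite /eta lnV ?posrE//; field|field]. Qed.

Lemma ln_le_sub1 x : 0 < x -> ln x <= x - 1.
Proof. by move=> h; have := @le_ln1Dx R (x - 1); rewrite (_ : 1 + (x - 1) = x); [apply; lra|ring]. Qed.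

(** A crude bound, from [- ln s <= s^-1 - 1] at the square root [s] of [t]; it yields smallness of
    [H2] near 0. *)
Lemma H2_sqrt t : 0 < t < 1 -> H2 t <= 3 * Num.sqrt t.
Proof.
move=> /andP[t0 t1]; have s0 : 0 < Num.sqrt t by rewrite sqrtr_gt0.
have e : t = Num.sqrt t * Num.sqrt t by rewrite -expr2 sqr_sqrtr// ltW.
move: (Num.sqrt t) s0 e => s s0 e.
have s1 : s < 1.
  by rewrite ltNge; apply/negP => h; move: t1; rewrite e ltNge -[X in X <= _]mulr1 ler_pM.
have h1 : - ln s <= s^-1 - 1 by rewrite -lnV ?posrE//; apply: ln_le_sub1; rewrite invr_gt0.
have h2 : eta t <= 2 * s.
  have hl : ln t = 2 * ln s by rewrite e lnM ?posrE//; ring.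
  have -> : 2 * s = (s * s * 2) * s^-1 by field; rewrite gt_eqF.
  have -> : eta t = (s * s * 2) * (- ln s) by rewrite /eta hl e; ring.
  by rewrite ler_wpM2l ?mulr_ge0 ?ltW//; move: h1; lra.
have h3 : eta (1 - t) <= t.
  have u0 : 0 < 1 - t by lra.
  rewrite /eta -mulrN; have : - ln (1 - t) <= (1 - t)^-1 - 1.
    by rewrite -lnV ?posrE//; apply: ln_le_sub1; rewrite invr_gt0.
  move=> /(ler_wpM2l (ltW u0)) h; apply: le_trans h _.
  by rewrite mulrBr mulfV ?gt_eqF//; lra.
have h4 : t <= s by rewrite e -[X in _ <= X]mulr1 ler_wpM2l ?ltW.
by rewrite /H2; lra.
Qed.

Lemma H2_small (e : R) : 0 < e -> exists d : R, [/\ 0 < d, d < 2^-1 & forall t, 0 < t <= d -> H2 t <= e].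
Proof.
move=> e0; pose d := Num.min ((e / 3) ^+ 2) 4^-1.
have d0 : 0 < d by rewrite lt_min; apply/andP; split; [apply: exprn_gt0; lra|lra].
have d1 : d <= 4^-1 by rewrite ge_min lexx orbT.
exists d; split=> //; first by move: d1; lra.
move=> t /andP[t0 t1]; apply: le_trans (H2_sqrt _) _; first by rewrite t0 /=; move: d1 t1; lra.
have : Num.sqrt t <= e / 3; last by lra.
rewrite -[e / 3]ger0_norm; last by lra.
rewrite -sqrtr_sqr ler_sqrt; last by rewrite exprn_ge0//; lra.
by apply: le_trans t1 _; rewrite ge_min lexx.
Qed.

Lemma H2_cont t : 0 < t -> t < 1 -> {for t, continuous H2}%classic.
Proof.
move=> t0 t1; apply: continuousD.
  apply: continuousN; apply: continuousM; first exact: cvg_id.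
  exact: continuous_ln.
apply: (@continuous_comp _ _ _ (fun x => 1 - x) eta).
  by apply: continuousB; [exact: cvg_cst|exact: cvg_id].
apply: continuousN; apply: continuousM; first exact: cvg_id.
by apply: continuous_ln; lra.
Qed.

Lemma H2_onto (y : R) : 0 < y <= ln 2 -> exists2 t, 0 <= t <= 1 & H2 t = y.
Proof.
move=> /andP[y0 y1]; have [d [d0 d1 hd]] := H2_small y0.
have [|||t ht <-] := @IVT R H2 d 2^-1 y; [by rewrite ltW| | |].
- apply: continuous_in_subspaceT => x; rewrite inE /= in_itv /= => /andP[h1 h2].
  by apply: H2_cont; [exact: lt_le_trans h1|move: h2; lra].
- rewrite H2_half ge_min le_max y1 (hd d) ?d0 ?lexx//= orbT//.
exists t => //; move: ht; rewrite in_itv /=; lra.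
Qed.

Lemma bernoulli (y : R) k : 0 <= y -> 1 + k%:R * y <= (1 + y) ^+ k.
Proof.
move=> y0; elim: k => [|k IH]; first by rewrite mul0r addr0 expr0.
rewrite exprS; apply: le_trans (ler_wpM2l (_ : 0 <= 1 + y) IH); last by lra.
have : 0 <= k%:R * (y * y) by rewrite !mulr_ge0.
by rewrite -natr1; lra.
Qed.

(** The ratio [(1 - d) / (1 - c)] exceeds 1, so its powers outgrow [c / d]. *)
Lemma marker_small (c d : R) : 0 < d -> d < c -> c < 1 ->
  exists k0, forall k, (k0 <= k)%N -> c * (1 - c) ^+ k <= d * (1 - d) ^+ k.
Proof.
move=> d0 dc c1; have u0 : 0 < 1 - c by lra.
pose q := (1 - d) / (1 - c) - 1.
have q0 : 0 < q by rewrite subr_gt0 ltr_pdivlMr// mul1r; lra.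
have e : 1 - d = (1 + q) * (1 - c) by rewrite /q (_ : 1 + ((1 - d) / (1 - c) - 1) = (1 - d) / (1 - c)); [rewrite divfK ?gt_eqF|ring].
exists (Num.bound (c / d / q)) => k hk.
rewrite e exprMn mulrA; apply: ler_wpM2r; first by rewrite exprn_ge0 ?ltW.
rewrite -ler_pdivrMl// [d^-1 * c]mulrC.
apply: le_trans (bernoulli k (ltW q0)).
have h : c / d / q <= k%:R.
  apply: ltW; apply: lt_le_trans (archi_boundP _) _; last by rewrite ler_nat.
  by rewrite !divr_ge0// ltW// (lt_trans d0).
by move: h; rewrite ler_pdivrMr//; lra.
Qed.

(** Intermediate values between 0 and [d]; the root is nonzero because the target value is
    positive. *)
Lemma marker_match (c d : R) k : 0 < c < 1 -> 0 < d < 1 -> c * (1 - c) ^+ k <= d * (1 - d) ^+ k ->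
  exists2 t, 0 < t <= d & t * (1 - t) ^+ k = c * (1 - c) ^+ k.
Proof.
move=> /andP[c0 c1] /andP[d0 d1] h; pose f t : R := t * (1 - t) ^+ k.
have fc0 : 0 < c * (1 - c) ^+ k by rewrite mulr_gt0// exprn_gt0// subr_gt0.
have [|||t ht e] := @IVT R f 0 d (c * (1 - c) ^+ k); [by rewrite ltW| | |].
- suff h' x : {for x, continuous f}%classic by apply: continuous_subspaceT.
  rewrite /f; apply: continuousM; first exact: cvg_id.
  elim: k {h fc0 f} => [|k IH]; first exact: cvg_cst.
  rewrite (_ : (fun t => _) = (fun t => (1 - t) * (1 - t) ^+ k)); last by apply/funext => t; rewrite exprS.
  by apply: continuousM => //; apply: continuousB; [exact: cvg_cst|exact: cvg_id].
- by rewrite /f mul0r ge_min le_max h (ltW fc0) orbT.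
exists t => //; move: ht; rewrite in_itv /= => /andP[t0 ->]; rewrite andbT lt_neqAle t0 andbT.
by apply/negP => /eqP t00; move: fc0; rewrite -e /f -t00 mul0r ltxx.
Qed.

End Eta.

(** * Entropy of sources and the intermediate source *)

Section SourceEntropy.
Context {R : realType}.
Implicit Types P Q : seq bool -> R.

Lemma bits_sum P r : source P -> \sum_(a <- bits r) P a = 1.
Proof.
by move=> HP; rewrite -(lets_sum HP r); have := big_lets HP r (fun=> 1); under eq_bigr do rewrite mulr1;
  under [in RHS]eq_bigr do rewrite mulr1.
Qed.

Lemma HlevE P r : source P -> Hlev P r = \sum_(a <- bits r) eta (P a).
Proof.
move=> HP; rewrite /Hlev /ew /lwords big_words_cons.
transitivity (\sum_(a <- lets P r) P a * - ln (P a)).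
  by apply: eq_bigr => a _; rewrite /= big_seq1 /lwt /= mulr1.
by rewrite (big_lets HP); apply: eq_bigr => a _; rewrite mulrN.
Qed.

Lemma massE P r V : source P -> mass P r V = \sum_(a <- bits r) P a * (V a)%:R.
Proof.
move=> HP; rewrite -(big_lets HP) /mass big_mkcond; apply: eq_bigr => a _.
by case: (V a); rewrite ?mulr1 ?mulr0.
Qed.

Definition ibits (tau : nat -> R) (a : seq bool) : R :=
  \prod_(k < size a) (if nth false a k then tau k else 1 - tau k).

Lemma ibits_rcons tau a b :
  ibits tau (rcons a b) = ibits tau a * (if b then tau (size a) else 1 - tau (size a)).
Proof.
rewrite /ibits size_rcons big_ord_recr /= nth_rcons ltnn eqxx; congr (_ * _).
by apply: eq_bigr => i _; rewrite nth_rcons ltn_ord.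
Qed.

Lemma ibits_source tau : (forall k, 0 <= tau k <= 1) -> source (ibits tau).
Proof.
move=> h; split; first 1 last.
- by rewrite /ibits big_ord0.
- by move=> w; rewrite !ibits_rcons -mulrDr subrK mulr1.
by move=> w; apply: prodr_ge0 => i _; have := h i; case: ifP => _; lra.
Qed.

Lemma Hlev_ibits tau r : (forall k, 0 <= tau k <= 1) -> Hlev (ibits tau) r = \sum_(k < r) H2 (tau k).
Proof.
move=> h; have hs := ibits_source h; rewrite (HlevE _ hs); elim: r => [|r IH].
  by rewrite big_ord0 /= big_seq1 (src_nil hs) eta1.
rewrite big_ord_recr /= -IH big_bitsS.
transitivity (\sum_(w <- bits r) (eta (ibits tau w) + ibits tau w * H2 (tau r))).
  rewrite big_seq [RHS]big_seq; apply: eq_bigr => w; rewrite mem_bits => /eqP hw.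
  have /andP[t0 t1] := h r; rewrite -subr_ge0 in t1; have p0 := src_ge0 hs w.
  by rewrite !ibits_rcons hw (etaM p0 t0) (etaM p0 t1) /H2; ring.
by rewrite big_split /=; congr (_ + _); rewrite -mulr_suml (bits_sum _ hs) mul1r.
Qed.

(** Without a splitting set every level has exactly one prefix of positive mass, and these prefixes
    extend one another. *)
Lemma split_dich P : source P -> (exists be, branch P be) \/ (exists r V, split_by P r V).
Proof.
move=> HP; have [[r [V h]]|hn] := pselect (exists r V, split_by P r V); first by right; exists r, V.
left; have huniq r a a' : a \in lets P r -> a' \in lets P r -> a = a'.
  move=> h h'; apply: contrapT => hne; apply: hn; exists r, (pred1 a); split.
    by exists a => //=.
  by exists a' => //=; apply/eqP => e; apply: hne.
have [f hf] : exists f : nat -> seq bool, forall r, f r \in lets P r.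
  suff h r : exists a, a \in lets P r by have [f hf] := choice h; exists f.
  have := lets_sum HP r.
  case: (lets P r) => [|a l]; last by exists a; rewrite inE eqxx.
  by rewrite big_nil => /esym/eqP; rewrite oner_eq0.
have f1 r : P (f r) = 1.
  rewrite -(lets_sum HP r); have := hf r; have := lets_uniq P r; have := huniq r.
  case: (lets P r) => [//|a [|a' l]] hu; first by rewrite inE big_seq1 => _ /eqP ->.
  have : a = a' by apply: hu; rewrite !inE eqxx ?orbT.
  by move=> ->; rewrite /= inE eqxx.
exists (fun k => nth false (f k.+1) k) => r; rewrite -[RHS](f1 r); congr P.
have hsz k : size (f k) = k by have := hf k; rewrite mem_lets => /andP[/eqP].
apply: (@eq_from_nth _ false); rewrite size_mkseq ?hsz// => i hi; rewrite nth_mkseq//.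
have : take i.+1 (f r) \in lets P i.+1.
  rewrite mem_lets size_takel ?hsz// eqxx /=; apply: lt_le_trans (src_take HP _ _).
  by rewrite f1.
by move=> /(huniq _ _ _ (hf i.+1)) ->; rewrite nth_take.
Qed.

Lemma Hlev_branch P be r : source P -> branch P be -> Hlev P r = 0.
Proof.
move=> HP hb; rewrite (HlevE _ HP) big_seq big1// => a; rewrite mem_bits => /eqP hs.
have [->|hne] := eqVneq a (mkseq be r); first by rewrite hb eta1.
have hm : mkseq be r \in bits r by rewrite mem_bits size_mkseq.
have ha : a \in rem (mkseq be r) (bits r) by rewrite mem_rem_uniq ?bits_uniq// inE hne mem_bits hs eqxx.
have := bits_sum r HP; rewrite (big_rem _ hm)/= hb (big_rem _ ha)/= => e.
have h0 : 0 <= \sum_(y <- rem a (rem (mkseq be r) (bits r))) P y by rewrite sumr_ge0// => y _; exact: src_ge0.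
have : P a = 0 by have := src_ge0 HP a; move: e h0; lra.
by move=> ->; rewrite eta0.
Qed.

Lemma Hlev_split P r V : source P -> split_by P r V -> 0 < Hlev P r.
Proof.
move=> HP [[a ha Va] [a' ha' Va']].
have hne : a' != a by apply/negP => /eqP e; move: Va'; rewrite e Va.
have ge0 b : b \in bits r -> 0 <= eta (P b).
  move=> hb; apply: eta_ge0; rewrite src_ge0//= -(bits_sum r HP) (big_rem b)//= lerDl sumr_ge0// => y _.
  exact: src_ge0.
move: ha ha'; rewrite !mem_lets => /andP[sa pa] /andP[sa' pa'].
have hb : a \in bits r by rewrite mem_bits.
have hb' : a' \in rem a (bits r) by rewrite mem_rem_uniq ?bits_uniq// inE hne mem_bits.
rewrite (HlevE _ HP) (big_rem a)//= ltr_wpDr//.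
  by rewrite big_seq sumr_ge0// => y /mem_rem; exact: ge0.
have := bits_sum r HP; rewrite (big_rem _ hb)/= (big_rem _ hb')/= => e.
have h0 : 0 <= \sum_(y <- rem a' (rem a (bits r))) P y by rewrite sumr_ge0// => y _; exact: src_ge0.
rewrite /eta oppr_gt0 pmulr_rlt0// ln_lt0// pa /=; move: e h0 pa'; lra.
Qed.

Lemma entle_trans P Q S : entle P Q -> entle Q S -> entle P S.
Proof.
move=> h1 h2 r e e0; have e1 : 0 < e / 2 by lra.
have [r1 hr1] := h1 r _ e1; have [r2 hr2] := h2 r1 _ e1.
by exists r2; move: hr1 hr2; lra.
Qed.

(* The tail of independent bits of a hub: finitely many equal biases if the
   entropy is finite, fair coins otherwise. *)
Lemma tail_biases P x r0 : 0 <= x -> x < Hlev P r0 -> exists tau : nat -> R,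
  [/\ forall k, 0 <= tau k <= 1,
      forall r e, 0 < e -> exists r', Hlev P r - e <= x + \sum_(k < r') H2 (tau k) &
      forall r e, 0 < e -> exists r', x + \sum_(k < r) H2 (tau k) - e <= Hlev P r'].
Proof.
move=> x0 hx.
have [[M hM]|hn] := pselect (exists M, forall r, Hlev P r <= M); last first.
  exists (fun=> 2^-1); split=> [k|r e e0|r e e0]; first by lra.
    have l2 : 0 < ln 2 :> R by rewrite ln_gt0// ltr1n.
    exists (Num.bound (`|Hlev P r| / ln 2)); rewrite sumr_const card_ord H2_half.
    have : `|Hlev P r| / ln 2 <= (Num.bound (`|Hlev P r| / ln 2))%:R.
      by apply/ltW/archi_boundP; rewrite divr_ge0// ltW.
    rewrite ler_pdivrMr// mulr_natl => h; have := ler_norm (Hlev P r); move: h; lra.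
  apply: contrapT => h; apply: hn; exists (x + \sum_(k < r) H2 2^-1) => r'.
  rewrite leNgt; apply/negP => hlt; apply: h; exists r'; move: hlt; lra.
pose S := [set y | exists r, y = Hlev P r]%classic.
have hS : has_sup S by split; [exists (Hlev P 0), 0%N|exists M => y [r ->]].
have hub r : Hlev P r <= sup S by apply: sup_upper_bound => //; exists r.
pose l := sup S - x; have l0 : 0 < l by rewrite subr_gt0; apply: lt_le_trans (hub r0).
have l2 : 0 < ln 2 :> R by rewrite ln_gt0// ltr1n.
(* Enough bits for each to need entropy [l / n <= ln 2], which [H2] attains. *)
pose n := (Num.bound (l / ln 2)).+1; have n0 : 0 < n%:R :> R by [].
have [|t ht et] := @H2_onto R (l / n%:R).
  rewrite divr_gt0//= ler_pdivrMr// mulrC -ler_pdivrMr//; apply: ltW.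
  apply: lt_le_trans (archi_boundP _) _; first by rewrite divr_ge0 ?ltW.
  by rewrite ler_nat.
pose tau k := if (k < n)%N then t else 0.
have htau k : 0 <= tau k <= 1 by rewrite /tau; case: ifP => _ //; lra.
have tn : \sum_(k < n) H2 (tau k) = l.
  under eq_bigr do rewrite /tau ltn_ord et.
  by rewrite sumr_const card_ord -[(l / n%:R) *+ n]mulr_natr divfK ?gt_eqF.
have tle r : \sum_(k < r) H2 (tau k) <= l.
  rewrite -tn; have [h|h] := leqP r n.
    rewrite -!(big_mkord xpredT (fun k => H2 (tau k))) (big_cat_nat _ h)//= lerDl.
    by rewrite sumr_ge0// => k _; exact: H2_ge0.
  rewrite -!(big_mkord xpredT (fun k => H2 (tau k))) (big_cat_nat _ (ltnW h))//= gerDl.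
  rewrite big_nat big1// => k /andP[hk _]; by rewrite /tau ltnNge hk /= H2_0.
exists tau; split=> // r e e0.
  by exists n; rewrite tn /l; have := hub r; lra.
have [y [r' ->] hy] := sup_adherent e0 hS.
by exists r'; have := tle r; rewrite /l; move: hy; lra.
Qed.

Lemma Iso_entropy P Q : source P -> source Q -> entle P Q -> entle Q P -> Iso P Q.
Proof.
move=> HP HQ hPQ hQP.
have zero P' Q' be r V : source P' -> source Q' -> entle Q' P' -> branch P' be -> split_by Q' r V -> False.
  move=> h1 h2 h3 h4 h5; have h := Hlev_split h2 h5.
  have [|r' hr'] := h3 r (Hlev Q' r / 2); first by lra.
  by move: hr'; rewrite (Hlev_branch _ h1 h4); lra.
have [[be hb]|[rP [VP sP]]] := split_dich HP; have [[be' hb']|[rQ [VQ sQ]]] := split_dich HQ.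
- exact: Iso_zero hb hb'.
- by have := zero _ _ _ _ _ HP HQ hQP hb sQ.
- by have := zero _ _ _ _ _ HQ HP hPQ hb' sP.
have hs0 := Hlev_split HP sP.
pose c := mass P rP VP; pose d := mass Q rQ VQ.
have cb : 0 < c < 1.
  have [[a la Va] [a' la' Va']] := sP.
  by rewrite (mass_gt0 HP la Va) (mass_lt1 HP la' Va').
have db : 0 < d < 1.
  have [[a la Va] [a' la' Va']] := sQ.
  by rewrite (mass_gt0 HQ la Va) (mass_lt1 HQ la' Va').
(* The two marker bits together use at most half of a positive level entropy of [P], leaving a
   positive amount for the other bits. *)
have [|de0 [de00 de01 hde0]] := @H2_small R (Hlev P rP / 4); first by lra.
pose de := Num.min de0 (Num.min (c / 2) (d / 2)).
have [[dec ded] [dep dele]] : (de < c /\ de < d) /\ (0 < de /\ de <= de0).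
  rewrite /de; move: cb db de00; clear => /andP[c0 _] /andP[d0 _] e0.
  have h1 : Num.min de0 (Num.min (c / 2) (d / 2)) <= c / 2 by rewrite !ge_min lexx !orbT.
  have h2 : Num.min de0 (Num.min (c / 2) (d / 2)) <= d / 2 by rewrite !ge_min lexx !orbT.
  split; split; [by move: h1 c0; clear; lra|by move: h2 d0; clear; lra| |by rewrite ge_min lexx].
  by rewrite !lt_min e0 !divr_gt0.
have dlt1 : 0 < de < 1 by rewrite dep /=; move: dec cb; lra.
have [k1 hk1] := marker_small dep dec (proj2 (andP cb)).
have [k2 hk2] := marker_small dep ded (proj2 (andP db)).
pose k := (k1 + k2)%N.
have [t ht et] := marker_match cb dlt1 (hk1 k.+1 (leqW (leq_addr _ _))).
have [s hs es] := marker_match db dlt1 (hk2 k.+1 (leqW (leq_addl _ _))).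
have H2t : H2 t <= Hlev P rP / 4 by apply: hde0; move: ht dele; lra.
have H2s : H2 s <= Hlev P rP / 4 by apply: hde0; move: hs dele; lra.
have t01 : 0 < t < 1 by move: ht dlt1; lra.
have s01 : 0 < s < 1 by move: hs dlt1; lra.
have H2t0 : 0 <= H2 t by apply: H2_ge0; move: t01; lra.
have H2s0 : 0 <= H2 s by apply: H2_ge0; move: s01; lra.
have [|| tau [h1 h2 h3]] := @tail_biases P (H2 t + H2 s) rP; [lra|lra|].
(* Bit 0 carries the marker matched with [P], bit 1 the one matched with [Q]. *)
pose tb k := match k with 0 => t | 1 => s | k'.+2 => tau k' end.
have htb j : 0 <= tb j <= 1 by case: j => [|[|j]] //=; [move: t01|move: s01]; lra.
have HR := ibits_source htb; pose S := ibits tb.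
have HS r : Hlev S r.+2 = H2 t + H2 s + \sum_(k < r) H2 (tau k).
  by rewrite (Hlev_ibits _ htb) !big_ord_recl /= addrA.
have hPS : entle P S.
  by move=> r e e0; have [r' hr'] := h2 r e e0; exists r'.+2; rewrite HS.
have hSP : entle S P.
  move=> r e e0; have [r' hr'] := h3 r e e0; exists r'; apply: le_trans hr'.
  rewrite lerB// -HS !(Hlev_ibits _ htb) !big_ord_recr /= -addrA lerDl.
  by apply: addr_ge0; apply: H2_ge0; [exact: (htb r)|exact: (htb r.+1)].
have b1 (x y : bool) : ibits tb [:: x; y] = (if x then t else 1 - t) * (if y then s else 1 - s).
  by rewrite /ibits !big_ord_recl big_ord0 /= mulr1.
have b0 (x : bool) : ibits tb [:: x] = (if x then t else 1 - t).
  by rewrite /ibits !big_ord_recl big_ord0 /= mulr1.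
have m0 : mass S 1 (fun a => nth false a 0) = t.
  by rewrite (massE _ _ HR) /bits /= !big_cons big_nil /= mulr1 mulr0 add0r addr0 b0.
have m1 : mass S 2 (fun a => nth false a 1) = s.
  rewrite (massE _ _ HR) /bits /= !big_cons big_nil /= !mulr1 !mulr0 !add0r addr0 !b1; ring.
have sS0 : split_by S 1 (fun a => nth false a 0).
  split; [exists [:: true]|exists [:: false]] => //; rewrite mem_lets /= /S b0; move: t01; lra.
have sS1 : split_by S 2 (fun a => nth false a 1).
  have u0 : 0 < 1 - t by move: t01; lra.
  by split; [exists [:: false; true]|exists [:: false; false]] => //; rewrite mem_lets /= /S b1 mulr_gt0//; move: s01; lra.
apply: (@Iso_trans _ _ S).
  by apply: (Iso_link (k := k) HP HR sP sS0) => //; rewrite m0 -et.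
apply: Iso_sym; apply: (Iso_link (k := k) HQ HR sQ sS1).
- by rewrite m1 -es.
- exact: entle_trans hQP hPS.
- exact: entle_trans hSP hPQ.
Qed.

End SourceEntropy.

(** * Coding of Polish alphabets *)

Definition wcyl B c : set (int -> nat -> bool) := [set x | win B x (- B%:Z) (B + B) = c].

Definition wcyls : set (set (int -> nat -> bool)) :=
  [set S | S = set0 \/ exists B c, S = wcyl B c].

(** The generators are closed under intersection, as uniqueness of measures in [law_bor] demands;
    the empty set is added for that purpose. *)
Definition OmT := g_sigma_algebraType wcyls.

Lemma wcylsI : setI_closed wcyls.
Proof.
move=> S S' [-> _|[B [c ->]]]; first by left; rewrite set0I.
move=> [->|[B' [c' ->]]]; first by left; rewrite setI0.
wlog hB : B B' c c' / (B <= B')%N.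
  move=> h; have [hB|hB] := leqP B B'; first exact: h.
  by rewrite setIC; apply: h; exact: ltnW.
have hdet x x' : wcyl B' c' x -> wcyl B' c' x' -> win B x (- B%:Z) (B + B) = win B x' (- B%:Z) (B + B).
  rewrite /wcyl /= => <- e; apply: eq_win => k hk.
  have hj : (k + (B' - B) < B' + B')%N by lia.
  have := win_inj e hj; have -> : - B'%:Z + (k + (B' - B))%:Z = - B%:Z + k%:Z by lia.
  by move=> h; rewrite -(take_mkseq (x _) hB) -(take_mkseq (x' _) hB) h.
have [[x [h1 h2]]|hn] := pselect (exists x, (wcyl B c `&` wcyl B' c') x); last first.
  by left; apply/seteqP; split=> x // hx; apply: hn; exists x.
right; exists B', c'; apply/seteqP; split=> y; first by case.
by move=> hy; split=> //; rewrite /wcyl /= (hdet y x).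
Qed.

Lemma mX_id : mX (id : OmT -> Om).
Proof.
move=> i r; pose B := (absz i + r).+1; pose k := absz (i + B%:Z)%R.
have hk : (k < B + B)%N by rewrite /k /B; lia.
have -> : [set x : OmT | id x i r] = [set x : OmT | exists c : seq (seq bool),
    nth false (nth [::] c k) r /\ win B x (- B%:Z) (B + B) = c].
  have e x : nth false (nth [::] (win B x (- B%:Z) (B + B)) k) r = x i r.
    rewrite nth_win// nth_mkseq; last by rewrite /B; lia.
    by congr (x _ r); rewrite /k /B; lia.
  apply/seteqP; split=> x /=; first by move=> h; exists (win B x (- B%:Z) (B + B)); rewrite e.
  by move=> [c [h hc]]; rewrite -(e x) hc.
apply: meas_ex => c; apply: meas_and; first exact: meas_cst.
by apply: sub_sigma_algebra; right; exists B, c.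
Qed.

Lemma mX_fun (d : measure_display) (T : measurableType d) (X : T -> Om) : mX X ->
  measurable_fun setT (X : T -> OmT).
Proof.
move=> hX; apply: (@measurability _ _ _ OmT _ _ wcyls) => // _ [S hS <-]; rewrite setTI.
case: hS => [->|[B [c ->]]]; first by rewrite preimage_set0.
exact: (bor_win B (- B%:Z) (B + B) c hX).
Qed.

Lemma law_bor (R : realType) (P : seq bool -> R) (d d' : measure_display) (T : measurableType d)
  (T' : measurableType d') (mu : probability T R) (nu : probability T' R) (X : T -> Om) (Y : T' -> Om) S :
  mX X -> mX Y -> lawX P mu X -> lawX P nu Y -> bor S ->
  mu [set t | S (X t)] = nu [set t | S (Y t)].
Proof.
move=> hX hY lX lY hS.
have mS : measurable [set x : OmT | S x] by exact: (hS _ _ _ mX_id).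
pose m1 := measure_function_pushforward__canonical__measure_function_Measure mu (mX_fun hX).
pose m2 := measure_function_pushforward__canonical__measure_function_Measure nu (mX_fun hY).
apply: (@measure_unique _ R OmT wcyls (fun=> wcyl 0 [::]) _ wcylsI _ _ m1 m2 _ _ _ mS) => //.
- by move=> i; right; exists 0%N, [::].
- by apply/seteqP; split=> x // _; exists 0%N.
- move=> A [->|[B [c ->]]]; first by rewrite !measure0.
  rewrite /m1 /m2 /= /pushforward.
  have [hc|hc] := boolP (c \in aw B (B + B)); first exact: etrans (lX _ _ hc) (esym (lY _ _ hc)).
  have e (U : Type) (Z : U -> Om) : (Z @^-1` wcyl B c) = set0.
    by apply/seteqP; split=> t //=; rewrite /wcyl /= => h; move: hc; rewrite -h win_aw.
  by rewrite !e !measure0.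
move=> k; rewrite /m1 /= /pushforward; apply: le_lt_trans (probability_le1 _ _) (ltry 1).
exact: (bor_win 0 _ _ _ hX).
Qed.

Section Disjoint.
Context {R : realType} {d : measure_display} {T : measurableType d} (mu : probability T R).

Lemma disj_sum_le (I : eqType) (f : I -> set T) (s : seq I) (C : set T) : uniq s ->
  (forall i, measurable (f i)) -> (forall i j t, f i t -> f j t -> i = j) ->
  measurable C -> (forall i, i \in s -> f i `<=` C) ->
  (\sum_(i <- s) mu (f i) <= mu C)%E.
Proof.
move=> hu hm hd mC hC; have [m1 <-] := @mu_disj R d T mu I (fun i t => f i t) s hu hm hd.
apply: le_measure; [exact/mem_set|exact/mem_set|].
by move=> t /= [i hi]; exact: hC.
Qed.

Lemma disj_finite (I : choiceType) (f : I -> set T) (e : R) : 0 < e ->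
  (forall i, measurable (f i)) -> (forall i j t, f i t -> f j t -> i = j) ->
  finite_set [set i | (e%:E <= mu (f i))%E].
Proof.
move=> e0 hm hd; apply: contrapT => hinf.
have [B hB hn] := infinite_set_fset (Num.bound e^-1).+1 hinf.
pose s := finmap.enum_fset B; have hn' : (Num.bound e^-1 < size s)%N := hn.
have hs := @disj_sum_le I f s setT (finmap.fset_uniq B) hm hd measurableT (fun _ _ _ _ => Logic.I).
have h2 : ((e * (size s)%:R)%:E <= \sum_(i <- s) mu (f i))%E.
  have -> : e * (size s)%:R = \sum_(i <- s) e by rewrite big_const_seq count_predT iter_addr_0 mulr_natr.
  rewrite -sumEFin big_seq [X in (_ <= X)%E]big_seq.
  by apply: lee_sum => i hi; exact: hB.
have := le_trans h2 hs; rewrite probability_setT lee_fin.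
apply/negP; rewrite -ltNge -ltr_pdivrMl// mulr1.
apply: lt_le_trans (archi_boundP _) _; first by rewrite invr_ge0 ltW.
by rewrite ler_nat; exact: ltnW.
Qed.

(** Level sets are disjoint, so at most countably many have positive mass, whereas an interval has
    positive Lebesgue measure. *)
Lemma null_level (g : T -> R) (a b : R) : (forall t, measurable [set x | g x = t]) -> a < b ->
  exists2 t, a < t < b & mu [set x | g x = t] = 0%E.
Proof.
move=> hm hab; apply: contrapT => hn.
pose F n := [set t | ((n.+1%:R^-1)%:E <= mu [set x | g x = t])%E] : set R.
have cF : countable (\bigcup_n F n).
  apply: bigcup_countable => // n _; apply: finite_set_countable; apply: disj_finite => //.
  by move=> t t' x /= -> ->.
have hsub : `]a, b[%classic `<=` \bigcup_n F n.
  move=> t /=; rewrite in_itv /= => ht.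
  have m0 : (0 < mu [set x | g x = t])%E.
    by rewrite lt0e measure_ge0 andbT; apply/eqP => h; apply: hn; exists t.
  have fin := fin_num_measure mu _ (hm t); rewrite -(fineK fin) lte_fin in m0.
  exists (Num.bound (fine (mu [set x | g x = t]))^-1) => //=.
  rewrite /F /= -(fineK fin) lee_fin -[X in _ <= X]invrK lef_pV2 ?posrE ?invr_gt0//.
  apply: ltW; apply: lt_le_trans (archi_boundP _) _; first by rewrite invr_ge0 ltW.
  by rewrite ler_nat.
have := countable_lebesgue_measure0 (sub_countable (subset_card_le hsub) cF).
rewrite lebesgue_measure_itv /= lte_fin hab => /eqP; rewrite -EFinB eqe subr_eq0 => /eqP e.
by rewrite e ltxx in hab.
Qed.

End Disjoint.

Lemma mkseq_nth (T : Type) (x0 : T) (f g : nat -> T) r k : (k < r)%N -> mkseq f r = mkseq g r -> f k = g k.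
Proof. by move=> h e; rewrite -(nth_mkseq x0 f h) e nth_mkseq. Qed.

Lemma mkseq_le (T : Type) (f g : nat -> T) r r' : (r <= r')%N -> mkseq f r' = mkseq g r' -> mkseq f r = mkseq g r.
Proof. by move=> h e; rewrite -(take_mkseq f h) e take_mkseq. Qed.

Section Coding.
Context {R : realType} {A : ptopologicalType} (d : A -> A -> R) (u : nat -> A) (rad : nat -> nat -> R).

Definition cd (a : A) (k : nat) : bool :=
  if @pickle_inv (nat * nat)%type k is Some q then d (u q.1) a < rad q.1 q.2 else false.
Definition off : set A := [set a | forall m l, d (u m) a <> rad m l].
(** Characterises the codes of points of [off] by conditions on prefixes, hence visibly Borel.
    Arbitrarily small balls make the points realising the prefixes Cauchy; the definite distance
    from each sphere, known from finitely many bits, keeps their limit off it. *)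
Definition J (c : nat -> bool) := [/\ forall l : nat, exists m : nat, c (pickle (m, l)),
  forall r, exists a, mkseq (cd a) r = mkseq c r &
  forall m l, exists r s, forall a, mkseq (cd a) r = mkseq c r -> s.+1%:R^-1 <= `|d (u m) a - rad m l|].
Definition dec (c : nat -> bool) : A := xget point [set a | off a /\ cd a = c].

Hypothesis d_ge0 : forall x y, 0 <= d x y.
Hypothesis d_eq0 : forall x y, d x y = 0 <-> x = y.
Hypothesis d_sym : forall x y, d x y = d y x.
Hypothesis d_tri : forall x y z, d x z <= d x y + d y z.
Hypothesis d_open : forall U : set A, open U <->
  (forall x, U x -> exists2 e : R, 0 < e & [set y | d x y < e] `<=` U).
Hypothesis d_compl : forall v : nat -> A,
  (forall e : R, 0 < e -> exists N : nat, forall m n : nat, (N <= m)%N -> (N <= n)%N -> d (v m) (v n) < e) ->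
  exists l : A, v @ \oo --> l.
Hypothesis u_dense : forall a (e : R), 0 < e -> exists m, d (u m) a < e.
Hypothesis rad_lo : forall m l, l.+2%:R^-1 < rad m l.
Hypothesis rad_hi : forall m l, rad m l < l.+1%:R^-1.

Lemma cd_pickle a m l : cd a (pickle (m, l)) = (d (u m) a < rad m l).
Proof. by rewrite /cd pickleK_inv. Qed.

Lemma inv_small (e : R) : 0 < e -> exists l : nat, l.+1%:R^-1 < e.
Proof.
move=> e0; exists (Num.bound e^-1); rewrite -[X in _ < X]invrK ltf_pV2 ?posrE ?invr_gt0//.
by apply: lt_le_trans (archi_boundP _) _; [rewrite invr_ge0 ltW|rewrite ler_nat].
Qed.

Lemma cd_bit a (l : nat) : exists m : nat, cd a (pickle (m, l)).
Proof.
have [|m hm] := u_dense a (e := l.+2%:R^-1); first by rewrite invr_gt0.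
by exists m; rewrite cd_pickle; exact: lt_trans hm _.
Qed.

Lemma cd_near a a' (m l : nat) : cd a (pickle (m, l)) -> cd a' (pickle (m, l)) -> d a a' < 2 * l.+1%:R^-1.
Proof.
rewrite !cd_pickle => h h'; have := rad_hi m l; have := d_tri a (u m) a'; rewrite (d_sym a (u m)).
by move: h h'; move: (l.+1%:R^-1) => z; lra.
Qed.

Lemma cd_small a (e : R) : 0 < e -> exists k, cd a k /\ forall a', cd a' k -> d a a' < e.
Proof.
move=> e0; have [|l hl] := @inv_small (e / 2); first by lra.
have [m hm] := cd_bit a l; exists (pickle (m, l)); split=> // a' h'.
by have := cd_near hm h'; move: hl; move: (l.+1%:R^-1) => z; lra.
Qed.

Lemma cd_inj a a' : cd a = cd a' -> a = a'.
Proof.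
move=> h; apply/d_eq0; apply/eqP; rewrite eq_le d_ge0 andbT; apply/ler_addgt0Pr => e e0; rewrite add0r.
by have [k [h1 h2]] := cd_small a e0; apply/ltW/h2; rewrite -h.
Qed.

Lemma off_J a : off a -> J (cd a).
Proof.
move=> ha; split=> [l|r|m l]; [exact: cd_bit|by exists a|].
have h0 : 0 < `|d (u m) a - rad m l| / 2.
  by rewrite divr_gt0// normr_gt0 subr_eq0; apply/eqP; exact: ha.
have [k [hk hk']] := cd_small a h0; have [s hs] := inv_small h0.
exists k.+1, s => a' e; have h := hk' a'; rewrite (mkseq_nth false (ltnSn k) e) in h.
have := h hk; have := d_tri (u m) a' a; have := d_tri (u m) a a'; rewrite (d_sym a' a) => t1 t2 t3.
have : `|d (u m) a - rad m l| <= `|d (u m) a' - rad m l| + `|d (u m) a - d (u m) a'|.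
  by rewrite [X in _ <= X]addrC; exact: ler_distD.
have : `|d (u m) a - d (u m) a'| <= d a a' by rewrite ler_norml; move: t1 t2; lra.
by move: hs t3; move: (s.+1%:R^-1) => z; lra.
Qed.

Lemma cvg_d (v : nat -> A) a : v @ \oo --> a -> forall e, 0 < e -> exists N, forall n, (N <= n)%N -> d a (v n) < e.
Proof.
move=> hv e e0.
have ho : open [set y | d a y < e].
  apply/d_open => x /= hx; exists (e - d a x); first by lra.
  by move=> y /= hy; have := d_tri a x y; move: hy; lra.
have : nbhs a [set y | d a y < e].
  by apply: open_nbhs_nbhs; split=> //=; rewrite (proj2 (d_eq0 a a)).
by move=> /hv [N _ hN]; exists N => n hn; exact: hN.
Qed.

Lemma J_dec c : J c -> off (dec c) /\ cd (dec c) = c.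
Proof.
move=> [h1 h2 h3]; suff [a ha] : exists a, off a /\ cd a = c.
  by rewrite /dec; case: xgetP => [y -> //|/(_ a)]; case.
have [v hv] := choice h2.
have hk k r : (k < r)%N -> cd (v r) k = c k by move=> hr; exact: (mkseq_nth false hr (hv r)).
have [|a hva] := d_compl (v := v).
  move=> e e0; have [|l hl] := @inv_small (e / 2); first by lra.
  have [m hm] := h1 l; exists (pickle (m, l)).+1 => n n' hn hn'.
  have := @cd_near (v n) (v n') m l; rewrite !hk// => /(_ hm hm); move: hl; move: (l.+1%:R^-1) => z; lra.
(* A late [v n] is closer to [a] than to the sphere, so the two points are on the same side of
   it. *)
have key m l : d (u m) a <> rad m l /\ (d (u m) a < rad m l) = c (pickle (m, l)).
  have [r [s hrs]] := h3 m l.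
  have [|N hN] := cvg_d hva (e := s.+1%:R^-1); first by rewrite invr_gt0.
  pose n := (N + r + (pickle (m, l)).+1)%N.
  have k1 : d a (v n) < s.+1%:R^-1 by apply: hN; rewrite /n -addnA leq_addr.
  have k2 : s.+1%:R^-1 <= `|d (u m) (v n) - rad m l|.
    by apply: hrs; apply: mkseq_le (hv n); rewrite /n addnAC leq_addl.
  have k3 : cd (v n) (pickle (m, l)) = c (pickle (m, l)) by apply: hk; rewrite /n leq_addl.
  have t1 := d_tri (u m) (v n) a; have t2 := d_tri (u m) a (v n); rewrite (d_sym (v n)) in t1.
  rewrite -k3 cd_pickle; case: (ltP (d (u m) (v n))) => h.
    move: k2; rewrite ltr0_norm; last by rewrite subr_lt0.
    move=> k2; have h' : d (u m) a < rad m l by move: k1 t1 k2; move: (s.+1%:R^-1) => z; lra.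
    by split; [apply/eqP; rewrite lt_eqF|rewrite h'].
  move: k2; rewrite ger0_norm; last by rewrite subr_ge0.
  move=> k2; have h' : rad m l < d (u m) a by move: k1 t2 k2; move: (s.+1%:R^-1) => z; lra.
  by split; [apply/eqP; rewrite gt_eqF|apply/negbTE; rewrite -leNgt ltW].
exists a; split; first by move=> m l; case: (key m l).
apply/funext => k; have := hk k k.+1 (ltnSn k); rewrite /cd; case E : (pickle_inv k) => [[m l]|] //= _.
have -> : k = pickle (m, l); last by case: (key m l).
by have := @pickle_invK (nat * nat)%type k; rewrite E /=.
Qed.

Lemma cd_cont a k : off a -> exists2 e : R, 0 < e & forall a', d a a' < e -> cd a' k = cd a k.
Proof.
move=> ha; rewrite /cd; case: (pickle_inv k) => [[m l]|] /=; last by exists 1.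
exists `|d (u m) a - rad m l|; first by rewrite normr_gt0 subr_eq0; apply/eqP; exact: ha.
move=> a' h; have t1 := d_tri (u m) a a'; have t2 := d_tri (u m) a' a; rewrite (d_sym a' a) in t2.
case: (ltP (d (u m) a)) => h'.
  by rewrite ltr0_norm ?subr_lt0// in h; apply/idP; move: h t1; lra.
by rewrite ger0_norm ?subr_ge0// in h; apply/negbTE; rewrite -leNgt; move: h t2; lra.
Qed.

Lemma dec_cont c (e : R) : J c -> 0 < e -> exists r, forall c', J c' -> mkseq c' r = mkseq c r ->
  d (dec c) (dec c') < e.
Proof.
move=> hc e0; have [_ he1] := J_dec hc; have [k [h1 h2]] := cd_small (dec c) e0.
exists k.+1 => c' hc' he; have [_ he2] := J_dec hc'; apply: h2; rewrite he2.
by rewrite (mkseq_nth false (ltnSn k) he) -he1.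
Qed.

Lemma open_code U a : open U -> U a <-> exists q : nat * nat,
  [set a' | d (u q.1) a' < rad q.1 q.2] `<=` U /\ cd a (pickle q).
Proof.
move=> hU; split; last first.
  by move=> [[m l] [h]]; rewrite cd_pickle => /h.
move=> /(proj1 (d_open U) hU) [e e0 he]; have [|l hl] := @inv_small (e / 2); first by lra.
have [m hm] := cd_bit a l; exists (m, l); split=> //= a' h'; apply: he => /=.
have := @cd_near a a' m l hm; rewrite cd_pickle => /(_ h'); move: hl; move: (l.+1%:R^-1) => z; lra.
Qed.

Lemma open_ball x e : open [set a | d x a < e].
Proof.
apply/d_open => y /= hy; exists (e - d x y); first by lra.
by move=> z /= hz; have := d_tri x y z; move: hz; lra.
Qed.

Lemma open_far x e : open [set a | e < d x a].
Proof.
apply/d_open => y /= hy; exists (d x y - e); first by lra.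
by move=> z /= hz; have := d_tri x z y; rewrite (d_sym z y); move: hz; lra.
Qed.

Lemma open_meas (U : set A) : open U -> measurable (U : set (borelT A)).
Proof. exact: sub_sigma_algebra. Qed.

Lemma sphere_meas x t : measurable ([set a | d x a = t] : set (borelT A)).
Proof.
have -> : [set a | d x a = t] = ~` ([set a | d x a < t] `|` [set a | t < d x a]).
  apply/seteqP; split=> a /=; first by move=> ->; rewrite ltxx; case.
  by case: (ltgtP (d x a) t) => // h h'; exfalso; apply: h'; [left|right].
apply: measurableC; apply: measurableU; apply: open_meas; [exact: open_ball|exact: open_far].
Qed.

Lemma cd_meas k : measurable ([set a | cd a k] : set (borelT A)).
Proof.
rewrite /cd; case: (pickle_inv k) => [q|]; first by apply: open_meas; exact: open_ball.
by rewrite (_ : [set a | false] = set0)//; apply/seteqP; split.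
Qed.

Lemma cell_meas r w : measurable ([set a | mkseq (cd a) r = w] : set (borelT A)).
Proof.
have hX : mX (fun a : borelT A => (fun _ : int => cd a)) by move=> i k; exact: cd_meas.
have := bor_win r 0 1 [:: w] hX; rewrite (_ : [set a | mkseq (cd a) r = w] = [set t | win r (fun=> cd t) 0 1 = [:: w]])//.
by apply/seteqP; split=> a; rewrite /win /=; [move=> ->|case].
Qed.

Lemma off_meas : measurable (off : set (borelT A)).
Proof.
apply: (@meas_all _ (borelT A) nat) => m; apply: (@meas_all _ (borelT A) nat) => l.
exact: (@meas_not _ (borelT A)) (sphere_meas _ _).
Qed.

Lemma point_meas (a : A) : measurable ([set a] : set (borelT A)).
Proof.
rewrite (_ : [set a] = [set x | d a x = 0]); first exact: sphere_meas.
by apply/seteqP; split=> x /=; [move=> ->; apply/d_eq0|move=> /d_eq0].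
Qed.

End Coding.

(** * Entropy of the code of a marginal *)

Lemma esum_seq_lt (R : realType) (T : choiceType) (D : set T) (f : T -> \bar R) y :
  (y < \esum_(i in D) f i)%E ->
  exists s : seq T, [/\ uniq s, forall x, x \in s -> D x & (y < \sum_(x <- s) f x)%E].
Proof.
rewrite /esum => /ereal_sup_gt [_ [X [finX XD] <-] hy].
exists (finmap.enum_fset (fset_set X)); split; first exact: finmap.fset_uniq.
  by move=> x; rewrite in_fset_set// inE; exact: XD.
by move: hy; rewrite fsbig_finite.
Qed.

Lemma esum_seq_le (R : realType) (T : choiceType) (D : set T) (f : T -> \bar R) (s : seq T) :
  uniq s -> (forall x, x \in s -> D x) -> (\sum_(x <- s) f x <= \esum_(i in D) f i)%E.
Proof.
move=> hu hD; apply: ereal_sup_ubound; exists [set` s]; last by rewrite -fsbig_seq.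
by split; [exact: finite_seq|move=> x /= /hD].
Qed.

Lemma sum_sub (R : realType) (T : eqType) (s L : seq T) (F : T -> R) : uniq s -> {subset s <= L} ->
  (forall x, x \in L -> 0 <= F x) -> \sum_(x <- s) F x <= \sum_(x <- L) F x.
Proof.
elim: s L => [|a s IH] L /=; first by move=> _ _ h; rewrite big_nil big_seq sumr_ge0.
move=> /andP[ha hu] hs h0; have haL : a \in L by apply: hs; rewrite inE eqxx.
rewrite big_cons (big_rem a haL) /= lerD2l; apply: IH => //.
  move=> x hx; have : x \in L by apply: hs; rewrite inE hx orbT.
  by rewrite (perm_mem (perm_to_rem haL)) inE => /orP[/eqP e|//]; move: ha; rewrite -e hx.
by move=> x /mem_rem; exact: h0.
Qed.

Lemma list_eventually (T : eqType) (s : seq T) (Q : T -> nat -> Prop) :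
  (forall a, a \in s -> exists N, forall r, (N <= r)%N -> Q a r) ->
  exists N, forall r, (N <= r)%N -> forall a, a \in s -> Q a r.
Proof.
elim: s => [|a s IH] h; first by exists 0%N.
have [|N hN] := IH; first by move=> b hb; apply: h; rewrite inE hb orbT.
have [|N' hN'] := h a; first by rewrite inE eqxx.
exists (N + N')%N => r hr b; rewrite inE => /orP[/eqP ->|hb]; first by apply: hN'; lia.
by apply: hN => //; lia.
Qed.

(** A word of positive mass at most [e] carries information at least [- ln e]. *)
Lemma Hlev_small (R : realType) (P : seq bool -> R) r e : source P -> 0 < e ->
  - ln e * \sum_(w <- bits r | P w <= e) P w <= Hlev P r.
Proof.
move=> HP e0; have le1 w : w \in bits r -> P w <= 1.
  move=> hw; rewrite -(bits_sum r HP) (big_rem w)//= lerDl sumr_ge0// => y _; exact: src_ge0.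
rewrite (HlevE _ HP) mulr_sumr big_mkcond /= big_seq [X in _ <= X]big_seq; apply: ler_sum => w hw.
have h0 := src_ge0 HP w.
case: ifP => [h|_]; last by apply: eta_ge0; rewrite h0 le1.
move: h0; rewrite le_eqVlt => /predU1P[<-|hp]; first by rewrite mulr0 eta0.
by rewrite /eta -mulrN mulrC; apply: ler_wpM2l; [exact: ltW|rewrite lerN2 ler_ln].
Qed.

Section CodeSource.
Context {R : realType} {A : ptopologicalType} (p : probability (borelT A) R) (cd : A -> nat -> bool).
Hypothesis cdm : forall r w, measurable ([set a | mkseq (cd a) r = w] : set (borelT A)).
Hypothesis cdi : forall a a', cd a = cd a' -> a = a'.
Hypothesis ptm : forall a, measurable ([set a] : set (borelT A)).

Definition csrc (w : seq bool) : R := fine (p [set a | mkseq (cd a) (size w) = w]).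
Notation pa a := (fine (p [set a])).

Lemma csrcE r w : size w = r -> p [set a | mkseq (cd a) r = w] = (csrc w)%:E.
Proof. by move=> <-; rewrite fineK// fin_num_measure. Qed.

Lemma paE a : p [set a] = (pa a)%:E.
Proof. by rewrite fineK// fin_num_measure. Qed.

Lemma csrc_source : source csrc.
Proof.
split=> [w||w].
- by rewrite fine_ge0.
- rewrite /csrc (_ : [set a | _] = setT) ?probability_setT//.
  by apply/seteqP; split.
apply: EFin_inj; rewrite EFinD -(csrcE (erefl (size w))) -(csrcE (size_rcons w false)) -(csrcE (size_rcons w true)).
rewrite -measureU//; last first.
  apply/seteqP; split=> a //= [-> /eqP]; by rewrite eqseq_rcons eqxx.
congr (p _); apply/seteqP; split=> a /=; rewrite mkseqS.
  by move=> ->; case: (cd a (size w)); [right|left].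
by move=> [] /rcons_inj [].
Qed.

Let HS := csrc_source.

Lemma pa_sum (s : seq A) (C : set (borelT A)) : uniq s -> measurable C -> (forall a, a \in s -> C a) ->
  ((\sum_(a <- s) pa a)%:E <= p C)%E.
Proof.
move=> hu mC hC; rewrite -sumEFin; under eq_bigr do rewrite -paE.
apply: (@disj_sum_le _ _ (borelT A) p A (fun a => [set a])) => //.
  by move=> i j t /= -> ->.
by move=> a /hC h t /= ->.
Qed.

Lemma pa_le_csrc a r : pa a <= csrc (mkseq (cd a) r).
Proof.
rewrite -lee_fin -(csrcE (size_mkseq _ _)) -paE; apply: le_measure; [exact/mem_set|exact/mem_set|].
by move=> x /= ->.
Qed.

Lemma csrc_cvg a : csrc (mkseq (cd a) r) @[r --> \oo] --> pa a.
Proof.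
pose F r := [set x | mkseq (cd x) r = mkseq (cd a) r] : set (borelT A).
have hF : \bigcap_r F r = [set a].
  apply/seteqP; split=> x; last by move=> -> r _.
  move=> h; apply: cdi; apply/funext => k.
  exact: (mkseq_nth false (ltnSn k) (h k.+1 I)).
have h : p \o F @ \oo --> p (\bigcap_r F r).
  apply: nonincreasing_cvg_mu.
  - by rewrite (le_lt_trans (probability_le1 _ _)) ?ltry//; exact: cdm.
  - by move=> i; exact: cdm.
  - by rewrite hF; exact: ptm.
  by move=> m n hmn; apply/subsetPset => x /=; exact: mkseq_le.
rewrite hF paE in h.
have -> : (fun r => csrc (mkseq (cd a) r)) = fine \o (p \o F).
  by apply/funext => r /=; rewrite /F (csrcE (size_mkseq _ _)).
exact: fine_cvg.
Qed.

(** If [p] is purely atomic, finitely many atoms carry all but [de] of the mass. Passing from atoms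
    to prefixes lowers the information, and the missing mass costs at most [de * C], with [C] the
    total information of the prefixes of length [r]. *)
Lemma Hlev_le r : ((Hlev csrc r)%:E <= entropy p)%E.
Proof.
rewrite /entropy; case: pselect => [es|ns]; last by rewrite leey.
apply/lee_addgt0Pr => e e0; pose C := \sum_(w <- bits r) - ln (csrc w).
have P1 w : w \in bits r -> csrc w <= 1.
  move=> hw; rewrite -(bits_sum r HS) (big_rem w)//= lerDl sumr_ge0// => y _; exact: src_ge0.
have L0 w : w \in bits r -> 0 <= - ln (csrc w) by move=> hw; rewrite oppr_ge0 ln_le0// P1.
have C0 : 0 <= C by rewrite /C big_seq sumr_ge0.
pose de := e / (C + 1); have C1 : 0 < C + 1 by lra.
have de0 : 0 < de by rewrite divr_gt0.
have [|s [hu hs hy]] := @esum_seq_lt R A (atoms p) (fun a => p [set a]) (1 - de)%:E.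
  by rewrite es lte_fin; lra.
have sp : 1 - de < \sum_(a <- s) pa a.
  by move: hy; under eq_bigr do rewrite paE; rewrite sumEFin lte_fin.
have sa a : a \in s -> 0 < pa a by move=> /hs; rewrite /atoms /= paE lte_fin.
apply: le_trans (_ : ((\sum_(a <- s) - (pa a * ln (pa a)))%:E + e%:E <= _)%E); last first.
  by rewrite leeD2r// -sumEFin; exact: (esum_seq_le _ hu hs).
rewrite -EFinD lee_fin.
pose wa a := mkseq (cd a) r; pose S w := \sum_(a <- s | wa a == w) pa a.
have Sle w : w \in bits r -> S w <= csrc w.
  rewrite mem_bits => /eqP hw; rewrite /S -big_filter -lee_fin -(csrcE hw); apply: pa_sum => //.
    by rewrite filter_uniq.
  by move=> a; rewrite mem_filter => /andP[/eqP].
have exch (g : seq bool -> R) : \sum_(a <- s) g (wa a) * pa a = \sum_(w <- bits r) g w * S w.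
  rewrite /S; under [RHS]eq_bigr do rewrite mulr_sumr big_mkcond.
  rewrite exchange_big /=; apply: eq_bigr => a _.
  have hw : wa a \in bits r by rewrite mem_bits size_mkseq.
  rewrite (big_rem _ hw)/= eqxx big_seq big1 ?addr0// => w.
  by rewrite mem_rem_uniq ?bits_uniq// inE eq_sym => /andP[/negbTE ->].
have Stot : \sum_(w <- bits r) S w = \sum_(a <- s) pa a.
  have := exch (fun=> 1); under eq_bigr do rewrite mul1r.
  by move=> ->; under [RHS]eq_bigr do rewrite mul1r.
have Sge w : w \in bits r -> csrc w - de <= S w.
  move=> hw; have := bits_sum r HS; rewrite (big_rem w)//= => e1.
  move: sp; rewrite -Stot (big_rem w)//=.
  have : \sum_(y <- rem w (bits r)) S y <= \sum_(y <- rem w (bits r)) csrc y.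
    by rewrite big_seq [X in _ <= X]big_seq; apply: ler_sum => y /mem_rem; exact: Sle.
  by move: e1; move: (\sum_(y <- rem _ _) S y) (\sum_(y <- rem _ _) csrc y) => x y; lra.
have step1 : \sum_(a <- s) - ln (csrc (wa a)) * pa a <= \sum_(a <- s) - (pa a * ln (pa a)).
  rewrite big_seq [X in _ <= X]big_seq; apply: ler_sum => a ha.
  rewrite -mulrN mulrC; apply: ler_wpM2l; first by rewrite ltW ?sa.
  rewrite lerN2 ler_ln ?posrE ?sa//; first exact: pa_le_csrc.
  exact: lt_le_trans (sa _ ha) (pa_le_csrc _ _).
have step2 : Hlev csrc r - de * C <= \sum_(w <- bits r) - ln (csrc w) * S w.
  rewrite (HlevE _ HS) /C mulr_sumr -sumrB big_seq [X in _ <= X]big_seq; apply: ler_sum => w hw.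
  have -> : eta (csrc w) - de * - ln (csrc w) = - ln (csrc w) * (csrc w - de) by rewrite /eta; ring.
  by rewrite ler_wpM2l ?L0// Sge.
have step3 : de * C <= e.
  by rewrite /de mulrAC ler_pdivrMr//; apply: ler_wpM2l; [exact: ltW|rewrite lerDl].
by rewrite -exch in step2; move: step1 step2 step3; lra.
Qed.

(** In the atomic case finitely many atoms already exceed [M], and long prefixes separate them with
    nearly the right masses. Otherwise a mass [ka] is not atomic. Points all of whose prefixes have
    mass above [ep] are atoms, so for large [r] the prefixes of mass at most [ep] carry at least
    [ka / 2]. *)
Lemma Hlev_ge (M : R) : (M%:E < entropy p)%E -> exists r, M <= Hlev csrc r.
Proof.
rewrite /entropy; case: pselect => [es|ns].
  move=> /esum_seq_lt [s [hu hs]]; rewrite sumEFin lte_fin => hM.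
  pose ep := (\sum_(a <- s) eta (pa a) - M) / (size s).+1%:R.
  have ep0 : 0 < ep by rewrite divr_gt0// subr_gt0.
  have sa a : a \in s -> 0 < pa a by move=> /hs; rewrite /atoms /= paE lte_fin.
  have [N hN] : exists N, forall r, (N <= r)%N -> forall a, a \in s ->
      eta (pa a) - ep <= eta (csrc (mkseq (cd a) r)) /\
      forall a', a' \in s -> a = a' \/ mkseq (cd a) r <> mkseq (cd a') r.
    apply: list_eventually => a ha.
    have [N1 hN1] : exists N, forall r, (N <= r)%N -> eta (pa a) - ep <= eta (csrc (mkseq (cd a) r)).
      have ce : {for pa a, continuous (@eta R)}.
        apply: continuousN; apply: continuousM; first exact: cvg_id.
        by apply: continuous_ln; exact: sa.
      have hc : eta (csrc (mkseq (cd a) r)) @[r --> \oo] --> eta (pa a).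
        by apply: continuous_cvg => //; exact: csrc_cvg.
      move/cvgrPdist_le : hc => /(_ _ ep0) [N _ h]; exists N => r hr.
      by have := h r hr; rewrite /= ler_norml; lra.
    have [N2 hN2] : exists N, forall r, (N <= r)%N -> forall a', a' \in s -> a = a' \/ mkseq (cd a) r <> mkseq (cd a') r.
      apply: list_eventually => a' _; have [->|hne] := pselect (a = a'); first by exists 0%N; left.
      have [k hk] : exists k, cd a k <> cd a' k.
        apply: contrapT => h; apply: hne; apply: cdi; apply/funext => k.
        by apply: contrapT => h'; apply: h; exists k.
      by exists k.+1 => r hr; right => e; apply: hk; exact: (mkseq_nth false hr e).
    by exists (N1 + N2)%N => r hr; split; [apply: hN1|apply: hN2]; lia.
  have {}hN := hN N (leqnn N); exists N.
  have hum : uniq (map (fun a => mkseq (cd a) N) s).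
    rewrite map_inj_in_uniq// => a a' ha ha' e.
    by have [_ /(_ a' ha') []] := hN a ha.
  have h1 : \sum_(w <- map (fun a => mkseq (cd a) N) s) eta (csrc w) <= Hlev csrc N.
    rewrite (HlevE _ HS); apply: sum_sub => //.
      by move=> w /mapP[a _ ->]; rewrite mem_bits size_mkseq.
    move=> w hw; apply: eta_ge0; rewrite src_ge0//= -(bits_sum N HS) (big_rem w)//= lerDl sumr_ge0// => y _.
    exact: src_ge0.
  apply: le_trans h1; rewrite big_map.
  have h2 : \sum_(a <- s) (eta (pa a) - ep) <= \sum_(a <- s) eta (csrc (mkseq (cd a) N)).
    by rewrite big_seq [X in _ <= X]big_seq; apply: ler_sum => a /hN [].
  apply: le_trans h2; rewrite sumrB big_const_seq count_predT iter_addr_0 -[ep *+ _]mulr_natr.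
  have h3 : ep * (size s).+1%:R = \sum_(a <- s) eta (pa a) - M by rewrite divfK.
  have : ep * (size s)%:R <= ep * (size s).+1%:R by rewrite ler_pM2l// ler_nat.
  by rewrite h3; move: (ep * _) (\sum_(a <- s) _) => x y; lra.
move=> _; pose s0 := (\esum_(a in atoms p) p [set a])%E.
have s01 : (s0 <= 1)%E.
  rewrite leNgt; apply/negP => /esum_seq_lt [s [hu _ h]].
  have := @pa_sum s setT hu measurableT (fun _ _ => I); rewrite probability_setT -sumEFin.
  by under eq_bigr do rewrite -paE; rewrite leNgt h.
have s00 : (0 <= s0)%E by apply: esum_ge0 => a _.
have [ka k0 ek] : exists2 ka : R, 0 < ka & s0 = (1 - ka)%:E.
  have ns' : s0 <> 1%E by [].
  case: s0 s01 s00 ns' => [x| |] //=; rewrite ?lee_fin => h1 _ hne.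
  exists (1 - x); last by congr (_%:E); ring.
  by rewrite subr_gt0 lt_neqAle h1 andbT; apply/eqP => e; apply: hne; rewrite e.
(* Chosen so that [- ln ep * (ka / 2)] is the absolute value of [M]. *)
pose ep := expR (- (`|M| * 2 / ka)).
have ep0 : 0 < ep by exact: expR_gt0.
have lep : - ln ep = `|M| * 2 / ka by rewrite /ep expRK opprK.
pose Ns r := [set a | ep < csrc (mkseq (cd a) r)] : set (borelT A).
have mN r : measurable (Ns r).
  have -> : Ns r = [set a | exists w, ep < csrc w /\ mkseq (cd a) r = w].
    by apply/seteqP; split=> a /=; [move=> h; exists (mkseq (cd a) r)|move=> [w [h e]]; rewrite /Ns /= e].
  by apply: (@meas_ex _ (borelT A) (seq bool)) => w; apply: meas_and; [exact: meas_cst|exact: cdm].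
have mI : measurable (\bigcap_r Ns r) by apply: bigcap_measurable.
have hX : finite_set [set a | (ep%:E <= p [set a])%E].
  apply: (@disj_finite _ _ (borelT A) p A (fun a => [set a])) => //.
  by move=> i j t /= -> ->.
pose sX := finmap.enum_fset (fset_set [set a | (ep%:E <= p [set a])%E]).
have mX' a : a \in sX = (ep%:E <= p [set a])%E.
  by rewrite in_fset_set//; apply/idP/idP; rewrite inE.
have pI : (p (\bigcap_r Ns r) <= (1 - ka)%:E)%E.
  have [m1 e1] := @mu_disj R _ (borelT A) p A (fun a t => t = a) sX (finmap.fset_uniq _) ptm
    (fun a a' t h h' => etrans (esym h) h').
  apply: le_trans (_ : (p [set t | exists2 w, w \in sX & t = w] <= _)%E); last first.
    rewrite e1 -ek; apply: esum_seq_le; first exact: finmap.fset_uniq.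
    by move=> a; rewrite mX' /atoms /=; apply: lt_le_trans; rewrite lte_fin.
  apply: le_measure; [exact/mem_set|exact/mem_set|] => a ha /=; exists a => //.
  rewrite mX' paE lee_fin.
  have := cvg_lim (@norm_hausdorff _ _) (@csrc_cvg a) => <-.
  apply: limr_ge; first by apply/cvg_ex; exists (pa a); exact: csrc_cvg.
  by apply: nearW => r; apply: ltW; exact: (ha r I).
have hcv : p \o Ns @ \oo --> p (\bigcap_r Ns r).
  apply: nonincreasing_cvg_mu => //.
  - by rewrite (le_lt_trans (probability_le1 _ _)) ?ltry.
  move=> m n hmn; apply/subsetPset => a /= h; apply: lt_le_trans h _.
  by rewrite -(take_mkseq (cd a) hmn); exact: src_take.
have fI := fin_num_measure p _ mI; rewrite -(fineK fI) in hcv.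
have [r hr] : exists r, fine (p (Ns r)) <= 1 - ka / 2.
  have k2 : 0 < ka / 2 by lra.
  have hc : fine (p (Ns r)) @[r --> \oo] --> fine (p (\bigcap_r Ns r)) by exact: fine_cvg.
  move/cvgrPdist_le : hc => /(_ _ k2) [r _ h]; exists r.
  have := h r (leqnn r); rewrite /= ler_norml => /andP[h1 _].
  by move: pI; rewrite -(fineK fI) lee_fin; move: h1; lra.
exists r; apply: le_trans (Hlev_small r HS ep0); rewrite lep.
have eN : fine (p (Ns r)) = \sum_(w <- bits r | ep < csrc w) csrc w.
  have [_ e1] := @mu_list R _ (borelT A) p _ (fun a => mkseq (cd a) r) [seq w <- bits r | ep < csrc w]
    (filter_uniq _ (bits_uniq r)) (fun w => cdm r w).
  have -> : Ns r = [set t | mkseq (cd t) r \in [seq w <- bits r | ep < csrc w]].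
    by apply/seteqP; split=> a /=; rewrite mem_filter mem_bits size_mkseq eqxx andbT.
  rewrite e1 big_filter -[RHS]/(fine (_%:E)) -sumEFin; congr fine.
  by rewrite big_seq_cond [RHS]big_seq_cond; apply: eq_bigr => w /andP[]; rewrite mem_bits => /eqP hw _; exact: csrcE.
have hsum : ka / 2 <= \sum_(w <- bits r | csrc w <= ep) csrc w.
  have := bits_sum r HS; rewrite (bigID (fun w => ep < csrc w)) /= -eN.
  rewrite (eq_bigl (fun w => csrc w <= ep)); last by move=> w; rewrite -leNgt.
  by move: hr; lra.
have hM : M <= `|M| * 2 / ka * (ka / 2).
  have -> : `|M| * 2 / ka * (ka / 2) = `|M| by field; rewrite gt_eqF.
  exact: ler_norm.
apply: le_trans hM _; apply: ler_wpM2l hsum.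
by rewrite divr_ge0 ?mulr_ge0// ltW.
Qed.

End CodeSource.

(** The interface of the coding: a Borel injection into bit strings that is a homeomorphism from the
    full set [off] onto [J]. The last field makes decoding measurable. *)
Record is_code (R : realType) (A : ptopologicalType) (p : probability (borelT A) R)
  (cd : A -> nat -> bool) (dec : (nat -> bool) -> A) (off : set A) (J : (nat -> bool) -> Prop) : Prop := IsCode {
  code_bit : forall k, measurable ([set a | cd a k] : set (borelT A));
  code_cell : forall r w, measurable ([set a | mkseq (cd a) r = w] : set (borelT A));
  code_inj : forall a a', cd a = cd a' -> a = a';
  code_pt : forall a, measurable ([set a] : set (borelT A));
  code_offm : measurable (off : set (borelT A));
  code_off1 : p off = 1%E;
  code_Jbor : forall i, bor (fun x => J (x i));
  code_offJ : forall a, off a -> J (cd a);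
  code_dec : forall c, J c -> off (dec c) /\ cd (dec c) = c;
  code_cont : forall a k, off a -> exists U : set A, [/\ open U, U a & forall a', U a' -> cd a' k = cd a k];
  code_dcont : forall c (U : set A), J c -> open U -> U (dec c) ->
    exists r, forall c', J c' -> mkseq c' r = mkseq c r -> U (dec c');
  code_open : forall U : set A, open U -> exists KU : nat -> Prop, forall a, U a <-> exists k, KU k /\ cd a k }.

Lemma code_exists (R : realType) (A : ptopologicalType) (p : probability (borelT A) R) : polish R A ->
  exists cd dec off J, is_code p cd dec off J.
Proof.
move=> [[d [[d0 de] ds dt dop dc]] [D [cD hD]]].
have op := open_ball dt dop.
have /countable_injP [f finj] := cD.
pose u n := xget point [set a | D a /\ f a = n].
have uE a : D a -> u (f a) = a.
  move=> ha; rewrite /u; case: xgetP => [y -> [h1 h2]|/(_ a)]; last by case.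
  by apply: finj; rewrite ?inE.
have ud a (e : R) : 0 < e -> exists m, d (u m) a < e.
  move=> e0; have : closure D a by rewrite hD.
  move=> /(_ [set y | d a y < e]) [|y [hy1 hy2]].
    by apply: open_nbhs_nbhs; split; [exact: op|rewrite /= (proj2 (de a a))].
  by exists (f y); rewrite uE// ds.
have hr (q : nat * nat) : exists t, (q.2.+2%:R^-1 < t < q.2.+1%:R^-1) /\ p [set a | d (u q.1) a = t] = 0%E.
  have [||t h1 h2] := @null_level R _ (borelT A) p (d (u q.1)) q.2.+2%:R^-1 q.2.+1%:R^-1.
  - by move=> t; exact: (sphere_meas ds dt dop).
  - by rewrite ltf_pV2 ?posrE// ltr_nat.
  by exists t.
have [rd hrd] := choice hr; pose rad m l := rd (m, l).
have rlo m l : l.+2%:R^-1 < rad m l by have [/andP[]] := hrd (m, l).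
have rhi m l : rad m l < l.+1%:R^-1 by have [/andP[]] := hrd (m, l).
have r0 m l : p [set a | d (u m) a = rad m l] = 0%E by have [] := hrd (m, l).
exists (cd d u rad), (dec d u rad), (off d u rad), (J d u rad); split.
- exact: (cd_meas u rad dt dop).
- exact: (cell_meas u rad dt dop).
- exact: (cd_inj d0 de ds dt ud rlo rhi).
- exact: (point_meas de ds dt dop).
- exact: (off_meas u rad ds dt dop).
- apply: (@full_bigcap R _ (borelT A) p (fun m a => forall l, d (u m) a <> rad m l)) => m.
    by apply: (@meas_all _ (borelT A) nat) => l; apply: (@meas_not _ (borelT A)); exact: (sphere_meas ds dt dop).
  apply: mu_not0.
    by apply: (@meas_all _ (borelT A) nat) => l; apply: (@meas_not _ (borelT A)); exact: (sphere_meas ds dt dop).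
  apply: (@full_bigcap R _ (borelT A) p (fun l a => d (u m) a <> rad m l)) => l.
    by apply: (@meas_not _ (borelT A)); exact: (sphere_meas ds dt dop).
  rewrite (_ : [set t | _] = [set a | d (u m) a = rad m l])//.
  by apply/seteqP; split=> a /=; [move/contrapT|move=> h h'].
- move=> i dd T X hX.
  have e1 r x x' : win r x i 1 = win r x' i 1 -> mkseq (x i) r = mkseq (x' i) r.
    by rewrite /win /= addr0 => -[].
  have -> : [set t | J d u rad (X t i)] = [set t | (forall l : nat, exists m : nat, X t i (pickle (m, l))) /\
     ((forall r, exists a, mkseq (cd d u rad a) r = mkseq (X t i) r) /\
     forall m l, exists r s, forall a, mkseq (cd d u rad a) r = mkseq (X t i) r -> s.+1%:R^-1 <= `|d (u m) a - rad m l|)].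
    by apply/seteqP; split=> t /=; [case|move=> [h1 [h2 h3]]; split].
  apply: meas_and.
    by apply: (@meas_all _ _ nat) => l; apply: (@meas_ex _ _ nat) => m; exact: hX.
  apply: meas_and.
    apply: (@meas_all _ _ nat) => r.
    apply: (@bor_det r i 1 (fun x => exists a, mkseq (cd d u rad a) r = mkseq (x i) r)) hX => x x' /e1 -> //.
  apply: (@meas_all _ _ nat) => m; apply: (@meas_all _ _ nat) => l.
  apply: (@meas_ex _ _ nat) => r; apply: (@meas_ex _ _ nat) => s.
  apply: (@bor_det r i 1 (fun x => forall a, mkseq (cd d u rad a) r = mkseq (x i) r -> s.+1%:R^-1 <= `|d (u m) a - rad m l|)) hX => x x' /e1 -> //.
- exact: (off_J ds dt ud rlo rhi).
- exact: (J_dec de ds dt dop dc rhi).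
- move=> a k ha; have [e e0 he] := cd_cont ds dt k ha.
  exists [set a' | d a a' < e]; split; [exact: op|by rewrite /= (proj2 (de a a))|exact: he].
- move=> c U hc oU hU; have [e e0 he] := proj1 (dop U) oU _ hU.
  have [r hr'] := dec_cont de ds dt dop dc ud rlo rhi hc e0; exists r => c' hc' ec.
  by apply: he; exact: hr'.
move=> U oU; exists (fun k => exists q : nat * nat, [set a' | d (u q.1) a' < rad q.1 q.2] `<=` U /\ k = pickle q) => a.
rewrite (open_code ds dt dop ud rlo rhi a oU); split.
  by move=> [q [h1 h2]]; exists (pickle q); split=> //; exists q.
by move=> [k [[q [h1 ->]] h2]]; exists q.
Qed.

(** Sets whose preimage has a measurable trace on [Z] form a sigma-algebra. The relative form serves
    decoders, which are under control only on codes. *)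
Lemma trace_sigma (d : measure_display) (T : measurableType d) (S : Type) (G : set (set S)) (f : T -> S) (Z : T -> Prop) :
  measurable [set t | Z t] -> (forall C, G C -> measurable [set t | Z t /\ C (f t)]) ->
  forall C, <<s G >> C -> measurable [set t | Z t /\ C (f t)].
Proof.
move=> mZ hG C; apply: (@smallest_sub _ _ G [set C | measurable [set t | Z t /\ C (f t)]]) => //; split.
- rewrite /= (_ : [set t | _] = set0)//; by apply/seteqP; split=> t // [].
- move=> B /= mB; rewrite (_ : [set t | _] = [set t | Z t] `\` [set t | Z t /\ B (f t)]); first exact: measurableD.
  apply/seteqP; split=> t /=; first by move=> [h1 [_ h2]]; split=> // -[].
  by move=> [h1 h2]; split=> //; split=> // h3; apply: h2.
move=> B /= mB; rewrite (_ : [set t | _] = \bigcup_n [set t | Z t /\ B n (f t)]); first exact: bigcupT_measurable.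
apply/seteqP; split=> t /=; first by move=> [h1 [n _ h2]]; exists n.
by move=> [n _ [h1 h2]]; split=> //; exists n.
Qed.

Lemma mu_eq_on (R : realType) (d : measure_display) (T : measurableType d) (mu : probability T R)
  (Z X Y : set T) : measurable Z -> measurable X -> measurable Y -> mu Z = 1%E ->
  (forall t, Z t -> (X t <-> Y t)) -> mu X = mu Y.
Proof.
move=> mZ mX mY hZ h.
have z : mu (~` Z) = 0%E by rewrite probability_setC// hZ subee.
have key (W : set T) : measurable W -> mu W = mu (W `&` Z).
  move=> mW; rewrite (measureDI mu mW mZ) -[RHS]add0e; congr (_ + _)%E.
  apply/eqP; rewrite eq_le measure_ge0 andbT -z; apply: le_measure; rewrite ?inE.
  - exact: measurableD.
  - exact: measurableC.
  by move=> t [].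
rewrite (key X)// (key Y)//; congr (mu _); apply/seteqP; split=> t [h1 h2]; split=> //; exact/h.
Qed.

Lemma ptws_cvg (A : ptopologicalType) (F : set_system {ptws int -> A}) (f : {ptws int -> A}) : Filter F ->
  (forall i V, nbhs (f i) V -> F [set g | V (g i)]) -> F --> f.
Proof.
move=> FF h; apply/cvg_sup => i; apply/cvg_image.
  apply/seteqP; split=> y // _; exists (fun=> y) => //.
move=> V hV; exists [set g : {ptws int -> A} | V (g i)]; first exact: h.
apply/seteqP; split=> y /=; first by move=> [g hg <-].
by move=> hy; exists (fun=> y).
Qed.

Lemma ptws_proj (A : ptopologicalType) (x : {ptws int -> A}) i V : nbhs (x i) V ->
  nbhs x [set x' : {ptws int -> A} | V (x' i)].
Proof. by move=> h; exact: (@proj_continuous int (fun=> A) i x V h). Qed.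

Lemma filter_list (T : Type) (I : eqType) (F : set_system T) (s : seq I) (Q : I -> set T) : Filter F ->
  (forall q, q \in s -> F (Q q)) -> F [set x | forall q, q \in s -> Q q x].
Proof.
move=> FF; elim: s => [|a s IH] h; first exact: filterS filterT.
have h1 : F (Q a) by apply: h; rewrite inE eqxx.
have h2 := IH (fun q hq => h q (mem_behead (s := a :: s) hq)).
apply: filterS (filterI h1 h2) => x [x1 x2] q; rewrite inE => /orP[/eqP ->//|]; exact: x2.
Qed.

Lemma lwt_prod (R : realType) (P : seq bool -> R) n c : size c = n ->
  lwt P n c = \prod_(k <- iota 0 n) P (nth [::] c k).
Proof.
rewrite /lwt; elim: n c => [|n IH] [|a c] //=; first by rewrite big_nil.
move=> [h]; rewrite big_cons /= IH// -[1%N]addn0 iotaDl big_map; congr (_ * _); exact: eq_bigr.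
Qed.

(** * Coded processes *)

Section CodedProcess.
Context {R : realType} {A : ptopologicalType} {p : probability (borelT A) R} {mu : probability (seqT A) R}.
Context {cd : A -> nat -> bool} {dec : (nat -> bool) -> A} {off : set A} {J : (nat -> bool) -> Prop}.
Hypothesis cA : is_code p cd dec off J.
Hypothesis hmu : iid_law p mu.

Definition cz (x : int -> A) : Om := fun i => cd (x i).
Definition dz (z : Om) : int -> A := fun i => dec (z i).
Definition JZ (z : Om) := forall i, J (z i).
Definition offZ (x : int -> A) := forall i, off (x i).

Lemma cyl_meas i (B : set (borelT A)) : measurable B -> measurable ([set x | B (x i)] : set (seqT A)).
Proof. by move=> mB; apply: sub_sigma_algebra; exists i, B. Qed.

Lemma cz_mX : mX (cz : seqT A -> Om).
Proof. by move=> i k; exact: (cyl_meas i (code_bit cA k)). Qed.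

Lemma dec_cd_code a : off a -> dec (cd a) = a.
Proof. by move=> h; apply: (code_inj cA); case: (code_dec cA (code_offJ cA h)). Qed.

Lemma offZ_meas : measurable ([set x | offZ x] : set (seqT A)).
Proof. by apply: (@meas_all _ (seqT A) int) => i; exact: (cyl_meas i (code_offm cA)). Qed.

Lemma offZ_full : mu [set x | offZ x] = 1%E.
Proof.
have h1 i : mu [set x : seqT A | off (x i)] = 1%E.
  have := hmu (s := [:: i]) (Bs := fun=> off) isT (fun=> code_offm cA).
  rewrite big_seq1 (code_off1 cA) => <-; congr (mu _); apply/seteqP; split=> x /=.
    by move=> h j; rewrite inE => /eqP ->.
  by apply; rewrite inE.
have -> : [set x : seqT A | offZ x] = [set x : seqT A | forall n : nat, (fun n x => off (x n%:Z) /\ off (x (- n%:Z))) n x].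
  apply/seteqP; split=> x /=; first by move=> h n; split; exact: h.
  by move=> h i; have [_|_] := leP 0 i; have := h (absz i); rewrite /= => -[q1 q2]; case: i q1 q2 => n /=; rewrite ?NegzE.
apply: full_bigcap => n.
  by apply: (@meas_and _ (seqT A)); exact: (cyl_meas _ (code_offm cA)).
apply: mu_not0; first by apply: (@meas_and _ (seqT A)); exact: (cyl_meas _ (code_offm cA)).
by apply: (@mu_and1 R _ (seqT A)) => //; exact: (cyl_meas _ (code_offm cA)).
Qed.

Lemma cz_law : lawX (csrc p cd) mu (cz : seqT A -> Om).
Proof.
move=> B c; rewrite mem_aw => /andP[/eqP hs /allP hal].
pose s := [seq - B%:Z + k%:Z | k <- iota 0 (B + B)].
pose Bs (i : int) := [set a | mkseq (cd a) B = nth [::] c (absz (i + B%:Z)%R)] : set (borelT A).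
have ek k : absz (- B%:Z + k%:Z + B%:Z)%R = k by lia.
have us : uniq s by rewrite map_inj_uniq ?iota_uniq// => k k'; lia.
have := hmu us (fun i => code_cell cA B (nth [::] c (absz (i + B%:Z)%R))).
have -> : [set x : seqT A | forall i, i \in s -> Bs i (x i)] = [set x : seqT A | win B (cz x) (- B%:Z) (B + B) = c].
  apply/seteqP; split=> x /=.
    move=> h; apply: (@eq_from_nth _ [::]); rewrite size_win ?hs// => k hk; rewrite nth_win//.
    have := h (- B%:Z + k%:Z); rewrite /Bs /= ek => -> //.
    by apply/mapP; exists k => //; rewrite mem_iota.
  by move=> e i /mapP[k]; rewrite mem_iota => /andP[_ hk] ->; rewrite /Bs /= ek -e nth_win.
rewrite big_map => ->; rewrite (lwt_prod _ hs) -prodEFin big_seq [RHS]big_seq; apply: eq_bigr => k.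
rewrite mem_iota => /andP[_ hk]; rewrite /Bs ek; apply: csrcE; first exact: (code_cell cA).
by apply/eqP; apply: hal; apply: mem_nth; rewrite hs.
Qed.

Lemma JZ_bor : bor JZ.
Proof. by move=> d T X hX; apply: (@meas_all _ _ int) => i; exact: (@code_Jbor _ _ _ _ _ _ _ cA i _ _ _ hX). Qed.

(** On [JZ] membership of a decoded letter in an open set is read from its bits by [code_open];
    [trace_sigma] is applied once for Borel sets of letters and once for events of sequences. *)
Lemma dz_bor (C : set (seqT A)) : measurable C -> bor (fun z => JZ z /\ C (dz z)).
Proof.
move=> mC d T X hX; have mJ := JZ_bor hX.
apply: (@trace_sigma _ _ _ (@cyl_gen A) (fun t => dz (X t)) (fun t => JZ (X t)) mJ _ C mC) => _ [i [B [mB ->]]].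
apply: (@trace_sigma _ _ _ (@open A) (fun t => dz (X t) i) (fun t => JZ (X t)) mJ _ B mB) => U oU.
have [KU hU] := code_open cA oU.
have -> : [set t | JZ (X t) /\ U (dz (X t) i)] = [set t | JZ (X t) /\ exists k, KU k /\ X t i k].
  by apply/seteqP; split=> t /= [h1 h2]; split=> //; move: h2; rewrite /dz hU; have [_ ->] := code_dec cA (h1 i).
apply: meas_and => //; apply: (@meas_ex _ _ nat) => k; apply: meas_and; [exact: meas_cst|exact: hX].
Qed.

Lemma cz_shift x : cz (zshift x) = oshift (cz x). Proof. by []. Qed.

Lemma JZ_cz x : offZ x -> JZ (cz x).
Proof. by move=> h i; exact: (code_offJ cA (h i)). Qed.

Lemma dz_cz x : offZ x -> dz (cz x) = x.
Proof. by move=> h; apply/funext => i; exact: (dec_cd_code (h i)). Qed.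

Lemma cz_dz z : JZ z -> offZ (dz z) /\ cz (dz z) = z.
Proof.
move=> h; split=> [i|]; first by case: (code_dec cA (h i)).
by apply/funext => i; case: (code_dec cA (h i)).
Qed.

(** Off the spheres each bit is locally constant, and only finitely many bits are concerned. *)
Lemma cz_near (x : seqsp A) m : offZ x -> nbhs x [set x' : seqsp A | agree m (cz x) (cz x')].
Proof.
move=> hx; pose L := [seq (j%:Z - m%:Z, k) | j <- iota 0 (m + m).+1, k <- iota 0 m].
have h : nbhs x [set x' : seqsp A | forall q, q \in L -> cd (x' q.1) q.2 = cd (x q.1) q.2].
  apply: (@filter_list _ _ (nbhs x) L (fun q => [set x' : seqsp A | cd (x' q.1) q.2 = cd (x q.1) q.2])) => q _.
  have [U [oU Ux hU]] := code_cont cA q.2 (hx q.1).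
  have hn : nbhs (x q.1) U by apply: open_nbhs_nbhs.
  by apply: filterS (ptws_proj hn) => x' /= /hU.
apply: filterS h => x' hx' i r hi hr; apply: (hx' (i, r)).
apply/allpairsP; exists (absz (i + m%:Z)%R, r); split; [change (absz (i + m%:Z)%R \in iota 0 (m + m).+1)|change (r \in iota 0 m)|];
  rewrite ?mem_iota; [lia|lia|].
by move=> /=; congr pair; lia.
Qed.

End CodedProcess.

Lemma all_shift (T : Type) (Q : T -> Prop) (x : int -> T) : (forall i, Q (x (i + 1))) <-> forall i, Q (x i).
Proof. by split=> h i; [have := h (i - 1); rewrite subrK|exact: h]. Qed.

(** * Transfer of maps of bit arrays to Polish alphabets *)

Section Transfer.
Context {R : realType} {A B : ptopologicalType}.
Context {p : probability (borelT A) R} {q : probability (borelT B) R}.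
Context {mu : probability (seqT A) R} {nu : probability (seqT B) R}.
Context {cdA : A -> nat -> bool} {decA : (nat -> bool) -> A} {offA : set A} {JA : (nat -> bool) -> Prop}.
Context {cdB : B -> nat -> bool} {decB : (nat -> bool) -> B} {offB : set B} {JB : (nat -> bool) -> Prop}.
Hypothesis cA : is_code p cdA decA offA JA.
Hypothesis cB : is_code q cdB decB offB JB.
Hypothesis hmu : iid_law p mu.
Hypothesis hnu : iid_law q nu.
Variables (F : Om -> Om) (D : Om -> Prop).
Hypothesis F_shift : forall x, F (oshift x) = oshift (F x).
Hypothesis F_bor : forall i r, bor (fun x => F x i r).
Hypothesis D_bor : bor D.
Hypothesis D_shift : forall x, D (oshift x) <-> D x.
Hypothesis F_cont : cont_on D F.

Notation czA := (@cz A cdA).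
Notation czB := (@cz B cdB).

Definition dom_map (x : seqsp A) := @offZ A offA x /\ (D (czA x) /\ @JZ JB (F (czA x))).
(** Outside [dom_map] the value is a constant sequence, which is shift-invariant, so measurability
    and equivariance hold everywhere. *)
Definition coded_map (x : seqsp A) : seqsp B :=
  if `[< dom_map x >] then @dz B decB (F (czA x)) else (fun=> point).

Hypothesis D_full : mu [set x | D (czA x)] = 1%E.
Hypothesis F_law : lawX (csrc q cdB) mu (fun x : seqT A => F (czA x)).

Lemma F_mX : mX (fun x : seqT A => F (czA x)).
Proof. by move=> i r; exact: (@F_bor i r _ _ _ (cz_mX cA)). Qed.

Lemma dom_map_meas : measurable ([set x | dom_map x] : set (seqT A)).
Proof.
apply: (@meas_and _ (seqT A)); first exact: (offZ_meas cA).
apply: (@meas_and _ (seqT A)); first exact: (D_bor (cz_mX cA)).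
exact: (JZ_bor cB F_mX).
Qed.

(** The image array has the law of the coded process of [nu], whose letters are almost surely off
    the spheres. *)
Lemma JZ_full : mu [set x | @JZ JB (F (czA x))] = 1%E.
Proof.
rewrite (law_bor F_mX (cz_mX cB) F_law (cz_law cB hnu) (JZ_bor cB)).
rewrite -(probability_setT nu); apply: (mu_eq_on (offZ_meas cB)) (offZ_full cB hnu) _ => //.
  exact: (JZ_bor cB (cz_mX cB)).
by move=> y hy; split=> // _; exact: (JZ_cz cB hy).
Qed.

Lemma dom_map_full : mu [set x | dom_map x] = 1%E.
Proof.
have m1 : measurable [set x : seqT A | D (czA x)] by exact: (D_bor (cz_mX cA)).
have m2 : measurable [set x : seqT A | @JZ JB (F (czA x))] by exact: (JZ_bor cB F_mX).
apply: (@mu_and1 R _ (seqT A)); [exact: (offZ_meas cA)|exact: (@meas_and _ (seqT A))|exact: (offZ_full cA hmu)|].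
by apply: (@mu_and1 R _ (seqT A)) => //; exact: JZ_full.
Qed.

Lemma coded_mapE x : dom_map x -> coded_map x = @dz B decB (F (czA x)).
Proof. by move=> h; rewrite /coded_map asboolT. Qed.

Lemma coded_map_pre (C : set (seqT B)) : measurable C -> measurable ([set x | C (coded_map x)] : set (seqT A)).
Proof.
move=> mC; have mE := dom_map_meas.
have -> : [set x : seqT A | C (coded_map x)] =
    [set x : seqT A | dom_map x /\ (@JZ JB (F (czA x)) /\ C (@dz B decB (F (czA x))))] `|`
    [set x : seqT A | ~ dom_map x /\ C (fun=> point)].
  apply/seteqP; split=> x /=.
    have [h|h] := pselect (dom_map x); first by rewrite coded_mapE// => hC; left; split=> //; split=> //; case: h => _ [].
    by rewrite /coded_map asboolF// => hC; right.
  move=> [[h [_ hC]]|[h hC]]; first by rewrite coded_mapE.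
  by rewrite /coded_map asboolF.
apply: measurableU.
  apply: (@meas_and _ (seqT A)) => //; exact: (dz_bor cB mC F_mX).
by apply: (@meas_and _ (seqT A)); [exact: meas_not|exact: meas_cst].
Qed.

Lemma coded_map_meas : measurable_fun setT (coded_map : seqT A -> seqT B).
Proof. by move=> _ C mC; rewrite setTI; exact: coded_map_pre. Qed.

(** On full sets both events are read from bit arrays of equal law, and [law_bor] compares them. *)
Lemma coded_map_law (C : set (seqT B)) : measurable C -> mu (coded_map @^-1` C) = nu C.
Proof.
move=> mC.
have m1 : measurable [set x : seqT A | @JZ JB (F (czA x)) /\ C (@dz B decB (F (czA x)))] by exact: (dz_bor cB mC F_mX).
have m2 : measurable [set y : seqT B | @JZ JB (czB y) /\ C (@dz B decB (czB y))] by exact: (dz_bor cB mC (cz_mX cB)).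
transitivity (mu [set x : seqT A | @JZ JB (F (czA x)) /\ C (@dz B decB (F (czA x)))]).
  apply: (mu_eq_on dom_map_meas _ m1 dom_map_full); first exact: coded_map_pre.
  move=> x hx /=; rewrite (coded_mapE hx); split; last by case.
  by move=> h; split=> //; case: hx => _ [].
rewrite (law_bor F_mX (cz_mX cB) F_law (cz_law cB hnu) (dz_bor cB mC)).
apply: (mu_eq_on (offZ_meas cB) m2 mC (offZ_full cB hnu)) => y hy /=; rewrite (dz_cz cB hy).
by split=> [[]//|h]; split=> //; exact: (JZ_cz cB hy).
Qed.

Lemma dom_map_shift x : dom_map (zshift x) <-> dom_map x.
Proof.
rewrite /dom_map cz_shift D_shift F_shift.
have -> : @offZ A offA (zshift x) = @offZ A offA x by apply/propext; exact: (all_shift offA x).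
by have -> : @JZ JB (oshift (F (czA x))) = @JZ JB (F (czA x)) by apply/propext; exact: (all_shift JB).
Qed.

Lemma coded_map_shift x : coded_map (zshift x) = zshift (coded_map x).
Proof.
have [h|h] := pselect (dom_map x).
  by rewrite !coded_mapE//; [rewrite cz_shift F_shift|exact/dom_map_shift].
by rewrite /coded_map !asboolF// => /dom_map_shift.
Qed.

Lemma coded_map_cont : {within ([set x | dom_map x] : set (seqsp A)), continuous coded_map}.
Proof.
apply/subspace_continuousP => x hx; have [h1 [h2 h3]] := hx.
apply: ptws_cvg => i V hV; have : nbhs (coded_map x i) V := hV.
rewrite (@nbhsE B) => -[U [oU Ux] UV].
rewrite (coded_mapE hx) in Ux; have [r hr] := code_dcont cB (h3 i) oU Ux.
have [m hm] := cont_agree (absz i + r).+1 F_cont h2.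
have hn := cz_near cA m h1; rewrite /= /within /=.
apply: filterS hn => x' ha hx'; apply: UV.
have e := coded_mapE hx'; change (U (coded_map x' i)); rewrite e.
have [_ [h2' h3']] := hx'; apply: hr; first exact: h3'.
apply/eq_in_map => k; rewrite mem_iota => /andP[_ hk].
by apply: (hm _ h2' ha); lia.
Qed.

End Transfer.

Theorem theorem3p17 (R : realType) (A B : ptopologicalType)
  (p : probability (borelT A) R) (q : probability (borelT B) R)
  (mu : probability (seqT A) R) (nu : probability (seqT B) R) :
  polish R A -> polish R B ->
  iid_law p mu -> iid_law q nu ->
  iid_entropy p = iid_entropy q ->
  exists phi : seqsp A -> seqsp B,
    [/\ measurable_fun setT (phi : seqT A -> seqT B),
        (forall x : seqsp A, phi (zshift x) = zshift (phi x)),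
        (forall F : set (seqT B), measurable F ->
           mu (phi @^-1` F) = nu F) &
        exists (E : set (seqT A)) (F : set (seqT B)) (psi : seqsp B -> seqsp A),
          [/\ measurable E /\ mu E = 1%E,
              measurable F /\ nu F = 1%E,
              phi @` E = F /\ psi @` F = E,
              (forall x, E x -> psi (phi x) = x) /\ (forall y, F y -> phi (psi y) = y) &
              {within (E : set (seqsp A)), continuous phi} /\ {within (F : set (seqsp B)), continuous psi}]].
Proof.
move=> pA pB hmu hnu hent.
have [cdA [decA [offA [JA cA]]]] := code_exists p pA.
have [cdB [decB [offB [JB cB]]]] := code_exists q pB.
(* Level entropies of one code stay below the common entropy, and those of the other exceed every
   smaller number; this works whether or not it is finite. *)
have ent (A' B' : ptopologicalType) (p' : probability (borelT A') R) (q' : probability (borelT B') R) cd dec off J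
    cd' dec' off' J' : is_code p' cd dec off J -> is_code q' cd' dec' off' J' -> entropy p' = entropy q' ->
    entle (csrc p' cd) (csrc q' cd').
  move=> c c' e r e0 he0; apply: (Hlev_ge (code_cell c') (code_inj c') (code_pt c')); rewrite -e.
  have hl : ((Hlev (csrc p' cd) r)%:E <= entropy p')%E.
    by apply: Hlev_le; [exact: (code_cell c)|exact: (code_pt c)].
  by apply: lt_le_trans hl; rewrite lte_fin ltrBlDr ltrDl.
have := Iso_entropy (csrc_source p (code_cell cA)) (csrc_source q (code_cell cB)) (ent _ _ _ _ _ _ _ _ _ _ _ _ cA cB hent)
  (ent _ _ _ _ _ _ _ _ _ _ _ _ cB cA (esym hent)).
move=> [F [G [D [E [[Fs Gs] [Fb Gb] [Db Eb Ds Es] [DF EG Fc Gc] law]]]]].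
have [lF _] := law _ _ mu _ (cz_mX cA); have [_ lG] := law _ _ nu _ (cz_mX cB).
have [D1 Fl] := lF (cz_law cA hmu); have [E1 Gl] := lG (cz_law cB hnu).
pose phi := @coded_map A B cdA offA decB JB F D.
pose psi := @coded_map B A cdB offB decA JA G E.
pose EA := [set x : seqT A | @dom_map A cdA offA JB F D x].
pose EB := [set y : seqT B | @dom_map B cdB offB JA G E y].
(* The domain requires the image array to consist of codes, so coding the decoded image returns that
   array and [G] undoes [F]. *)
have inv1 x : EA x -> EB (phi x) /\ psi (phi x) = x.
  move=> hx; have [h1 [h2 h3]] := hx.
  have e1 : phi x = @dz B decB (F (@cz A cdA x)) by exact: coded_mapE.
  have [u1 e2] := cz_dz cB h3; have [h4 e3] := DF _ h2.
  have hy : EB (phi x).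
    by rewrite e1; split=> //; rewrite e2; split=> //; rewrite e3; exact: (JZ_cz cA h1).
  split=> //; rewrite /psi (coded_mapE hy) e1 e2 e3; exact: (dz_cz cA h1).
have inv2 y : EB y -> EA (psi y) /\ phi (psi y) = y.
  move=> hy; have [h1 [h2 h3]] := hy.
  have e1 : psi y = @dz A decA (G (@cz B cdB y)) by exact: coded_mapE.
  have [u1 e2] := cz_dz cA h3; have [h4 e3] := EG _ h2.
  have hx : EA (psi y).
    by rewrite e1; split=> //; rewrite e2; split=> //; rewrite e3; exact: (JZ_cz cB h1).
  split=> //; rewrite /phi (coded_mapE hx) e1 e2 e3; exact: (dz_cz cB h1).
exists phi; split.
- exact: (coded_map_meas cA cB Fb Db).
- exact: (coded_map_shift Fs Ds).
- exact: (coded_map_law cA cB hmu hnu Fb Db D1 Fl).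
exists EA, EB, psi; split.
- by split; [exact: (dom_map_meas cA cB Fb Db)|exact: (dom_map_full cA cB hmu hnu Fb Db D1 Fl)].
- by split; [exact: (dom_map_meas cB cA Gb Eb)|exact: (dom_map_full cB cA hnu hmu Gb Eb E1 Gl)].
- split; apply/seteqP; split.
  + by move=> _ [x hx <-]; case: (inv1 x hx).
  + by move=> y hy; have [h1 h2] := inv2 y hy; exists (psi y).
  + by move=> _ [y hy <-]; case: (inv2 y hy).
  + by move=> x hx; have [h1 h2] := inv1 x hx; exists (phi x).
- by split=> [x /inv1 []|y /inv2 []].
split; [exact: (coded_map_cont cA cB Fc)|exact: (coded_map_cont cB cA Gc)].
Qed.
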